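(* Let $F$ be a non-archimedean local field of odd residue characteristic $p$, let $\lambda$ be a non-trivial continuous unitary character of $F^+$, let $V=X\oplus Y$ be a symplectic space over $F$ as in the context, let $W_\lambda(g)$, $g\in \mathrm{Sp}(V)$, be the Weil operators (which preserve $\mathcal S(X,E)$), and let $\delta:\mathfrak H\to \mathrm{GL}(\mathcal S(X,E))$ be the map defined in the context, where $\mathfrak H=\mathrm{Gal}\bigl(E/\mathbf Q(\sqrt p,\sqrt{-p})\bigr)$. There exists $\alpha\in \mathrm{GL}(\mathcal S(X,E))$ such that $$\delta(\sigma)=\alpha^{-1}\,{}^\sigma\!\alpha\qquad\text{for all }\sigma\in\mathfrak H,$$ and for any such $\alpha$ the operators $\alpha W_\lambda(g)\alpha^{-1}$, $g\in \mathrm{Sp}(V)$, leave the $\mathbf Q(\sqrt p,\sqrt{-p})$-subspace $\mathcal S\bigl(X,\mathbf Q(\sqrt p,\sqrt{-p})\bigr)$ of $\mathcal S(X,E)$ invariant, and so provide a form of the Weil representation realized over $\mathbf Q(\sqrt p,\sqrt{-p})$ (that is, $g\mapsto \alpha W_\lambda(g)\alpha^{-1}$ restricts to a projective representation of $\mathrm{Sp}(V)$ on $\mathcal S\bigl(X,\mathbf Q(\sqrt p,\sqrt{-p})\bigr)$ whose extension of scalars to $E$ is isomorphic, via $\alpha$, to $W_\lambda$ on $\mathcal S(X,E)$).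
   Context: **Local field.** $F$ is a non-archimedean local field with ring of integers $\mathcal O$, residue field of order $q$ and characteristic $p\neq 2$, absolute value $|s|=q^{-v(s)}$. $\lambda$ is a non-trivial continuous unitary character of $F^+$. $d_\lambda t$ is the Haar measure on $F$ self-dual for $\lambda$, i.e. for which the Fourier transform $\mathcal F_\lambda\phi(s)=\int_F\lambda(st)\phi(t)\,d_\lambda t$ satisfies $\mathcal F_\lambda\mathcal F_\lambda\phi(t)=\phi(-t)$ for locally constant compactly supported $\phi$. **Symplectic space.** $V$ is a finite-dimensional $F$-vector space with a non-degenerate alternating form $\langle\ ,\ \rangle$, $V=X\oplus Y$ with $X,Y$ maximal totally isotropic, $x_1,\dots,x_n$ a fixed basis of $X$, and $y_1,\dots,y_n$ the basis of $Y$ with $\langle x_i,y_j\rangle=\delta_{ij}$. $\mathrm{Sp}(V)$ acts on $V$ on the right; products are composed accordingly. Write $g=\begin{pmatrix}a&b\\c&d\end{pmatrix}$ with $a:X\to X$, $b:X\to Y$, $c:Y\to X$, $d:Y\to Y$, so $xg=xa+xb$, $yg=yc+yd$. Put $Y_g=Y/\ker c$ and $P=\{g\in\mathrm{Sp}(V): Yg=Y\}$. **Measures.** For $0\le i\le n$ let $\tau_i\in\mathrm{Sp}(V)$ be given by $x_j\tau_i=-y_j,\ y_j\tau_i=x_j$ for $j\le i$ and $x_j\tau_i=x_j,\ y_j\tau_i=y_j$ for $j>i$. Identify $Y_{\tau_i}$ with the span of $y_1,\dots,y_i$ and let $\mu_{\lambda,\tau_i}=\prod_{k=1}^i d_\lambda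 y_k$. If $\dim Y_g=i$, then $g=p_1\tau_ip_2$ for some $p_1,p_2\in P$; $p_1$ induces an isomorphism $\overline{p_1}:Y_g\to Y_{\tau_i}$, and $\mu_{\lambda,g}=|\det(p_1p_2|_Y)|^{-1/2}\,\overline{p_1}\cdot\mu_{\lambda,\tau_i}$, where $(\overline{p_1}\cdot\mu)(O)=\mu(O\overline{p_1})$. It is known that this Haar measure on $Y_g$ is well defined. **Weil operators.** For a subfield $L\subseteq\mathbf C$, $\mathcal S(X,L)$ is the space of locally constant compactly supported functions $X\to L$, and $\mathcal S(X)=\mathcal S(X,\mathbf C)$. For $g\in\mathrm{Sp}(V)$, $\phi\in\mathcal S(X)$, $x\in X$, $$[W_\lambda(g)\phi](x)=\int_{Y_g}\lambda\Bigl(\tfrac{\langle xa,xb\rangle-2\langle xb,yc\rangle+\langle yc,yd\rangle}{2}\Bigr)\phi(xa+yc)\,d\mu_{\lambda,g}y .$$ This is the Weil representation of type $\lambda$, a projective representation of $\mathrm{Sp}(V)$: it satisfies $W_\lambda(g)^{-1}S_\lambda(h)W_\lambda(g)=S_\lambda(hg)$ for $h$ in the Heisenberg group $H=V\times F$ (product $(v,t)(v',t')=(v+v',t+t'+\langle v,v'\rangle/2)$, action $(v,t)g=(vg,t)$), where $[S_\lambda(x+y,t)\phi](x')=\lambda(t+\tfrac12\langle x,y\rangle+\langle x',y\rangle)\phi(x+x')$ is the Schrödinger representation. **Galois actions.** $\mathbf Q(\lambda)$ is the field generated over $\mathbf Q$ by the values of $\lambda$, and $E=\mathbf Q(\lambda)(\sqrt{-1})$;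 the operators $W_\lambda(g)$ preserve $\mathcal S(X,E)$. $\mathrm{Gal}(E/\mathbf Q)$ acts on $\mathcal S(X,E)$ by $(\sigma(\phi))(x)=\sigma(\phi(x))$ and on $\mathrm{End}(\mathcal S(X,E))$ by ${}^\sigma T(\phi)=\sigma(T(\sigma^{-1}(\phi)))$. Let $\mathcal P$ be the closure of the prime ring of $F$ ($\mathbf Z/p\mathbf Z$ if $\mathrm{char}\,F=p$, $\mathbf Z_p$ if $\mathrm{char}\,F=0$). The image of $\lambda$ is $\nu_p$ (the complex $p$-th roots of unity) resp. the group of all complex $p$-power roots of unity, and $\mathcal P^*\simeq\mathrm{Gal}(\mathbf Q(\lambda)/\mathbf Q)$, $s\mapsto\sigma_s$, where $\sigma_s(\zeta)=\zeta^s$ for $\zeta\in\mathrm{im}\,\lambda$. **The map $\delta$.** Let $\mathfrak H=\mathrm{Gal}(E/\mathbf Q(\sqrt p,\sqrt{-p}))$; restriction to $\mathbf Q(\lambda)$ identifies $\mathfrak H$ with $\{\sigma_r: r\in(\mathcal P^* )^2\}$. Let $\epsilon\in\mathcal P^*$ be a primitive $(p-1)$-th root of unity, and $U_1=\{1\}$ if $\mathrm{char}\,F=p$, $U_1=1+p\mathbf Z_p$ if $\mathrm{char}\,F=0$. Each $\sigma\in\mathfrak H$ has $\sigma|_{\mathbf Q(\lambda)}=\sigma_{\epsilon^{2i}s^2}$ for a unique integer $1\le i\le(p-1)/2$ and a unique $s\in U_1$. Let $\eta\in\mathfrak H$ be the element with $\eta|_{\mathbf Q(\lambda)}=\sigma_{\epsilon^2}$.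 For $t\in F^*$ let $g_t\in\mathrm{Sp}(V)$ be $(x+y)g_t=t^{-1}x+ty$; put $\iota=g_{-1}$, $\rho_e=\frac12(I+W_\lambda(\iota))$, $\rho_o=\frac12(I-W_\lambda(\iota))$. Fix $u\in\mathbf Q(\nu_p,\sqrt{-1})$ with $N(u)=-1$, $N$ being the norm from $\mathbf Q(\nu_p,\sqrt{-1})$ to $\mathbf Q(\sqrt p,\sqrt{-p})$ (such $u$ exists). For $\sigma$ with associated $(i,s)$, define $D(\sigma)=W_\lambda(g_{\epsilon^is})$, $A(\sigma)=\rho_e+\bigl(\prod_{l=0}^{i-1}\eta^l(u)\bigr)\rho_o$, and $\delta(\sigma)=A(\sigma)D(\sigma)$. *)

(* Defs.v *)
From HB Require Import structures.
From mathcomp Require Import all_boot all_order all_algebra.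
From mathcomp Require Import sesquilinear generic_quotient complex.
From mathcomp Require Import all_classical all_reals all_analysis.

Set Implicit Arguments.
Unset Strict Implicit.
Unset Printing Implicit Defensive.

Import Order.TTheory GRing.Theory Num.Theory.
Import numFieldNormedType.Exports.

Local Open Scope classical_set_scope.
Local Open Scope ring_scope.
Local Open Scope complex_scope.
Local Open Scope quotient_scope.

(* [val_ge v m] is the fractional ideal {s | m <= v(s)}, with v(0) = +oo: the
   value of [v] at 0 is never used. *)
Definition val_ge (F : fieldType) (v : F -> int) (m : int) : set F :=
  [set s | s = 0 \/ (m <= v s)%R].

(* A field with a normalized discrete valuation and the topology defined by it,
   complete and with a residue field of order [resorder]. *)
HB.mixin Record isNonArchLocal F of GRing.Field F & Topological F := {
  lval : F -> int;
  resorder : nat;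
  lvalM : forall s t : F, s != 0 -> t != 0 -> lval (s * t) = lval s + lval t;
  lvalD : forall s t : F, s != 0 -> t != 0 -> s + t != 0 ->
    (Order.min (lval s) (lval t) <= lval (s + t))%R;
  lval_uniformizer : exists2 s : F, s != 0 & lval s = 1;
  lval_nbhs : forall (s : F) (A : set F),
    nbhs s A <-> exists m : int, [set t | val_ge lval m (t - s)] `<=` A;
  lval_complete : forall a : nat -> F,
    (forall m : int, exists N, forall i j, (N <= i)%N -> (N <= j)%N ->
       val_ge lval m (a i - a j)) ->
    exists l : F, a @ \oo --> l;
  residue_classes :
    ([set [set t | val_ge lval 1 (t - s)] | s in val_ge lval 0]
       #= `I_resorder)%card
}.

#[short(type="nonArchLocalFieldType")]
HB.structure Definition NonArchLocalField :=
  {F of GRing.Field F & Topological F & isNonArchLocal F}.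

(* F with its Borel sets; the alias only serves to choose 0 as the base point
   required of a measurable type. *)
Definition pointedF (F : nonArchLocalFieldType) : Type := F.
HB.instance Definition _ (F : nonArchLocalFieldType) := Choice.on (pointedF F).
HB.instance Definition _ (F : nonArchLocalFieldType) :=
  isPointed.Build (pointedF F) (0 : F).
Definition borelF (F : nonArchLocalFieldType) :=
  g_sigma_algebraType (@open F : set (set (pointedF F))).

Section LocalField.
Context (R : realType) (F : nonArchLocalFieldType).

Definition labs (s : F) : R :=
  if s == 0 then 0 else (@resorder F)%:R ^ (- lval s).

Definition is_residue_char (p : nat) : Prop :=
  prime p /\ val_ge lval 1 (p%:R : F).

Definition primering_closure : set F := closure (range (fun n : int => n%:~R)).
Definition primering_units : set F :=
  [set s | [/\ s != 0, primering_closure s & primering_closure s^-1]].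

(* 1 + pP; this is {1} when F has characteristic p. *)
Definition one_units (p : nat) : set F :=
  [set 1 + p%:R * z | z in primering_closure].

(* Continuity is for the usual topology of the complex numbers, which the
   library attaches to the alias R[i]^o. *)
Definition unitary_character (lam : F -> R[i]) : Prop :=
  [/\ forall s t, lam (s + t) = lam s * lam t,
      forall s, `|lam s| = 1 &
      continuous (lam : F -> R[i]^o)].


Definition is_haar (mu : {measure set (borelF F) -> \bar R}) : Prop :=
  [/\ forall (s : F) (A : set F), measurable (A : set (borelF F)) ->
        mu [set s + t | t in A] = mu A,
      forall K : set F, compact K -> (mu K < +oo)%E &
      mu setT != 0%E].

End LocalField.

Definition schwartz (R : realType) (T : topologicalType) (L : set R[i]) :
    set (T -> R[i]) :=
  [set f : T -> R[i] | [/\ forall x, \forall y \near x, f y = f x,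
               compact (closure [set x | f x != 0]) &
               forall x, L (f x)]].

(* Integral of a function which takes finitely many non-zero values, as are all
   the locally constant compactly supported ones. *)
Definition sint (R : realType) (T : Type) (mu : set T -> \bar R)
    (f : T -> R[i]) : R[i] :=
  \sum_(z \in [set: R[i]]) z * (fine (mu (f @^-1` [set z])))%:C.

Definition fourier (R : realType) (F : nonArchLocalFieldType) (lam : F -> R[i])
    (mu : set F -> \bar R) (f : F -> R[i]) : F -> R[i] :=
  fun s => sint mu (fun t => lam (s * t) * f t).

Definition self_dual (R : realType) (F : nonArchLocalFieldType)
    (lam : F -> R[i]) (mu : set F -> \bar R) : Prop :=
  forall f, schwartz (T := F) [set: R[i]] f ->
  forall t, fourier lam mu (fourier lam mu f) t = f (- t).

Fixpoint prod_measure (R : realType) (F : nonArchLocalFieldType)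
    (mu : set (borelF F) -> \bar R) (i : nat) :
    set (i.-tuple (borelF F)) -> \bar R :=
  match i with
  | 0 => fun O => \d_([tuple] : 0.-tuple (borelF F)) O
  | j.+1 => fun O =>
      product_measure1 mu (prod_measure mu (i := j))
        [set st : borelF F * j.-tuple (borelF F) | O [tuple of st.1 :: st.2]]
  end.

Definition isotropic (F : fieldType) (V : vectType F) (B : V -> V -> F)
    (U : {vspace V}) : Prop :=
  forall u v, u \in U -> v \in U -> B u v = 0.

Definition maximal_isotropic (F : fieldType) (V : vectType F) (B : V -> V -> F)
    (U : {vspace V}) : Prop :=
  isotropic B U /\
  forall U' : {vspace V}, isotropic B U' -> (U <= U')%VS -> U' = U.

Record sympl_space (F : fieldType) := SymplSpace {
  sV :> vectType F;
  sform : {biscalar sV};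
  sform_alt : forall v, sform v v = 0;
  sform_nondeg : forall v, (forall w, sform v w = 0) -> v = 0;
  sX : {vspace sV};
  sY : {vspace sV};
  sXY : (sX + sY)%VS = fullv /\ directv (sX + sY);
  sX_max : maximal_isotropic sform sX;
  sY_max : maximal_isotropic sform sY;
  sn : nat;
  sx : sn.-tuple sV;
  sy : sn.-tuple sV;
  sx_basis : basis_of sX sx;
  sy_basis : basis_of sY sy;
  sxy_dual : forall i j : 'I_sn, sform (tnth sx i) (tnth sy j) = (i == j)%:R
}.

Section Symplectic.
Context (F : fieldType) (V : sympl_space F).

Local Notation Xt := (subvs_of (sX V)).
Local Notation Yt := (subvs_of (sY V)).
Local Notation n := (sn V).
Local Notation "<< u , v >>" := (sform V u v) (format "<< u ,  v >>").

(* Endomorphisms act on the right: vg is [g v], and the product gh, for which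
   v(gh) = (vg)h, is [spmul g h]. *)
Definition spmul (g h : 'End(V)) : 'End(V) := (h \o g)%VF.

Definition Sp : set 'End(V) :=
  [set g : 'End(V) | forall u v, << g u, g v >> = << u, v >>].

Definition parabolic : set 'End(V) :=
  [set g : 'End(V) | Sp g /\ (g @: sY V)%VS = sY V].

Definition projX (v : V) : Xt := vsproj (sX V) (daddv_pi (sX V) (sY V) v).
Definition projY (v : V) : Yt := vsproj (sY V) (daddv_pi (sY V) (sX V) v).

Definition blka (g : 'End(V)) (x : Xt) : Xt := projX (g (vsval x)).
Definition blkb (g : 'End(V)) (x : Xt) : Yt := projY (g (vsval x)).
Definition blkc (g : 'End(V)) (y : Yt) : Xt := projX (g (vsval y)).
Definition blkd (g : 'End(V)) (y : Yt) : Yt := projY (g (vsval y)).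

Definition ybase (k : 'I_n) : Yt := vsproj (sY V) (tnth (sy V) k).

(* Meaningful for endomorphisms of V which leave Y invariant. *)
Definition detY (g : 'End(V)) : F :=
  \det (\matrix_(i, j) coord (sy V) j (g (tnth (sy V) i))).

(* In V the coordinate of v on x_j is <v, y_j>, that on y_j is <x_j, v>. *)
Definition tau (i : nat) : 'End(V) :=
  linfun (fun v => \sum_(j < n)
    let x := tnth (sx V) j in let y := tnth (sy V) j in
    if (j < i)%N then << v, y >> *: (- y) + << x, v >> *: x
    else << v, y >> *: x + << x, v >> *: y).

Definition dilation (t : F) : 'End(V) :=
  t^-1 *: daddv_pi (sX V) (sY V) + t *: daddv_pi (sY V) (sX V).

Definition kerc_rel (g : 'End(V)) : rel Yt :=
  fun y y' => blkc g (y - y') == 0.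

Lemma blkcB g y y' : blkc g (y - y') = blkc g y - blkc g y'.
Proof. by rewrite /blkc /projX !linearB. Qed.

Lemma kerc_refl g : reflexive (kerc_rel g).
Proof. by move=> y; rewrite /kerc_rel blkcB subrr. Qed.

Lemma kerc_sym g : symmetric (kerc_rel g).
Proof. by move=> y z; rewrite /kerc_rel !blkcB !subr_eq0 eq_sym. Qed.

Lemma kerc_trans g : transitive (kerc_rel g).
Proof.
by move=> y x z; rewrite /kerc_rel !blkcB !subr_eq0 => /eqP-> /eqP->.
Qed.

Definition kerc_equiv g : equiv_rel Yt :=
  EquivRel (kerc_rel g) (@kerc_refl g) (@kerc_sym g) (@kerc_trans g).

(* Y_g = Y / ker c. *)
Definition Yg (g : 'End(V)) := {eq_quot (kerc_equiv g)}.

Definition dimYg (g : 'End(V)) : nat :=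
  \dim (sY V) - \dim (sY V :&: lker (daddv_pi (sX V) (sY V) \o g)%VF)%VS.

(* Induced by p in P, whose restriction to Y is its block d. *)
Definition pbar (g h p : 'End(V)) (yb : Yg g) : Yg h :=
  \pi_(Yg h) (blkd p (repr yb)).

Definition bruhat (g : 'End(V)) : 'End(V) * 'End(V) :=
  xget (\1%VF, \1%VF) [set pp | [/\ parabolic pp.1, parabolic pp.2 &
    g = spmul (spmul pp.1 (tau (dimYg g))) pp.2]].

End Symplectic.
Arguments Sp {F} V.

Section Weil.
Context (R : realType) (F : nonArchLocalFieldType) (V : sympl_space F).
Context (lam : F -> R[i]) (mu : set F -> \bar R).

Local Notation Xt := (subvs_of (sX V)).
Local Notation Yt := (subvs_of (sY V)).
Local Notation n := (sn V).
Local Notation "<< u , v >>" :=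
  (sform V (vsval u) (vsval v)) (format "<< u ,  v >>").

(* S(X, L); the topology of X is that of F^n through the basis x_1, .., x_n. *)
Definition vecX (r : 'rV[F]_n) : Xt :=
  vsproj (sX V) (\sum_(j < n) r 0 j *: tnth (sx V) j).

Definition SX (L : set R[i]) : set (Xt -> R[i]) :=
  [set phi : Xt -> R[i] | schwartz L (phi \o vecX)].

(* Y_(tau_i) is identified with F^i through the classes of y_1, .., y_i. *)
Definition mu_tau (i : nat) : set (Yg (tau V i)) -> \bar R :=
  fun O => prod_measure (mu : set (borelF F) -> \bar R)
    [set t : i.-tuple (borelF F) |
      O (\pi_(Yg (tau V i))
           (\sum_(k < n | (k < i)%N) ((t : seq F)`_k : F) *: ybase k))].

(* The Haar measure on Y_g, as a function of sets of cosets.  It does not depend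
   on the pair (p1, p2) selected by [bruhat]. *)
Definition mu_g (g : 'End(V)) : set (Yg g) -> \bar R :=
  let: (p1, p2) := bruhat g in
  fun O => (((Num.sqrt (labs R (detY (spmul p1 p2))))^-1)%:E *
            mu_tau (pbar (tau V (dimYg g)) p1 @` O))%E.

Definition weil (g : 'End(V)) (phi : Xt -> R[i]) : Xt -> R[i] := fun x =>
  sint (mu_g (g := g)) (fun yb : Yg g =>
    let y : Yt := repr yb in
    lam ((<< blka g x, blkb g x >> - 2 * << blkb g x, blkc g y >>
          + << blkc g y, blkd g y >>) / 2)
    * phi (blka g x + blkc g y)).

End Weil.

Section Galois.
Context (R : realType).
Local Notation C := R[i].

Definition subfieldC (K : set C) : Prop := divring_closed (fun z => z \in K).

Definition Qadj (A : set C) : set C := smallest subfieldC A.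

(* Gal(L/K).  An automorphism of the subfield L of C is represented by its
   extension to C by the identity outside L, so that distinct elements of the
   set are distinct automorphisms. *)
Definition Gal (L K : set C) : set (C -> C) :=
  [set sigma | [/\ set_bij L L sigma,
    forall x y, L x -> L y -> sigma (x + y) = sigma x + sigma y,
    forall x y, L x -> L y -> sigma (x * y) = sigma x * sigma y,
    forall x, K x -> sigma x = x &
    forall z, ~ L z -> sigma z = z]].

Definition normC (L K : set C) (z : C) : C :=
  \big[*%R/1]_(sigma \in Gal L K) sigma z.

Definition sqrt_pm (p : nat) : set C :=
  Qadj [set sqrtC (p%:R : C); sqrtC (- p%:R : C)].

Definition cyclo_i (p : nat) : set C :=
  Qadj ([set z | z ^+ p = 1] `|` [set sqrtC (-1 : C)]).

Context (F : nonArchLocalFieldType) (lam : F -> C).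

Definition fieldE : set C := Qadj (range lam `|` [set sqrtC (-1 : C)]).

(* sigma restricts to sigma_s on Q(lambda): zeta |-> zeta^s on im lambda, where
   zeta^s = zeta^m for any m = s mod p^k P, if zeta^(p^k) = 1. *)
Definition acts_as (p : nat) (sigma : C -> C) (s : F) : Prop :=
  forall (zeta : C) (k m : nat), range lam zeta -> zeta ^+ (p ^ k) = 1 ->
  (exists2 z : F, primering_closure z & s - m%:R = (p ^ k)%:R * z) ->
  sigma zeta = zeta ^+ m.

Definition assoc (p : nat) (eps : F) (sigma : C -> C) : set (nat * F) :=
  [set c | [/\ (1 <= c.1 <= p.-1./2)%N, one_units p c.2 &
               acts_as p sigma (eps ^+ (2 * c.1) * c.2 ^+ 2)]].

End Galois.

(* An operator on a subspace S of X -> C is represented by a map defined on all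
   functions, of which only the restriction to S matters. *)
Section Operators.
Context (R : realType) (X : Type).
Local Notation C := R[i].
Local Notation fn := (X -> C).

Definition linear_on (L : set C) (S : set fn) (T : fn -> fn) : Prop :=
  forall a phi psi, L a -> S phi -> S psi ->
  T (fun x => a * phi x + psi x) = (fun x => a * T phi x + T psi x).

Definition GL (L : set C) (S : set fn) : set (fn -> fn) :=
  [set T | set_bij S S T /\ linear_on L S T].

Definition opinv (S : set fn) (T : fn -> fn) : fn -> fn := 'pinv_id S T.

(* phi |-> sigma (T (sigma^-1 phi)), for sigma an automorphism of L. *)
Definition galconj (L : set C) (sigma : C -> C) (T : fn -> fn) : fn -> fn :=
  fun phi => sigma \o T ('pinv_id L sigma \o phi).

Context (G : Type) (grp : set G) (mulG : G -> G -> G).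

Definition proj_rep (L : set C) (S : set fn) (T : G -> fn -> fn) : Prop :=
  (forall g, grp g -> GL L S (T g)) /\
  forall g h, grp g -> grp h -> exists c, [/\ L c, c != 0 &
    forall phi, S phi ->
      T g (T h phi) = (fun x => c * T (mulG g h) phi x)].

(* The canonical map from the scalar extension to L of the K-space S0 to the
   L-space S is bijective. *)
Definition scalar_extension (K L : set C) (S0 S : set fn) : Prop :=
  [/\ S0 `<=` S,
      forall phi, S phi -> exists m (c : 'I_m -> C) (psi : 'I_m -> fn),
        (forall j, L (c j) /\ S0 (psi j)) /\
        phi = (fun x => \sum_(j < m) c j * psi j x) &
      forall m (psi : 'I_m -> fn), (forall j, S0 (psi j)) ->
        (forall c : 'I_m -> C, (forall j, K (c j)) ->
           (forall x, \sum_(j < m) c j * psi j x = 0) -> forall j, c j = 0) ->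
        forall c : 'I_m -> C, (forall j, L (c j)) ->
           (forall x, \sum_(j < m) c j * psi j x = 0) -> forall j, c j = 0].

(* T0 is a projective representation on the K-space S0 and [al] is an
   isomorphism of T, on the L-space S, with the scalar extension of T0. *)
Definition is_form (K L : set C) (S0 S : set fn) (T0 T : G -> fn -> fn)
    (al : fn -> fn) : Prop :=
  [/\ proj_rep K S0 T0, scalar_extension K L S0 S, GL L S al &
      forall g, grp g -> exists TL : fn -> fn,
        [/\ GL L S TL, forall phi, S0 phi -> TL phi = T0 g phi &
            forall phi, S phi -> al (T g phi) = TL (al phi)]].

End Operators.

Section Delta.
Context (R : realType) (F : nonArchLocalFieldType) (V : sympl_space F).
Context (lam : F -> R[i]) (mu : set F -> \bar R) (p : nat).
Context (eps : F) (u : R[i]) (eta : R[i] -> R[i]).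

Local Notation fn := (subvs_of (sX V) -> R[i]).
Local Notation W := (weil (V := V) lam mu).

Definition rho_even (phi : fn) : fn :=
  fun x => 2^-1 * (phi x + W (dilation V (-1)) phi x).

Definition rho_odd (phi : fn) : fn :=
  fun x => 2^-1 * (phi x - W (dilation V (-1)) phi x).

Definition Dop (i : nat) (s : F) : fn -> fn := W (dilation V (eps ^+ i * s)).

Definition Aop (i : nat) (phi : fn) : fn :=
  fun x => rho_even phi x + (\prod_(0 <= l < i) iter l eta u) * rho_odd phi x.

Definition delta (sigma : R[i] -> R[i]) : fn -> fn :=
  let: (i, s) := xget (0%N, 0) (assoc lam p eps sigma) in Aop i \o Dop i s.

End Delta.

(* Main.v *)
Require Import Defs.
From HB Require Import structures.
From mathcomp Require Import all_boot all_order all_algebra.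
From mathcomp Require finfield.
From mathcomp Require Import sesquilinear generic_quotient complex ring lra zify.
From mathcomp Require Import all_classical all_reals all_analysis.

Set Implicit Arguments.
Unset Strict Implicit.
Unset Printing Implicit Defensive.

Import Order.TTheory GRing.Theory Num.Theory.
Import numFieldNormedType.Exports.

Local Open Scope classical_set_scope.
Local Open Scope ring_scope.
Local Open Scope complex_scope.

(* The operators psi |-> delta(sg) (sg \o psi) form a semilinear action of the
   Galois group: delta is a cocycle because the scalars eps^i s of two elements
   multiply to the scalar of their product up to sign, and the products of the
   conjugates of u, whose full product is the norm -1, account for the sign on
   odd functions.  The action commutes with all W(g), since sg twists lam by the
   square of that scalar and hence W(g) by the conjugation with its dilation.

   Schwartz functions are the union of the finite-dimensional spaces of functions
   on the quotients of lattices, which the action preserves and on which it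
   factors through a finite group.  There the fixed functions span (Lagrange
   interpolation in a generating root of unity), so that they contain a basis
   adapted to the filtration; alpha maps it to a basis of K-valued functions.
   Then sg \o alpha psi = alpha (delta(sg) (sg \o psi)), so alpha W(g) alpha^-1
   preserves the functions fixed by the Galois group, which are K-valued.

   Every sg fixing sqrt p and sqrt (-p) fixes the quadratic Gauss sum, and so
   raises roots of unity to the power of a square. *)

(** * The valuation and its finite quotients *)

Section Transversals.
Variable A : zmodType.
Implicit Types (M N : set A) (R : seq A).

(** All the analysis is finite. On functions of a given lattice quotient an integral is a volume
    times a sum over coset representatives, so a change of variables is a change of transversal and
    a field automorphism can be applied term by term. The scalars left over, volumes of lattices and
    factors |det|^(-1/2), are square roots of powers of q; they lie in Q(sqrt p, sqrt(-p)), which is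
    why the Galois group over that field commutes with them. For the volumes this rests on the
    self-duality of the measure.

    In characteristic 0 the extension E is infinite. So everything attached to one function has to
    be shown to depend on sg only through its value at one root of unity, and the fixed field of the
    Galois group is found by extending embeddings with Zorn's lemma.

    Projectivity of W is not computed but deduced: three operators whose group elements multiply to
    1 compose to an operator commuting with the Schroedinger representation, whose commutant is
    scalar. The constants obtained are complex numbers; evaluation at a test function places them in
    E or in Q(sqrt p, sqrt(-p)). *)

Definition subgroup M := M 0 /\ forall x y, M x -> M y -> M (x - y).

Lemma subgroup0 M : subgroup M -> M 0. Proof. by case. Qed.
Lemma subgroupB M x y : subgroup M -> M x -> M y -> M (x - y).
Proof. by case=> _; apply. Qed.
Lemma subgroupN M x : subgroup M -> M x -> M (- x).
Proof. by move=> sM Mx; rewrite -sub0r; apply: subgroupB => //; apply: subgroup0. Qed.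
Lemma subgroupD M x y : subgroup M -> M x -> M y -> M (x + y).
Proof. by move=> sM Mx My; rewrite -[y]opprK; apply: subgroupB => //; apply: subgroupN. Qed.
Lemma subgroup_sum M I (r : seq I) (P : pred I) (f : I -> A) : subgroup M ->
  (forall i, P i -> M (f i)) -> M (\sum_(i <- r | P i) f i).
Proof.
move=> sM Mf; elim/big_ind: _ => //; first by case: sM.
by move=> x y; apply: subgroupD.
Qed.

Definition transversal M N R := [/\ uniq R, forall r, r \in R -> M r,
  forall x, M x -> exists2 r, r \in R & N (x - r) &
  forall r r', r \in R -> r' \in R -> N (r - r') -> r = r'].

(** Source of all changes of variables: translating or dilating the variable of a finite sum
    replaces the transversal by another one of the same quotient. The double sum over congruent
    pairs collapses on either side because each class meets each list exactly once. *)
Lemma transversal_sum (B : nmodType) (f : A -> B) M N R R' :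
  subgroup N -> (forall x y, M x -> M y -> N (x - y) -> f x = f y) ->
  transversal M N R -> transversal M N R' ->
  \sum_(r <- R) f r = \sum_(r <- R') f r.
Proof.
move=> sN fN [uR MR eR iR] [uR' MR' eR' iR'].
transitivity (\sum_(r <- R) \sum_(r' <- R' | `[< N (r - r') >]) f r').
  rewrite big_seq [RHS]big_seq; apply: eq_bigr => r rR.
  have [r' r'R' Nrr'] := eR' r (MR r rR).
  rewrite big_mkcond (bigD1_seq r') //= asboolT // big_seq_cond big1 => [|x].
    by rewrite addr0; apply: fN => //; [exact: MR | exact: MR'].
  move=> /andP[xR' xr']; rewrite asboolF // => Nrx; case/eqP: xr'.
  apply: iR' => //; have -> : x - r' = (r - r') - (r - x).
    by rewrite opprB [RHS]addrC subrKA.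
  exact: subgroupB.
rewrite (exchange_big_dep xpredT) //= big_seq [RHS]big_seq.
apply: eq_bigr => r' r'R'; have [r rR Nrr'] := eR r' (MR' r' r'R').
have Nr: N (r - r') by rewrite -opprB; apply: subgroupN.
rewrite big_mkcond (bigD1_seq r) //= asboolT // big_seq_cond big1 => [|x].
  by rewrite addr0.
move=> /andP[xR xr]; rewrite asboolF // => Nrx; case/eqP: xr.
apply: iR => //; have -> : x - r = (x - r') - (r - r') by rewrite opprB subrKA.
exact: subgroupB.
Qed.

Lemma transversal_image (h h' : A -> A) M N R :
  cancel h h' -> cancel h' h ->
  (forall x, M x -> M (h x)) -> (forall x, M x -> M (h' x)) ->
  (forall x y, N (h x - h y) <-> N (x - y)) ->
  transversal M N R -> transversal M N [seq h r | r <- R].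
Proof.
move=> hK h'K Mh Mh' Nh [uR MR eR iR]; split.
- by rewrite (map_inj_uniq (can_inj hK)).
- by move=> _ /mapP[r rR ->]; apply/Mh/MR.
- move=> x Mx; have [r rR Nr] := eR (h' x) (Mh' x Mx).
  by exists (h r); [apply: map_f | rewrite -[x]h'K; apply/Nh].
- by move=> _ _ /mapP[r rR ->] /mapP[r' r'R ->] /Nh /iR ->.
Qed.

Lemma transversal1 M : subgroup M -> transversal M M [:: 0].
Proof.
move=> sM; split=> //.
- by move=> r; rewrite inE => /eqP->; apply: subgroup0.
- by move=> x mx; exists 0; rewrite ?inE // subr0.
- by move=> r r'; rewrite !inE => /eqP-> /eqP->.
Qed.

Lemma transversal_trans M N N' R R' : subgroup M -> subgroup N ->
  subgroup N' -> N `<=` M -> N' `<=` N ->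
  transversal M N R -> transversal N N' R' ->
  transversal M N' [seq r + r' | r <- R, r' <- R'].
Proof.
move=> sM sN sN' NM N'N [uR MR eR iR] [uR' MR' eR' iR'].
have key r s r' s' : r \in R -> r' \in R -> s \in R' -> s' \in R' ->
    N' (r + s - (r' + s')) -> r = r' /\ s = s'.
  move=> rR r'R sR s'R NN; have rr' : r = r'.
    apply: iR => //.
    have -> : r - r' = (r + s - (r' + s')) - (s - s').
      by rewrite opprD addrACA addrK.
    by apply: subgroupB => //; [exact: N'N | apply: subgroupB => //; exact: MR'].
  split=> //; apply: iR' => //; move: NN.
  by rewrite rr' opprD addrACA subrr add0r.
split.
- apply: allpairs_uniq => // -[r s] [r' s'] /allpairsP[[a b] /= [aR bR [-> ->]]].
  move=> /allpairsP[[a' b'] /= [a'R b'R [-> ->]]] /= e.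
  have NN : N' (a + b - (a' + b')) by rewrite e subrr; apply: subgroup0.
  by have [-> ->] := key _ _ _ _ aR a'R bR b'R NN.
- move=> _ /allpairsP[[a b] /= [aR bR ->]].
  by apply: subgroupD => //; [exact: MR | apply: NM; exact: MR'].
- move=> x Mx; have [r rR Nr] := eR x Mx; have [s sR Ns] := eR' _ Nr.
  by exists (r + s); [apply/allpairsP; exists (r, s) | rewrite opprD addrA].
- move=> _ _ /allpairsP[[a b] /= [aR bR ->]] /allpairsP[[a' b'] /= [a'R b'R ->]].
  by move=> /(key _ _ _ _ aR a'R bR b'R)[-> ->].
Qed.

Lemma transversal_shift x0 M N R : subgroup M -> M x0 ->
  transversal M N R -> transversal M N [seq x0 + r | r <- R].
Proof.
move=> sM Mx0; apply: (@transversal_image _ (fun x => - x0 + x)).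
- by move=> x; rewrite addKr.
- by move=> x; rewrite addNKr.
- by move=> x; apply: subgroupD.
- by move=> x; apply: subgroupD => //; apply: subgroupN.
- by move=> x y; rewrite opprD addrACA subrr add0r.
Qed.

End Transversals.

Section Valuation.
Context {F : nonArchLocalFieldType}.
Local Notation v := (@lval F).
Local Notation O := (val_ge v).
Implicit Types (s t x y : F) (m : int).

Lemma lval1 : v 1 = 0.
Proof.
have := lvalM _ _ (oner_neq0 F) (oner_neq0 F); rewrite mulr1 => /eqP.
by rewrite -subr_eq0 opprD addrA subrr sub0r oppr_eq0 => /eqP.
Qed.

Lemma lvalV s : s != 0 -> v s^-1 = - v s.
Proof.
move=> s0; have := lvalM _ _ s0 (invr_neq0 s0); rewrite mulfV // lval1.
by move=> /esym/eqP; rewrite addrC addr_eq0 => /eqP.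
Qed.

Lemma lvalN s : v (- s) = v s.
Proof.
have [->|s0] := eqVneq s 0; first by rewrite oppr0.
have n1 : (-1 : F) != 0 by rewrite oppr_eq0 oner_neq0.
have : v (-1) + v (-1) = 0 by rewrite -lvalM // mulrNN mulr1 lval1.
rewrite -mulr2n => /eqP; rewrite mulrn_eq0 /= => /eqP e.
by rewrite -mulN1r lvalM // e add0r.
Qed.

Lemma val_ge0 m : O m 0. Proof. by left. Qed.

Lemma val_geE m s : s != 0 -> O m s <-> m <= v s.
Proof. by move=> /negbTE s0; split=> [[/eqP|//]|]; [rewrite s0|right]. Qed.

Lemma val_geN m s : O m s -> O m (- s).
Proof. by move=> [->|ms]; [left; rewrite oppr0 | right; rewrite lvalN]. Qed.

Lemma val_geD m s t : O m s -> O m t -> O m (s + t).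
Proof.
have [->|s0] := eqVneq s 0; first by rewrite add0r.
have [->|t0] := eqVneq t 0; first by rewrite addr0.
move=> /(val_geE _ s0) ms /(val_geE _ t0) mt.
have [->|st0] := eqVneq (s + t) 0; first by left.
right; apply: le_trans (lvalD _ _ s0 t0 st0).
by rewrite le_min ms.
Qed.

Lemma val_ge_subgroup m : subgroup (O m).
Proof. by split=> [|x y ? /val_geN]; [left | exact: val_geD]. Qed.

Lemma val_ge_le m m' s : m <= m' -> O m' s -> O m s.
Proof. by move=> mm' [->|ms]; [left|right; apply: le_trans ms]. Qed.

Lemma val_geM m m' s t : O m s -> O m' t -> O (m + m') (s * t).
Proof.
have [->|s0] := eqVneq s 0; first by rewrite mul0r; left.
have [->|t0] := eqVneq t 0; first by rewrite mulr0; left.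
move=> /(val_geE _ s0) ms /(val_geE _ t0) mt.
by right; rewrite lvalM // lerD.
Qed.

Lemma val_geMl m s t : O 0 s -> O m t -> O m (s * t).
Proof. by move=> s0 tm; rewrite -[m]add0r; apply: val_geM. Qed.

Lemma val_geMr m s t : O m s -> O 0 t -> O m (s * t).
Proof. by move=> s0 tm; rewrite -[m]addr0; apply: val_geM. Qed.

Lemma val_ge1 : O 0 1. Proof. by right; rewrite lval1. Qed.

Lemma val_ge_nat n : O 0 n%:R.
Proof. by elim: n => [|n IH]; [left|rewrite -addn1 natrD; apply: val_geD val_ge1]. Qed.

Lemma val_ge_int (n : int) : O 0 n%:~R.
Proof. by case: n => n; [|rewrite NegzE mulrNz; apply: val_geN]; apply: val_ge_nat. Qed.

Lemma val_geX n m s : O m s -> O (m *+ n) (s ^+ n).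
Proof.
by move=> ms; elim: n => [|n IH]; [exact: val_ge1|rewrite exprS mulrS; apply: val_geM].
Qed.

Lemma val_geX0 n s : O 0 s -> O 0 (s ^+ n).
Proof. by move=> /(val_geX n); rewrite mul0rn. Qed.

Definition vunit s := s != 0 /\ v s = 0.

Lemma vunit_neq0 s : vunit s -> s != 0. Proof. by case. Qed.
Lemma vunit1 : vunit 1. Proof. by split; [exact: oner_neq0|exact: lval1]. Qed.
Lemma vunitM s t : vunit s -> vunit t -> vunit (s * t).
Proof. by move=> [s0 vs] [t0 vt]; split; rewrite ?mulf_neq0 ?lvalM ?vs ?vt. Qed.
Lemma vunitV s : vunit s -> vunit s^-1.
Proof. by move=> [s0 vs]; split; rewrite ?invr_neq0 ?lvalV ?vs ?oppr0. Qed.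
Lemma vunitN s : vunit s -> vunit (- s).
Proof. by move=> [s0 vs]; split; rewrite ?oppr_eq0 ?lvalN. Qed.
Lemma vunitX n s : vunit s -> vunit (s ^+ n).
Proof. by move=> us; elim: n => [|n IH]; [exact: vunit1|rewrite exprS; apply: vunitM]. Qed.
Lemma vunit_ge0 s : vunit s -> O 0 s. Proof. by move=> [_ vs]; right; rewrite vs. Qed.

Lemma val_ge_vunitM u m s : vunit u -> O m (u * s) <-> O m s.
Proof.
move=> uu; have geM w x : vunit w -> O m x -> O m (w * x).
  by move=> /vunit_ge0 w0 mx; rewrite -[m]add0r; apply: val_geM.
split; last exact: geM.
by move=> /(geM _ _ (vunitV uu)); rewrite mulKf //; case: uu.
Qed.

Lemma vunitP s : O 0 s -> ~ O 1 s -> vunit s.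
Proof.
move=> O0 nO1; have s0 : s != 0 by apply/eqP => s0; apply: nO1; left.
move: O0 => /(val_geE _ s0) vs0; split=> //; apply/eqP; rewrite eq_le vs0 andbT.
by apply: contra_notT nO1; rewrite -ltNge => vs; right; rewrite -[1]add0r lezD1.
Qed.

Lemma vunit_nge1 s : vunit s -> ~ O 1 s.
Proof. by move=> [s0 vs] /(val_geE _ s0); rewrite vs. Qed.

Lemma vunit_congr s t : vunit s -> O 1 (t - s) -> vunit t.
Proof.
move=> us ts; apply: vunitP.
  rewrite -(subrK s t); apply: val_geD; last exact: vunit_ge0.
  exact: (@val_ge_le _ 1).
move=> t1; apply: (vunit_nge1 us).
by rewrite -[s](subKr t); apply: val_geD => //; apply: val_geN.
Qed.

Lemma vunit_mul1 s t : O 0 s -> O 0 t -> s * t = 1 -> vunit s.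
Proof.
move=> os ot st; apply: vunitP => // s1; have := val_geM s1 ot.
by rewrite st addr0 => /(vunit_nge1 vunit1).
Qed.

Definition varpi : F := s2val (cid2 (@lval_uniformizer F)).
Lemma varpi_neq0 : varpi != 0. Proof. exact: (s2valP (cid2 (@lval_uniformizer F))). Qed.
Lemma lval_varpi : v varpi = 1. Proof. exact: (s2valP' (cid2 (@lval_uniformizer F))). Qed.

Lemma piXz_neq0 m : varpi ^ m != 0. Proof. exact: expfz_neq0 _ varpi_neq0. Qed.

Lemma lval_pin n : v (varpi ^+ n) = n%:Z.
Proof.
elim: n => [|n IH]; first exact: lval1.
by rewrite exprS lvalM ?expf_neq0 ?varpi_neq0 // IH lval_varpi intS.
Qed.

Lemma lval_piXz m : v (varpi ^ m) = m.
Proof.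
case: m => n; first by rewrite -exprnP lval_pin.
by rewrite NegzE -exprnN lvalV ?expf_neq0 ?varpi_neq0 // lval_pin.
Qed.

Lemma val_ge_pi m m' s : O m (varpi ^ m' * s) <-> O (m - m') s.
Proof.
have h k k' x : O k x -> O (k + k') (varpi ^ k' * x).
  move=> kx; rewrite addrC; apply: val_geM kx; right.
  by rewrite lval_piXz.
split=> [/(h _ (- m'))|/(h _ m')]; last by rewrite subrK.
by rewrite mulrA -expfzDr ?varpi_neq0 // addNr mul1r.
Qed.

Lemma val_ge_all0 s : (forall m, O m s) -> s = 0.
Proof.
move=> h; apply/eqP; apply: contraT => s0.
by have /(val_geE _ s0) := h (v s + 1); rewrite gerDl.
Qed.

Lemma nbhs_val_ge m s : nbhs s [set t | O m (t - s)].
Proof. by apply/lval_nbhs; exists m. Qed.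

Lemma val_ge_open m s : open [set t | O m (t - s)].
Proof.
rewrite openE => t /= mt; apply/lval_nbhs; exists m => x /= mx.
by rewrite -(subrK t x) -addrA; apply: val_geD.
Qed.

Lemma val_ge_closed m s : closed [set t | O m (t - s)].
Proof.
move=> t /(_ _ (nbhs_val_ge m t)) [x [/= mx mtx]].
rewrite -(subrK x t) -addrA; apply: val_geD => //.
by rewrite -opprB; apply: val_geN.
Qed.

Lemma closure_val_ge (A : set F) s : closure A s <-> forall m, exists2 t, A t & O m (t - s).
Proof.
split=> [cAs m|h B /lval_nbhs[m mB]].
  by have [t [At mt]] := cAs _ (nbhs_val_ge m s); exists t.
by have [t At mt] := h m; exists t; split=> //; apply: mB.
Qed.

(** The order of the residue field is given as the cardinality of a set of cosets; a point chosen in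
    each coset turns it into a list over which one can sum. *)
Lemma residue_reps : exists2 R : seq F, transversal (O 0) (O 1) R & size R = @resorder F.
Proof.
have := @residue_classes F; rewrite card_eq_sym => /card_set_bijP[f [fS fI fJ]].
have h i : exists s, `I_(@resorder F) i -> O 0 s /\ f i = [set t | O 1 (t - s)].
  have [iq|niq] := pselect (`I_(@resorder F) i); last by exists 0.
  by have [s s0 e] := fS i iq; exists s.
have [r rP] := choice h.
have self x : [set t | O 1 (t - x)] x by rewrite /= subrr; left.
have sub x y : [set t | O 1 (t - x)] = [set t | O 1 (t - y)] <-> O 1 (x - y).
  split=> [e|mxy]; first by have := self x; rewrite e.
  rewrite predeqE => t /=; split=> mt.
    have -> : t - y = (t - x) + (x - y) by rewrite subrKA.
    exact: val_geD.
  have -> : t - x = (t - y) + (- (x - y)) by rewrite opprB subrKA.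
  by apply: val_geD => //; apply: val_geN.
exists [seq r i | i <- iota 0 (@resorder F)]; last by rewrite size_map size_iota.
have rI i j : (i < @resorder F)%N -> (j < @resorder F)%N -> O 1 (r i - r j) -> i = j.
  move=> iq jq /sub e; apply: fI; rewrite ?inE //.
  by have [_ ->] := rP i iq; have [_ ->] := rP j jq.
split.
- rewrite map_inj_in_uniq ?iota_uniq // => i j.
  rewrite !mem_iota /= !add0n => iq jq e; apply: rI => //.
  by rewrite e subrr; left.
- move=> _ /mapP[i + ->]; rewrite mem_iota /= add0n => iq.
  by case: (rP i iq).
- move=> x x0; have [|i iq fi] := fJ [set t | O 1 (t - x)].
    by exists x.
  exists (r i); first by apply: map_f; rewrite mem_iota /= add0n.
  by apply/sub; rewrite -fi; case: (rP i iq).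
- move=> _ _ /mapP[i + ->] /mapP[j + ->].
  by rewrite !mem_iota /= !add0n => iq jq /rI ->.
Qed.

Lemma transversal_pi m m' n R : transversal (O m) (O m') R ->
  transversal (O (m + n)) (O (m' + n)) [seq varpi ^ n * r | r <- R].
Proof.
move=> [uR MR eR iR]; split.
- by rewrite map_inj_uniq //; apply: mulfI; apply: piXz_neq0.
- by move=> _ /mapP[r rR ->]; apply/val_ge_pi; rewrite addrK; apply: MR.
- move=> x mx; have [|r rR mr] := eR (varpi ^ (- n) * x).
    by apply/val_ge_pi; rewrite opprK.
  exists (varpi ^ n * r); first exact: map_f.
  have -> : x - varpi ^ n * r = varpi ^ n * (varpi ^ (- n) * x - r).
    by rewrite mulrBr mulrA -expfzDr ?varpi_neq0 // addrN mul1r.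
  by apply/val_ge_pi; rewrite addrK.
- move=> _ _ /mapP[r rR ->] /mapP[r' r'R ->]; rewrite -mulrBr => /val_ge_pi.
  by rewrite addrK => /iR ->.
Qed.

Lemma resorder_gt0 : (0 < @resorder F)%N.
Proof.
have [R [_ _ eR _] <-] := residue_reps.
by have [r + _] := eR 0 (val_ge0 0); case: R {eR}.
Qed.

(** Digit expansion: representatives modulo one more power of the uniformizer arise by adding
    residue digits scaled by [varpi ^ (m + n)]. *)
Lemma val_ge_reps m (n : nat) : exists2 R : seq F, transversal (O m) (O (m + n%:Z)) R
   & size R = (@resorder F ^ n)%N.
Proof.
elim: n => [|n [R tR sR]].
  exists [:: 0] => //; have -> : m + 0%N%:Z = m by rewrite addr0.
  exact: transversal1 (val_ge_subgroup m).
have [R1 tR1 sR1] := residue_reps.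
exists [seq r + r' | r <- R, r' <- [seq varpi ^ (m + n%:Z) * r | r <- R1]]; last first.
  by rewrite size_allpairs size_map sR sR1 expnSr.
have le1 k (j : nat) : k <= k + j%:Z by rewrite lerDl.
apply: (@transversal_trans F _ (O (m + n%:Z))) => //; try exact: val_ge_subgroup.
- by move=> x; apply: val_ge_le.
- by move=> x; apply: val_ge_le; rewrite -addn1 PoszD addrA le1.
- have := transversal_pi (m + n%:Z) tR1.
  by rewrite add0r [1 + _]addrC -addrA -PoszD addn1.
Qed.

Lemma val_ge_reps2 m m' : m <= m' -> exists2 R : seq F, transversal (O m) (O m') R
   & size R = (@resorder F ^ `|m' - m|)%N.
Proof.
move=> mm'; have [R tR sR] := val_ge_reps m `|m' - m|; exists R => //.
by move: tR; rewrite gez0_abs ?subr_ge0 // addrCA subrr addr0.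
Qed.

End Valuation.

(** * The closure of the prime ring *)

Section PrimeRing.
Context {F : nonArchLocalFieldType}.
Variable p : nat.
Hypothesis p_char : is_residue_char F p.
Local Notation v := (@lval F).
Local Notation O := (val_ge v).
Local Notation P := (@primering_closure F).
Local Notation pk k := ((p ^ k)%N%:R : F).

Lemma char_prime : prime p. Proof. by case: p_char. Qed.
Let p_gt0 : (0 < p)%N := prime_gt0 char_prime.
Lemma val_ge_p : O 1 (p%:R : F). Proof. by case: p_char. Qed.

(** Bezout: by [a * m = b * p + 1] a positive valuation of [m] would give 1 a positive valuation. *)
Lemma nat_vunit (m : nat) : ~~ (p %| m)%N -> vunit (m%:R : F).
Proof.
move=> npm; apply: vunitP; first exact: val_ge_nat.
move=> m1; have cop : coprime m p by rewrite coprime_sym prime_coprime ?char_prime.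
have m_gt0 : (0 < m)%N by case: m npm {m1 cop} => //; rewrite dvdn0.
have [a b e _] := egcdnP p m_gt0.
have /(congr1 (fun n => n%:R : F)) : (a * m = b * p + 1)%N by rewrite e (eqP cop).
rewrite natrD !natrM => {}e; apply: (vunit_nge1 (@vunit1 F)).
have -> : 1 = a%:R * m%:R - b%:R * p%:R :> F by rewrite e addrC addKr.
apply: val_geD; last first.
  by apply: val_geN; apply: val_geMl val_ge_p; apply: val_ge_nat.
by apply: val_geMl m1; apply: val_ge_nat.
Qed.

Lemma int_vunit (m : int) : ~~ (p %| m)%Z -> vunit (m%:~R : F).
Proof.
rewrite dvdzE /=; case: m => m /=; first exact: nat_vunit.
by move=> h; rewrite NegzE mulrNz; apply/vunitN/nat_vunit.
Qed.

Lemma val_ge1_dvdz (m : int) : O 1 (m%:~R : F) -> (p %| m)%Z.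
Proof. by move=> m1; apply: contraT => /int_vunit /vunit_nge1. Qed.

Lemma val_ge1_dvdn (m : nat) : O 1 (m%:R : F) -> (p %| m)%N.
Proof. by move=> m1; apply: contraT => /nat_vunit /vunit_nge1. Qed.

Lemma val_ge_pX k z : O 0 z -> O k%:Z (pk k * z).
Proof.
move=> z0; apply: val_geMr => //.
by rewrite natrX -[k%:Z]natz; apply: val_geX; exact: val_ge_p.
Qed.

Lemma closureP_int s : P s <-> forall m, exists n : int, O m (s - n%:~R).
Proof.
split=> [/closure_val_ge h m|h].
  by have [_ [n _ <-] hn] := h m; exists n; rewrite -opprB; apply: val_geN.
by apply/closure_val_ge => m; have [n] := h m; exists n%:~R => //; rewrite -opprB; apply: val_geN.
Qed.

Lemma primering_int (n : int) : P n%:~R.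
Proof. by apply/closureP_int => m; exists n; rewrite subrr; left. Qed.

Lemma primering_nat (n : nat) : P n%:R.
Proof. by rewrite pmulrn; apply: primering_int. Qed.

Lemma primering1 : P 1. Proof. by rewrite -[1]/(1%:R); apply: primering_nat. Qed.
Lemma primering0 : P 0. Proof. by rewrite -[0]/(0%:R); apply: primering_nat. Qed.

Lemma primeringB x y : P x -> P y -> P (x - y).
Proof.
move=> /closureP_int hx /closureP_int hy; apply/closureP_int => m.
have [n hn] := hx m; have [n' hn'] := hy m; exists (n - n').
have -> : x - y - (n - n')%:~R = (x - n%:~R) - (y - n'%:~R) by rewrite intrB; ring.
by apply: val_geD => //; apply: val_geN.
Qed.

Lemma primeringN x : P x -> P (- x).
Proof. by move=> px; rewrite -sub0r; apply: primeringB px; apply: primering0. Qed.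
Lemma primeringD x y : P x -> P y -> P (x + y).
Proof. by move=> px py; rewrite -[y]opprK; apply: primeringB px _; apply: primeringN. Qed.

Lemma primering_ge0 x : P x -> O 0 x.
Proof.
move=> /closureP_int /(_ 0) [n hn]; rewrite -(subrK n%:~R x).
by apply: val_geD => //; apply: val_ge_int.
Qed.

Lemma primeringM x y : P x -> P y -> P (x * y).
Proof.
move=> px py; have [x0 y0] := (primering_ge0 px, primering_ge0 py).
move: px py => /closureP_int hx /closureP_int hy; apply/closureP_int => m.
have [n hn] := hx m; have [n' hn'] := hy m; exists (n * n'); rewrite intrM.
have -> : x * y - n%:~R * n'%:~R = (x - n%:~R) * y + n%:~R * (y - n'%:~R).
  by rewrite mulrBl mulrBr addrA subrK.
apply: val_geD; first by apply: val_geMr.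
by apply: val_geMl => //; apply: val_ge_int.
Qed.

Lemma primeringX n x : P x -> P (x ^+ n).
Proof.
by move=> px; elim: n => [|n IH]; [exact: primering1|rewrite exprS; apply: primeringM].
Qed.

Lemma primering_closed x : (forall m, exists2 t, P t & O m (x - t)) -> P x.
Proof.
move=> h; apply/closureP_int => m; have [t /closureP_int /(_ m) [n hn] xt] := h m.
by exists n; rewrite -(subrKA t); apply: val_geD.
Qed.

(* In characteristic 0 the valuation of [F] restricts to a multiple of the
   p-adic one on integers; in characteristic p an integer of positive valuation
   vanishes. *)
Lemma val_ge_dvdz k (n : int) : p%:R != 0 :> F ->
  O (v p%:R *+ k) (n%:~R : F) -> ((p ^ k)%N %| n)%Z.
Proof.
move=> p0; have vp : 1 <= v p%:R by apply/(val_geE _ p0)/val_ge_p.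
elim: k n => [|k IH] n hn; first by rewrite expn0 dvd1z.
have /dvdzP[n' en] : (p %| n)%Z.
  apply: val_ge1_dvdz; apply: val_ge_le hn; rewrite mulrS -[1]addr0.
  by apply: lerD => //; rewrite mulrn_wge0 // (le_trans _ vp).
rewrite en expnS [(p * _)%N]mulnC PoszM dvdz_mul2r ?eqz_nat -?lt0n ?p_gt0 // IH //.
  case: (eqVneq n' 0) => [->|n'0]; first by left.
  have [n'F0|n'F0] := eqVneq (n'%:~R : F) 0; first by left.
  move: hn; rewrite en intrM => /val_geE -/(_ (mulf_neq0 n'F0 p0)).
  rewrite lvalM // mulrS addrC lerD2r => h; exact/val_geE.
Qed.

(** The point is that the quotient [z] stays in the closure of the prime ring: this lets [r] act on
    roots of unity of order dividing p^k as the exponent [m]. *)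
Lemma primering_nat_approx r k : P r ->
  exists (m : nat), exists2 z, P z & r - m%:R = pk k * z.
Proof.
move=> Pr; suff [n [z Pz e]] : exists (n : int), exists2 z, P z & r - n%:~R = pk k * z.
  have pk0 : (p ^ k)%N%:Z != 0 by rewrite eqz_nat -lt0n expn_gt0 p_gt0.
  exists `|(n %% (p ^ k)%N)%Z|%N, (z + (n %/ (p ^ k)%N)%Z%:~R).
    by apply: primeringD => //; apply: primering_int.
  rewrite mulrDr -e pmulrn gez0_abs ?modz_ge0 //.
  have -> : n%:~R = (n %/ (p ^ k)%N)%Z%:~R * pk k + (n %% (p ^ k)%N)%Z%:~R :> F.
    by rewrite {1}(divz_eq n (p ^ k)%N) rmorphD rmorphM.
  ring.
(* In characteristic p, integers congruent modulo the maximal ideal are equal in F, so for positive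
   exponents [r] is itself an integer and [z = 0] works. *)
have [p0|p0] := eqVneq (p%:R : F) 0.
  case: k => [|k]; first by exists 0, r => //; rewrite subr0 expn0 mul1r.
  move: Pr => /closureP_int h; have [n hn] := h 1.
  exists n, 0; rewrite ?mulr0; first exact: primering0.
  apply: val_ge_all0 => m; have [n' hn'] := h (Num.max m 1).
  have /val_ge1_dvdz/dvdzP[w ew] : O 1 ((n' - n)%:~R : F).
    rewrite intrB -(subrKA r) [n'%:~R - r + _]addrC; apply: val_geD => //.
    rewrite -opprB; apply: val_geN; apply: val_ge_le hn'; by rewrite le_max lexx orbT.
  have -> : n%:~R = n'%:~R :> F.
    apply/eqP; rewrite eq_sym -subr_eq0 -intrB ew intrM.
    by rewrite (_ : p%:~R = p%:R) // p0 mulr0.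
  by apply: val_ge_le hn'; rewrite le_max lexx.
have vpk : v (pk k) = v p%:R *+ k.
  rewrite natrX; elim: k => [|k IH]; first by rewrite lval1.
  by rewrite exprS lvalM ?expf_neq0 // IH mulrS.
have pk0 : pk k != 0 by rewrite natrX expf_neq0.
(* In characteristic 0, a finer approximation n' of r differs from n by a multiple of p^k, so (r -
   n) / p^k is a limit of the integers (n' - n) / p^k. *)
move: Pr => /closureP_int h; have [n hn] := h (v p%:R *+ k).
exists n, ((r - n%:~R) / pk k); last by rewrite mulrC divfK.
apply/closureP_int => m; have [n' hn'] := h (Num.max (m + v p%:R *+ k) (v p%:R *+ k)).
have /(val_ge_dvdz p0)/dvdzP[w ew] : O (v p%:R *+ k) ((n' - n)%:~R : F).
  rewrite intrB -(subrKA r) [n'%:~R - r + _]addrC; apply: val_geD => //.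
  rewrite -opprB; apply: val_geN; apply: val_ge_le hn'; by rewrite le_max lexx orbT.
exists w; have -> : (r - n%:~R) / pk k - w%:~R = (pk k)^-1 * (r - n'%:~R).
  have -> : n' = w * (p ^ k)%N + n by rewrite -ew subrK.
  rewrite intrD intrM [_%:~R * _]mulrC opprD [_ - n%:~R]addrC addrA mulrBr.
  by rewrite mulKf // [RHS]addrC mulrC [RHS]addrC.
rewrite -[m](addrK (v p%:R *+ k)) addrC; apply: val_geM.
  by right; rewrite lvalV // vpk.
by apply: val_ge_le hn'; rewrite le_max lexx.
Qed.

Lemma primering_dvd z : P z -> O 1 z -> exists2 w, P w & z = p%:R * w.
Proof.
move=> Pz z1; have [m [w Pw]] := primering_nat_approx 1 Pz.
rewrite expn1 => e; have /val_ge1_dvdn/dvdnP[m' em] : O 1 (m%:R : F).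
  rewrite -[m%:R](subKr z) e; apply: val_geD => //; apply: val_geN.
  by apply: val_geMr val_ge_p (primering_ge0 Pw).
exists (m'%:R + w); first by apply: primeringD Pw; apply: primering_nat.
by rewrite mulrDr -e em natrM [p%:R * _]mulrC subrKC.
Qed.

(** Trades the factor [p%:R * z] for a condition on valuations, which passes to products and
    limits. *)
Lemma one_unitsE s : @one_units F p s <-> P s /\ O 1 (s - 1).
Proof.
split=> [[z Pz <-]|[Ps s1]].
  rewrite addrAC subrr add0r; split; last by apply: val_geMr val_ge_p (primering_ge0 Pz).
  by apply: primeringD; [exact: primering1|apply: primeringM => //; exact: primering_nat].
have [|w Pw e] := primering_dvd _ s1; first by apply: primeringB => //; exact: primering1.
by exists w => //; rewrite -e subrKC.
Qed.

Lemma one_units_vunit s : @one_units F p s -> vunit s.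
Proof. by move=> /one_unitsE[_ s1]; apply: vunit_congr s1; exact: vunit1. Qed.

Lemma one_unitsM s t : @one_units F p s -> @one_units F p t -> @one_units F p (s * t).
Proof.
move=> us /one_unitsE[Pt t1]; have s0 := vunit_ge0 (one_units_vunit us).
move: us => /one_unitsE[Ps s1]; apply/one_unitsE; split; first exact: primeringM.
have -> : s * t - 1 = s * (t - 1) + (s - 1) by rewrite mulrBr mulr1 subrKA.
by apply: val_geD => //; apply: val_geMl.
Qed.

Lemma one_units1 : @one_units F p 1.
Proof. by apply/one_unitsE; rewrite subrr; split; [exact: primering1|left]. Qed.

Lemma one_unitsX n s : @one_units F p s -> @one_units F p (s ^+ n).
Proof.
by move=> us; elim: n => [|n IH]; [exact: one_units1|rewrite exprS; apply: one_unitsM].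
Qed.

Lemma primering_limit (a : nat -> F) : (forall k, P (a k)) ->
  (forall k, O k%:Z (a k.+1 - a k)) ->
  exists2 l, P l & forall k, O k%:Z (l - a k).
Proof.
move=> Pa ha; have haj k j : O k%:Z (a (k + j)%N - a k).
  elim: j => [|j IH]; first by rewrite addn0 subrr; left.
  rewrite addnS -(subrKA (a (k + j)%N)); apply: val_geD => //.
  by apply: val_ge_le (ha _); rewrite lez_nat leq_addr.
have [l hl] : exists l : F, a @ \oo --> l.
  apply: lval_complete => m; exists `|m|%N => i j mi mj.
  rewrite -(subrKA (a `|m|%N)); apply: (@val_ge_le _ _ `|m|%N%:Z); first exact: ler_norm.
  apply: val_geD; first by rewrite -(subnKC mi).
  by rewrite -opprB; apply: val_geN; rewrite -(subnKC mj).
have lk k : O k%:Z (l - a k).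
  have [N _ hN] := hl _ (nbhs_val_ge k%:Z l).
  have := hN (maxn N k) (leq_maxl _ _) => /= h.
  rewrite -(subrKA (a (maxn N k))); apply: val_geD; last by rewrite -(subnKC (leq_maxr N k)).
  by rewrite -opprB; apply: val_geN.
exists l => //; apply: primering_closed => m; exists (a `|m|%N) => //.
by apply: val_ge_le (lk _); apply: ler_norm.
Qed.

Lemma vunit2 : p != 2%N -> vunit (2 : F).
Proof.
move=> p2; apply: (@nat_vunit 2); apply: contra p2 => /dvdn_leq -/(_ isT).
by have := prime_gt1 char_prime; case: p => [|[|[|]]].
Qed.

(** Each p-th power gains one in valuation: the cofactor of y - 1 in y^p - 1 is a sum of p terms
    congruent to 1, hence lies in the maximal ideal. *)
Lemma one_units_pX w k : @one_units F p w -> O k.+1%:Z (w ^+ (p ^ k) - 1).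
Proof.
move=> uw; elim: k => [|k IH]; first by rewrite expn0 expr1; case/one_unitsE: uw.
rewrite expnSr exprM; have := one_unitsX (p ^ k) uw; move: IH.
set y := w ^+ _ => IH uy; rewrite subrX1 -[k.+2]addn1 PoszD; apply: val_geM => //.
have -> : \sum_(i < p) y ^+ i = \sum_(i < p) (y ^+ i - 1) + p%:R.
  by rewrite big_split /= sumrN sumr_const card_ord subrK.
apply: val_geD; last exact: val_ge_p.
by elim/big_ind: _ => [|? ?|i _]; [left|exact: val_geD|case/one_unitsE: (one_unitsX i uy)].
Qed.

(* The square root of [w] is the limit of [w ^ ((p ^ k + 1) / 2)]. *)
Lemma one_units_sqrt w : p != 2%N -> @one_units F p w ->
  exists2 s, @one_units F p s & s ^+ 2 = w.
Proof.
move=> p2 uw; have podd : odd p by case: (even_prime char_prime) p2 => // ->.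
pose a k := w ^+ ((p ^ k).+1./2).
have halfE k : ((p ^ k).+1./2 * 2 = (p ^ k).+1)%N.
  by rewrite muln2 halfK /= oddX podd orbT.
have ua k : @one_units F p (a k) by apply: one_unitsX.
have [|k|l Pl hl] := @primering_limit a.
- by move=> k; case/one_unitsE: (ua k).
(* Consecutive exponents differ by p^k (p - 1) / 2, so consecutive terms differ by a factor that is
   a power of [w ^+ (p ^ k)] and thus close to 1. *)
- have e : ((p ^ k.+1).+1./2 = (p ^ k).+1./2 + p ^ k * p.-1./2)%N.
    apply/eqP; rewrite -(eqn_pmul2r (isT : 0 < 2)%N) mulnDl !halfE -mulnA.
    rewrite muln2 halfK (negbTE _ : odd p.-1 = false); last first.
      by move: podd p_gt0; case: p => //= n ->.
    by rewrite subn0 expnSr addSn -mulnS prednK.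
  rewrite /a e exprD exprM; have := one_units_pX k uw; set y := w ^+ _ => hy.
  rewrite -[X in _ - X]mulr1 -mulrBr; apply: val_geMl.
    exact: (vunit_ge0 (one_units_vunit (ua k))).
  rewrite subrX1; apply: val_geMr; first by apply: val_ge_le hy; rewrite lez_nat.
  have uy : @one_units F p y by apply: one_unitsX.
  elim/big_ind: _ => [|? ?|i _]; [by left|exact: val_geD|].
  exact/vunit_ge0/one_units_vunit/one_unitsX.
have ul : @one_units F p l.
  apply/one_unitsE; split=> //; rewrite -(subrKA (a 1%N)); apply: val_geD; first exact: (hl 1%N).
  by case/one_unitsE: (ua 1%N).
exists l => //; apply/eqP; rewrite -subr_eq0; apply/eqP; apply: val_ge_all0 => m.
apply: (@val_ge_le _ _ `|m|%N%:Z); first exact: ler_norm.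
rewrite -(subrKA (a `|m|%N ^+ 2)); apply: val_geD.
  rewrite subr_sqr; apply: val_geMr => //.
  by apply: val_geD; apply/vunit_ge0/one_units_vunit.
(* The square of the k-th term is w times w^(p^k), which tends to w. *)
rewrite /a -exprM halfE exprS -[X in _ - X]mulr1 -mulrBr.
apply: val_geMl; first by apply/vunit_ge0/one_units_vunit.
by apply: val_ge_le (one_units_pX _ uw); rewrite lez_nat.
Qed.

End PrimeRing.

(** * The root of unity [eps] and its reduction modulo p *)

Section Teichmuller.
Context {F : nonArchLocalFieldType}.
Variables (p : nat) (eps : F).
Hypotheses (p_char : is_residue_char F p) (eps_unit : primering_units eps).
Hypothesis eps_prim : (p.-1).-primitive_root eps.
Local Notation v := (@lval F).
Local Notation O := (val_ge v).
Local Notation P := (@primering_closure F).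

Let p_prime : prime p := char_prime p_char.
Let p_gt1 : (1 < p)%N := prime_gt1 p_prime.

Lemma eps_primering : P eps. Proof. by case: eps_unit. Qed.

Lemma eps_vunit : vunit eps.
Proof.
have e0 := primering_ge0 eps_primering.
apply: (@vunit_mul1 _ eps (eps ^+ p.-1.-1) e0 (val_geX0 _ e0)).
by rewrite -exprS prednK ?(prim_expr_order eps_prim) // -ltnS prednK // ltnW.
Qed.

(** The cofactor of x - 1 in x^(p-1) - 1 is congruent to p - 1, a unit, so it is not the factor that
    vanishes. *)
Lemma teichmuller_inj x : x ^+ p.-1 = 1 -> O 1 (x - 1) -> x = 1.
Proof.
move=> xp x1; have ux : vunit x by apply: vunit_congr x1; exact: vunit1.
have xX i : O 1 (x ^+ i - 1).
  rewrite subrX1; apply: val_geMr => //.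
  elim/big_ind: _ => [|? ?|j _]; [by left|exact: val_geD|exact/vunit_ge0/vunitX].
have : (x - 1) * (\sum_(i < p.-1) x ^+ i) = 0 by rewrite -subrX1 xp subrr.
move=> /eqP; rewrite mulf_eq0 => /orP[/eqP|/eqP s0].
  by move=> /eqP; rewrite subr_eq0 => /eqP.
have : vunit (\sum_(i < p.-1) x ^+ i).
  apply: (@vunit_congr _ p.-1%:R); last first.
    rewrite -[X in X%:R](card_ord p.-1) -sumr_const -sumrB.
    by elim/big_ind: _ => [|? ?|j _]; [left|exact: val_geD|exact: xX].
  apply: (nat_vunit p_char); apply/negP => /dvdn_leq.
  by have := p_gt1; lia.
by rewrite s0 => /vunit_neq0/eqP.
Qed.

Lemma epsX_congr i j : O 1 (eps ^+ i - eps ^+ j) -> eps ^+ i = eps ^+ j.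
Proof.
wlog ij : i j / (j <= i)%N.
  move=> h; case: (leqP j i) => [|/ltnW] ij; first exact: h.
  by rewrite -opprB => /val_geN; rewrite opprK => /h ->.
rewrite -(subnK ij) exprD -[X in _ - X]mul1r -mulrBl mulrC.
move=> /(val_ge_vunitM _ _ (vunitX j eps_vunit)) /teichmuller_inj -> //; first by rewrite mul1r.
by rewrite -exprM mulnC exprM (prim_expr_order eps_prim) expr1n.
Qed.

Lemma nat_Fp_eq (a b : nat) : (a%:R == b%:R :> 'F_p) <-> O 1 (a%:R - b%:R : F).
Proof.
have h (c : nat) : (c%:R == 0 :> 'F_p) = (p %| c)%N.
  by rewrite -(dvdn_pcharf (pchar_Fp p_prime)).
wlog ba : a b / (b <= a)%N.
  move=> hw; case: (leqP b a) => [|/ltnW] ab; first exact: hw.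
  rewrite eq_sym; have [h1 h2] := hw _ _ ab; split=> [/h1|]; rewrite -opprB => /val_geN; rewrite ?opprK.
    by [].
  exact: h2.
rewrite -subr_eq0 -!natrB // h; split=> [/dvdnP[m ->]|/(val_ge1_dvdn p_char)//].
by rewrite natrM; apply: val_geMl (val_ge_p p_char); exact: val_ge_nat.
Qed.

(** Gauss sums are indexed by ['F_p] whereas [eps] lives in F; the integer [e] carries primitivity
    from one to the other. *)
Lemma eps_nat : exists e : nat, O 1 (eps - e%:R) /\ (p.-1).-primitive_root (e%:R : 'F_p).
Proof.
have [e [z Pz]] := primering_nat_approx p_char 1 eps_primering; rewrite expn1 => ez.
have e1 : O 1 (eps - e%:R).
  by rewrite ez; apply: val_geMr (val_ge_p p_char) (primering_ge0 Pz).
exists e; split=> //.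
have eX i : O 1 (eps ^+ i - (e ^ i)%N%:R).
  rewrite natrX subrXX; apply: val_geMr => //.
  elim/big_ind: _ => [|? ?|j _]; [by left|exact: val_geD|].
  apply: val_geMr; first exact/val_geX0/primering_ge0/eps_primering.
  exact/val_geX0/val_ge_nat.
have eE i : (e%:R ^+ i == 1 :> 'F_p) = (eps ^+ i == 1).
  apply/idP/idP; rewrite -natrX -[1 in X in X -> _]/(1%:R).
    move=> /nat_Fp_eq h; apply/eqP; rewrite -(expr0 eps); apply: epsX_congr.
    by rewrite expr0 -(subrKA (e ^ i)%N%:R); apply: val_geD.
  move=> /eqP h; have -> : (1 : 'F_p) = 1%:R by []; apply/nat_Fp_eq.
  by rewrite -opprB; apply: val_geN; rewrite -{1}[1%:R]h; apply: eX.
have p1 : (0 < p.-1)%N by rewrite -ltnS prednK // ltnW.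
apply/andP; split=> //; apply/forallP => i; rewrite unity_rootE eE.
by move: eps_prim => /andP[_ /forallP/(_ i)]; rewrite unity_rootE.
Qed.

End Teichmuller.

(** * The order of the residue field is a power of p *)

Section ResidueOrder.
Context {F : nonArchLocalFieldType}.
Variable p : nat.
Hypothesis p_char : is_residue_char F p.
Local Notation v := (@lval F).
Local Notation O := (val_ge v).

Lemma transversal_le (A : zmodType) (M M' N : set A) R R' : subgroup N -> M `<=` M' ->
  transversal M N R -> transversal M' N R' -> (size R <= size R')%N.
Proof.
move=> sN MM' [uR MR eR iR] [uR' MR' eR' iR'].
have h x : exists r, M' x -> r \in R' /\ N (x - r).
  have [Mx|nMx] := pselect (M' x); last by exists 0.
  by have [r ? ?] := eR' x Mx; exists r.
have [f fP] := choice h.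
rewrite -(size_map f); apply: uniq_leq_size.
  rewrite map_inj_in_uniq // => x y xR yR e; apply: iR => //.
  have [_ h1] := fP x (MM' _ (MR _ xR)); have [_ h2] := fP y (MM' _ (MR _ yR)).
  have -> : x - y = (x - f x) - (y - f y) by rewrite e opprB subrKA.
  exact: subgroupB.
by move=> _ /mapP[x xR ->]; case: (fP x (MM' _ (MR _ xR))).
Qed.

(** Without a field structure on the residue classes: a chain of groups between the maximal ideal
    and the ring of integers is grown, each step multiplying the index by p. It must reach the whole
    ring, as otherwise the index would exceed q. *)
Lemma resorder_pX : exists f, @resorder F = (p ^ f)%N.
Proof.
have p_prime := char_prime p_char; have p_gt1 := prime_gt1 p_prime.
have [R tR sR] := @residue_reps F; have sO m := @val_ge_subgroup F m.
have step k (H : set F) RH : subgroup H -> O 1 `<=` H -> H `<=` O 0 ->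
    transversal H (O 1) RH -> size RH = (p ^ k)%N ->
    (exists f, @resorder F = (p ^ f)%N) \/ exists H' RH', [/\ subgroup H', O 1 `<=` H', H' `<=` O 0,
    transversal H' (O 1) RH' & size RH' = (p ^ k.+1)%N].
  move=> sH O1H HO0 tH sRH; have [OH|nOH] := pselect (O 0 `<=` H).
    left; exists k; rewrite -sR -sRH; apply/eqP; rewrite eqn_leq.
    by rewrite (transversal_le (sO 1) OH tR tH) (transversal_le (sO 1) HO0 tH tR).
  right; have [x Ox nHx] : exists2 x, O 0 x & ~ H x.
    apply: contrapT => h; apply: nOH => x Ox; apply: contrapT => nHx.
    by apply: h; exists x.
  have pH y : O 0 y -> H (p%:R * y).
    by move=> y0; apply: O1H; apply: val_geMr (val_ge_p p_char) y0.
  (* The group H + Zx. Since p times the ring of integers lies in H, the multiples j x with j < p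
     represent H' / H, and -j may be replaced by (p - 1) j, so natural multiples suffice. *)
  pose H' := [set y | exists j : nat, H (y - j%:R * x)].
  have HZ (j : nat) y : H y -> H (j%:R * y).
    by move=> Hy; rewrite mulr_natl; elim: j => [|j IH]; [rewrite mulr0n; case: sH|rewrite mulrS; apply: subgroupD].
  have sH' : subgroup H'.
    split=> [|y z [i hi] [j hj]]; first by exists 0%N; rewrite mul0r subr0; case: sH.
    exists (i + (p.-1 * j))%N.
    have -> : y - z - (i + p.-1 * j)%N%:R * x =
        (y - i%:R * x) - (z - j%:R * x) - p%:R * (j%:R * x).
      by rewrite -{2}(prednK (ltnW p_gt1)) -natr1 natrD natrM; ring.
    apply: subgroupB => //; first exact: subgroupB.
    by apply: pH; apply: val_geMl => //; exact: val_ge_nat.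
  have tx : transversal H' H [seq j%:R * x | j <- iota 0 p].
    have key i j : (i < j < p)%N -> ~ H (j%:R * x - i%:R * x).
      move=> /andP[ij jp]; rewrite -mulrBl -natrB ?(ltnW ij) // => h.
      have cop : coprime (j - i) p.
        rewrite coprime_sym prime_coprime //; apply/negP => /dvdn_leq.
        by rewrite subn_gt0 ij => /(_ isT); rewrite leqNgt (leq_ltn_trans (leq_subr _ _) jp).
      have [|a b e _] := @egcdnP (j - i) p; first by rewrite subn_gt0.
      apply: nHx; have /(congr1 (fun n => n%:R * x)) : (a * (j - i) = b * p + 1)%N by rewrite e (eqP cop).
      rewrite natrD mulrDl mul1r !natrM -!mulrA => /eqP; rewrite addrC -subr_eq => /eqP <-.
      apply: subgroupB => //; first exact: HZ.
      by apply: HZ; apply: pH.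
    have key' i j : (i < p)%N -> (j < p)%N -> H (j%:R * x - i%:R * x) -> i = j.
      move=> ip jp h; case: (ltngtP i j) => // ij; exfalso.
        by apply: (@key i j) => //; rewrite ij.
      by apply: (@key j i); rewrite ?ij // -opprB; apply: subgroupN.
    split.
    - rewrite map_inj_in_uniq ?iota_uniq // => i j; rewrite !mem_iota !add0n => /= ip jp e.
      by apply: key' => //; rewrite e subrr; case: sH.
    - by move=> _ /mapP[j _ ->]; exists j; rewrite subrr; case: sH.
    - move=> y [j hj]; exists ((j %% p)%N%:R * x).
        by apply: map_f; rewrite mem_iota /= ltn_mod ltnW.
      have -> : y - (j %% p)%N%:R * x = (y - j%:R * x) + p%:R * ((j %/ p)%N%:R * x).
        rewrite {2}(divn_eq j p) natrD natrM mulrDl opprD addrA [_ * p%:R]mulrC -mulrA.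
        by rewrite addrAC subrK.
      apply: subgroupD => //; apply: pH; apply: val_geMl => //; exact: val_ge_nat.
    - move=> _ _ /mapP[i + ->] /mapP[j + ->]; rewrite !mem_iota !add0n /= => ip jp h.
      by rewrite (key' j i).
  have HH' : H `<=` H' by move=> y Hy; exists 0%N; rewrite mul0r subr0.
  exists H', [seq r + r' | r <- [seq j%:R * x | j <- iota 0 p], r' <- RH]; split=> //.
  - by move=> y /O1H /HH'.
  - move=> y [j /HO0 hj]; rewrite -(subrK (j%:R * x) y); apply: val_geD => //.
    by apply: val_geMl => //; exact: val_ge_nat.
  - exact: (transversal_trans sH' sH (sO 1)).
  - by rewrite size_allpairs size_map size_iota sRH expnS.
apply: contrapT => nf.
have big k : exists H RH, [/\ subgroup H, O 1 `<=` H, H `<=` O 0, transversal H (O 1) RH &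
    size RH = (p ^ k)%N].
  elim: k => [|k [H [RH [h1 h2 h3 h4 h5]]]].
    exists (O 1), [:: 0]; split=> //; first by move=> x; apply: val_ge_le.
    exact: (transversal1 (sO 1)).
  by have [] := step k H RH.
(* At step q the index would be p^q > q. *)
have [H [RH [_ _ h3 h4 h5]]] := big (@resorder F).
have := transversal_le (sO 1) h3 h4 tR; rewrite h5 sR leqNgt.
by rewrite ltn_expl.
Qed.

End ResidueOrder.

(** * Lattices and Schwartz functions *)

Definition latt {F : nonArchLocalFieldType} n (m : int) : set 'rV[F]_n :=
  [set x | forall j, val_ge (@lval F) m (x 0 j)].
Arguments latt {F} n m _.

Section Lattices.
Context {F : nonArchLocalFieldType}.
Local Notation latt := (@latt F).
Implicit Types (m : int).
Local Notation v := (@lval F).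
Local Notation O := (val_ge v).

Lemma latt_subgroup n m : subgroup (latt n m).
Proof.
split=> [j|x y hx hy j]; rewrite !mxE; first by left.
by apply: val_geD => //; apply: val_geN.
Qed.

Lemma latt_le n m m' x : m <= m' -> latt n m' x -> latt n m x.
Proof. by move=> mm' h j; apply: val_ge_le (h j). Qed.

Lemma latt_scale n c m k x : O k c -> latt n m x -> latt n (k + m) (c *: x).
Proof. by move=> ck hx j; rewrite mxE; apply: val_geM. Qed.

Lemma latt_vunit n u m x : vunit u -> latt n m (u *: x) <-> latt n m x.
Proof.
by move=> uu; split=> h j; have := h j; rewrite mxE => /(val_ge_vunitM _ _ uu).
Qed.

Lemma latt_ex n (x : 'rV[F]_n) : exists m, latt n m x.
Proof.
suff [m hm] : exists m, forall j, j \in enum 'I_n -> O m (x 0 j).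
  by exists m => j; apply: hm; rewrite mem_enum.
elim: (enum _) => [|i s [m hm]]; first by exists 0.
exists (Num.min m (v (x 0 i))) => j; rewrite inE => /orP[/eqP->|/hm].
  by right; rewrite ge_min lexx orbT.
by apply: val_ge_le; rewrite ge_min lexx.
Qed.

Lemma mx_val_ge n k (A : 'M[F]_(n, k)) : exists e : int, forall i j, O e (A i j).
Proof.
have [e he] := latt_ex (mxvec A); exists e => i j.
by have := he (mxvec_index i j); rewrite mxvecE.
Qed.

Lemma val_ge_sum m I (r : seq I) (Q : pred I) (f : I -> F) :
  (forall i, Q i -> O m (f i)) -> O m (\sum_(i <- r | Q i) f i).
Proof. exact: subgroup_sum (val_ge_subgroup m). Qed.

Lemma latt_mulmx n k (A : 'M[F]_(n, k)) :
  exists e, forall m x, latt n m x -> latt k (m + e) (x *m A).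
Proof.
have [e he] := mx_val_ge A; exists e => m x hx j; rewrite mxE.
by apply: val_ge_sum => i _; apply: val_geM.
Qed.

Definition dot n (x y : 'rV[F]_n) : F := (x *m y^T) 0 0.

Lemma dotE n (x y : 'rV[F]_n) : dot x y = \sum_j x 0 j * y 0 j.
Proof. by rewrite /dot mxE; apply: eq_bigr => j _; rewrite mxE. Qed.
Lemma dotC n (x y : 'rV[F]_n) : dot x y = dot y x.
Proof. by rewrite !dotE; apply: eq_bigr => j _; rewrite mulrC. Qed.
Lemma dotDl n (x y z : 'rV[F]_n) : dot (x + y) z = dot x z + dot y z.
Proof. by rewrite /dot mulmxDl mxE. Qed.
Lemma dotDr n (x y z : 'rV[F]_n) : dot z (x + y) = dot z x + dot z y.
Proof. by rewrite !(dotC z) dotDl. Qed.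
Lemma dotNl n (x y : 'rV[F]_n) : dot (- x) y = - dot x y.
Proof. by rewrite /dot mulNmx mxE. Qed.
Lemma dotNr n (x y : 'rV[F]_n) : dot x (- y) = - dot x y.
Proof. by rewrite !(dotC x) dotNl. Qed.
Lemma dotBl n (x y z : 'rV[F]_n) : dot (x - y) z = dot x z - dot y z.
Proof. by rewrite dotDl dotNl. Qed.
Lemma dotBr n (x y z : 'rV[F]_n) : dot z (x - y) = dot z x - dot z y.
Proof. by rewrite dotDr dotNr. Qed.
Lemma dotZl n c (x y : 'rV[F]_n) : dot (c *: x) y = c * dot x y.
Proof. by rewrite /dot -scalemxAl mxE. Qed.
Lemma dotZr n c (x y : 'rV[F]_n) : dot x (c *: y) = c * dot x y.
Proof. by rewrite !(dotC x) dotZl. Qed.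
Lemma dot0l n (y : 'rV[F]_n) : dot 0 y = 0.
Proof. by rewrite /dot mul0mx mxE. Qed.
Lemma dot0r n (y : 'rV[F]_n) : dot y 0 = 0.
Proof. by rewrite dotC dot0l. Qed.
Lemma val_ge_dot n m m' x y : latt n m x -> latt n m' y -> O (m + m') (dot x y).
Proof. by move=> hx hy; rewrite dotE; apply: val_ge_sum => j _; apply: val_geM. Qed.

Fixpoint tuples (R : seq F) n : seq (n.-tuple F) :=
  match n return seq (n.-tuple F) with
  | 0 => [:: [tuple]]
  | n.+1 => [seq cons_tuple a t | a <- R, t <- tuples R n]
  end.

Lemma mem_tuples R n (t : n.-tuple F) : (t \in tuples R n) = all (mem R) t.
Proof.
elim: n t => [|n IH] t; first by rewrite tuple0 inE eqxx.
case/tupleP: t => a t; rewrite /= -IH; apply/allpairsP/andP.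
  by case=> -[b s] /= [bR st /(congr1 val) [-> e]]; rewrite bR (val_inj e).
by case=> aR tR; exists (a, t).
Qed.

Lemma uniq_tuples R n : uniq R -> uniq (tuples R n).
Proof.
move=> uR; elim: n => //= n IH; apply: allpairs_uniq => //.
by move=> [a s] [b t] _ _ /(congr1 val) [-> e]; rewrite (val_inj e).
Qed.

Definition row_tuple n (t : n.-tuple F) : 'rV[F]_n := \row_j tnth t j.
Definition tuple_row n (x : 'rV[F]_n) : n.-tuple F := [tuple x 0 j | j < n].

Lemma row_tupleK n : cancel (@row_tuple n) (@tuple_row n).
Proof. by move=> t; apply/eq_from_tnth => j; rewrite tnth_mktuple mxE. Qed.

Lemma transversal_rows a b R n : transversal (O a) (O b) R ->
  transversal (latt n a) (latt n b) [seq row_tuple t | t <- tuples R n].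
Proof.
move=> [uR MR eR iR].
have memP (t : n.-tuple F) : reflect (forall j, tnth t j \in R) (t \in tuples R n).
  by rewrite mem_tuples; apply: all_tnthP.
split.
- by rewrite map_inj_uniq ?uniq_tuples //; apply: can_inj (@row_tupleK n).
- by move=> _ /mapP[t /memP tR ->] j; rewrite mxE; apply: MR.
- move=> x hx; have h j : exists r, r \in R /\ O b (x 0 j - r).
    by have [r ? ?] := eR _ (hx j); exists r.
  have [r rP] := choice h; exists (row_tuple [tuple r j | j < n]).
    by apply/map_f/memP => j; rewrite tnth_mktuple; case: (rP j).
  by move=> j; rewrite !mxE tnth_mktuple; case: (rP j).
- move=> _ _ /mapP[t /memP tR ->] /mapP[t' /memP t'R ->] h.
  apply/rowP => j; rewrite !mxE; apply: iR => //.
  by have := h j; rewrite !mxE.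
Qed.

Lemma latt_reps n (a b : int) : a <= b ->
  exists2 R, transversal (latt n a) (latt n b) R & (0 < size R)%N.
Proof.
move=> /(val_ge_reps2 (F := F))[R tR _]; have t := transversal_rows n tR.
exists [seq row_tuple t | t <- tuples R n] => //.
case: t => _ _ eR _; have [r + _] := eR 0 (subgroup0 (latt_subgroup n a)).
by case: [seq _ | _ <- _].
Qed.

Lemma nbhs_rowP n (x : 'rV[F]_n) (A : set 'rV[F]_n) :
  nbhs x A <-> exists m, [set y | latt n m (y - x)] `<=` A.
Proof.
split=> [[P hP PA]|[m mA]]; last first.
  exists (fun i j => [set t | O m (t - x i j)]).
    by move=> i j; apply: nbhs_val_ge.
  by move=> y hy; apply: mA => j; rewrite !mxE; apply: hy.
suff [m hm] : exists m, forall j, j \in enum 'I_n -> [set t | O m (t - x 0 j)] `<=` P 0 j.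
  exists m => y hy; apply: PA => i j; rewrite ord1; apply: (hm j); first by rewrite mem_enum.
  by have := hy j; rewrite !mxE.
elim: (enum _) => [|i s [m hm]]; first by exists 0.
have /lval_nbhs[m' hm'] := hP 0 i.
exists (Num.max m m') => j; rewrite inE => /orP[/eqP->|js] t ht.
  by apply: hm'; apply: val_ge_le ht; rewrite le_max lexx orbT.
by apply: (hm j js); apply: val_ge_le ht; rewrite le_max lexx.
Qed.

Lemma latt_near n (a : 'rV[F]_n) m x y : latt n m (y - a) -> latt n m (x - y) -> latt n m (x - a).
Proof. by move=> h1 h2; rewrite -(subrKA y); apply: (subgroupD (latt_subgroup n m)). Qed.

Lemma latt_sym n m (x y : 'rV[F]_n) : latt n m (x - y) -> latt n m (y - x).
Proof. by rewrite -opprB => /(subgroupN (latt_subgroup n m)); rewrite opprK. Qed.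

Lemma latt_closed n m : closed (latt n m).
Proof.
move=> x h; have [|y [/= my xy]] := h [set y | latt n m (y - x)].
  by apply/nbhs_rowP; exists m.
rewrite -(subrK y x); apply: (subgroupD (latt_subgroup n m)) => //.
exact: latt_sym.
Qed.

Lemma ultra_finite_cover (T : Type) (U : set_system T) (I : eqType) (R : seq I)
  (A : set T) (B : I -> set T) : UltraFilter U -> U A ->
  (forall x, A x -> exists2 r, r \in R & B r x) -> exists2 r, r \in R & U (B r).
Proof.
move=> UU; elim: R A => [|r0 R IH] A UA cov.
  exfalso; apply: (@filter_not_empty _ U); apply: filterS UA => x /cov[].
  by move=> r; rewrite in_nil.
have [Ur0|nUr0] := in_ultra_setVsetC (B r0) UU; first by exists r0; rewrite ?mem_head.
have [||r rR Ur] := IH (A `&` ~` B r0); first exact: filterI.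
  move=> x [/cov[r + Brx] nB]; rewrite inE => /orP[/eqP e|]; last by exists r.
  by case: nB; rewrite -e.
by exists r => //; rewrite inE rR orbT.
Qed.

(** By finiteness of the quotients, an ultrafilter on the lattice contains one coset of each smaller
    lattice. The chosen centres are Cauchy in each coordinate, and their limit is a limit of the
    ultrafilter. *)
Lemma latt_compact n m0 : compact (latt n m0).
Proof.
rewrite compact_ultra => U UU /= Um0.
have FU : ProperFilter U := @ultra_proper _ _ UU.
have meet A B : U A -> U B -> exists x, A x /\ B x.
  by move=> UA UB; apply: (@filter_ex _ U); apply: filterI.
have h (k : nat) : exists r, U [set y | latt n (m0 + k%:Z) (y - r)].
  have [|R [_ _ eR _] _] := @latt_reps n m0 (m0 + k%:Z); first by rewrite lerDl.
  by have [r rR Ur] := @ultra_finite_cover _ U _ R _ (fun r => [set y | latt n (m0 + k%:Z) (y - r)]) UU Um0 eR; exists r.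
have [r rP] := choice h.
have rC (i j : nat) : (i <= j)%N -> latt n (m0 + i%:Z) (r j - r i).
  move=> ij; have [y [/= yi yj]] := meet _ _ (rP i) (rP j).
  apply: (latt_near yi); apply: latt_sym; apply: latt_le yj.
  by rewrite lerD2l lez_nat.
have rl j : exists l : F, (fun k => r k 0 j) @ \oo --> l.
  apply: lval_complete => m; exists `|m - m0|%N => i k hi hk.
  have le_m : m <= m0 + `|m - m0|%N%:Z by rewrite -lerBlDl; apply: ler_norm.
  have h1 := latt_le le_m (rC _ _ hi); have h2 := latt_le le_m (rC _ _ hk).
  have h3 : latt n m (r `|m - m0|%N - r k) by apply: latt_sym.
  by have := latt_near h3 h1 j; rewrite !mxE.
have [l lP] := choice rl.
have lC (k : nat) : latt n (m0 + k%:Z) ((\row_j l j) - r k).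
  move=> j; rewrite !mxE.
  have [N _ hN] := lP j _ (nbhs_val_ge (m0 + k%:Z) (l j)).
  have /= h1 := hN (maxn N k) (leq_maxl _ _).
  rewrite -(subrKA (r (maxn N k) 0 j)); apply: val_geD.
    by rewrite -opprB; apply: val_geN.
  by have := rC _ _ (leq_maxr N k) j; rewrite !mxE.
have Ul A : nbhs (\row_j l j) A -> U A.
  move=> /nbhs_rowP[m mA].
  have le_m : m <= m0 + `|m - m0|%N%:Z by rewrite -lerBlDl; apply: ler_norm.
  apply: filterS (rP `|m - m0|%N) => y hy; apply: mA.
  by apply: latt_le le_m _; apply: latt_near (latt_sym (lC _)) hy.
exists (\row_j l j); split=> //.
have [|y [/= y0 yl]] := meet _ [set y | latt n m0 (y - \row_j l j)] Um0.
  by apply: Ul; apply/nbhs_rowP; exists m0.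
rewrite -(subrK y (\row_j _)); apply: (subgroupD (latt_subgroup n m0)) => //.
exact: latt_sym.
Qed.

Lemma val_ge_compact m : compact (O m).
Proof.
have := @continuous_compact _ _ (fun x : 'rV[F]_1 => x 0 0) (latt 1 m) _ (@latt_compact 1 m).
have -> : [set x 0 0 | x in latt 1 m] = O m.
  rewrite predeqE => t; split=> [[x hx <-]|tm]; first exact: hx.
  by exists (\row_j t); rewrite ?mxE // => j; rewrite mxE.
apply; apply: continuous_subspaceT => x A /lval_nbhs[k kA].
apply/nbhs_rowP; exists k => y /= h; apply: kA.
by have := h 0; rewrite !mxE.
Qed.

End Lattices.

(** * Schwartz functions as functions on quotients of lattices *)

Section Schwartz.
Context {R : realType} {F : nonArchLocalFieldType}.
Local Notation C := R[i].

(* The [m]-th step of a filtration of the Schwartz space of [F^n] by functions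
   on a finite quotient. *)
Definition level n (m : int) (f : 'rV[F]_n -> C) :=
  (forall x y, latt n m (x - y) -> f x = f y) /\
  (forall x, f x != 0 -> latt n (- m) x).

Lemma level_le n m m' (f : 'rV[F]_n -> C) : m <= m' -> level m f -> level m' f.
Proof.
move=> mm' [h1 h2]; split=> [x y /(latt_le mm')/h1//|x /h2]; apply: latt_le.
by rewrite lerN2.
Qed.

Lemma level_weaken n a b (f : 'rV[F]_n -> C) :
  (forall x y, latt n a (x - y) -> f x = f y) ->
  (forall x, f x != 0 -> latt n b x) -> exists m, level m f.
Proof.
move=> h1 h2; exists (Num.max a (- b)); split=> [x y h|x /h2].
  by apply: h1; apply: latt_le h; rewrite le_max lexx.
by apply: latt_le; rewrite lerNl le_max lexx orbT.
Qed.

(** Compactness of the support makes local constancy uniform and bounds the support by a lattice. *)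
Lemma schwartzP n (L : set C) (f : 'rV[F]_n -> C) :
  schwartz L f <-> (forall x, L (f x)) /\ exists m, level m f.
Proof.
split=> [[locf cpt Lf]|[Lf [m [h1 h2]]]]; last first.
  split=> // [x|].
    by apply/nbhs_rowP; exists m => y; apply: h1.
  apply: (@subclosed_compact _ _ (latt n (- m))); [exact: closed_closure|exact: latt_compact|].
  rewrite (closure_id (latt n (- m))).1; last exact: latt_closed.
  by apply: closureS => x /= /h2.
(* [D k] collects the points at which size and local constancy are controlled by the single
   parameter k; these sets increase, and each point is interior to one of them. *)
split=> //; pose D (k : nat) : set 'rV[F]_n := [set x | latt n (- k%:Z) x /\
  forall y, latt n k%:Z (y - x) -> f y = f x].
have DS k k' : (k <= k')%N -> D k `<=` D k'.
  move=> kk' x [h1 h2]; split; first by apply: latt_le h1; rewrite lerN2 lez_nat.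
  by move=> y h; apply: h2; apply: latt_le h; rewrite lez_nat.
have Dopen (x : 'rV[F]_n) : exists k, nbhs x (D k).
  have /nbhs_rowP[m hm] := locf x; have [b hb] := latt_ex x.
  exists (maxn `|m| `|b|); apply/nbhs_rowP; exists (maxn `|m| `|b|)%:Z => y /= hy.
  have bK : - (maxn `|m| `|b|)%:Z <= b.
    rewrite lerNl; apply: le_trans (_ : `|b|%N%:Z <= _); last by rewrite lez_nat leq_maxr.
    by lia.
  have mK : m <= (maxn `|m| `|b|)%:Z.
    apply: le_trans (_ : `|m|%N%:Z <= _); last by rewrite lez_nat leq_maxl.
    exact: ler_norm.
  split.
    rewrite -(subrK x y); apply: (subgroupD (latt_subgroup n _)); last exact: latt_le hb.
    by apply: latt_le hy; rewrite lerNl (le_trans _ (_ : 0 <= _)) // oppr_le0.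
  move=> z hz; rewrite (hm y); last exact: latt_le hy.
  by apply: hm; apply: latt_le mK _; apply: latt_near hy hz.
(* Otherwise the sets [Ak k] generate a proper filter on the support. A cluster point of it would be
   interior to some [D k], which [Ak k] avoids. *)
have [K KD] : exists K, forall x, f x != 0 -> D K x.
  apply: contrapT => nK; pose Ak k := [set x | f x != 0 /\ ~ D k x].
  have Ak0 k : Ak k !=set0.
    apply: contrapT => hk; apply: nK; exists k => x fx.
    by apply: contrapT => nD; apply: hk; exists x.
  have FF : ProperFilter (filter_from setT Ak).
    apply: filter_from_proper; last by move=> k _; apply: Ak0.
    apply: filter_from_filter; first by exists 0%N.
    move=> i j _ _; exists (maxn i j) => // x [fx nD]; split; split=> // Dx; apply: nD.
      by apply: DS Dx; rewrite leq_maxl.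
    by apply: DS Dx; rewrite leq_maxr.
  have [|x [_ clx]] := cpt _ FF.
    by exists 0%N => // x [fx _]; apply: subset_closure.
  have [k kx] := Dopen x; have [|y [[fy nDy] Dy]] := clx (Ak k) (D k) _ kx.
    by exists k.
  exact: nDy.
exists K%:Z; split=> [x y h|x /KD[]//].
have [fx|/KD[_ fx]] := eqVneq (f x) 0; last by rewrite fx //; apply: latt_sym.
by have [fy|/KD[_ fy]] := eqVneq (f y) 0; [rewrite fx fy|rewrite fy].
Qed.

End Schwartz.

(** * Measures of lattices *)

Lemma in_set_asbool (T : Type) (A : set T) x : (x \in A) = `[< A x >].
Proof. by apply/idP/asboolP; rewrite inE. Qed.

Section StepIntegrals.
Context {R : realType}.
Local Notation C := R[i].

(** [sint] sums values against the measures of their fibres. When these are proportional to the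
    number of sample points in the fibre, regrouping the samples by value gives a Riemann sum. *)
Lemma sint_count (T : choiceType) (mu : set T -> \bar R) (f : T -> C) (s : seq T) (w : R) :
  (forall z, z != 0 ->
     mu (f @^-1` [set z]) = (w * (count (fun t => f t == z) s)%:R)%:E) ->
  sint mu f = w%:C * \sum_(t <- s) f t.
Proof.
move=> h; pose zs := undup [seq f t | t <- s].
rewrite /sint (fsbigE zs) ?undup_uniq //; last first.
  move=> z _; rewrite mem_undup => nz; have [->|z0] := eqVneq z 0; first by rewrite mul0r.
  rewrite h //= (_ : count _ _ = 0%N) ?mulr0 ?mulr0 //; apply/eqP; rewrite -leqn0 leqNgt -has_count.
  by apply: contra nz => /hasP[t ts /eqP <-]; apply: map_f.
rewrite big_mkcond /=; transitivity (\sum_(z <- zs) w%:C * \sum_(t <- s | f t == z) f t).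
  apply: eq_bigr => z _; rewrite mem_setT; have [->|z0] := eqVneq z 0.
    by rewrite mul0r big1 ?mulr0 // => t /eqP.
  rewrite h //= rmorphM /= mulrCA; congr (_ * _).
  rewrite (eq_bigr (fun=> z)); last by move=> t /eqP.
  by rewrite big_const_seq iter_addr_0 rmorph_nat mulr_natr.
rewrite -mulr_sumr (exchange_big_dep xpredT) //=; congr (_ * _).
rewrite big_seq [RHS]big_seq; apply: eq_bigr => t ts.
rewrite big_mkcond (bigD1_seq (f t)) ?undup_uniq ?mem_undup ?map_f //= eqxx.
by rewrite big1 ?addr0 // => z /negbTE; rewrite eq_sym => ->.
Qed.

Context {F : nonArchLocalFieldType}.
Variable mu : {measure set (borelF F) -> \bar R}.
Hypothesis mu_haar : is_haar mu.
Local Notation O := (val_ge (@lval F)).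

Definition vol (m : int) : R := fine (mu (O m)).

Lemma open_measurable_borelF (A : set F) : open A -> measurable (A : set (borelF F)).
Proof. by move=> oA; apply: sub_sigma_algebra. Qed.

Lemma coset_measurable m s : measurable ([set t | O m (t - s)] : set (borelF F)).
Proof. by apply: open_measurable_borelF; apply: val_ge_open. Qed.

Lemma val_ge_measurable m : measurable (O m : set (borelF F)).
Proof.
have := coset_measurable m 0; congr measurable.
by rewrite predeqE => t /=; rewrite subr0.
Qed.

Lemma volE m : mu (O m) = (vol m)%:E.
Proof.
rewrite /vol fineK // ge0_fin_numE //.
by case: mu_haar => _ + _; apply; apply: val_ge_compact.
Qed.

Lemma mu_coset m s : mu [set t | O m (t - s)] = (vol m)%:E.
Proof.
case: mu_haar => tr _ _; rewrite -volE -(tr s _ (val_ge_measurable m)).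
congr (mu _); rewrite predeqE => t /=; split=> [h|[x hx <-]].
  by exists (t - s) => //; rewrite subrKC.
by rewrite addrAC subrr add0r.
Qed.

Lemma vol_ge0 m : 0 <= vol m. Proof. by apply: fine_ge0; apply: measure_ge0. Qed.

Lemma integral_step (h : F -> R) a b (r : seq F) :
  transversal (O a) (O b) r -> (forall x, 0 <= h x) -> (a <= b) ->
  (forall x y, O b (x - y) -> h x = h y) -> (forall x, h x != 0 -> O a x) ->
  (\int[mu]_(x in setT) (h x)%:E)%E = ((\sum_(t <- r) h t) * vol b)%:E.
Proof.
move=> [ur Mr er ir] h0 ab hb ha; pose D s : set (borelF F) := [set t | O b (t - s)].
have -> : (\int[mu]_(x in setT) (h x)%:E)%E =
    (\int[mu]_(x in setT) (\sum_(t <- r) (h t)%:E * (\1_(D t) x)%:E))%E.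
  apply: eq_integral => x _; have [Ox|nOx] := pselect (O a x).
    have [t tr xt] := er x Ox; rewrite (bigD1_seq t) //= big_seq_cond big1 ?adde0.
      by rewrite indicE mem_set // mule1 (hb _ _ xt).
    move=> t' /andP[t'r /eqP tt']; rewrite indicE memNset ?mule0 //.
    move=> h'; apply: tt'; apply: ir => //.
    have -> : t' - t = (x - t) - (x - t') by rewrite opprB [RHS]addrC subrKA.
    by apply: val_geD => //; apply: val_geN.
  have -> : h x = 0 by apply/eqP; apply: contra_notT nOx => /ha.
  rewrite big_seq big1 // => t tr; rewrite indicE memNset ?mule0 //.
  move=> h'; apply: nOx; rewrite -(subrK t x); apply: val_geD (Mr t tr).
  exact: val_ge_le h'.
rewrite ge0_integral_sum //; last 2 first.
- move=> t; apply: emeasurable_funM; first exact: measurable_cst.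
  apply: (measurable_realfun.measurable_EFinP _ _).2.
  by apply: measurable_realfun.measurable_indic; apply: coset_measurable.
- by move=> t x _; rewrite mule_ge0 ?lee_fin // indicE.
rewrite mulr_suml -sumEFin; apply: eq_bigr => t _.
rewrite ge0_integralZl_EFin //; last first.
- apply: (measurable_realfun.measurable_EFinP _ _).2.
  by apply: measurable_realfun.measurable_indic; apply: coset_measurable.
rewrite integral_indic ?setIT //; last exact: coset_measurable.
by rewrite mu_coset.
Qed.

Lemma mu_step (A : set F) a b (r : seq F) :
  transversal (O a) (O b) r -> a <= b ->
  (forall x y, O b (x - y) -> A x -> A y) -> A `<=` O a ->
  mu A = (vol b * (count (fun t => `[< A t >]) r)%:R)%:E.
Proof.
move=> tr ab Ab Aa; have mA : measurable (A : set (borelF F)).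
  apply: open_measurable_borelF; rewrite openE => x Ax; apply/lval_nbhs; exists b => y /= h.
  by apply: Ab Ax; rewrite -opprB; apply: val_geN.
have := integral_indic mu measurableT mA; rewrite setIT => <-.
have e (x : F) : \1_A x = (`[< A x >])%:R :> R by rewrite indicE in_set_asbool.
rewrite (integral_step tr) //.
- rewrite mulrC -sum1_count natr_sum; congr ((_ * _)%:E); rewrite [RHS]big_mkcond /=.
  by apply: eq_bigr => t _; rewrite e; case: asboolP.
- move=> x y xy; rewrite !e; congr (nat_of_bool _)%:R; apply: asbool_equiv_eq; split.
    exact: Ab.
  by apply: Ab; rewrite -opprB; apply: val_geN.
- by move=> x; rewrite e; case: asboolP => [/Aa//|]; rewrite eqxx.
Qed.

Lemma volM m (n : nat) : vol m = vol (m + n%:Z) * (@resorder F ^ n)%N%:R.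
Proof.
have [r tr sr] := val_ge_reps (F := F) m n.
have := volE m; rewrite (mu_step tr) ?lerDl //.
- move=> [<-]; rewrite -sr; congr (_ * _%:R).
  rewrite -[RHS](count_predT r); apply: eq_in_count => t ts /=.
  by case: tr => _ Mr _ _; rewrite asboolT //; apply: Mr.
- by move=> x y xy hx; rewrite -[y](subKr x); apply: val_geD => //; apply/val_geN/(val_ge_le _ xy); rewrite lerDl.
Qed.

(** If one ideal had measure 0, so would all larger ones by [volM], and F is their union. *)
Lemma vol_gt0 m : 0 < vol m.
Proof.
rewrite lt_def vol_ge0 andbT; apply/eqP => v0; case: mu_haar => _ _ /eqP; apply.
have z (k : nat) : mu (O (m - k%:Z)) = 0 by rewrite volE (volM _ k) subrK v0 mul0r.
apply/eqP; rewrite eq_le measure_ge0 andbT.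
have -> : setT = \bigcup_k (O (m - k%:Z) : set (borelF F)).
  rewrite predeqE => x; split=> // _; have [->|x0] := eqVneq (x : F) 0.
    by exists 0%N => //; left.
  by exists `|m - lval (x : F)|%N => //; right; lia.
apply: le_trans (generalized_Boole_inequality mu _ _) _ => [i||].
- exact: val_ge_measurable.
- by apply: bigcup_measurable => i _; exact: val_ge_measurable.
- by rewrite eseries0 // => i _ _; apply: z.
Qed.

(** [product_measure1] integrates the measures of the sections, which form again a step function of
    the first coordinate. *)
Lemma prod_measure_step (a b : int) (r : seq F) (ab : a <= b) (tr : transversal (O a) (O b) r) n (A : set (n.-tuple F)) :
  (forall x y : n.-tuple F, (forall j, O b (tnth x j - tnth y j)) -> A x -> A y) ->
  (forall x, A x -> forall j, O a (tnth x j)) ->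
  prod_measure (mu : set (borelF F) -> \bar R) (A : set (n.-tuple (borelF F))) =
    (vol b ^+ n * (count (fun t => `[< A t >]) (tuples r n))%:R)%:E.
Proof.
elim: n A => [|n IH] A Ab Aa /=.
  rewrite expr0 mul1r addn0 /dirac indicE; congr (_%:R%:E); congr nat_of_bool.
pose As (x : F) : set (n.-tuple F) := [set t | A (cons_tuple x t)].
have AsE (x : F) : prod_measure (mu : set (borelF F) -> \bar R) (As x : set (n.-tuple (borelF F))) =
    (vol b ^+ n * (count (fun t => `[< As x t >]) (tuples r n))%:R)%:E.
  apply: IH => [s t st|t At j].
    apply: Ab => j; rewrite !(tnth_nth 0) /=; case: j => [[|j] jn] /=.
      by rewrite subrr; left.
    by have := st (Ordinal (jn : (j < n)%N)); rewrite !(tnth_nth 0).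
  by have := Aa _ At (lift ord0 j); rewrite !(tnth_nth 0).
rewrite /product_measure1.
pose h (x : F) := vol b ^+ n * (count (fun t => `[< As x t >]) (tuples r n))%:R.
transitivity (\int[mu]_(x in setT) (h x)%:E)%E.
  apply: eq_integral => x _ /=; rewrite /h -AsE; congr prod_measure.
  rewrite predeqE => t; rewrite /xsection /As /= in_setE /=.
  by rewrite (_ : [tuple of x :: t] = cons_tuple x t) //; apply: val_inj.
rewrite (integral_step tr) //.
- congr EFin; rewrite exprS -mulrA [RHS]mulrC; congr (_ * _).
  rewrite -mulr_sumr -natr_sum; congr (_ * _%:R).
  rewrite count_flatten -map_comp sumnE big_map; apply: eq_bigr => x _ /=.
  by rewrite count_map.
- by move=> x; rewrite mulr_ge0 ?exprn_ge0 ?vol_ge0.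
- move=> x y xy; rewrite /h; congr (_ * _%:R); apply: eq_count => t.
  have hA x' y' : O b (x' - y') -> As x' t -> As y' t.
    move=> h'; apply: Ab => j; rewrite !(tnth_nth 0) /=; case: j => [[|j] jn] //=.
    by rewrite subrr; left.
  apply: asbool_equiv_eq; split; apply: hA => //.
  by rewrite -opprB; apply: val_geN.
- move=> x; rewrite mulf_eq0 negb_or pnatr_eq0 -lt0n -has_count => /andP[_ /hasP[t _ /asboolP At]].
  by have := Aa _ At ord0; rewrite (tnth_nth 0).
Qed.

Definition rint n (f : 'rV[F]_n -> C) : C :=
  sint (fun A : set (n.-tuple F) => prod_measure (mu : set (borelF F) -> \bar R) (A : set (n.-tuple (borelF F))))
    (fun t => f (row_tuple t)).

Lemma rintE n (f : 'rV[F]_n -> C) (a b : int) r : a <= b -> transversal (latt n a) (latt n b) r ->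
  (forall x y, latt n b (x - y) -> f x = f y) -> (forall x, f x != 0 -> latt n a x) ->
  rint f = (vol b ^+ n)%:C * \sum_(x <- r) f x.
Proof.
move=> ab tr fb fa; have [r0 tr0 _] := val_ge_reps2 (F := F) ab.
rewrite /rint (@sint_count _ _ _ (tuples r0 n) (vol b ^+ n)); last first.
  move=> z z0; rewrite (prod_measure_step ab tr0).
  - congr ((_ * _%:R)%:E); apply: eq_count => t /=.
    by apply/asboolP/eqP.
  - move=> x y xy /= <-; apply: fb => j; rewrite !mxE -opprB; apply: val_geN.
    exact: xy.
  - by move=> x /= fx j; have := fa (row_tuple x); rewrite fx => /(_ z0 j); rewrite mxE.
congr (_ * _); rewrite -(big_map (@row_tuple F n) xpredT f).
apply: (transversal_sum (latt_subgroup n b)) (transversal_rows n tr0) tr.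
by move=> x y _ _; apply: fb.
Qed.

(** One list and one weight serve all functions of the same level, so identities between integrals
    can be checked on finite sums. *)
Lemma rint_levelE n (f : 'rV[F]_n -> C) m : level m f -> 0 <= m -> exists r,
  [/\ transversal (latt n (- m)) (latt n m) r, (0 < size r)%N &
      forall g, level m g -> rint g = (vol m ^+ n)%:C * \sum_(x <- r) g x].
Proof.
move=> lf m0; have mm : - m <= m by rewrite ge0_cp.
have [r tr sr] := latt_reps (F := F) n mm; exists r; split=> // g [g1 g2].
exact: (rintE mm tr).
Qed.

End StepIntegrals.

(** * Additive characters *)

Section AdditiveCharacter.
Context {R : realType} {F : nonArchLocalFieldType}.
Local Notation C := R[i].
Variables (lam : F -> C).
Hypotheses (lam_char : unitary_character lam) (lam_nontrivial : exists t, lam t != 1).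
Local Notation O := (val_ge (@lval F)).

Lemma lamD s t : lam (s + t) = lam s * lam t. Proof. by case: lam_char. Qed.
Lemma lam_norm s : `|lam s| = 1. Proof. by case: lam_char. Qed.
Lemma lam_neq0 s : lam s != 0. Proof. by rewrite -normr_eq0 lam_norm oner_neq0. Qed.
Lemma lam0 : lam 0 = 1.
Proof. by apply: (mulfI (lam_neq0 0)); rewrite -lamD addr0 mulr1. Qed.
Lemma lamN s : lam (- s) = (lam s)^-1.
Proof. by apply: (mulfI (lam_neq0 s)); rewrite -lamD subrr lam0 divff ?lam_neq0. Qed.
Lemma lamB s t : lam (s - t) = lam s / lam t.
Proof. by rewrite lamD lamN. Qed.
Lemma lamMn s n : lam (s *+ n) = lam s ^+ n.
Proof. by elim: n => [|n IH]; rewrite ?mulr0n ?lam0 // mulrS lamD IH exprS. Qed.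
Lemma lam_nat s n : lam (n%:R * s) = lam s ^+ n.
Proof. by rewrite mulr_natl lamMn. Qed.

(* A subgroup of the unit circle contained in a small disc around 1 is trivial:
   squaring doubles distances to 1, up to a factor 3/4. *)
Lemma unit_small_powers (z : C) : (forall k : nat, `|z ^+ k - 1| < 2^-1) -> z = 1.
Proof.
move=> h; apply/eqP; rewrite -subr_eq0 -normr_eq0; apply/negPn/negP => e0.
have e_gt0 : 0 < `|z - 1| by rewrite lt_def e0 normr_ge0.
have grow k : (1 + k%:R / 2) * `|z - 1| <= `|z ^+ (2 ^ k) - 1|.
  elim: k => [|k IH]; first by rewrite mul0r addr0 mul1r expn0 expr1.
  rewrite expnSr exprM subr_sqr_1 normrM.
  have h2 : 3 / 2 <= `|z ^+ (2 ^ k) + 1|.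
    have -> : z ^+ (2 ^ k) + 1 = 2 - (1 - z ^+ (2 ^ k)) by ring.
    apply: le_trans (lerB_dist _ _); rewrite ger0_norm // distrC.
    have -> : 3 / 2 = 2 - 2^-1 :> C by field.
    by rewrite lerB // ltW.
  apply: le_trans (_ : ((1 + k%:R / 2) * `|z - 1|) * (3 / 2) <= _).
    rewrite -mulrA [_ * (3 / 2)]mulrC mulrA ler_pM2r // -subr_ge0.
    have -> : (1 + k%:R / 2) * (3 / 2) - (1 + k.+1%:R / 2) = k%:R / 4 :> C.
      by rewrite -natr1; field.
    by rewrite mulr_ge0 ?ler0n ?invr_ge0 ?ler0n.
  by apply: ler_pM => //; rewrite mulr_ge0 ?addr_ge0 ?divr_ge0 ?ler0n.
have real_e : `|z - 1| = (complex.Re `|z - 1|)%:C.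
  by rewrite RRe_real ?normr_real.
have r_gt0 : 0 < complex.Re `|z - 1| by move: e_gt0; rewrite real_e ltcR.
pose k := Num.bound (complex.Re `|z - 1|)^-1.
have hk : 1 < k%:R * `|z - 1|.
  rewrite real_e -(rmorph_nat (real_complex R)) -rmorphM /= ltcR.
  by rewrite -ltr_pdivrMr // mul1r archi_boundP // invr_ge0 ltW.
have h1 := le_lt_trans (grow k) (h _).
have h2 : 2^-1 <= (1 + k%:R / 2) * `|z - 1|.
  apply: le_trans (_ : (k%:R * `|z - 1|) * 2^-1 <= _).
    by rewrite ler_peMl ?invr_ge0 ?ler0n // ltW.
  by rewrite mulrDl mul1r mulrAC lerDr.
by have := le_lt_trans h2 h1; rewrite ltxx.
Qed.

Lemma lam_trivial_near0 : exists m, forall t, O m t -> lam t = 1.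
Proof.
have lc : {for 0, continuous (lam : F -> R[i]^o)} by case: lam_char => _ _; apply.
have /cvgrPdist_lt/(_ (2^-1)) := lc; rewrite invr_gt0 ltr0n => /(_ isT).
rewrite lam0 => /lval_nbhs[m hm]; exists m => t mt; apply: unit_small_powers => k.
rewrite distrC -lamMn; apply: hm; rewrite /= subr0.
by elim: k => [|k IH]; [rewrite mulr0n; left|rewrite mulrS; apply: val_geD].
Qed.

(** The exponent of the largest fractional ideal on which [lam] is trivial. *)
Definition is_conductor (d : int) : Prop :=
  (forall t, O d t -> lam t = 1) /\ exists2 t, O (d - 1) t & lam t != 1.

Lemma conductor_ex : exists d, is_conductor d.
Proof.
have [m hm] := lam_trivial_near0; have [t0 t0n] := lam_nontrivial.
have t00 : t0 != 0 by apply: contra t0n => /eqP ->; rewrite lam0.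
pose Q (k : nat) := `[< forall t, O (lval t0 + k%:Z) t -> lam t = 1 >].
have exQ : exists k, Q k.
  exists `|m - lval t0|%N; apply/asboolP => t ht; apply: hm; apply: val_ge_le ht.
  by lia.
case: (ex_minnP exQ) => k /asboolP Qk kmin; exists (lval t0 + k%:Z); split=> //.
case: k Qk kmin => [|k] Qk kmin.
  by case/eqP: t0n; apply: Qk; right; rewrite addr0.
apply: contrapT => nt; suff : Q k by move=> /kmin; rewrite ltnn.
apply/asboolP => t ht; apply/eqP; apply: contra_notT nt => lt; exists t => //.
by apply: val_ge_le ht; lia.
Qed.

Definition conductor : int := xget 0 is_conductor.

Lemma conductorP : is_conductor conductor.
Proof. exact: (xgetPex 0 conductor_ex). Qed.

Lemma lam_conductor t : O conductor t -> lam t = 1.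
Proof. by case: conductorP => + _; apply. Qed.

(** If the valuation of s were smaller, s times the ideal would contain the element [t1] at which
    [lam] is not trivial. *)
Lemma conductor_sharp m s : (forall t, O m t -> lam (s * t) = 1) -> O (conductor - m) s.
Proof.
move=> h; have [_ [t1 t1O t1n]] := conductorP.
have [->|s0] := eqVneq s 0; first by left.
right; rewrite leNgt; apply/negP => lt_s; case/eqP: t1n.
have t1E : t1 = s * (s^-1 * t1) by rewrite mulVKf.
rewrite t1E; apply: h; apply: (@val_ge_le _ _ (- lval s + (conductor - 1))); first by lia.
by apply: val_geM => //; right; rewrite lvalV.
Qed.

Definition chi n (b x : 'rV[F]_n) : C := lam (dot x b).

Lemma chiDl n (b b' x : 'rV[F]_n) : chi (b + b') x = chi b x * chi b' x.
Proof. by rewrite /chi dotDr lamD. Qed.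

Lemma chi_latt n a m (b x : 'rV[F]_n) : latt n a b -> latt n m x -> conductor <= a + m -> chi b x = 1.
Proof.
move=> hb hx h; apply: lam_conductor; apply: val_ge_le h _; rewrite addrC.
exact: val_ge_dot.
Qed.

(** The direction of lattice duality that needs sharpness of the conductor; vectors with one nonzero
    coordinate suffice as tests. *)
Lemma chi_dual n m (x : 'rV[F]_n) :
  (forall b, latt n (conductor - m) b -> chi b x = 1) -> latt n m x.
Proof.
move=> h j; rewrite -[m](subKr conductor); apply: conductor_sharp => t ht.
have := h (\row_k (if k == j then t else 0)); rewrite /chi dotE (bigD1 j) //= mxE eqxx.
rewrite big1 ?addr0; last by move=> k /negbTE kj; rewrite mxE kj mulr0.
by apply=> k; rewrite mxE; case: eqP => // _; left.
Qed.

(** Orthogonality of characters: translation by some [b1] with [chi b1 x != 1] permutes the classes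
    and multiplies the sum by [chi b1 x]. *)
Lemma chi_sum n a m r (x : 'rV[F]_n) : a <= m -> transversal (latt n (conductor - m)) (latt n (conductor - a)) r ->
  latt n a x -> \sum_(b <- r) chi b x = if `[< latt n m x >] then (size r)%:R else 0.
Proof.
move=> am tr xa; case: asboolP => [xm|nxm].
  rewrite (eq_big_seq (fun=> 1)) ?big_const_seq ?count_predT ?iter_addr_0 //.
  case: tr => _ Mr _ _ b br; apply: (chi_latt (Mr b br) xm).
  by rewrite subrK.
have [b1 b1d b1x] : exists2 b1, latt n (conductor - m) b1 & chi b1 x != 1.
  apply: contrapT => h; apply: nxm; apply: chi_dual => b hb.
  by apply/eqP; apply: contra_notT h => hn; exists b.
have sh := transversal_shift (latt_subgroup n _) b1d tr.
have : \sum_(b <- r) chi b x = \sum_(b <- [seq b1 + b | b <- r]) chi b x.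
  apply: (transversal_sum (latt_subgroup n (conductor - a))) tr sh => b b' _ _ bb'.
  rewrite -[b](subrK b') chiDl (chi_latt bb' xa) ?mul1r //.
  by rewrite subrK.
rewrite big_map; under [RHS]eq_bigr do rewrite chiDl.
rewrite -mulr_sumr => /eqP; rewrite -subr_eq0 -{1}[\sum_(_ <- _) _]mul1r -mulrBl mulf_eq0.
by rewrite subr_eq0 eq_sym (negbTE b1x) => /eqP.
Qed.

End AdditiveCharacter.

(** * Self-dual measures and volumes of ideals *)

Section SelfDual.
Context {R : realType} {F : nonArchLocalFieldType}.
Local Notation C := R[i].
Variables (lam : F -> C) (mu : {measure set (borelF F) -> \bar R}).
Hypotheses (lam_char : unitary_character lam) (lam_nontrivial : exists t, lam t != 1).
Hypotheses (mu_haar : is_haar mu) (mu_dual : self_dual lam mu).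
Local Notation O := (val_ge (@lval F)).
Local Notation d := (conductor lam).

Let sintE (f : F -> C) a b (r : seq F) : a <= b -> transversal (O a) (O b) r ->
  (forall x y, O b (x - y) -> f x = f y) -> (forall x, f x != 0 -> O a x) ->
  sint (mu : set F -> \bar R) f = (vol mu b)%:C * \sum_(x <- r) f x.
Proof.
move=> ab tr fb fa; apply: sint_count => z z0; rewrite (mu_step mu_haar tr ab).
- by congr ((_ * _%:R)%:E); apply: eq_count => t /=; apply/asboolP/eqP.
- by move=> x y xy /= <-; apply: fb; rewrite -opprB; apply: val_geN.
- by move=> x /= fx; apply: fa; rewrite fx.
Qed.

Let ind m : F -> C := fun t => (`[< O m t >])%:R.

Let ind_inv m x y : O m (x - y) -> ind m x = ind m y.
Proof.
move=> xy; congr (nat_of_bool _)%:R; apply: asbool_equiv_eq; split=> h.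
  by rewrite -[y](subKr x); apply: val_geD => //; apply: val_geN.
by rewrite -(subrK y x); apply: val_geD.
Qed.

Let ind_supp m x : ind m x != 0 -> O m x.
Proof. by rewrite /ind; case: asboolP => // _ /eqP. Qed.

Let sint_ind m : sint (mu : set F -> \bar R) (ind m) = (vol mu m)%:C.
Proof.
rewrite (sintE (lexx m) (transversal1 (val_ge_subgroup m))); [|exact: ind_inv|exact: ind_supp].
by rewrite big_seq1 /ind asboolT ?mulr1 //; left.
Qed.

(** The Fourier transform of the indicator of the ring of integers is its volume times the indicator
    of the ideal of exponent [d]. A second transform, evaluated at 0, must return 1. *)
Lemma vol_self_dual : vol mu 0 * vol mu d = 1.
Proof.
have four s : fourier lam mu (ind 0) s = (vol mu 0)%:C * ind d s.
  rewrite /fourier /ind; case: (asboolP (O d s)) => [sd|nsd].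
    rewrite mulr1 -sint_ind; congr sint; apply/funext => t; rewrite /ind.
    case: asboolP => [t0|]; rewrite ?mulr0 // (lam_conductor lam_char lam_nontrivial) ?mul1r //.
    by rewrite -[d]addr0; apply: val_geM.
  have [b b0 bs] : exists2 b, 0 <= b & forall t, O b t -> O d (s * t).
    exists (Num.max 0 (d - lval s)); first by rewrite le_max lexx.
    move=> t tb; have [->|s0] := eqVneq s 0; first by rewrite mul0r; left.
    rewrite -[d](subrKC (lval s)); apply: val_geM; first by right.
    by apply: val_ge_le tb; rewrite le_max lexx orbT.
  have [r tr _] := val_ge_reps2 (F := F) b0.
  rewrite (sintE b0 tr); last 2 first.
  - move=> x y xy; rewrite -[x](subrK y) mulrDr (lamD lam_char).
    rewrite (lam_conductor lam_char lam_nontrivial) ?mul1r; last exact: bs.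
    congr (_ * _); rewrite subrK; apply: (@ind_inv 0); exact: val_ge_le xy.
  - by move=> x; rewrite mulf_eq0 negb_or => /andP[_ /(@ind_supp 0)].
  rewrite mulr0 (eq_big_seq (fun t => lam (s * t))); last first.
    by case: (tr) => _ Mr _ _ t ht; rewrite asboolT ?mulr1 //; apply: Mr.
  have [t1 t10 t1s] : exists2 t1, O 0 t1 & lam (s * t1) != 1.
    apply: contrapT => h; apply: nsd; rewrite -[d]subr0.
    apply: (conductor_sharp lam_char lam_nontrivial) => t t0.
    by apply/eqP; apply: contra_notT h => hn; exists t.
  have sh := transversal_shift (val_ge_subgroup 0) t10 tr.
  have : \sum_(t <- r) lam (s * t) = \sum_(t <- [seq t1 + t | t <- r]) lam (s * t).
    apply: (transversal_sum (val_ge_subgroup b)) tr sh => x y _ _ xy.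
    rewrite -[x](subrK y) mulrDr (lamD lam_char).
    by rewrite (lam_conductor lam_char lam_nontrivial) ?mul1r //; apply: bs.
  rewrite big_map; under [RHS]eq_bigr do rewrite mulrDr (lamD lam_char).
  rewrite -mulr_sumr => /eqP; rewrite -subr_eq0 -{1}[\sum_(_ <- _) _]mul1r -mulrBl mulf_eq0.
  by rewrite subr_eq0 eq_sym (negbTE t1s) => /eqP ->; rewrite mulr0.
have sch : schwartz (T := F) [set: C] (ind 0).
  split=> // [x|].
    by apply/lval_nbhs; exists 0 => y; apply: ind_inv.
  apply: (@subclosed_compact _ _ (O 0)); [exact: closed_closure|exact: val_ge_compact|].
  have cl : closed (O 0).
    by have := @val_ge_closed F 0 0; congr closed; rewrite predeqE => t /=; rewrite subr0.
  rewrite (closure_id (O 0)).1 //.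
  by apply: closureS => x /= /ind_supp.
have := mu_dual sch 0; rewrite oppr0 {2}/ind asboolT; last by left.
rewrite /fourier -/(fourier lam mu (ind 0)).
have -> : (fun t => lam (0 * t) * fourier lam mu (ind 0) t) = (fun t => (vol mu 0)%:C * ind d t).
  by apply/funext => t; rewrite mul0r (lam0 lam_char) mul1r four.
rewrite (sintE (lexx d) (transversal1 (val_ge_subgroup d))).
- rewrite big_seq1 /ind asboolT ?mulr1 -?rmorphM /=; last by left.
  by rewrite mulrC => -[].
- by move=> x y /ind_inv ->.
- by move=> x; rewrite mulf_eq0 negb_or => /andP[_ /ind_supp].
Qed.

(** What self-duality is for: it makes the volumes square roots of powers of q, so that they will
    lie in Q(sqrt p, sqrt(-p)). *)
Lemma vol_sqr m : exists k : int, vol mu m ^+ 2 = (@resorder F)%:R ^ k.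
Proof.
have q0 : (@resorder F)%:R != 0 :> R by rewrite pnatr_eq0 -lt0n resorder_gt0.
have volZ m' : vol mu m' = (@resorder F)%:R ^ (- m') * vol mu 0.
  case: (lerP 0 m') => hm.
    rewrite (volM mu_haar 0 `|m'|%N) add0r gez0_abs // mulrCA natrX.
    have -> : (@resorder F)%:R ^+ `|m'| = (@resorder F)%:R ^ m' :> R by rewrite exprnP gez0_abs.
    by rewrite -expfzDr // addNr mulr1.
  rewrite (volM mu_haar m' `|m'|%N) ltz0_abs // addrN mulrC natrX; congr (_ * _).
  by rewrite exprnP ltz0_abs.
have := vol_self_dual; rewrite (volZ d) => e.
exists (d - m *+ 2); rewrite volZ exprMn.
have -> : vol mu 0 ^+ 2 = (@resorder F)%:R ^ d.
  apply: (mulfI (expfz_neq0 (- d) q0)); rewrite -expfzDr // addNr expr0z.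
  by rewrite -[RHS]e expr2; ring.
by rewrite expr2 -!expfzDr //; congr (_ ^ _); lia.
Qed.

End SelfDual.

(** * Symplectic matrices *)

Section SymplecticMatrices.
Context {F : fieldType} {n : nat}.
Implicit Types (G H : 'M[F]_(n + n)) (a b c d : 'M[F]_n).

Definition symplJ : 'M[F]_(n + n) := block_mx 0 1%:M (- 1%:M) 0.
Definition spmx G := G *m symplJ *m G^T = symplJ.

Lemma spmx_block a b c d : spmx (block_mx a b c d) <->
  [/\ a *m b^T = b *m a^T, a *m d^T - b *m c^T = 1%:M & c *m d^T = d *m c^T].
Proof.
rewrite /spmx /symplJ tr_block_mx !mulmx_block !mulmx0 !mulmx1 !mulmxN !mulmx1 !add0r !addr0 !mulNmx.
split=> [/eq_block_mx[/eqP h1 h2 _ /eqP h4]|[h1 h2 h3]].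
  split; first by apply/eqP; rewrite -subr_eq0 addrC.
    by rewrite addrC.
  by apply/eqP; rewrite -subr_eq0 addrC.
congr block_mx; [by rewrite h1 addrC subrr|by rewrite addrC| |by rewrite h3 addrC subrr].
apply: trmx_inj; rewrite linearD !linearN /= !trmx_mul !trmxK trmx1 -h2 opprB.
by rewrite addrC.
Qed.

Lemma spmx_mul G H : spmx G -> spmx H -> spmx (G *m H).
Proof. by rewrite /spmx => hG hH; rewrite trmx_mul !mulmxA -(mulmxA G) -(mulmxA G) hH. Qed.

Lemma symplJ_unit : symplJ *m - symplJ = 1%:M.
Proof.
rewrite /symplJ opp_block_mx mulmx_block !oppr0 !opprK !mulmx0 !mul0mx !mulmx1.
by rewrite mulmxN mulmx1 opprK !addr0 !add0r -scalar_mx_block.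
Qed.

Lemma spmx_inverse G : spmx G -> G *m (symplJ *m G^T *m - symplJ) = 1%:M.
Proof. by move=> hG; rewrite !mulmxA (hG : _ = _) symplJ_unit. Qed.

Lemma spmx_unit G : spmx G -> G \in unitmx.
Proof. by move=> /spmx_inverse /mulmx1_unit[]. Qed.

Lemma spmx_tr G : spmx G -> spmx G^T.
Proof.
move=> hG; have := mulmx1C (spmx_inverse hG); rewrite /spmx trmxK => e.
have JJ := symplJ_unit; have J1 : - symplJ *m symplJ = 1%:M by rewrite mulNmx -mulmxN.
have : (- symplJ) *m (symplJ *m G^T *m - symplJ *m G) = - symplJ by rewrite e mulmx1.
rewrite !mulmxA J1 mul1mx mulmxN mulNmx => /eqP; rewrite eqr_opp => /eqP.
by [].
Qed.

Lemma spmx_invmx G : spmx G -> spmx (invmx G).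
Proof.
move=> hG; have uG := spmx_unit hG; rewrite /spmx trmx_inv.
rewrite -{1}hG !mulmxA mulVmx // mul1mx -mulmxA mulmxV ?mulmx1 //.
by rewrite unitmx_tr.
Qed.

(** Element of the Levi factor of the stabilizer of Y: acting by M on Y forces the contragredient of
    M on X. *)
Definition levi (M : 'M[F]_n) : 'M[F]_(n + n) := block_mx (invmx M)^T 0 0 M.

Lemma levi_spmx M : M \in unitmx -> spmx (levi M).
Proof.
move=> uM; apply/spmx_block; rewrite !trmx0 !mulmx0 !mul0mx; split=> //.
by rewrite subr0 -trmx_mul mulmxV // trmx1.
Qed.

Lemma levi_inv M : M \in unitmx -> levi M *m levi (invmx M) = 1%:M.
Proof.
move=> uM; rewrite /levi mulmx_block !mulmx0 !mul0mx !addr0 !add0r invmxK.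
by rewrite -trmx_mul mulmxV // trmx1 -scalar_mx_block.
Qed.

Definition taumx (i : nat) : 'M[F]_(n + n) :=
  block_mx (1%:M - pid_mx i) (- pid_mx i) (pid_mx i) (1%:M - pid_mx i).

(* Move [c] to the normal form [pid_mx (\rank c)] by Gaussian elimination on both
   sides; the symplectic relations then force the unipotent factor. *)
Lemma bruhat_mx a b c d : spmx (block_mx a b c d) ->
  exists P1 P2, [/\ spmx P1, spmx P2, dlsubmx P1 = 0, dlsubmx P2 = 0 &
    block_mx a b c d = P1 *m taumx (\rank c) *m P2].
Proof.
move=> hG; set r := \rank c; pose L := col_ebase c; pose U := row_ebase c.
have uL : L \in unitmx by apply: col_ebase_unit.
have uU : U \in unitmx by apply: row_ebase_unit.
have uLV : invmx L \in unitmx by rewrite unitmx_inv.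
have uUT : U^T \in unitmx by rewrite unitmx_tr.
pose E : 'M[F]_n := pid_mx r.
have ET : E^T = E by rewrite /E tr_pid_mx.
have EE : E *m E = E by rewrite /E pid_mx_id // rank_leq_row.
(* Both sides of the elimination act through Levi elements; they turn the lower left block into
   [E]. *)
pose G' := levi (invmx L) *m block_mx a b c d *m levi U^T.
have hG' : spmx G' by apply: spmx_mul (levi_spmx uUT); apply: spmx_mul hG; apply: levi_spmx.
pose a' := ulsubmx G'; pose b' := ursubmx G'; pose d' := drsubmx G'.
have eG' : G' = block_mx a' b' E d'.
  rewrite -[G' in LHS]submxK; congr block_mx.
  rewrite /G' /levi !mulmx_block !mulmx0 !mul0mx !addr0 !add0r block_mxKdl.
  rewrite trmx_inv trmxK -[c]mulmx_ebase -/L -/U !mulmxA mulVmx // mul1mx.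
  by rewrite -mulmxA mulmxV // mulmx1.
have [h1 h2 h3] : [/\ a' *m b'^T = b' *m a'^T, a' *m d'^T - b' *m E = 1%:M & E *m d'^T = d' *m E].
  by move: hG'; rewrite eG' => /spmx_block; rewrite ET.
have [_ _ h4] : [/\ a'^T *m E = E *m a', a'^T *m d' - E *m b' = 1%:M & b'^T *m d' = d'^T *m b'].
  by move: (spmx_tr hG'); rewrite eG' tr_block_mx => /spmx_block; rewrite !trmxK ET; case.
have h5 : a'^T *m E = E *m a'.
  by move: (spmx_tr hG'); rewrite eG' tr_block_mx => /spmx_block; rewrite !trmxK ET; case.
(* The symplectic relations make z symmetric, so N is symplectic. Multiplying by its inverse
   replaces a' by a' - z E, which [E] kills from the left; that is what lets the remaining factor
   stabilize Y. *)
pose z := E *m a'.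
have zT : z^T = z by rewrite /z trmx_mul ET h5.
have zE : z *m E = z by rewrite /z -h5 -mulmxA EE.
have Ez : E *m z = z by rewrite /z mulmxA EE.
pose N : 'M[F]_(n + n) := block_mx 1%:M z 0 1%:M.
pose Ni : 'M[F]_(n + n) := block_mx 1%:M (- z) 0 1%:M.
pose Ti : 'M[F]_(n + n) := block_mx (1%:M - E) E (- E) (1%:M - E).
have E1 : (1%:M - E) *m E = 0 by rewrite mulmxBl mul1mx EE subrr.
have E2 : E *m (1%:M - E) = 0 by rewrite mulmxBr mulmx1 EE subrr.
have E3 : (1%:M - E) *m (1%:M - E) + E *m E = 1%:M by rewrite mulmxBr E1 subr0 mulmx1 EE subrK.
have NNi : N *m Ni = 1%:M.
  rewrite mulmx_block !mulmx0 !mul0mx !mul1mx !mulmx1 !addr0 !add0r addNr.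
  by rewrite -scalar_mx_block.
have TTi : taumx r *m Ti = 1%:M.
  rewrite /taumx mulmx_block -/E !mulmxN !mulNmx opprK E1 E2 oppr0 addr0 E3.
  by rewrite [E *m E + _]addrC E3 -scalar_mx_block.
have sNi : spmx Ni.
  by apply/spmx_block; rewrite !trmx1 !trmx0 !linearN /= zT !mulmx0 !mul0mx !mulmx1 !mul1mx subr0.
have sN : spmx N.
  by apply/spmx_block; rewrite !trmx1 !trmx0 zT !mulmx0 !mul0mx !mulmx1 !mul1mx subr0.
have sTi : spmx Ti.
  have T1 : (1%:M - E)^T = 1%:M - E by rewrite raddfB /= trmx1 ET.
  have T2 : (- E)^T = - E by rewrite raddfN /= ET.
  by apply/spmx_block; rewrite T1 T2 ET !mulmxN !mulNmx opprK E1 E2 oppr0 E3.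
exists (levi L *m N), (Ti *m Ni *m G' *m levi (invmx U^T)); split.
- by apply: spmx_mul => //; apply: levi_spmx.
- apply: spmx_mul; last by apply: levi_spmx; rewrite unitmx_inv.
  by apply: spmx_mul => //; apply: spmx_mul.
- by rewrite /levi /N mulmx_block block_mxKdl !mul0mx mulmx0 addr0.
- rewrite eG' /levi /Ni /Ti !mulmx_block block_mxKdl !(mulmx0, mul0mx, mul1mx, mulmx1, addr0, add0r).
  have -> : - E *m a' + (- E *m - z + (1%:M - E)) *m E = 0.
    by rewrite !mulNmx mulmxN opprK Ez mulmxDl zE E1 addr0 -/z addNr.
  by rewrite mul0mx.
- have -> : levi L *m N *m taumx r *m (Ti *m Ni *m G' *m levi (invmx U^T)) =
      levi L *m (N *m (taumx r *m Ti) *m Ni) *m G' *m levi (invmx U^T) by rewrite !mulmxA.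
  rewrite TTi mulmx1 NNi mulmx1 /G' !mulmxA levi_inv // mul1mx -mulmxA levi_inv //.
  by rewrite mulmx1.
Qed.

End SymplecticMatrices.

(** * Coordinates on V and matrices of endomorphisms *)

Section Coordinates.
Context {F : fieldType} (V : sympl_space F).
Local Notation n := (sn V).
Local Notation B := (sform V).
Local Notation Xt := (subvs_of (sX V)).
Local Notation Yt := (subvs_of (sY V)).
Local Notation x_ k := (tnth (sx V) k).
Local Notation y_ k := (tnth (sy V) k).
Implicit Types (r s : 'rV[F]_n) (g h : 'End(V)).

Definition xvec r : V := \sum_j r 0 j *: x_ j.
Definition yvec s : V := \sum_j s 0 j *: y_ j.
Definition xcoord (w : V) : 'rV[F]_n := \row_j B w (y_ j).
Definition ycoord (w : V) : 'rV[F]_n := \row_j B (x_ j) w.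

Lemma form_antisym (u w : V) : B u w = - B w u.
Proof.
apply/eqP; rewrite -addr_eq0; apply/eqP; have := sform_alt (u + w).
by rewrite linearDl !linearD /= !sform_alt add0r addr0.
Qed.

Lemma xvec_mem r : xvec r \in sX V.
Proof.
apply: memv_suml => j _; apply: memvZ; apply: (basis_mem (sx_basis V)).
exact: mem_tnth.
Qed.

Lemma yvec_mem r : yvec r \in sY V.
Proof.
apply: memv_suml => j _; apply: memvZ; apply: (basis_mem (sy_basis V)).
exact: mem_tnth.
Qed.

Lemma x_mem k : x_ k \in sX V. Proof. by apply: (basis_mem (sx_basis V)); exact: mem_tnth. Qed.
Lemma y_mem k : y_ k \in sY V. Proof. by apply: (basis_mem (sy_basis V)); exact: mem_tnth. Qed.

Lemma formXX u w : u \in sX V -> w \in sX V -> B u w = 0.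
Proof. by case: (sX_max V) => h _; apply: h. Qed.
Lemma formYY u w : u \in sY V -> w \in sY V -> B u w = 0.
Proof. by case: (sY_max V) => h _; apply: h. Qed.

Lemma form_xy r s : B (xvec r) (yvec s) = (r *m s^T) 0 0.
Proof.
rewrite linear_sumlz mxE; apply: eq_bigr => j _; rewrite linearZl_LR linear_sum /=.
rewrite (bigD1 j) //= big1 => [|k kj]; rewrite linearZ /= sxy_dual ?eqxx ?mulr1 ?addr0 ?mxE //.
by rewrite eq_sym (negbTE kj) mulr0.
Qed.

Lemma xcoordK r s : xcoord (xvec r + yvec s) = r.
Proof.
apply/rowP => j; rewrite mxE linearDl (formYY (yvec_mem s) (y_mem j)) addr0.
rewrite linear_sumlz (bigD1 j) //= big1 => [|k kj]; rewrite linearZl_LR sxy_dual ?eqxx ?mulr1 ?addr0 //.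
by rewrite (negbTE kj) mulr0.
Qed.

Lemma ycoordK r s : ycoord (xvec r + yvec s) = s.
Proof.
apply/rowP => j; rewrite mxE linearD /= (formXX (x_mem j) (xvec_mem r)) add0r.
rewrite linear_sum (bigD1 j) //= big1 => [|k kj]; rewrite linearZ /= sxy_dual ?eqxx ?mulr1 ?addr0 //.
by rewrite eq_sym (negbTE kj) mulr0.
Qed.

Lemma xvec_surj u : u \in sX V -> exists r, u = xvec r.
Proof.
move=> uX; exists (\row_j coord (sx V) j u).
rewrite {1}(coord_basis (sx_basis V) uX); apply: eq_bigr => j _.
by rewrite mxE (tnth_nth 0).
Qed.

Lemma yvec_surj u : u \in sY V -> exists r, u = yvec r.
Proof.
move=> uX; exists (\row_j coord (sy V) j u).
rewrite {1}(coord_basis (sy_basis V) uX); apply: eq_bigr => j _.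
by rewrite mxE (tnth_nth 0).
Qed.

Lemma vec_coordK w : xvec (xcoord w) + yvec (ycoord w) = w.
Proof.
have [XY _] := sXY V; have : w \in (sX V + sY V)%VS by rewrite XY memvf.
move=> /memv_addP[u /xvec_surj[r ->] [t /yvec_surj[s ->] ->]].
by rewrite xcoordK ycoordK.
Qed.

Lemma sY_dim : \dim (sY V) = n.
Proof. by rewrite -(size_basis (sy_basis V)). Qed.

Lemma xvecD r s : xvec (r + s) = xvec r + xvec s.
Proof. by rewrite /xvec -big_split; apply: eq_bigr => j _; rewrite mxE scalerDl. Qed.
Lemma yvecD r s : yvec (r + s) = yvec r + yvec s.
Proof. by rewrite /yvec -big_split; apply: eq_bigr => j _; rewrite mxE scalerDl. Qed.
Lemma xvecZ c r : xvec (c *: r) = c *: xvec r.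
Proof. by rewrite /xvec scaler_sumr; apply: eq_bigr => j _; rewrite mxE scalerA. Qed.
Lemma yvecZ c r : yvec (c *: r) = c *: yvec r.
Proof. by rewrite /yvec scaler_sumr; apply: eq_bigr => j _; rewrite mxE scalerA. Qed.
Lemma xvec0 : xvec 0 = 0. Proof. by rewrite -[0](scale0r 0) xvecZ scale0r. Qed.
Lemma yvec0 : yvec 0 = 0. Proof. by rewrite -[0](scale0r 0) yvecZ scale0r. Qed.

Definition vcoord (w : V) : 'rV[F]_(n + n) := row_mx (xcoord w) (ycoord w).
Definition coordv (z : 'rV[F]_(n + n)) : V := xvec (lsubmx z) + yvec (rsubmx z).

Lemma vcoordK : cancel vcoord coordv.
Proof. by move=> w; rewrite /coordv row_mxKl row_mxKr vec_coordK. Qed.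
Lemma coordvK : cancel coordv vcoord.
Proof. by move=> z; rewrite /vcoord xcoordK ycoordK hsubmxK. Qed.

Lemma vcoord_linear : linear vcoord.
Proof.
move=> a u w; apply/rowP => j; rewrite !mxE; case: (fintype.split j) => k; rewrite !mxE.
  by rewrite linearDl linearZl_LR.
by rewrite linearD linearZ.
Qed.
HB.instance Definition _ := GRing.isLinear.Build F V 'rV[F]_(n + n) *:%R vcoord vcoord_linear.

Lemma coordv_linear : linear coordv.
Proof. by move=> a u w; apply: (can_inj vcoordK); rewrite linearP /= !coordvK. Qed.
HB.instance Definition _ := GRing.isLinear.Build F 'rV[F]_(n + n) V *:%R coordv coordv_linear.

Lemma form_vcoord u w : B u w = (vcoord u *m symplJ *m (vcoord w)^T) 0 0.
Proof.
rewrite -{1}(vec_coordK u) -{1}(vec_coordK w) linearDl !linearD /=.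
rewrite (formXX (xvec_mem _) (xvec_mem _)) (formYY (yvec_mem _) (yvec_mem _)) add0r addr0.
rewrite [B (yvec _) _]form_antisym !form_xy /vcoord /symplJ mul_row_block !mulmx0 add0r addr0.
rewrite mulmx1 mulmxN mulmx1 tr_row_mx mul_row_col mulNmx.
have tr1 r s : (r *m s^T) 0 0 = (s *m r^T) 0 0.
  by rewrite -[in LHS](trmxK r) -trmx_mul mxE.
have addE (A A' : 'M[F]_1) : (- A + A') 0 0 = A' 0 0 - A 0 0 by rewrite !mxE addrC.
by rewrite (tr1 (xcoord w)) addE.
Qed.

Definition mx_of g : 'M[F]_(n + n) := lin1_mx (vcoord \o g \o coordv).
Definition of_mx (G : 'M[F]_(n + n)) : 'End(V) := linfun (coordv \o mulmxr G \o vcoord).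

Lemma mx_ofE g w : vcoord (g w) = vcoord w *m mx_of g.
Proof. by rewrite /mx_of mul_rV_lin1 /= vcoordK. Qed.

Lemma of_mxE G w : vcoord (of_mx G w) = vcoord w *m G.
Proof. by rewrite lfunE /= coordvK. Qed.

Lemma end_eq g h : (forall w, vcoord (g w) = vcoord (h w)) -> g = h.
Proof. by move=> e; apply/lfunP => w; apply: (can_inj vcoordK). Qed.

Lemma of_mxK g : of_mx (mx_of g) = g.
Proof. by apply: end_eq => w; rewrite of_mxE mx_ofE. Qed.

Lemma mx_ofK G : mx_of (of_mx G) = G.
Proof.
apply/row_matrixP => i; rewrite !rowE -[delta_mx 0 i]coordvK -mx_ofE of_mxE.
by [].
Qed.

Lemma mx_of_spmul g h : mx_of (spmul g h) = mx_of g *m mx_of h.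
Proof.
apply/row_matrixP => i; rewrite !rowE -[delta_mx 0 i]coordvK -mx_ofE /spmul comp_lfunE.
by rewrite !mx_ofE mulmxA.
Qed.

Lemma Sp_mx g : Sp V g <-> spmx (mx_of g).
Proof.
split=> [h|h u w]; last first.
  by rewrite !form_vcoord !mx_ofE trmx_mul !mulmxA -(mulmxA _ (mx_of g)) -(mulmxA _ (mx_of g *m _)) (h : _ = _).
apply/matrixP => i j; have := h (coordv (delta_mx 0 i)) (coordv (delta_mx 0 j)).
rewrite !form_vcoord !mx_ofE !coordvK trmx_mul trmx_delta !mulmxA.
rewrite -!rowE -!colE !mxE => <-.
by apply: eq_bigr => k _; rewrite -row_mul [RHS]mulrC mxE mulrC; congr (_ * _); rewrite !mxE.
Qed.

End Coordinates.

(** * Weil operators in coordinates *)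

Lemma mul_pid_entry (F : fieldType) m n i (a : 'rV[F]_m) (j : 'I_n) :
  (a *m (pid_mx i : 'M[F]_(m, n))) 0 j = \sum_(k < m | (k == j :> nat) && (k < i)%N) a 0 k.
Proof.
rewrite mxE [RHS]big_mkcond; apply: eq_bigr => k _; rewrite mxE.
by case: ifP => _; rewrite ?mulr1 ?mulr0.
Qed.

Lemma mul_pid_sq (F : fieldType) n i (a : 'rV[F]_n) (j : 'I_n) :
  (a *m (pid_mx i : 'M[F]_n)) 0 j = if (j < i)%N then a 0 j else 0.
Proof.
rewrite mul_pid_entry; case: ifP => ji; last first.
  by rewrite big1 // => k /andP[/eqP/val_inj -> ]; rewrite ji.
rewrite (big_pred1 j) // => k; apply/andP/eqP => [[/eqP/val_inj]//|->].
by rewrite ji.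
Qed.

Section Blocks.
Context {F : fieldType} (V : sympl_space F).
Local Notation n := (sn V).
Local Notation Xt := (subvs_of (sX V)).
Local Notation Yt := (subvs_of (sY V)).
Implicit Types (r s : 'rV[F]_n) (g h : 'End(V)).
Local Open Scope quotient_scope.

Definition Xvec r : Xt := vsproj (sX V) (xvec r).
Definition Yvec s : Yt := vsproj (sY V) (yvec s).

Lemma val_Xvec r : vsval (Xvec r) = xvec r.
Proof. by rewrite vsprojK // xvec_mem. Qed.
Lemma val_Yvec r : vsval (Yvec r) = yvec r.
Proof. by rewrite vsprojK // yvec_mem. Qed.

Lemma Xvec_surj (x : Xt) : exists r, x = Xvec r.
Proof.
have [r e] := xvec_surj (subvsP x); exists r.
by apply: val_inj; rewrite /= val_Xvec.
Qed.
Lemma Yvec_surj (y : Yt) : exists r, y = Yvec r.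
Proof.
have [r e] := yvec_surj (subvsP y); exists r.
by apply: val_inj; rewrite /= val_Yvec.
Qed.
Lemma Xvec_inj : injective Xvec.
Proof.
move=> r s /(congr1 vsval); rewrite !val_Xvec => e.
by rewrite -(xcoordK r 0) -(xcoordK s 0) e.
Qed.
Lemma XvecD r s : Xvec (r + s) = Xvec r + Xvec s.
Proof. by rewrite /Xvec xvecD linearD. Qed.
Lemma YvecB r s : Yvec (r - s) = Yvec r - Yvec s.
Proof. by rewrite /Yvec -scaleN1r yvecD yvecZ linearD linearZ /= scaleN1r. Qed.
Lemma Xvec_eq0 r : (Xvec r == 0) = (r == 0).
Proof. by rewrite -(inj_eq Xvec_inj) /Xvec xvec0 linear0. Qed.

Lemma sXYcap : (sX V :&: sY V = 0)%VS.
Proof. by have [_ /directv_addP] := sXY V. Qed.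

Lemma daddv_piXY (w : V) : daddv_pi (sX V) (sY V) w = xvec (xcoord w).
Proof.
have YX : (sY V :&: sX V = 0)%VS by rewrite capvC sXYcap.
rewrite -{1}(vec_coordK w) linearD /= (daddv_pi_id sXYcap (xvec_mem _)).
have := daddv_pi_add sXYcap (subvP (addvSr _ _) _ (yvec_mem (ycoord w))).
by rewrite (daddv_pi_id YX (yvec_mem _)) => /eqP; rewrite -subr_eq0 addrK => /eqP ->; rewrite addr0.
Qed.

Lemma daddv_piYX (w : V) : daddv_pi (sY V) (sX V) w = yvec (ycoord w).
Proof.
have YX : (sY V :&: sX V = 0)%VS by rewrite capvC sXYcap.
rewrite -{1}(vec_coordK w) linearD /= (daddv_pi_id YX (yvec_mem _)).
have := daddv_pi_add YX (subvP (addvSr _ _) _ (xvec_mem (xcoord w))).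
by rewrite (daddv_pi_id sXYcap (xvec_mem _)) => /eqP; rewrite -subr_eq0 addrK => /eqP ->; rewrite add0r.
Qed.

Lemma projXE w : projX w = Xvec (xcoord w).
Proof. by rewrite /projX daddv_piXY. Qed.
Lemma projYE w : projY w = Yvec (ycoord w).
Proof. by rewrite /projY daddv_piYX. Qed.

Definition ga g : 'M[F]_n := ulsubmx (mx_of g).
Definition gb g : 'M[F]_n := ursubmx (mx_of g).
Definition gc g : 'M[F]_n := dlsubmx (mx_of g).
Definition gd g : 'M[F]_n := drsubmx (mx_of g).

Lemma mx_of_blocks g : mx_of g = block_mx (ga g) (gb g) (gc g) (gd g).
Proof. by rewrite submxK. Qed.

Lemma vcoord_xvec r : vcoord (xvec r) = row_mx r 0.
Proof. by have := coordvK (row_mx r 0); rewrite /coordv row_mxKl row_mxKr yvec0 addr0. Qed.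
Lemma vcoord_yvec r : vcoord (yvec r) = row_mx 0 r.
Proof. by have := coordvK (row_mx 0 r); rewrite /coordv row_mxKl row_mxKr xvec0 add0r. Qed.

Lemma act_xvec g r : vcoord (g (xvec r)) = row_mx (r *m ga g) (r *m gb g).
Proof. by rewrite mx_ofE vcoord_xvec mx_of_blocks mul_row_block !mul0mx !addr0. Qed.
Lemma act_yvec g s : vcoord (g (yvec s)) = row_mx (s *m gc g) (s *m gd g).
Proof. by rewrite mx_ofE vcoord_yvec mx_of_blocks mul_row_block !mul0mx !add0r. Qed.

Lemma blkaE g r : blka g (Xvec r) = Xvec (r *m ga g).
Proof. by rewrite /blka projXE val_Xvec; have /eq_row_mx[-> _] := act_xvec g r. Qed.
Lemma blkbE g r : blkb g (Xvec r) = Yvec (r *m gb g).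
Proof. by rewrite /blkb projYE val_Xvec; have /eq_row_mx[_ ->] := act_xvec g r. Qed.
Lemma blkcE g s : blkc g (Yvec s) = Xvec (s *m gc g).
Proof. by rewrite /blkc projXE val_Yvec; have /eq_row_mx[-> _] := act_yvec g s. Qed.
Lemma blkdE g s : blkd g (Yvec s) = Yvec (s *m gd g).
Proof. by rewrite /blkd projYE val_Yvec; have /eq_row_mx[_ ->] := act_yvec g s. Qed.

Lemma mem_sY_xcoord w : (w \in sY V) = (xcoord w == 0).
Proof.
apply/idP/eqP => [/yvec_surj[s ->]|w0].
  by have := vcoord_yvec s => /eq_row_mx[].
by rewrite -(vec_coordK w) w0 xvec0 add0r yvec_mem.
Qed.

(** [dimYg] is a difference of dimensions of subspaces of V. The rank normal form of c exhibits a
    basis of Y, the rows of [M], whose vectors from index [rk] on span ker c. *)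
Lemma dimYgE g : dimYg g = \rank (gc g).
Proof.
set rk := \rank _; pose U := row_ebase (gc g); pose M := invmx (col_ebase (gc g)).
have uU : U \in unitmx by apply: row_ebase_unit.
have uM : M \in unitmx by rewrite unitmx_inv col_ebase_unit.
have McE : M *m gc g = pid_mx rk *m U.
  by rewrite -[gc g in LHS]mulmx_ebase !mulmxA mulVmx ?col_ebase_unit // mul1mx.
have rkn : (rk <= n)%N by apply: rank_leq_row.
pose y' := [tuple yvec (row k M) | k < n].
have y'comb (s : 'I_n -> F) : \sum_(k < n) s k *: y'`_k = yvec (\row_k s k *m M).
  transitivity (\sum_k s k *: yvec (row k M)).
    by apply: eq_bigr => k _; rewrite -tnth_nth tnth_mktuple.
  rewrite mulmx_sum_row; elim/big_rec2: _ => [|k z w _ ->]; first by rewrite yvec0.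
  by rewrite yvecD yvecZ mxE.
have fy' : free y'.
  apply/freeP => s; rewrite y'comb => /(congr1 (@ycoord F V)).
  have -> : ycoord (0 : V) = 0 by rewrite -(ycoordK 0 0) xvec0 yvec0 addr0.
  rewrite -[yvec _]add0r -(xvec0 V) ycoordK => /(congr1 (mulmx^~ (invmx M))).
  rewrite mul0mx mulmxK // => e k; have := congr1 (fun w : 'rV[F]_n => w 0 k) e.
  by rewrite !mxE.
pose N := (sY V :&: lker (daddv_pi (sX V) (sY V) \o g)%VF)%VS.
have memN s : (yvec s \in N) = (s *m gc g == 0).
  rewrite memv_cap yvec_mem /= memv_ker comp_lfunE daddv_piXY.
  have /eq_row_mx[-> _] := act_yvec g s.
  apply/eqP/eqP => [e|->]; last exact: xvec0.
  have := xcoordK (s *m gc g) 0; rewrite e yvec0 addr0 => <-.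
  by apply/rowP => j; rewrite !mxE linear0l.
have NE : N = <<drop rk y'>>%VS.
  apply/eqP; rewrite eqEsubv; apply/andP; split; last first.
    apply/span_subvP => w /(nthP 0)[k]; rewrite size_drop size_tuple => kn <-.
    have kn' : (rk + k < n)%N by rewrite -ltn_subRL.
    rewrite nth_drop -[(rk + k)%N]/(val (Ordinal kn')) -tnth_nth tnth_mktuple memN.
    rewrite -row_mul McE row_mul (_ : row _ _ = 0) ?mul0mx //.
    by apply/rowP => l; rewrite !mxE /= ltnNge leq_addr andbF.
  apply/subvP => w wN; have [s0 es0] : exists s, w = yvec s by apply: yvec_surj; move: wN; rewrite memv_cap => /andP[].
  pose s := s0 *m invmx M; have es : s0 = s *m M by rewrite mulmxKV.
  move: wN; rewrite es0 memN es -mulmxA McE => /eqP /(congr1 (mulmx^~ (invmx U))).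
  rewrite mul0mx mulmxA mulmxK // => sE; have s_lt (k : 'I_n) : (k < rk)%N -> s 0 k = 0.
    by move=> kr; have := congr1 (fun w : 'rV[F]_n => w 0 k) sE; rewrite mul_pid_sq kr => ->; rewrite mxE.
  have -> : s = \row_k s 0 k by apply/rowP => k; rewrite mxE.
  rewrite -y'comb; apply: memv_suml => k _.
  have [kr|kr] := ltnP k rk; first by rewrite s_lt // scale0r mem0v.
  apply/memvZ/memv_span; have -> : y'`_k = nth 0 (drop rk y') (k - rk) by rewrite nth_drop subnKC.
  by apply: mem_nth; rewrite size_drop size_tuple ltn_sub2r // (leq_ltn_trans kr).
rewrite /dimYg -/N NE (eqnP (_ : free (drop rk y'))).
  by rewrite size_drop size_tuple sY_dim subKn.
by move: fy'; rewrite -{1}(cat_take_drop rk y') cat_free => /and3P[].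
Qed.

Lemma parabolic_mx p : parabolic p <-> spmx (mx_of p) /\ gc p = 0.
Proof.
split=> [[/Sp_mx sp pY]|[sp pc]].
  split=> //; apply/row_matrixP => k; rewrite rowE row0; apply/eqP.
  have : p (yvec (delta_mx 0 k)) \in sY V by rewrite -pY memv_img // yvec_mem.
  by rewrite mem_sY_xcoord; have /eq_row_mx[-> _] := act_yvec p (delta_mx 0 k).
split; first exact/Sp_mx.
have lk0 : (sY V :&: lker p = 0)%VS.
  apply/eqP; rewrite -subv0; apply/subvP => w; rewrite memv_cap memv_ker => /andP[_ /eqP pw].
  rewrite memv0; have := mx_ofE p w; rewrite pw linear0 => /esym /(congr1 (mulmx^~ (invmx (mx_of p)))).
  by rewrite mul0mx mulmxK ?spmx_unit // => /(congr1 (@coordv F V)); rewrite vcoordK linear0 => ->.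
apply/eqP; rewrite eqEdim limg_dim_eq // leqnn andbT.
apply/subvP => w /memv_imgP[y /yvec_surj[s ->] ->].
by rewrite mem_sY_xcoord; have /eq_row_mx[-> _] := act_yvec p s; rewrite pc mulmx0.
Qed.

Lemma tau_mx i : tau V i = @of_mx F V (taumx i).
Proof.
rewrite /tau /of_mx; congr linfun; apply/funext => w.
rewrite /= /coordv /vcoord /taumx mul_row_block row_mxKl row_mxKr -big_split.
apply: eq_bigr => j _ /=; rewrite !mulmxBr !mulmx1 mulmxN !mxE.
rewrite -![(\sum_(_ < _) _ * pid_mx i _ _)]/(_) .
have pidE (z : 'rV[F]_n) : \sum_k z 0 k * pid_mx i k j = if (j < i)%N then z 0 j else 0.
  by rewrite -(mul_pid_sq i z j) mxE.
rewrite !pidE !mxE; case: ifP => _.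
  by rewrite subrr add0r scalerN addrC -scaleNr subrr addr0 scaleNr.
by congr (_ *: _ + _ *: _); ring.
Qed.

Lemma bruhat_ex g : Sp V g -> exists pp : 'End(V) * 'End(V), [/\ parabolic pp.1, parabolic pp.2 &
    g = spmul (spmul pp.1 (tau V (dimYg g))) pp.2].
Proof.
move=> /Sp_mx; rewrite mx_of_blocks => /bruhat_mx[P1 [P2 [s1 s2 c1 c2 e]]].
exists (@of_mx F V P1, @of_mx F V P2); split.
- by apply/parabolic_mx; rewrite /gc mx_ofK.
- by apply/parabolic_mx; rewrite /gc mx_ofK.
- rewrite -[LHS]of_mxK mx_of_blocks e -dimYgE -[RHS]of_mxK !mx_of_spmul !mx_ofK tau_mx mx_ofK.
  by [].
Qed.

Lemma bruhatP g : Sp V g -> [/\ parabolic (bruhat g).1, parabolic (bruhat g).2 &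
    g = spmul (spmul (bruhat g).1 (tau V (dimYg g))) (bruhat g).2].
Proof. by move=> /bruhat_ex h; have := xgetPex (\1%VF, \1%VF) h. Qed.

Lemma detYE g : gc g = 0 -> detY g = \det (gd g).
Proof.
move=> g0; congr determinant; apply/matrixP => i j; rewrite mxE.
have ey : tnth (sy V) i = yvec (delta_mx 0 i).
  rewrite /yvec (bigD1 i) //= mxE !eqxx scale1r big1 ?addr0 // => k /negbTE ki.
  by rewrite mxE ki andbF scale0r.
have -> : g (tnth (sy V) i) = yvec (row i (gd g)).
  rewrite ey; apply: (can_inj (@vcoordK F V)); rewrite act_yvec vcoord_yvec g0 mulmx0.
  by rewrite rowE.
have -> : yvec (row i (gd g)) = \sum_k row i (gd g) 0 k *: (sy V)`_k.
  by apply: eq_bigr => k _; rewrite (tnth_nth 0).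
by rewrite coord_sum_free ?mxE //; apply: basis_free (sy_basis V).
Qed.

Lemma kerc_relE g s s' : kerc_rel g (Yvec s) (Yvec s') = ((s - s') *m gc g == 0).
Proof. by rewrite /kerc_rel -YvecB blkcE Xvec_eq0. Qed.

Lemma pi_Yvec_eq g s s' : (s - s') *m gc g = 0 -> \pi_(Yg g) (Yvec s) = \pi_(Yg g) (Yvec s').
Proof. by move=> h; apply/eqP; rewrite eqmodE /= kerc_relE h. Qed.

Lemma pi_Yvec_eqP g s s' : \pi_(Yg g) (Yvec s) = \pi_(Yg g) (Yvec s') -> (s - s') *m gc g = 0.
Proof. by move=> /eqP; rewrite eqmodE /= kerc_relE => /eqP. Qed.

End Blocks.

(** * Weil operators as integrals over F^i *)

Section WeilFormula.
Context {R : realType} {F : nonArchLocalFieldType} (V : sympl_space F).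
Local Notation C := R[i].
Variables (lam : F -> C) (mu : {measure set (borelF F) -> \bar R}).
Local Notation n := (sn V).
Implicit Types (r s : 'rV[F]_n) (g h : 'End(V)).
Local Open Scope quotient_scope.

Lemma Sp_blocks g : Sp V g -> [/\ ga g *m (gb g)^T = gb g *m (ga g)^T,
  ga g *m (gd g)^T - gb g *m (gc g)^T = 1%:M & gc g *m (gd g)^T = gd g *m (gc g)^T].
Proof. by move=> /Sp_mx; rewrite mx_of_blocks => /spmx_block. Qed.

(* The quadratic form under [lam] in the Weil operator, in coordinates. *)
Definition wphase g r s : F :=
  (dot (r *m ga g) (r *m gb g) + 2 * dot (s *m gc g) (r *m gb g) + dot (s *m gc g) (s *m gd g)) / 2.

(** The term in c and d depends only on the class of s modulo ker c as well, because c d^T is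
    symmetric. *)
Lemma wphase_kerc g r s s' : Sp V g -> (s - s') *m gc g = 0 -> wphase g r s = wphase g r s'.
Proof.
move=> /Sp_blocks[_ _ h3]; rewrite mulmxBl => /eqP; rewrite subr_eq0 => /eqP e.
rewrite /wphase e; congr ((_ + _) / 2).
have sym x y : dot (x *m gc g) (y *m gd g) = dot (x *m gd g) (y *m gc g).
  by rewrite /dot !trmx_mul -!mulmxA (mulmxA (gc g)) h3 !mulmxA.
by rewrite -{1}e sym e -sym e.
Qed.

Definition wint g (phi : subvs_of (sX V) -> C) r s : C :=
  lam (wphase g r s) * phi (Xvec (V := V) (r *m ga g + s *m gc g)).

Lemma weil_integrand g phi r (yb : Yg g) s : Sp V g -> yb = \pi_(Yg g) (Yvec (V := V) s) ->
  (let y := repr yb in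
    lam ((sform V (vsval (blka g (Xvec (V := V) r))) (vsval (blkb g (Xvec (V := V) r)))
          - 2 * sform V (vsval (blkb g (Xvec (V := V) r))) (vsval (blkc g y))
          + sform V (vsval (blkc g y)) (vsval (blkd g y))) / 2)
    * phi (blka g (Xvec (V := V) r) + blkc g y)) = wint g phi r s.
Proof.
move=> sg e /=; have [s' es'] := Yvec_surj (repr yb).
have h : (s' - s) *m gc g = 0 by apply: pi_Yvec_eqP; rewrite -es' reprK.
rewrite es' blkaE blkbE blkcE blkdE !val_Xvec !val_Yvec.
rewrite [sform V (yvec _) _]form_antisym !form_xy -!/(dot _ _) mulrN opprK /wint -(wphase_kerc r sg h) -XvecD.
by move: h; rewrite /wphase mulmxBl => /eqP; rewrite subr_eq0 => /eqP ->.
Qed.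

Lemma mul_pid_rows m i (a : 'rV[F]_i) (le_im : (i <= m)%N) :
  \sum_(k < m | (k < i)%N) (tuple_row a : seq F)`_k *: delta_mx 0 k = a *m (pid_mx i : 'M[F]_(i, m)).
Proof.
apply/rowP => j; rewrite mul_pid_entry summxE.
under eq_bigr do rewrite !mxE eqxx /=.
have [ji|ij] := ltnP j i.
  rewrite (bigD1 j) //= eqxx mulr1 big1 ?addr0; last by move=> k /andP[_ /negbTE]; rewrite eq_sym => ->; rewrite mulr0.
  rewrite (big_pred1 (Ordinal ji)) => [|k]; last first.
    by rewrite ltn_ord andbT; apply/eqP/eqP => [e|->//]; apply: val_inj.
  by have := tnth_mktuple (fun k => a 0 k) (Ordinal ji); rewrite (tnth_nth 0).
rewrite !big1 // => [k /andP[/eqP kj]|k ki]; first by rewrite kj ltnNge ij.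
by case: eqP => [e|]; rewrite ?mulr0 //; move: ki; rewrite -e ltnNge ij.
Qed.

Hypothesis mu_haar : is_haar mu.

Lemma labs_sqr (s : F) : s != 0 -> exists k : int,
  ((Num.sqrt (labs R s))^-1) ^+ 2 = (@resorder F)%:R ^ k /\ 0 < (Num.sqrt (labs R s))^-1.
Proof.
move=> s0; have q0 : 0 < (@resorder F)%:R :> R by rewrite ltr0n resorder_gt0.
have l0 : 0 < labs R s by rewrite /labs (negbTE s0) exprz_gt0.
exists (lval s); rewrite invr_gt0 sqrtr_gt0 l0 exprVn sqr_sqrtr ?ltW //.
by rewrite /labs (negbTE s0) -invr_expz invrK.
Qed.

Lemma sintZ (T : Type) (c : R) (nu : set T -> \bar R) (f : T -> C) : 0 <= c ->
  sint (fun A => (c%:E * nu A)%E) f = c%:C * sint nu f.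
Proof.
move=> c0; rewrite /sint mulr_fsumr; apply: eq_fsbigr => z _.
rewrite mulrCA; congr (_ * _); rewrite -rmorphM /=; congr (_%:C).
have [->|cn] := eqVneq c 0; first by rewrite mul0e mul0r.
have cp : 0 < c by rewrite lt_def cn.
by case: (nu _) => [x||] //; rewrite ?gt0_muley ?gt0_muleNy ?lte_fin // mulr0.
Qed.

(** Transports the measure of Y_g through the chosen Bruhat decomposition. What is kept of that
    choice: c maps the rows of [M] to a basis of its image, and the factor is a positive square root
    of a power of q. Its exact value is recorded when the block c of g vanishes, for the sake of the
    dilations. *)
Lemma weil_formula g : Sp V g -> exists i (M : 'M[F]_(i, n)) (c : R),
  [/\ 0 < c, exists k : int, c ^+ 2 = (@resorder F)%:R ^ k, row_free (M *m gc g),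
    forall s, exists t : 'rV[F]_i, t *m M *m gc g = s *m gc g &
    (gc g = 0 -> c = (Num.sqrt (labs R (\det (gd g))))^-1) /\
    forall phi r, weil lam mu g phi (Xvec r) =
      c%:C * rint mu (fun t : 'rV[F]_i => wint g phi r (t *m M))].
Proof.
move=> sg; have [p1P p2P] := bruhatP sg; case e12: (bruhat g) p1P p2P => [p1 p2] /= p1P p2P eg.
set i := dimYg g in eg.
move: (p1P) => /parabolic_mx[s1 c1]; move: (p2P) => /parabolic_mx[s2 c2].
have le_in : (i <= n)%N by rewrite /i dimYgE rank_leq_row.
pose E : 'M[F]_n := pid_mx i; pose E' : 'M[F]_(i, n) := pid_mx i.
have EE' : E' *m E = E' by rewrite /E /E' pid_mx_id.
have E'T : E'^T *m E' = E by rewrite /E' tr_pid_mx pid_mx_id // leqnn.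
have [u1 v1] : gd p1 \in unitmx /\ ga p1 \in unitmx.
  move: s1; rewrite mx_of_blocks => /spmx_block[_ + _]; rewrite c1 trmx0 mulmx0 subr0.
  by move=> /mulmx1_unit[]; rewrite unitmx_tr.
have v2 : ga p2 \in unitmx.
  move: s2; rewrite mx_of_blocks => /spmx_block[_ + _]; rewrite c2 trmx0 mulmx0 subr0.
  by move=> /mulmx1_unit[].
have gcE : gc g = gd p1 *m E *m ga p2.
  rewrite {1}/gc eg !mx_of_spmul tau_mx mx_ofK (mx_of_blocks p1) (mx_of_blocks p2) /taumx c1 c2.
  by rewrite !mulmx_block !mul0mx !mulmx0 !addr0 !add0r block_mxKdl.
(* The inverse of p1 on Y, restricted to the first i basis vectors: a parametrization of Y_g inverse
   to [pbar]. *)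
pose M := E' *m invmx (gd p1).
have McE : M *m gc g = E' *m ga p2.
  by rewrite /M gcE !mulmxA mulmxKV // EE'.
pose c := (Num.sqrt (labs R (detY (spmul p1 p2))))^-1.
have c12 : gc (spmul p1 p2) = 0.
  rewrite /gc mx_of_spmul (mx_of_blocks p1) (mx_of_blocks p2) c1 c2.
  by rewrite mulmx_block block_mxKdl mul0mx mulmx0 addr0.
have det0 : detY (spmul p1 p2) != 0.
  rewrite detYE //.
  have : spmx (mx_of (spmul p1 p2)) by rewrite mx_of_spmul; apply: spmx_mul.
  rewrite mx_of_blocks => /spmx_block[_ + _]; rewrite c12 trmx0 mulmx0 subr0.
  by move=> /mulmx1_unit[_]; rewrite unitmx_tr unitmxE unitfE.
have [k [ck c0]] := labs_sqr det0.
exists i, M, c; split=> //; first by exists k.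
- rewrite McE /row_free mxrankMfree ?row_free_unit // /E' rank_pid_mx //.
- move=> s; exists (s *m gd p1 *m E'^T); rewrite -mulmxA McE gcE !mulmxA.
  by rewrite -(mulmxA _ E'^T) E'T.
split=> [g0|phi r].
  have i0 : i = 0%N by rewrite /i dimYgE g0 mxrank0.
  rewrite /c -detYE //; congr (Num.sqrt (labs R (detY _)))^-1.
  apply: (can_inj (@of_mxK F V)); rewrite [in RHS]eg !mx_of_spmul tau_mx mx_ofK i0.
  by rewrite /taumx pid_mx_0 subr0 oppr0 -scalar_mx_block mulmx1.
rewrite /weil /mu_g e12 sintZ ?ltW // -/c; congr (_ * _).
rewrite /rint /sint; apply: eq_fsbigr => z _; congr (_ * (fine _)%:C).
rewrite /mu_tau; congr prod_measure; rewrite predeqE => t /=.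
have -> : \sum_(k < n | (k < i)%N) (t : seq F)`_k *: @ybase F V k = Yvec (row_tuple (t : i.-tuple F) *m E').
  rewrite -(mul_pid_rows (row_tuple (t : i.-tuple F)) le_in) row_tupleK.
  elim/big_rec2: _ => [|l z1 z2 _ ->]; first by rewrite /Yvec yvec0 linear0.
  rewrite /Yvec yvecD yvecZ linearD linearZ /=; congr (_ *: vsproj _ _ + _).
  rewrite /yvec (bigD1 l) //= mxE !eqxx scale1r big1 ?addr0 // => j /negbTE jl.
  by rewrite mxE jl andbF scale0r.
have gcT : gc (tau V i) = E by rewrite tau_mx /gc mx_ofK /taumx block_mxKdl.
(* p1 sends the class of s to that of t exactly when s and t M agree modulo ker c. *)
have key s : (s *m gd p1 - row_tuple t *m E') *m E = 0 <-> (s - row_tuple t *m M) *m gc g = 0.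
  have -> : (s - row_tuple t *m M) *m gc g = (s *m gd p1 - row_tuple t *m E') *m E *m ga p2.
    by rewrite gcE !mulmxA mulmxBl /M -!mulmxA mulVmx // mulmx1.
  split=> [->|/(congr1 (mulmx^~ (invmx (ga p2))))]; first by rewrite mul0mx.
  by rewrite mul0mx mulmxK.
split=> [[yb fz /= e]|fz].
  have [s es] := Yvec_surj (repr yb).
  have h : (s *m gd p1 - row_tuple t *m E') *m E = 0.
    by rewrite -gcT; apply: pi_Yvec_eqP; rewrite -e /pbar es blkdE.
  rewrite -fz -(@weil_integrand g phi r yb) // -[LHS]reprK es.
  by apply: pi_Yvec_eq; apply/key.
exists (\pi_(Yg g) (Yvec (row_tuple t *m M))).
  by rewrite /= -fz; apply: weil_integrand.
rewrite /pbar; have [s es] := Yvec_surj (repr (\pi_(Yg g) (Yvec (row_tuple t *m M)))).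
rewrite es blkdE; apply: pi_Yvec_eq; rewrite gcT; apply/key.
by apply: pi_Yvec_eqP; rewrite -es reprK.
Qed.

End WeilFormula.

(** * Invariance properties of the integral over F^n *)

Section RintTheory.
Context {R : realType} {F : nonArchLocalFieldType}.
Local Notation C := R[i].
Variable mu : {measure set (borelF F) -> \bar R}.
Hypothesis mu_haar : is_haar mu.

Definition sch n (f : 'rV[F]_n -> C) := exists m, level m f.

Lemma sch2 n (f g : 'rV[F]_n -> C) : sch f -> sch g ->
  exists m, [/\ 0 <= m, level m f & level m g].
Proof.
move=> [a fa] [b gb]; exists (Num.max 0 (Num.max a b)); split.
- by rewrite le_max lexx.
- by apply: level_le fa; rewrite !le_max lexx orbT.
- by apply: level_le gb; rewrite !le_max lexx !orbT.
Qed.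

Lemma level_lin n m (a : C) (f g : 'rV[F]_n -> C) : level m f -> level m g ->
  level m (fun x => a * f x + g x).
Proof.
move=> [f1 f2] [g1 g2]; split=> [x y xy|x]; first by rewrite (f1 _ _ xy) (g1 _ _ xy).
have [fx|/f2//] := eqVneq (f x) 0; have [gx|/g2//] := eqVneq (g x) 0.
by rewrite fx gx mulr0 addr0 eqxx.
Qed.

Lemma sch_lin n (a : C) (f g : 'rV[F]_n -> C) : sch f -> sch g -> sch (fun x => a * f x + g x).
Proof. by move=> sf sg; have [m [_ lf lg]] := sch2 sf sg; exists m; apply: level_lin. Qed.

Lemma rint_lin n (a : C) (f g : 'rV[F]_n -> C) : sch f -> sch g ->
  rint mu (fun x => a * f x + g x) = a * rint mu f + rint mu g.
Proof.
move=> sf sg; have [m [m0 lf lg]] := sch2 sf sg.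
have [r [_ _ h]] := rint_levelE mu_haar lf m0.
by rewrite !h //; [rewrite big_split /= -mulr_sumr; ring|apply: level_lin].
Qed.

Lemma rint_shift n (f : 'rV[F]_n -> C) x0 : sch f -> rint mu (fun x => f (x0 + x)) = rint mu f.
Proof.
move=> sf; have [m0 x0m] := latt_ex x0; have [m1 lf] := sf.
(* The level is enlarged until its support lattice contains x0, so that translation by x0 permutes
   the cosets in it. *)
pose m := Num.max 0 (Num.max m1 (- m0)); have m_ge0 : 0 <= m by rewrite le_max lexx.
have lm : level m f by apply: level_le lf; rewrite !le_max lexx orbT.
have xm : latt n (- m) x0 by apply: latt_le x0m; rewrite lerNl !le_max lexx !orbT.
have lsh : level m (fun x => f (x0 + x)).
  case: lm => l1 l2; split=> [x y xy|x /l2 h].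
    by apply: l1; rewrite opprD addrACA subrr add0r.
  by rewrite -(addKr x0 x); apply: (subgroupD (latt_subgroup n _)) => //; apply: (subgroupN (latt_subgroup n _)).
have [r [tr _ h]] := rint_levelE mu_haar lm m_ge0; rewrite !h //; congr (_ * _).
rewrite -(big_map (fun x => x0 + x) xpredT f).
apply: (transversal_sum (latt_subgroup n m)) (transversal_shift (latt_subgroup n _) xm tr) tr.
by move=> x y _ _; case: lm => l1 _; apply: l1.
Qed.

Lemma rint_vunit n (f : 'rV[F]_n -> C) u : vunit u -> sch f -> rint mu (fun x => f (u *: x)) = rint mu f.
Proof.
move=> uu sf; have [m [m0 lm _]] := sch2 sf sf.
have u0 := vunit_neq0 uu.
have lsc : level m (fun x => f (u *: x)).
  case: lm => l1 l2; split=> [x y xy|x /l2 /latt_vunit -/(_ uu)//].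
  by apply: l1; rewrite -scalerBr; apply/latt_vunit.
have [r [tr _ h]] := rint_levelE mu_haar lm m0; rewrite !h //; congr (_ * _).
rewrite -(big_map (fun x => u *: x) xpredT f).
have tr' : transversal (latt n (- m)) (latt n m) [seq u *: x | x <- r].
  apply: (@transversal_image _ _ (fun x => u^-1 *: x)) tr.
  - by move=> x; rewrite scalerA mulVf // scale1r.
  - by move=> x; rewrite scalerA mulfV // scale1r.
  - by move=> x; apply: (latt_vunit _ _ uu).2.
  - by move=> x; apply: (latt_vunit _ _ (vunitV uu)).2.
  - by move=> x y; rewrite -scalerBr; apply: latt_vunit.
apply: (transversal_sum (latt_subgroup n m)) tr' tr.
by move=> x y _ _; case: lm => l1 _; apply: l1.
Qed.

Lemma rint0 (f : 'rV[F]_0 -> C) : rint mu f = f 0.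
Proof.
have e x : x = 0 :> 'rV[F]_0 by apply/rowP => -[].
have l0 m x : latt 0 m x by move=> -[].
rewrite (@rintE _ _ _ mu_haar _ f 0 0 [:: 0]) //.
- by rewrite big_seq1 expr0 mul1r.
- exact: transversal1 (latt_subgroup 0 0).
- by move=> x y _; rewrite (e x) (e y).
Qed.

End RintTheory.

(** * Intertwining of Weil operators with the Schroedinger representation *)

Section WeilOperators.
Context {R : realType} {F : nonArchLocalFieldType} (V : sympl_space F).
Local Notation C := R[i].
Variables (lam : F -> C) (mu : {measure set (borelF F) -> \bar R}).
Hypotheses (lam_char : unitary_character lam) (lam_nontrivial : exists t, lam t != 1).
Hypotheses (mu_haar : is_haar mu) (unit2 : vunit (2 : F)).
Local Notation n := (sn V).
Local Notation O := (val_ge (@lval F)).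
Local Notation d := (conductor lam).
Implicit Types (r s x a b : 'rV[F]_n) (g : 'End(V)) (f : 'rV[F]_n -> C).

Definition Xrow (x : subvs_of (sX V)) : 'rV[F]_n := xcoord (vsval x).
Lemma XvecK : cancel (@Xvec F V) Xrow.
Proof. by move=> r; rewrite /Xrow val_Xvec -[xvec r]addr0 -(yvec0 V) xcoordK. Qed.
Lemma XrowK : cancel Xrow (@Xvec F V).
Proof. by move=> x; have [r ->] := Xvec_surj x; rewrite XvecK. Qed.

Definition weilc g f r : C := weil lam mu g (f \o Xrow) (Xvec r).

Definition weil_kernel g f i (M : 'M[F]_(i, n)) r (t : 'rV[F]_i) : C :=
  lam (wphase g r (t *m M)) * f (r *m ga g + t *m M *m gc g).

Lemma weilc_formula g : Sp V g -> exists i (M : 'M[F]_(i, n)) (c : R),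
  [/\ 0 < c, exists k : int, c ^+ 2 = (@resorder F)%:R ^ k, row_free (M *m gc g),
    forall s, exists t : 'rV[F]_i, t *m M *m gc g = s *m gc g &
    (gc g = 0 -> c = (Num.sqrt (labs R (\det (gd g))))^-1) /\
    forall f r, weilc g f r = c%:C * rint mu (weil_kernel g f M r)].
Proof.
move=> sg; have [i [M [c [h1 h2 h3 h4 [h5 h6]]]]] := weil_formula lam mu sg.
exists i, M, c; split=> //; split=> // f r; rewrite /weilc h6; congr (_ * rint _ _).
by apply/funext => t; rewrite /wint /= XvecK.
Qed.

Lemma phase_sub g r s (e : 'rV[F]_n) : Sp V g -> wphase g r s - wphase g r (s - e) =
  dot (e *m gc g) (r *m gb g) + dot (s *m gc g) (e *m gd g) - dot (e *m gc g) (e *m gd g) / 2.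
Proof.
move=> /Sp_blocks[_ _ h3]; have u2 := vunit_neq0 unit2.
have sym x y : dot (x *m gc g) (y *m gd g) = dot (y *m gc g) (x *m gd g).
  by rewrite dotC /dot !trmx_mul -!mulmxA (mulmxA (gd g)) -h3 !mulmxA.
rewrite /wphase !mulmxBl !(dotBl, dotBr) (sym e s).
by field.
Qed.

(** The support of f bounds t M c, and a right inverse of M c then bounds t. On this support [lam]
    is trivial on the three terms of [phase_sub] for small increments. *)
Lemma weil_kernel_sch g f i (M : 'M[F]_(i, n)) r : Sp V g -> row_free (M *m gc g) -> sch f ->
  sch (weil_kernel g f M r).
Proof.
move=> sg /row_freeP[Np NNp] [m [f1 f2]].
have [e he] := latt_mulmx (M *m gc g); have [e' he'] := latt_mulmx (M *m gd g).
have [e'' he''] := latt_mulmx Np.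
have [br hbr] := latt_ex (r *m gb g); have [ar har] := latt_ex (r *m ga g).
pose b := Num.min (- m) ar.
have supp t : f (r *m ga g + t *m M *m gc g) != 0 -> latt n b (t *m M *m gc g).
  move=> /f2 h; rewrite -(addKr (r *m ga g) (t *m M *m gc g)).
  apply: (subgroupD (latt_subgroup n b)); last by apply: latt_le h; rewrite ge_min lexx.
  by apply: (subgroupN (latt_subgroup n b)); apply: latt_le har; rewrite ge_min lexx orbT.
(* Depth of invariance: m - e for f, then one bound for each term of [phase_sub]; b + e'' bounds the
   support. *)
apply: (@level_weaken _ _ _ (Num.max 0 (Num.max (m - e) (Num.max (d - e - br) (Num.max (d - b - e') (d - e - e'))))) (b + e'')); last first.
  move=> t; rewrite /weil_kernel mulf_eq0 negb_or => /andP[_ /supp] h.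
  by have := he'' _ _ h; rewrite -!mulmxA (mulmxA M) NNp mulmx1.
set k := Num.max _ _ => t t' tt'; rewrite /weil_kernel.
have [k0 km k1 k2 k3] : [/\ 0 <= k, m - e <= k, d - e - br <= k, d - b - e' <= k & d - e - e' <= k].
  by rewrite /k; split; lia.
pose dl := t - t'; have hN : latt n (k + e) (dl *m M *m gc g) by rewrite -mulmxA; apply: he.
have hN' : latt n (k + e') (dl *m M *m gd g) by rewrite -mulmxA; apply: he'.
have -> : f (r *m ga g + t' *m M *m gc g) = f (r *m ga g + t *m M *m gc g).
  apply: f1; rewrite opprD addrACA subrr add0r -!mulmxBl -opprB !mulNmx.
  by apply: (subgroupN (latt_subgroup n m)); apply: latt_le hN; lia.
have [->|/supp ht] := eqVneq (f (r *m ga g + t *m M *m gc g)) 0; first by rewrite !mulr0.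
congr (_ * _); apply/eqP; rewrite -[lam (wphase _ _ (t' *m M))]mul1r.
have -> : t' *m M = t *m M - dl *m M by rewrite -mulmxBl opprB addrC subrK.
have := phase_sub r (t *m M) (dl *m M) sg => /eqP; rewrite subr_eq => /eqP ->.
rewrite (lamD lam_char) (lam_conductor lam_char lam_nontrivial) //.
apply: val_geD; [apply: val_geD|apply: val_geN].
- by apply: (@val_ge_le _ _ (k + e + br)); [lia|exact: val_ge_dot].
- by apply: (@val_ge_le _ _ (b + (k + e'))); [lia|exact: val_ge_dot].
- rewrite mulrC; apply/(val_ge_vunitM _ _ (vunitV unit2)).
  by apply: (@val_ge_le _ _ (k + e + (k + e'))); [lia|exact: val_ge_dot].
Qed.

Lemma weilc_lin g (z : C) f f' : Sp V g -> sch f -> sch f' ->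
  weilc g (fun x => z * f x + f' x) = (fun x => z * weilc g f x + weilc g f' x).
Proof.
move=> sg sf sf'; have [i [M [c [h1 h2 h3 h4 [h5 h6]]]]] := weilc_formula sg.
apply/funext => r; rewrite !h6.
have -> : weil_kernel g (fun x => z * f x + f' x) M r =
    (fun t => z * weil_kernel g f M r t + weil_kernel g f' M r t).
  by apply/funext => t; rewrite /weil_kernel; ring.
by rewrite rint_lin //; [ring|exact: weil_kernel_sch|exact: weil_kernel_sch].
Qed.

(** The operator of the Heisenberg element (a + b, 0), with a in X and b in Y. *)
Definition schroedinger a b f x : C := lam (dot a b / 2 + dot x b) * f (x + a).

Lemma schroedinger_small f : sch f -> exists k, forall a b,
  latt n k a -> latt n k b -> schroedinger a b f = f.
Proof.
move=> [m [f1 f2]]; exists (Num.max m (Num.max (d + m) (Num.max 0 d))) => a b ha hb.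
apply/funext => x; rewrite /schroedinger.
have -> : f (x + a) = f x.
  by apply: f1; rewrite addrAC subrr add0r; apply: latt_le ha; rewrite le_max lexx.
have [->|/f2 hx] := eqVneq (f x) 0; first by rewrite mulr0.
rewrite (lam_conductor lam_char lam_nontrivial) ?mul1r //; apply: val_geD.
  rewrite mulrC; apply/(val_ge_vunitM _ _ (vunitV unit2)).
  apply: (val_ge_le _ (val_ge_dot ha hb)); lia.
by apply: (val_ge_le _ (val_ge_dot hx hb)); lia.
Qed.

Lemma sch_schroedinger a b f : sch f -> sch (schroedinger a b f).
Proof.
move=> [m [f1 f2]]; have [ma ha] := latt_ex a; have [mb hb] := latt_ex b.
apply: (@level_weaken _ _ _ (Num.max m (d - mb)) (Num.min (- m) ma)) => [x y xy|x].
  rewrite /schroedinger (f1 (x + a) (y + a)); last first.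
    by rewrite opprD addrACA subrr addr0; apply: latt_le xy; rewrite le_max lexx.
  congr (_ * _); rewrite -(subrK y x) dotDl addrCA (lamD lam_char).
  rewrite (lam_conductor lam_char lam_nontrivial) ?mul1r //.
  by apply: (val_ge_le _ (val_ge_dot xy hb)); lia.
rewrite /schroedinger mulf_eq0 negb_or => /andP[_ /f2 h]; rewrite -(addrK a x).
apply: (subgroupB (latt_subgroup n _)); first by apply: latt_le h; rewrite ge_min lexx.
by apply: latt_le ha; rewrite ge_min lexx orbT.
Qed.

Lemma weilc_intertwine g a b f : Sp V g -> sch f ->
  schroedinger a b (weilc g f) =
  weilc g (schroedinger (a *m ga g + b *m gc g) (a *m gb g + b *m gd g) f).
Proof.
move=> sg sf; have [i [M [c [h1 h2 h3 h4 [h5 h6]]]]] := weilc_formula sg.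
have [r1 r2 r3] := Sp_blocks sg; have u2 := vunit_neq0 unit2.
apply/funext => r; rewrite {1}/schroedinger !h6; have [t0 ht0] := h4 b.
set a' := a *m ga g + _; set b' := a *m gb g + _.
(* Translating the variable by t0, which has the same image under c as b, absorbs the part of the
   Heisenberg element coming from Y. *)
rewrite -(rint_shift mu_haar (- t0) (weil_kernel_sch r sg h3 (sch_schroedinger a' b' sf))).
rewrite mulrCA; congr (_ * _).
have : sch (weil_kernel g f M (r + a)) by apply: weil_kernel_sch.
move=> /(rint_lin mu_haar (lam (dot a b / 2 + dot r b)))/(_ (weil_kernel_sch (r + a) sg h3 sf)) _.
have sk := weil_kernel_sch (r + a) sg h3 sf.
have s0 : sch (fun _ : 'rV[F]_i => 0 : C) by exists 0; split=> // x; rewrite eqxx.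
transitivity (rint mu (fun t => lam (dot a b / 2 + dot r b) * weil_kernel g f M (r + a) t + 0)).
  rewrite rint_lin //.
  have -> : rint mu (fun _ : 'rV[F]_i => 0 : C) = 0.
    have [m [m0 l0 _]] := sch2 s0 s0; have [q [_ _ ->//]] := rint_levelE mu_haar l0 m0.
    by rewrite big1 ?mulr0.
  by rewrite addr0.
congr rint; apply/funext => t; rewrite addr0 /weil_kernel /schroedinger mulrA -(lamD lam_char).
have eN : (- t0 + t) *m M *m gc g = t *m M *m gc g - b *m gc g.
  by rewrite addrC !mulmxBl ht0.
have -> : r *m ga g + (- t0 + t) *m M *m gc g + a' = (r + a) *m ga g + t *m M *m gc g.
  by rewrite eN /a' mulmxDl -addrA addrACA addNr addr0 [t *m _ *m _ + _]addrC addrA.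
rewrite mulrA -(lamD lam_char); congr (lam _ * _).
(* t0 M and b agree modulo ker c, which the phase does not see, so b can replace t0 M. *)
rewrite eN (@wphase_kerc _ _ g r _ (t *m M - b) sg); last first.
  by rewrite !mulmxBl eN opprB addrA subrK subrr.
set s := t *m M.
have symAB x y : dot (x *m ga g) (y *m gb g) = dot (y *m ga g) (x *m gb g).
  by rewrite dotC /dot !trmx_mul -!mulmxA (mulmxA (gb g)) -r1 !mulmxA.
have symCD x y : dot (x *m gc g) (y *m gd g) = dot (y *m gc g) (x *m gd g).
  by rewrite dotC /dot !trmx_mul -!mulmxA (mulmxA (gd g)) -r3 !mulmxA.
have symAD x y : dot (x *m ga g) (y *m gd g) = dot x y + dot (y *m gc g) (x *m gb g).
  rewrite [dot (y *m _) _]dotC /dot !trmx_mul !mulmxA -(mulmxA x) -(mulmxA x (gb g)).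
  have -> : ga g *m (gd g)^T = 1%:M + gb g *m (gc g)^T by rewrite -r2 subrK.
  by rewrite mulmxDr mulmx1 mulmxDl mxE.
rewrite /wphase /a' /b' !(mulmxDl, mulmxBl, mulNmx) !(dotDl, dotDr, dotBl, dotBr, dotNl, dotNr).
rewrite (symCD b s) (symAD r b) (symAD a b) (symAB r a).
by field.
Qed.

(** By intertwining, W(g) f is fixed by all small Heisenberg elements. Invariance under small
    translations is uniform local constancy; invariance under small modulations bounds the support,
    by duality of lattices. *)
Lemma weilc_sch g f : Sp V g -> sch f -> sch (weilc g f).
Proof.
move=> sg sf; have [k hk] := schroedinger_small sf.
have [eA hA] := latt_mulmx (ga g); have [eB hB] := latt_mulmx (gb g).
have [eC hC] := latt_mulmx (gc g); have [eD hD] := latt_mulmx (gd g).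
pose k' := Num.max (k - eA) (Num.max (k - eB) (Num.max (k - eC) (k - eD))).
have inv a b : latt n k' a -> latt n k' b -> schroedinger a b (weilc g f) = weilc g f.
  move=> ha hb; rewrite weilc_intertwine //; congr weilc; apply: hk.
    apply: (subgroupD (latt_subgroup n k)).
      by apply: latt_le (hA _ _ ha); rewrite /k'; lia.
    by apply: latt_le (hC _ _ hb); rewrite /k'; lia.
  apply: (subgroupD (latt_subgroup n k)).
    by apply: latt_le (hB _ _ ha); rewrite /k'; lia.
  by apply: latt_le (hD _ _ hb); rewrite /k'; lia.
have l0 : latt n k' (0 : 'rV[F]_n) by apply: subgroup0 (latt_subgroup n k').
apply: (@level_weaken _ _ _ k' (d - k')) => [x y xy|x wx].
  have := congr1 (fun h => h y) (inv _ _ xy l0).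
  rewrite /schroedinger !dot0r mul0r addr0 (lam0 lam_char) mul1r => <-.
  by rewrite addrC subrK.
apply: (chi_dual lam_char lam_nontrivial) => b hb; rewrite opprB addrC subrK in hb.
have := congr1 (fun h => h x) (inv _ _ l0 hb).
rewrite /schroedinger dot0l mul0r add0r addr0 => /eqP.
by rewrite -subr_eq0 -{2}[weilc g f x]mul1r -mulrBl mulf_eq0 (negbTE wx) orbF subr_eq0 => /eqP.
Qed.

Definition ball m : 'rV[F]_n -> C := fun x => (`[< latt n m x >])%:R.

Lemma ball_inv m x y : latt n m (x - y) -> ball m x = ball m y.
Proof.
move=> xy; congr (nat_of_bool _)%:R; apply: asbool_equiv_eq; split=> h.
  by rewrite -[y](subKr x); apply: (subgroupB (latt_subgroup n m)).
by rewrite -(subrK y x); apply: (subgroupD (latt_subgroup n m)).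
Qed.

Lemma ball_supp m x : ball m x != 0 -> latt n m x.
Proof. by rewrite /ball; case: asboolP => // _ /eqP. Qed.

Lemma ball_sch m : sch (ball m).
Proof. by apply: level_weaken (@ball_supp m); exact: ball_inv. Qed.

(** For a small ball the phase is trivial on the support, so at 0 the integrand is the indicator of
    a set containing 0, and nothing can cancel. *)
Lemma weilc_ball_neq0 g : Sp V g -> exists m0, forall m, m0 <= m -> weilc g (ball m) 0 != 0.
Proof.
move=> sg; have [i [M [c [c0 h2 h3 h4 [h5 h6]]]]] := weilc_formula sg.
have [Np NNp] := row_freeP h3.
have [e' he'] := latt_mulmx (M *m gd g); have [e'' he''] := latt_mulmx Np.
exists (Num.max 0 (d - e' - e'')) => m hm; rewrite h6 mulf_eq0 negb_or; apply/andP; split.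
  by rewrite eq_complex /= eqxx andbT gt_eqF.
have kE t : weil_kernel g (ball m) M 0 t = (`[< latt n m (t *m M *m gc g) >])%:R.
  rewrite /weil_kernel mul0mx add0r /ball; case: asboolP => h; last by rewrite mulr0.
  rewrite mulr1 (lam_conductor lam_char lam_nontrivial) // /wphase !mul0mx dot0l dot0r mulr0 !add0r.
  rewrite mulrC; apply/(val_ge_vunitM _ _ (vunitV unit2)).
  have ht : latt i (m + e'') t by have := he'' _ _ h; rewrite -!mulmxA (mulmxA M) NNp mulmx1.
  have := val_ge_dot h (he' _ _ ht); rewrite mulmxA; apply: val_ge_le; lia.
have sk : sch (weil_kernel g (ball m) M 0) by apply: weil_kernel_sch => //; exact: ball_sch.
have [l [l0 lk _]] := sch2 sk sk; have [q [tq _ ->//]] := rint_levelE mu_haar lk l0.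
rewrite mulf_eq0 negb_or; apply/andP; split.
  by rewrite eq_complex /= eqxx andbT expf_neq0 // gt_eqF // vol_gt0.
under eq_bigr do rewrite kE.
rewrite -natr_sum pnatr_eq0 -lt0n.
case: tq => _ _ eq _; have [x0 x0q hx0] := eq 0 (subgroup0 (latt_subgroup i (- l))).
have e0 : weil_kernel g (ball m) M 0 x0 = 1.
  have [lk1 _] := lk; rewrite -(lk1 _ _ hx0) kE !mul0mx asboolT //.
  exact: (subgroup0 (latt_subgroup n m)).
rewrite (big_rem x0) //=; move: e0; rewrite kE; case: asboolP => //= _ /eqP.
by rewrite eq_sym oner_eq0.
Qed.

End WeilOperators.

(** * Schur's lemma *)

Section WeilTwist.
Context {R : realType} {F : nonArchLocalFieldType} (V : sympl_space F).
Local Notation C := R[i].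
Variables (lam : F -> C) (mu : {measure set (borelF F) -> \bar R}).
Hypotheses (lam_char : unitary_character lam) (lam_nontrivial : exists t, lam t != 1).
Hypotheses (mu_haar : is_haar mu) (unit2 : vunit (2 : F)).
Local Notation n := (sn V).
Local Notation weilc := (weilc (V := V) lam mu).
Implicit Types (r s : 'rV[F]_n) (g h : 'End(V)) (f : 'rV[F]_n -> C).

Lemma sch_scale k u (f : 'rV[F]_k -> C) : vunit u -> sch f -> sch (fun x => f (u *: x)).
Proof.
move=> uu [m [l1 l2]]; exists m; split=> [x y xy|x /l2 /latt_vunit -/(_ uu)//].
by apply: l1; rewrite -scalerBr; apply/latt_vunit.
Qed.

Lemma level_map k m (sig : C -> C) (f : 'rV[F]_k -> C) : sig 0 = 0 -> level m f ->
  level m (fun x => sig (f x)).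
Proof.
move=> s0 [l1 l2]; split=> [x y /l1->//|x h]; apply: l2.
by apply: contra h => /eqP ->; rewrite s0.
Qed.

Lemma sch_map k (sig : C -> C) (f : 'rV[F]_k -> C) : sig 0 = 0 -> sch f -> sch (fun x => sig (f x)).
Proof. by move=> s0 [m l]; exists m; apply: level_map. Qed.

Lemma weilc_valued (E : set C) g f : Sp V g -> sch f ->
  E 0 -> (forall x y, E x -> E y -> E (x + y)) -> (forall x y, E x -> E y -> E (x * y)) ->
  (forall s : F, E (lam s)) ->
  (forall x : R, (exists k : int, x ^+ 2 = (@resorder F)%:R ^ k) -> E x%:C) ->
  (forall m : int, exists k : int, vol mu m ^+ 2 = (@resorder F)%:R ^ k) ->
  (forall x, E (f x)) -> forall r, E (weilc g f r).
Proof.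
move=> sg sf E0 ED EM El ER volE Ef r.
have [i [M [c [c0 ck h3 h4 [h5 h6]]]]] := weilc_formula lam mu sg.
rewrite h6; apply: (EM); first exact: ER.
have sk := weil_kernel_sch lam_char lam_nontrivial unit2 r sg h3 sf.
have [m [m0 lm _]] := sch2 sk sk; have [q [_ _ ->//]] := rint_levelE mu_haar lm m0.
apply: (EM); last by elim/big_ind: _ => // t _; apply: EM.
have [k hk] := volE m; apply: ER; exists (k * i%:Z).
by rewrite exprAC hk -exprz_exp.
Qed.

(* A Galois element acting on [lam] through a square [t ^ 2] acts on Weil
   operators as conjugation by the dilation by [t]. *)
Lemma weilc_twist (E : set C) (sig : C -> C) g t f : Sp V g -> vunit t -> sch f ->
  E 0 -> (forall x y, E x -> E y -> E (x + y)) -> (forall x y, E x -> E y -> E (x * y)) ->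
  (forall s : F, E (lam s)) ->
  (forall x : R, (exists k : int, x ^+ 2 = (@resorder F)%:R ^ k) -> E x%:C /\ sig x%:C = x%:C) ->
  (forall m : int, exists k : int, vol mu m ^+ 2 = (@resorder F)%:R ^ k) ->
  (forall x y, E x -> E y -> sig (x + y) = sig x + sig y) ->
  (forall x y, E x -> E y -> sig (x * y) = sig x * sig y) ->
  (forall s : F, sig (lam s) = lam (t ^+ 2 * s)) ->
  (forall x, E (f x)) ->
  (fun r => sig (weilc g f (t^-1 *: r))) = weilc g (fun x => sig (f (t^-1 *: x))).
Proof.
move=> sg ut sf E0 ED EM El ER volE sD sM sl Ef.
have t0 := vunit_neq0 ut.
have s0 : sig 0 = 0.
  by have := sD 0 0 E0 E0; rewrite addr0 => /eqP; rewrite -subr_eq0 opprD addrA subrr sub0r oppr_eq0 => /eqP.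
have [i [M [c [c0 ck h3 h4 [h5 h6]]]]] := weilc_formula lam mu sg.
apply/funext => r; rewrite !h6.
have sk := weil_kernel_sch lam_char lam_nontrivial unit2 (t^-1 *: r) sg h3 sf.
have [m [m0 lm _]] := sch2 sk sk; have [q [_ _ hq]] := rint_levelE mu_haar lm m0.
have Ek x : E (weil_kernel lam g f M (t^-1 *: r) x) by apply: EM.
have [Ec sc] := ER _ ck.
have [Ev sv] : E (vol mu m ^+ i)%:C /\ sig (vol mu m ^+ i)%:C = (vol mu m ^+ i)%:C.
  by have [k hk] := volE m; apply: ER; exists (k * i%:Z); rewrite exprAC hk -exprz_exp.
have Esum (l : seq 'rV[F]_i) : E (\sum_(x <- l) weil_kernel lam g f M (t^-1 *: r) x).
  by elim/big_ind: _.
have ssum (l : seq 'rV[F]_i) : sig (\sum_(x <- l) weil_kernel lam g f M (t^-1 *: r) x) =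
    \sum_(x <- l) sig (weil_kernel lam g f M (t^-1 *: r) x).
  by elim: l => [|x l IH]; rewrite ?big_nil // !big_cons sD // IH.
rewrite hq // !sM ?sc ?sv ?ssum //; last exact: EM.
rewrite -(hq (fun x => sig (weil_kernel lam g f M (t^-1 *: r) x))); last exact: level_map.
congr (_ * _).
have sf' : sch (fun x => sig (f (t^-1 *: x))).
  by apply: (@sch_scale _ _ (sig \o f)); [exact: vunitV|exact: sch_map].
(* Substituting t x for x: the phase is homogeneous of degree 2 in r and x jointly, which produces
   the factor t^2. *)
rewrite -(rint_vunit mu_haar ut (weil_kernel_sch lam_char lam_nontrivial unit2 r sg h3 sf')).
congr rint; apply/funext => x; rewrite /weil_kernel sM // sl; congr (lam _ * sig (f _)).
  rewrite /wphase !(=^~ scalemxAl, dotZl, dotZr).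
  by field; rewrite t0 (vunit_neq0 unit2).
by rewrite -!scalemxAl scalerDr scalerA mulVf // scale1r.
Qed.

Lemma mx_of_dilation (t : F) : mx_of (dilation V t) = block_mx (t^-1)%:M 0 0 t%:M.
Proof.
rewrite -[RHS](@mx_ofK F V); congr mx_of; apply: end_eq => w; rewrite of_mxE.
rewrite /dilation add_lfunE !scale_lfunE daddv_piXY daddv_piYX /vcoord.
rewrite -xvecZ -yvecZ xcoordK ycoordK mul_row_block !mulmx0 addr0 add0r.
by rewrite !mul_mx_scalar.
Qed.

Lemma dilation_Sp (t : F) : t != 0 -> Sp V (dilation V t).
Proof.
move=> t0; apply/Sp_mx; rewrite mx_of_dilation; apply/spmx_block.
rewrite !trmx0 !mulmx0 !mul0mx subr0; split=> //.
by rewrite tr_scalar_mx -scalar_mxM mulVf.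
Qed.

(** The block c vanishes, so Y_g is a point, and the determinant of a unit dilation has absolute
    value 1: no scalar is left. *)
Lemma weilc_dilation (t : F) f : vunit t -> weilc (dilation V t) f = (fun r => f (t^-1 *: r)).
Proof.
move=> ut; have t0 := vunit_neq0 ut; have sg := dilation_Sp t0.
have [i [M [c [c0 ck h3 h4 [h5 h6]]]]] := weilc_formula lam mu sg.
have [a0 b0 c00 d0] : [/\ ga (dilation V t) = (t^-1)%:M, gb (dilation V t) = 0,
    gc (dilation V t) = 0 & gd (dilation V t) = t%:M].
  by rewrite /ga /gb /gc /gd mx_of_dilation block_mxKul block_mxKur block_mxKdl block_mxKdr.
have i0 : i = 0%N by move: h3; rewrite c00 mulmx0 /row_free mxrank0 eq_sym => /eqP.
have c1 : c = 1.
  rewrite h5 // d0 det_scalar; have [tn0 tnv] := vunitX n ut.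
  by rewrite /labs (negbTE tn0) tnv oppr0 expr0z sqrtr1 invr1.
move: M h3 h4 h6; rewrite i0 => M h3 h4 h6; apply/funext => r.
rewrite h6 c1 mul1r (rint0 mu_haar) /weil_kernel /wphase !mul0mx a0 b0 mulmx0 !(dot0r, dot0l) mulr0 !add0r mul0r.
by rewrite (lam0 lam_char) mul1r addr0 mul_mx_scalar.
Qed.

End WeilTwist.

(** * Irreducibility of the Schroedinger representation and projectivity of W *)

Section Schur.
Context {R : realType} {F : nonArchLocalFieldType} (V : sympl_space F).
Local Notation C := R[i].
Variables (lam : F -> C) (mu : {measure set (borelF F) -> \bar R}).
Hypotheses (lam_char : unitary_character lam) (lam_nontrivial : exists t, lam t != 1).
Hypotheses (mu_haar : is_haar mu) (unit2 : vunit (2 : F)).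
Local Notation n := (sn V).
Local Notation weilc := (weilc (V := V) lam mu).
Local Notation d := (conductor lam).
Local Notation schroedinger := (@schroedinger R F V lam).
Local Notation ball := (@ball R F V).
Implicit Types (r s x a b : 'rV[F]_n) (g h : 'End(V)) (f : 'rV[F]_n -> C).

Lemma schroedinger0b b f : schroedinger 0 b f = (fun x => chi lam b x * f x).
Proof. by apply/funext => x; rewrite /schroedinger dot0l mul0r add0r addr0. Qed.
Lemma schroedinger_a0 a f : schroedinger a 0 f = (fun x => f (x + a)).
Proof. by apply/funext => x; rewrite /schroedinger !dot0r mul0r add0r (lam0 lam_char) mul1r. Qed.

(** Fourier inversion on a finite quotient: on the support of f the indicator of a smaller ball is
    an average of characters. Hence cutting f down to a ball is a combination of modulations. *)
Lemma fourier_cut f (a m : int) x0 : a <= m -> (forall x, f x != 0 -> latt n a x) -> latt n a x0 ->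
  exists B : seq 'rV[F]_n, (0 < size B)%N /\ forall x,
    \sum_(b <- B) chi lam b (x - x0) * f x = (size B)%:R * (ball m (x - x0) * f x).
Proof.
move=> am fa x0a; have [|B tB sB] := @latt_reps F n (d - m) (d - a); first by rewrite lerB.
exists B; split=> // x; rewrite -mulr_suml.
have [->|/fa xa] := eqVneq (f x) 0; first by rewrite !mulr0.
rewrite (chi_sum lam_char lam_nontrivial am tB); last exact: (subgroupB (latt_subgroup n a)).
by rewrite /ball; case: asboolP => _; rewrite ?mul1r // !mul0r mulr0.
Qed.

Section Invariant.
Variable N : set ('rV[F]_n -> C).
Hypotheses (N0 : N (fun=> 0)) (N_lin : forall (z : C) f f', N f -> N f' -> N (fun x => z * f x + f' x)).
Hypotheses (N_S : forall a b f, N f -> N (schroedinger a b f)).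

Lemma invariant_sum I (l : seq I) (c : I -> C) (f : I -> 'rV[F]_n -> C) :
  (forall i, N (f i)) -> N (fun x => \sum_(i <- l) c i * f i x).
Proof.
move=> Nf; elim: l => [|i l IH].
  by rewrite (_ : (fun x => _) = fun=> 0) //; apply/funext => x; rewrite big_nil.
rewrite (_ : (fun x => _) = fun x => c i * f i x + \sum_(i <- l) c i * f i x); first exact: N_lin.
by apply/funext => x; rewrite big_cons.
Qed.

Lemma invariant_cut f (a m : int) x0 : a <= m -> (forall x, f x != 0 -> latt n a x) -> latt n a x0 ->
  N f -> N (fun x => ball m (x - x0) * f x).
Proof.
move=> am fa x0a Nf; have [B [sB hB]] := fourier_cut am fa x0a.
have := @invariant_sum _ B (fun b => (size B)%:R^-1 * chi lam b (- x0)) (fun b x => chi lam b x * f x).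
have nB : (size B)%:R != 0 :> C by rewrite pnatr_eq0 -lt0n.
rewrite (_ : (fun x => \sum_(i <- B) _) = (fun x => ball m (x - x0) * f x)); last first.
  apply/funext => x; apply: (mulfI nB); rewrite -hB mulr_sumr; apply: eq_bigr => b _.
  by rewrite /chi dotDl (lamD lam_char) !mulrA divff // mul1r [lam (dot x b) * _]mulrC.
by apply=> b; rewrite -schroedinger0b; apply: N_S.
Qed.

(** Irreducibility in the form needed: cut a nonzero element down to a ball on which it is constant,
    translate that ball to the origin, and cut again. *)
Lemma invariant_ball f : sch f -> N f -> (exists x0, f x0 != 0) ->
  exists m0, forall m, m0 <= m -> N (ball m).
Proof.
move=> sf Nf [x0 fx0]; have [m [m0 [f1 f2] _]] := sch2 sf sf.
have mm : - m <= m by lia.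
have := invariant_cut mm f2 (f2 _ fx0) Nf.
have -> : (fun x => ball m (x - x0) * f x) = (fun x => f x0 * ball m (x - x0) + 0).
  apply/funext => x; rewrite addr0 mulrC; have [->|/ball_supp h] := eqVneq (ball m (x - x0)) 0.
    by rewrite !mulr0.
  by rewrite (f1 _ _ h).
move=> /(N_S x0 0); rewrite schroedinger_a0 => h.
have Nb : N (ball m).
  have := N_lin (f x0)^-1 h N0; congr N; apply/funext => x.
  by rewrite !addr0 addrK mulrA mulVf // mul1r.
exists m => m' mm'.
have := invariant_cut mm' (@ball_supp _ _ _ m) (subgroup0 (latt_subgroup n m)) Nb.
congr N; apply/funext => x; rewrite subr0 /ball.
case: asboolP => h'; last by rewrite mul0r.
by rewrite mul1r asboolT //; apply: latt_le h'.
Qed.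

End Invariant.

(** Invariance under the translations by a lattice and the modulations by its dual determines the
    ball function up to a scalar, so T scales it. Cutting shows that the scalar is the same for all
    radii, and every Schwartz function is a combination of translated balls. *)
Lemma commutant_scalar (T : ('rV[F]_n -> C) -> 'rV[F]_n -> C) :
  (forall f, sch f -> sch (T f)) ->
  (forall z f f', sch f -> sch f' -> T (fun x => z * f x + f' x) = (fun x => z * T f x + T f' x)) ->
  (forall a b f, sch f -> schroedinger a b (T f) = T (schroedinger a b f)) ->
  exists c, forall f, sch f -> T f = (fun x => c * f x).
Proof.
move=> Tsch Tlin TS; have s0 : sch (fun _ : 'rV[F]_n => 0 : C) by exists 0; split=> // x; rewrite eqxx.
have T0 : T (fun=> 0) = fun=> 0.
  have := Tlin (-1) _ _ s0 s0; rewrite (_ : (fun x => -1 * 0 + 0) = fun=> 0); last first.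
    by apply/funext => x; rewrite mulr0 addr0.
  by move=> ->; apply/funext => x; rewrite mulN1r addNr.
have Tsum I (l : seq I) (c : I -> C) (f : I -> 'rV[F]_n -> C) : (forall i, sch (f i)) ->
    sch (fun x => \sum_(i <- l) c i * f i x) /\
    T (fun x => \sum_(i <- l) c i * f i x) = (fun x => \sum_(i <- l) c i * T (f i) x).
  move=> sf; elim: l => [|i l [IH1 IH2]].
    by rewrite (_ : (fun x => _) = fun=> 0) ?T0; [split=> //; apply/funext => x; rewrite big_nil|apply/funext => x; rewrite big_nil].
  rewrite (_ : (fun x => _) = fun x => c i * f i x + \sum_(i <- l) c i * f i x); last first.
    by apply/funext => x; rewrite big_cons.
  split; first exact: sch_lin.
  by rewrite Tlin // IH2; apply/funext => x; rewrite big_cons.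
have Tball m : exists c, T (ball m) = (fun x => c * ball m x).
  exists (T (ball m) 0); apply/funext => x; rewrite /ball; case: asboolP => [xm|nxm].
    have := congr1 (fun h : 'rV[F]_n -> C => h 0) (TS x 0 (ball m) (@ball_sch R F V m)); rewrite !schroedinger_a0 add0r mulr1.
    move=> ->; congr (T _ _); apply/funext => y; apply: ball_inv.
    by rewrite addrC addrA addNr add0r.
  rewrite mulr0; apply/eqP; apply: contra_notT nxm => Tx.
  apply: (chi_dual lam_char lam_nontrivial) => b hb.
  have := congr1 (fun h : 'rV[F]_n -> C => h x) (TS 0 b (ball m) (@ball_sch R F V m)); rewrite !schroedinger0b.
  rewrite (_ : (fun y => chi lam b y * ball m y) = ball m); last first.
    apply/funext => y; have [->|/ball_supp hy] := eqVneq (ball m y) 0; first by rewrite mulr0.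
    by rewrite (chi_latt lam_char lam_nontrivial hb hy) ?mul1r // subrK.
  move=> /eqP; rewrite -subr_eq0 -{2}[T _ x]mul1r -mulrBl mulf_eq0 (negbTE Tx) orbF subr_eq0.
  by move=> /eqP.
have ball0 m : ball m 0 = 1 by rewrite /ball asboolT //; apply: (subgroup0 (latt_subgroup n m)).
have Tball_le m m' c : m <= m' -> T (ball m) = (fun x => c * ball m x) ->
    T (ball m') = (fun x => c * ball m' x).
  move=> mm' Tm; have [B [sB hB]] := fourier_cut mm' (@ball_supp _ _ _ m) (subgroup0 (latt_subgroup n m)).
  have nB : (size B)%:R != 0 :> C by rewrite pnatr_eq0 -lt0n.
  have bb x : ball m' x * ball m x = ball m' x.
    rewrite /ball; case: asboolP => h'; last by rewrite mul0r.
    by rewrite mul1r asboolT //; apply: latt_le h'.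
  have e : (fun x => \sum_(b <- B) (size B)%:R^-1 * schroedinger 0 b (ball m) x) = ball m'.
    apply/funext => x; rewrite -mulr_sumr; apply: (mulfI nB); rewrite mulVKf //.
    have := hB x; rewrite subr0 bb => <-; apply: eq_bigr => b _.
    by rewrite schroedinger0b.
  have sS b : sch (schroedinger 0 b (ball m)) by apply: sch_schroedinger => //; exact: (@ball_sch R F V).
  have [_] := Tsum _ B (fun=> (size B)%:R^-1) (fun b => schroedinger 0 b (ball m)) sS.
  rewrite e => ->; apply/funext => x; rewrite -e mulr_sumr; apply: eq_bigr => b _.
  rewrite -TS; last exact: (@ball_sch R F V).
  by rewrite Tm !schroedinger0b; ring.
have [c hc] := Tball 0; exists c => f sf.
have hcm m : T (ball m) = (fun x => c * ball m x).
  have [c' hc'] := Tball m; rewrite hc'; suff -> : c' = c by [].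
  have h1 := Tball_le _ (Num.max 0 m) _ (_ : m <= _) hc'.
  have h2 := Tball_le _ (Num.max 0 m) _ (_ : 0 <= _) hc.
  have := congr1 (fun h : 'rV[F]_n -> C => h 0) (h1 (_ : m <= Num.max 0 m)).
  rewrite h2 ?le_max ?lexx ?orbT // ball0 !mulr1 => ->//.
have [m [m0 [f1 f2] _]] := sch2 sf sf; have mm : - m <= m by lia.
have [Rr [uR MR eR iR] _] := @latt_reps F n _ _ mm.
have fE : f = (fun x => \sum_(r <- Rr) f r * schroedinger (- r) 0 (ball m) x).
  apply/funext => x; have [fx|/f2 hx] := eqVneq (f x) 0.
    rewrite fx big_seq big1 // => r rR; rewrite schroedinger_a0.
    have [->|/ball_supp h] := eqVneq (ball m (x - r)) 0; first by rewrite mulr0.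
    by rewrite -(f1 _ _ h) fx mul0r.
  have [r0 r0R h0] := eR x hx; rewrite (bigD1_seq r0) //= big_seq_cond big1 ?addr0.
    by rewrite schroedinger_a0 /ball asboolT // mulr1; apply: f1.
  move=> r /andP[rR rr0]; rewrite schroedinger_a0.
  have [->|/ball_supp h] := eqVneq (ball m (x - r)) 0; first by rewrite mulr0.
  case/eqP: rr0; apply: iR => //; have -> : r - r0 = (x - r0) - (x - r).
    by rewrite opprB [RHS]addrC subrKA.
  exact: (subgroupB (latt_subgroup n m)).
have sS r : sch (schroedinger (- r) 0 (ball m)) by apply: sch_schroedinger => //; exact: (@ball_sch R F V).
rewrite [in LHS]fE; have [_ ->] := Tsum _ Rr f (fun r => schroedinger (- r) 0 (ball m)) sS.
apply/funext => x; rewrite [in RHS]fE mulr_sumr; apply: eq_bigr => r _.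
rewrite -TS; last exact: (@ball_sch R F V).
by rewrite hcm !schroedinger_a0; ring.
Qed.

Definition schw (z : 'rV[F]_(n + n)) f := schroedinger (lsubmx z) (rsubmx z) f.

Lemma schw_weilc g z f : Sp V g -> sch f -> schw z (weilc g f) = weilc g (schw (z *m mx_of g) f).
Proof.
move=> sg sf; rewrite /schw weilc_intertwine // mx_of_blocks.
have -> : z *m block_mx (ga g) (gb g) (gc g) (gd g) =
    row_mx (lsubmx z *m ga g + rsubmx z *m gc g) (lsubmx z *m gb g + rsubmx z *m gd g).
  by rewrite -{1}[z]hsubmxK mul_row_block.
by rewrite row_mxKl row_mxKr.
Qed.

Let ws g f : Sp V g -> sch f -> sch (weilc g f).
Proof. exact: weilc_sch. Qed.
Let wl g z f f' : Sp V g -> sch f -> sch f' ->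
  weilc g (fun x => z * f x + f' x) = (fun x => z * weilc g f x + weilc g f' x).
Proof. exact: weilc_lin. Qed.
Let sch0 : sch (fun _ : 'rV[F]_n => 0 : C).
Proof. by exists 0; split=> // x; rewrite eqxx. Qed.
Let weilc0 g : Sp V g -> weilc g (fun=> 0) = (fun=> 0).
Proof.
move=> sg; have := wl (-1) sg sch0 sch0.
rewrite (_ : (fun x => -1 * 0 + 0) = fun=> 0); last by apply/funext => x; rewrite mulr0 addr0.
by move=> ->; apply/funext => x; rewrite mulN1r addNr.
Qed.

(** The kernel of W(g) is stable under the Heisenberg group; were it nonzero, it would contain all
    small balls, against [weilc_ball_neq0]. *)
Lemma weilc_inj0 g f : Sp V g -> sch f -> weilc g f = (fun=> 0) -> f = (fun=> 0).
Proof.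
move=> sg sf Wf; apply: contrapT => nf.
have [x0 fx0] : exists x0, f x0 != 0.
  apply: contrapT => h; apply: nf; apply/funext => x; apply/eqP; apply: contra_notT h => fx.
  by exists x.
pose N f := sch f /\ weilc g f = (fun=> 0).
have [|z h h' [sh Wh] [sh' Wh']|a b h [sh Wh]|m0 hm0] := @invariant_ball N _ _ _ f sf (conj sf Wf) (ex_intro _ x0 fx0).
- by split=> //; apply: weilc0.
- split; first exact: sch_lin.
  by rewrite wl // Wh Wh'; apply/funext => x; rewrite mulr0 addr0.
- split; first exact: sch_schroedinger.
  have := schw_weilc (row_mx a b *m invmx (mx_of g)) sg sh.
  rewrite mulmxKV; last exact/spmx_unit/Sp_mx.
  rewrite {2}/schw row_mxKl row_mxKr => <-; rewrite Wh.
  by apply/funext => x; rewrite /schw /schroedinger mulr0.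
have [m1 hm1] := weilc_ball_neq0 lam_char lam_nontrivial mu_haar unit2 sg.
have [|_ W0] := hm0 (Num.max m0 m1); first by rewrite le_max lexx.
by have := hm1 (Num.max m0 m1); rewrite W0 ?le_max ?lexx ?orbT // eqxx => /(_ isT).
Qed.

Definition spinv g : 'End(V) := of_mx (invmx (mx_of g)).
Lemma spinv_Sp g : Sp V g -> Sp V (spinv g).
Proof. by move=> /Sp_mx sg; apply/Sp_mx; rewrite mx_ofK; apply: spmx_invmx. Qed.

(** The composite commutes with the Schroedinger operators because g h k = 1. Three factors cover
    both inverses, with k = 1, and products, with k inverse to g h. *)
Lemma weilc_scalar g h k : Sp V g -> Sp V h -> Sp V k -> mx_of g *m mx_of h *m mx_of k = 1%:M ->
  exists2 c, c != 0 & forall f, sch f -> weilc g (weilc h (weilc k f)) = (fun x => c * f x).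
Proof.
move=> sg sh sk ghk.
have [c hc] : exists c, forall f, sch f -> weilc g (weilc h (weilc k f)) = (fun x => c * f x).
  apply: commutant_scalar => [f sf|z f f' sf sf'|a b f sf].
  - by do 3!apply: ws => //.
  - by rewrite wl // wl ?wl //; do ?apply: ws.
  - have := schw_weilc (row_mx a b) sg (ws sh (ws sk sf)).
    rewrite {1}/schw row_mxKl row_mxKr => ->.
    rewrite schw_weilc ?schw_weilc //; [|exact: ws].
    by rewrite -(mulmxA _ (mx_of g)) -(mulmxA _ (_ *m _)) ghk mulmx1 /schw row_mxKl row_mxKr.
exists c => //; apply/eqP => c0.
have sb := @ball_sch R F V 0; have := hc _ sb; rewrite c0.
have -> : (fun x => 0 * ball 0 x) = (fun=> 0) by apply/funext => x; rewrite mul0r.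
move=> /(weilc_inj0 sg (ws sh (ws sk sb))) /(weilc_inj0 sh (ws sk sb)).
move=> /(weilc_inj0 sk sb) /(congr1 (fun h : 'rV[F]_n -> C => h 0)); rewrite /ball asboolT.
  by move=> /eqP; rewrite oner_eq0.
exact: (subgroup0 (latt_subgroup n 0)).
Qed.

Lemma weilc1_scalar : exists2 c, c != 0 & forall f, sch f -> weilc \1%VF f = (fun x => c * f x).
Proof.
exists 1; first exact: oner_neq0.
move=> f _; have -> : (\1%VF : 'End(V)) = dilation V 1.
  apply: end_eq => w; rewrite [RHS]mx_ofE mx_of_dilation invr1 -scalar_mx_block mulmx1.
  by rewrite id_lfunE.
by rewrite weilc_dilation //; [apply/funext => x; rewrite invr1 scale1r mul1r|exact: vunit1].
Qed.

Lemma weilc_spinv g : Sp V g -> exists2 c, c != 0 &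
  forall f, sch f -> weilc g (weilc (spinv g) f) = (fun x => c * f x).
Proof.
move=> sg; have s1 : Sp V \1%VF by move=> u v; rewrite !id_lfunE.
have m1 : mx_of (\1%VF : 'End(V)) = 1%:M.
  by rewrite -[RHS](@mx_ofK F V); congr mx_of; apply: end_eq => w; rewrite of_mxE mulmx1 id_lfunE.
have [|c c0 hc] := weilc_scalar sg (spinv_Sp sg) s1.
  by rewrite m1 mulmx1 mx_ofK mulmxV //; apply/spmx_unit/Sp_mx.
have [c' c'0 hc'] := weilc1_scalar; exists (c / c'); first by rewrite mulf_neq0 ?invr_neq0.
move=> f sf; have sf' : sch (fun x => c'^-1 * f x + 0).
  by apply: sch_lin => //; exists 0; split=> // x; rewrite eqxx.
have := hc _ sf'; rewrite hc' //.
have -> : (fun x => c' * (c'^-1 * f x + 0)) = f by apply/funext => x; rewrite addr0 mulVKf.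
by move=> ->; apply/funext => x; rewrite addr0 mulrA.
Qed.

Lemma weilc_proj g h : Sp V g -> Sp V h -> exists2 c, c != 0 &
  forall f, sch f -> weilc g (weilc h f) = (fun x => c * weilc (spmul g h) f x).
Proof.
move=> sg sh; have sk : Sp V (spmul g h) by apply/Sp_mx; rewrite mx_of_spmul; apply: spmx_mul; apply/Sp_mx.
set k := spmul g h in sk *; have sk' := spinv_Sp sk.
have uk : mx_of k \in unitmx by apply/spmx_unit/Sp_mx.
have [|c1 c10 h1] := weilc_scalar sg sh sk'.
  by rewrite -mx_of_spmul mx_ofK mulmxV.
have [c3 c30 h3] := weilc_spinv sk'.
have kk : spinv (spinv k) = k by rewrite /spinv mx_ofK invmxK of_mxK.
rewrite kk in h3; exists (c1 / c3); first by rewrite mulf_neq0 ?invr_neq0.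
move=> f sf; have sf' : sch (fun x => c3^-1 * f x + 0) by apply: sch_lin.
have sz : sch (fun x => c3^-1 * weilc k f x + weilc k (fun=> 0) x).
  by apply: sch_lin; apply: ws.
(* Up to the scalar c3, f is W(k^-1) W(k) f; inserting this makes the three-fold composite
   appear. *)
have e : f = weilc (spinv k) (weilc k (fun x => c3^-1 * f x + 0)).
  by rewrite h3 //; apply/funext => x; rewrite addr0 mulVKf.
rewrite [in LHS]e h1; last by rewrite wl.
by rewrite wl // weilc0 //; apply/funext => x; rewrite addr0 mulrA.
Qed.

End Schur.

(** * Subfields of C and their embeddings *)

Section Subfields.
Context {R : realType}.
Local Notation C := R[i].
Implicit Types (K L A : set C) (x y z : C).

Lemma subfieldP K : K 1 -> (forall x y, K x -> K y -> K (x - y)) ->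
  (forall x y, K x -> K y -> K (x / y)) -> subfieldC K.
Proof.
by move=> K1 KB Kd; split=> [|x y|x y]; rewrite -!topredE /= !in_setE; [|apply: KB|apply: Kd].
Qed.

Section Closure.
Variables (K : set C) (hK : subfieldC K).

Lemma sf1 : K 1.
Proof. by case: hK => h _ _; apply/set_mem. Qed.
Lemma sfB x y : K x -> K y -> K (x - y).
Proof. by case: hK => _ h _ /mem_set Kx /mem_set Ky; apply/set_mem/h. Qed.
Lemma sfdiv x y : K x -> K y -> K (x / y).
Proof. by case: hK => _ _ h /mem_set Kx /mem_set Ky; apply/set_mem/h. Qed.
Lemma sf0 : K 0.
Proof. by rewrite -(subrr 1); apply: sfB; exact: sf1. Qed.
Lemma sfN x : K x -> K (- x).
Proof. by rewrite -[- x]sub0r; apply: sfB; exact: sf0. Qed.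
Lemma sfD x y : K x -> K y -> K (x + y).
Proof. by move=> Kx Ky; rewrite -[y]opprK; apply: sfB => //; exact: sfN. Qed.
Lemma sfV x : K x -> K x^-1.
Proof. by rewrite -[x^-1]div1r; apply: sfdiv; exact: sf1. Qed.
Lemma sfM x y : K x -> K y -> K (x * y).
Proof. by move=> Kx Ky; rewrite -[y]invrK; apply: sfdiv => //; exact: sfV. Qed.
Lemma sfX n x : K x -> K (x ^+ n).
Proof. by move=> Kx; elim: n => [|n IH]; rewrite ?expr0 ?exprS; [exact: sf1|exact: sfM]. Qed.
Lemma sf_nat n : K n%:R.
Proof. by elim: n => [|n IH]; rewrite ?mulrS; [exact: sf0|apply: sfD => //; exact: sf1]. Qed.
Lemma sf_sum I (r : seq I) (f : I -> C) : (forall i, K (f i)) -> K (\sum_(i <- r) f i).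
Proof. by move=> Kf; elim/big_rec: _ => [|i x _ Kx]; [exact: sf0|exact: sfD]. Qed.
Lemma sf_prod I (r : seq I) (Q : pred I) (f : I -> C) : (forall i, Q i -> K (f i)) ->
  K (\prod_(i <- r | Q i) f i).
Proof. by move=> Kf; elim/big_rec: _ => [|i x Qi Kx]; [exact: sf1|apply: sfM => //; exact: Kf]. Qed.

(** Indexed by the proof [hK] so that the closure structure can be attached to it; [subF] is then
    the subfield as a type, over which polynomials and matrices make sense. *)
Definition mem_sf of subfieldC K : {pred C} := fun z => z \in K.
HB.instance Definition _ := GRing.isDivringClosed.Build C (mem_sf hK) hK.
Definition subF := {x : C | x \in mem_sf hK}.
HB.instance Definition _ := SubType.on subF.
HB.instance Definition _ := Choice.on subF.
HB.instance Definition _ := [SubChoice_isSubIntegralDomain of subF by <:].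
HB.instance Definition _ := [SubIntegralDomain_isSubField of subF by <:].

Lemma subF_val (a : subF) : K (val a).
Proof. by apply/set_mem; exact: (valP a). Qed.

Lemma subF_ex x : K x -> exists a : subF, val a = x.
Proof. by move=> Kx; exists (exist _ x (mem_set Kx)). Qed.
End Closure.

Lemma Qadj_subfield A : subfieldC (Qadj A).
Proof.
apply: subfieldP => [M [sM _]|x y hx hy M [sM AM]|x y hx hy M [sM AM]]; first exact: sf1.
  by apply: sfB => //; [apply: hx|apply: hy].
by apply: sfdiv => //; [apply: hx|apply: hy].
Qed.

Lemma Qadj_gen A x : A x -> Qadj A x.
Proof. by move=> Ax M [_]; apply. Qed.

Lemma Qadj_sub A K : subfieldC K -> A `<=` K -> Qadj A `<=` K.
Proof. exact: smallest_sub. Qed.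

Definition alg K (hK : subfieldC K) y := algebraicOver (val : subF hK -> C) y.

Lemma alg_le K L (hK : subfieldC K) (hL : subfieldC L) y : K `<=` L -> alg hK y -> alg hL y.
Proof.
move=> KL [q q0 qy]; have hq i : exists a : subF hL, val a = val q`_i.
  by apply: subF_ex; apply: KL; exact: subF_val.
pose a i := projT1 (cid (hq i)); have aE i : val (a i) = val q`_i by rewrite /a; case: cid.
exists (\poly_(i < size q) a i).
  apply: contra_neq q0 => e; apply/polyP => i; apply/val_inj; rewrite coef0.
  have [iq|iq] := ltnP i (size q); last by rewrite nth_default.
  by have := congr1 (fun f : {poly subF hL} => val f`_i) e; rewrite coef_poly iq coef0 aE => ->; rewrite !raddf0.
suff -> : map_poly val (\poly_(i < size q) a i) = map_poly val q :> {poly C} by [].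
apply/polyP => i; rewrite !coef_map coef_poly /=.
by case: ltnP => iq; [rewrite aE|rewrite nth_default // !raddf0].
Qed.

Lemma alg_Qadj A K (hK : subfieldC K) : (forall a, A a -> alg hK a) -> forall x, Qadj A x -> alg hK x.
Proof.
move=> hA; apply: (@Qadj_sub A [set x | alg hK x]) => //; apply: subfieldP => [|x y|x y] /=.
- exact: algebraic1.
- exact: algebraic_sub.
- exact: algebraic_div.
Qed.

Lemma alg_unity_root K (hK : subfieldC K) n a : (0 < n)%N -> a ^+ n = 1 -> alg hK a.
Proof.
move=> n0 an; exists ('X^n - 1); first by rewrite -size_poly_gt0 size_XnsubC.
have -> : map_poly val ('X^n - 1 : {poly subF hK}) = 'X^n - 1 :> {poly C}.
  by apply/polyP => i; rewrite coefB coefXn coef1 coef_map coefB coefXn coef1 raddfB -!(rmorph_nat (val : {rmorphism subF hK -> C})).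
by rewrite /root !hornerE an subrr.
Qed.

(* Graphs of embeddings into C of subfields of C. *)
Definition isograph (G : set (C * C)) : Prop :=
  [/\ G (1, 1), forall x y x' y', G (x, x') -> G (y, y') -> G (x - y, x' - y'),
    forall x y x' y', G (x, x') -> G (y, y') -> G (x / y, x' / y') &
    forall y, G (0, y) -> y = 0].

Section Isograph.
Variables (G : set (C * C)) (hG : isograph G).

Lemma ig1 : G (1, 1). Proof. by case: hG. Qed.
Lemma igB x y x' y' : G (x, x') -> G (y, y') -> G (x - y, x' - y').
Proof. by case: hG => _ + _ _; apply. Qed.
Lemma igdiv x y x' y' : G (x, x') -> G (y, y') -> G (x / y, x' / y').
Proof. by case: hG => _ _ + _; apply. Qed.
Lemma ig_fun x y y' : G (x, y) -> G (x, y') -> y = y'.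
Proof.
move=> h h'; apply/eqP; rewrite -subr_eq0; apply/eqP; case: hG => _ _ _; apply.
by have := igB h h'; rewrite subrr.
Qed.
Lemma ig0 : G (0, 0). Proof. by rewrite -{1}(subrr 1) -(subrr 1); apply: igB; exact: ig1. Qed.
Lemma igD x y x' y' : G (x, x') -> G (y, y') -> G (x + y, x' + y').
Proof.
by move=> h h'; rewrite -[y]opprK -[y']opprK; apply: igB => //; rewrite -[- y]sub0r -[- y']sub0r;
  apply: igB => //; exact: ig0.
Qed.
Lemma igM x y x' y' : G (x, x') -> G (y, y') -> G (x * y, x' * y').
Proof.
move=> h h'; rewrite -[y]invrK -[y']invrK; apply: igdiv => //.
by rewrite -[y^-1]div1r -[y'^-1]div1r; apply: igdiv => //; exact: ig1.
Qed.
Lemma igX n x x' : G (x, x') -> G (x ^+ n, x' ^+ n).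
Proof. by move=> h; elim: n => [|n IH]; rewrite ?expr0 ?exprS; [exact: ig1|exact: igM]. Qed.
Lemma ig_inj x x' y : G (x, y) -> G (x', y) -> x = x'.
Proof.
move=> h h'; apply/eqP; rewrite -subr_eq0; apply/negPn/negP => n0.
have h0 : G (x - x', 0) by have := igB h h'; rewrite subrr.
have := igdiv h0 h0; rewrite divff // mul0r => h1.
by have /eqP := ig_fun ig1 h1; rewrite oner_eq0.
Qed.

Definition gdom : set C := [set x | exists y, G (x, y)].

Lemma gdom_subfield : subfieldC gdom.
Proof.
apply: subfieldP => [|x y [x' hx] [y' hy]|x y [x' hx] [y' hy]].
- by exists 1; exact: ig1.
- by exists (x' - y'); exact: igB.
- by exists (x' / y'); exact: igdiv.
Qed.

Definition gfun (a : subF gdom_subfield) : C := xget 0 [set y | G (val a, y)].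

Lemma gfunP a : G (val a, gfun a).
Proof. by rewrite /gfun; case: xgetP => [y -> //|h]; have [y /h] := subF_val a. Qed.

Lemma gfunE a y : G (val a, y) -> gfun a = y.
Proof. by move=> h; apply: ig_fun h; exact: gfunP. Qed.

Fact gfun_zmod : zmod_morphism gfun.
Proof. by move=> a b; apply: gfunE; rewrite raddfB; apply: igB; exact: gfunP. Qed.
Fact gfun_monoid : monoid_morphism gfun.
Proof.
split; first by apply: gfunE; rewrite rmorph1; exact: ig1.
by move=> a b; apply: gfunE; rewrite rmorphM; apply: igM; exact: gfunP.
Qed.
HB.instance Definition _ := GRing.isZmodMorphism.Build _ _ gfun gfun_zmod.
HB.instance Definition _ := GRing.isMonoidMorphism.Build _ _ gfun gfun_monoid.
End Isograph.

(** The minimal polynomial, chosen by least degree; remainders of divisions by it have smaller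
    degree and so cannot annihilate y unless zero. *)
Lemma min_annihilator K (hK : subfieldC K) y : alg hK y ->
  exists2 q : {poly subF hK}, q != 0 & forall f, root (map_poly val f) y = (q %| f).
Proof.
move=> [q0 q00 q0y].
pose Q n := `[< exists2 q : {poly subF hK}, q != 0 & root (map_poly val q) y /\ size q = n >].
have exQ : exists n, Q n by exists (size q0); apply/asboolP; exists q0.
case: (ex_minnP exQ) => n /asboolP[q qn0 [qy sq]] minn; exists q => // f.
have fE : root (map_poly val f) y = root (map_poly val (f %% q)) y.
  rewrite {1}(divp_eq f q) rmorphD rmorphM /= /root hornerD hornerM (eqP qy).
  by rewrite mulr0 add0r.
rewrite fE /dvdp; have [->|m0] := eqVneq (f %% q) 0; first by rewrite rmorph0 root0.
apply/negP => ry; have := minn (size (f %% q)).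
have -> : Q (size (f %% q)) by apply/asboolP; exists (f %% q).
by move=> /(_ isT); rewrite -sq leqNgt ltn_modp qn0.
Qed.

Section Extend.
Variables (D : set C) (hD : subfieldC D) (s : {rmorphism subF hD -> C}).
Variables (z z' : C) (q : {poly subF hD}).
Hypotheses (q0 : q != 0) (qz : forall f, root (map_poly val f) z = (q %| f)).
Hypothesis qz' : root (map_poly s q) z'.
Local Notation "f ^v" := (map_poly val f : {poly C}) (at level 2, format "f ^v").
Local Notation "f ^s" := (map_poly s f) (at level 2, format "f ^s").

(** By minimality q is irreducible: a polynomial not divisible by q is coprime to q, and Bezout
    keeps it from vanishing at z'. This is what makes [extend] the graph of an embedding. *)
Lemma extend_root f : (f^v.[z] == 0) = (f^s.[z'] == 0).
Proof.
have fr g : (g^v.[z] == 0) = (q %| g) by rewrite -qz.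
rewrite fr; apply/idP/idP => [/dvdpP[g ->]|f0].
  by rewrite rmorphM /= hornerM (eqP qz') mulr0.
apply/negPn/negP => qf; have cop : coprimep q f.
  have /dvdpP[k qE] := dvdp_gcdl q f.
  have [k0 g0] : k != 0 /\ gcdp q f != 0 by apply/andP; rewrite -negb_or -mulf_eq0 -qE.
  have : (k * gcdp q f)^v.[z] == 0 by rewrite -qE fr dvdpp.
  rewrite rmorphM /= hornerM mulf_eq0 !fr => /orP[qk|qg]; last first.
    by case/negP: qf; apply: dvdp_trans qg (dvdp_gcdr _ _).
  rewrite /coprimep; have := dvdp_leq k0 qk; rewrite {1}qE size_mul //.
  have : (0 < size (gcdp q f))%N by rewrite size_poly_gt0.
  by move: (size (gcdp q f)) (size k) => a b; lia.
have [[a b] /= ab] := Bezout_coprimepP _ _ cop; have := ab.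
rewrite -size_poly_eq1 => /eqP/esym/eqP; rewrite eq_sym => /eqP/eqP s1.
have [c c0 e] : exists2 c : subF hD, c != 0 & a * q + b * f = c%:P.
  have /size_poly1P[c c0 ->] : size (a * q + b * f) == 1%N by [].
  by exists c.
have := congr1 (fun g : {poly subF hD} => g^s.[z']) e.
rewrite rmorphD !rmorphM /= hornerD !hornerM (eqP qz') (eqP f0) !mulr0 addr0 map_polyC /= hornerC.
by move=> /esym/eqP; rewrite fmorph_eq0 (negbTE c0).
Qed.

(* The graph of the extension of [s] to D(z) which maps z to z'. *)
Definition extend : set (C * C) := [set c | exists f h : {poly subF hD},
  h^v.[z] != 0 /\ c = (f^v.[z] / h^v.[z], f^s.[z'] / h^s.[z'])].

Lemma extend_isograph : isograph extend.
Proof.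
have hs h : h^v.[z] != 0 -> h^s.[z'] != 0 by rewrite extend_root.
split=> [|x y x' y' [f [h [h0 [-> ->]]]] [g [k [k0 [-> ->]]]]|x y x' y' [f [h [h0 [-> ->]]]] [g [k [k0 [-> ->]]]]|y [f [h [h0 [e ->]]]]].
- by exists 1, 1; rewrite !rmorph1 !hornerE; split; rewrite ?divr1 ?oner_neq0 ?invr1 ?mulr1.
- exists (f * k - g * h), (h * k); rewrite !rmorphB !rmorphM /= !hornerE.
  have := hs _ h0; have := hs _ k0 => k1 h1; split; first by rewrite mulf_neq0.
  by congr (_, _); field; apply/andP.
- have [g0|g0] := eqVneq g^v.[z] 0.
    have /eqP g1 : g^s.[z'] == 0 by rewrite -extend_root g0.
    exists 0, 1; rewrite !rmorph0 !rmorph1 !hornerE g0 g1; split; first exact: oner_neq0.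
    by rewrite !mul0r invr0 !mulr0.
  exists (f * k), (h * g); rewrite !rmorphM /= !hornerE; split; first by rewrite mulf_neq0.
  have := hs _ h0; have := hs _ k0; have := hs _ g0 => g1 k1 h1.
  by congr (_, _); field; apply/and3P.
- move/esym/eqP: e; rewrite mulf_eq0 invr_eq0 (negbTE h0) orbF extend_root => /eqP->.
  by rewrite mul0r.
Qed.

Lemma extend_gen : extend (z, z').
Proof.
by exists 'X, 1; rewrite !rmorph1 !map_polyX !hornerE !divr1; split=> //; exact: oner_neq0.
Qed.
Lemma extend_base a : extend (val a, s a).
Proof.
exists a%:P, 1; rewrite !rmorph1 !map_polyC !hornerE !divr1; split=> //; exact: oner_neq0.
Qed.
End Extend.

(** A polynomial of degree n all of whose roots equal x determines x by its two leading
    coefficients; this expresses separability in characteristic 0. *)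
Lemma mean_root (l x : C) n : l != 0 -> n != 0%N -> x = - (l * - (x *+ n) / l) / n%:R.
Proof. by move=> l0 n0; rewrite -mulr_natr; field; rewrite pnatr_eq0 n0 l0. Qed.

(** * Embeddings that move a given element *)

Section Embedding.
Variables (K L : set C) (hK : subfieldC K).
Hypotheses (KL : K `<=` L) (Lalg : forall y, L y -> alg hK y).

(** x is sent to another root of its minimal polynomial, and the embedding is extended to L by
    Zorn's lemma, which allows L to be infinite over K. *)
Lemma embedding_ex x : L x -> ~ K x -> exists G, [/\ isograph G, forall k, K k -> G (k, k),
  forall y, L y -> exists y', G (y, y') & exists2 x', x' != x & G (x, x')].
Proof.
move=> Lx nKx; have [q q0 qx] := min_annihilator (Lalg Lx).
pose qv : {poly C} := map_poly val q; have qxr : root qv x by rewrite /qv qx dvdpp.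
have qv0 : qv != 0 by rewrite map_poly_eq0.
(* Were x the only root, its expression by the two leading coefficients would put it in K. *)
have [x' xx' qx'] : exists2 x', x' != x & root qv x'.
  apply: contrapT => nex; apply: nKx.
  have [rs qE] := closed_field_poly_normal qv.
  have hrs y : y \in rs -> y = x.
    move=> yr; apply/eqP/negPn/negP => yx; apply: nex; exists y => //.
    by rewrite qE rootZ ?lead_coef_eq0 // root_prod_XsubC.
  have sr : size rs != 0%N.
    have sv : (1 < size qv)%N by apply: root_size_gt1 qxr.
    by move: sv; rewrite qE size_scale ?lead_coef_eq0 // size_prod_XsubC; lia.
  have Kq i : K qv`_i by rewrite coef_map; exact: subF_val.
  have h : qv`_(size rs).-1 = lead_coef qv * - (x *+ size rs).
    rewrite {1}qE coefZ coefPn_prod_XsubC //; congr (_ * - _).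
    rewrite big_seq (eq_bigr (fun=> x)) => [|y /hrs->//]; rewrite -big_seq.
    by rewrite big_const_seq count_predT iter_addr_0.
  have -> : x = - (qv`_(size rs).-1 / lead_coef qv) / (size rs)%:R.
    by rewrite h; apply: mean_root; rewrite ?lead_coef_eq0.
  apply: (sfdiv hK _ (sf_nat hK _)); apply: (sfN hK); apply: (sfdiv hK); [exact: Kq|].
  by rewrite lead_coefE; exact: Kq.
have G0 : isograph (extend (val : subF hK -> C) x x') by apply: (extend_isograph q0 qx qx').
pose E0 := extend (val : subF hK -> C) x x'.
pose P0 (G : set (C * C)) := isograph G /\ E0 `<=` G.
have PE0 : P0 E0 by split.
pose PZ G := G = set0 \/ P0 G.
have [|G [[G00|[hG G0G]] maxG]] := @Zorn_bigcup _ PZ.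
- move=> Fs FP tot; have [[X FX [hX GX]]|nX] := pselect (exists2 X, Fs X & P0 X); last first.
    left; rewrite -subset0 => c [X FX Xc]; have [X0|X0] := FP X FX; first by rewrite X0 in Xc.
    by case: nX; exists X.
  have com c c' : (\bigcup_(X in Fs) X) c -> (\bigcup_(X in Fs) X) c' ->
      exists Y, [/\ Fs Y, isograph Y, Y c & Y c'].
    move=> [Y FY Yc] [Y' FY' Yc']; have [YY|YY] := tot _ _ FY FY'.
    - exists Y'; split=> //; last exact: YY.
      by have [Y0|[]//] := FP _ FY'; rewrite Y0 in Yc'.
    - exists Y; split=> //; last exact: YY.
      by have [Y0|[]//] := FP _ FY; rewrite Y0 in Yc.
  right; split; last by move=> c /GX Xc; exists X.
  split=> [|a b a' b' h h'|a b a' b' h h'|b h].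
  - by exists X => //; exact: ig1.
  - by have [Y [FY hY Yc Yc']] := com _ _ h h'; exists Y => //; exact: igB.
  - by have [Y [FY hY Yc Yc']] := com _ _ h h'; exists Y => //; exact: igdiv.
  - by have [Y [FY hY Yc _]] := com _ _ h h; case: hY => _ _ _; apply.
- exfalso; apply: (maxG E0); last by right.
  rewrite G00; split=> // h; have : E0 (x, x') by apply: extend_gen.
  by move=> /h.
have GK k : K k -> G (k, k).
  by move=> /(subF_ex hK)[a <-]; apply: G0G; apply: (extend_base (val : subF hK -> C)).
exists G; split=> //; last by exists x' => //; apply: G0G; exact: extend_gen.
move=> y Ly; apply: contrapT => ny.
have ay : alg (gdom_subfield hG) y by apply: alg_le (Lalg Ly) => k Kk; exists k; exact: GK.
have [r r0 ry] := min_annihilator ay.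
(* Were y missing from the domain, a root of its transported minimal polynomial would extend the
   maximal graph. *)
pose s := (@gfun G hG : {rmorphism subF (gdom_subfield hG) -> C}).
have [y' ry'] : exists y', root (map_poly s r) y'.
  apply/closed_rootP; rewrite size_map_poly.
  have : (1 < size (map_poly val r))%N by apply: (@root_size_gt1 _ y); rewrite ?map_poly_eq0 // ry dvdpp.
  by rewrite size_map_poly; lia.
apply: (maxG (extend s y y')).
  split=> [[a b] Gab|h]; last by apply: ny; exists y'; apply: h; exact: extend_gen.
  have [c cE] := subF_ex (gdom_subfield hG) (ex_intro _ b Gab).
  have -> : (a, b) = (val c, s c) by rewrite cE; congr (_, _); apply/esym/gfunE; rewrite cE.
  exact: extend_base.
right; split; first exact: (extend_isograph r0 ry ry').
move=> [a b] h; have /G0G Gab := h.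
have [c cE] := subF_ex (gdom_subfield hG) (ex_intro _ b Gab).
have -> : (a, b) = (val c, s c) by rewrite cE; congr (_, _); apply/esym/gfunE; rewrite cE.
exact: extend_base.
Qed.
End Embedding.
End Subfields.

(** * Galois groups and Gauss sums *)

Section GaloisGroup.
Context {R : realType}.
Local Notation C := R[i].
Implicit Types (K L A : set C) (x y z : C) (sg tau : C -> C).

Section Element.
Variables (K L : set C) (hL : subfieldC L) (sg : C -> C) (hs : Gal L K sg).

Lemma gal_in x : L x -> L (sg x). Proof. by case: hs => -[h _ _] _ _ _ _; apply: h. Qed.
Lemma galD x y : L x -> L y -> sg (x + y) = sg x + sg y. Proof. by case: hs => _ h _ _ _; apply: h. Qed.
Lemma galM x y : L x -> L y -> sg (x * y) = sg x * sg y. Proof. by case: hs => _ _ h _ _; apply: h. Qed.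
Lemma gal_fix x : K x -> sg x = x. Proof. by case: hs => _ _ _ h _; apply: h. Qed.
Lemma gal_out x : ~ L x -> sg x = x. Proof. by case: hs => _ _ _ _ h; apply: h. Qed.
Lemma gal_inj x y : L x -> L y -> sg x = sg y -> x = y.
Proof. by case: hs => -[_ h _] _ _ _ _ Lx Ly; apply: h; rewrite inE. Qed.
Lemma gal_surj y : L y -> exists2 x, L x & sg x = y.
Proof. by case: hs => -[_ _ h] _ _ _ _ /h[x]; exists x. Qed.
Lemma gal0 : sg 0 = 0.
Proof.
have h0 := sf0 hL; apply: (addrI (sg 0)); by rewrite -galD // !addr0.
Qed.
Lemma gal1 : sg 1 = 1.
Proof.
have h1 := sf1 hL; have n0 : sg 1 != 0.
  by apply/eqP => e; have := gal_inj h1 (sf0 hL); rewrite e gal0 => /(_ erefl)/eqP; rewrite oner_eq0.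
by apply: (mulfI n0); rewrite -galM // !mulr1.
Qed.
Lemma galN x : L x -> sg (- x) = - sg x.
Proof. by move=> Lx; apply/eqP; rewrite eq_sym -subr_eq0 -opprD oppr_eq0 -galD ?addrN ?gal0 //; exact: sfN. Qed.
Lemma galB x y : L x -> L y -> sg (x - y) = sg x - sg y.
Proof. by move=> Lx Ly; rewrite galD ?galN //; exact: sfN. Qed.
Lemma galX n x : L x -> sg (x ^+ n) = sg x ^+ n.
Proof.
by move=> Lx; elim: n => [|n IH]; rewrite ?expr0 ?gal1 // !exprS galM ?IH //; exact: sfX.
Qed.
Lemma gal_eq0 x : L x -> (sg x == 0) = (x == 0).
Proof. by move=> Lx; apply/eqP/eqP => [e|->]; [apply: gal_inj => //; [exact: sf0|rewrite gal0]|exact: gal0]. Qed.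
Lemma galV x : L x -> sg x^-1 = (sg x)^-1.
Proof.
move=> Lx; have [->|x0] := eqVneq x 0; first by rewrite invr0 gal0 invr0.
have s0 : sg x != 0 by rewrite gal_eq0.
by apply: (mulfI s0); rewrite -galM ?divff ?gal1 //; exact: sfV.
Qed.
Lemma galdiv x y : L x -> L y -> sg (x / y) = sg x / sg y.
Proof. by move=> Lx Ly; rewrite galM ?galV //; exact: sfV. Qed.
Lemma gal_sum I (r : seq I) (Q : pred I) (f : I -> C) : (forall i, Q i -> L (f i)) ->
  sg (\sum_(i <- r | Q i) f i) = \sum_(i <- r | Q i) sg (f i).
Proof.
move=> Lf; elim: r => [|i r IH]; first by rewrite !big_nil gal0.
rewrite !big_cons; case: ifP => // Qi; rewrite galD ?IH //; first exact: Lf.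
by elim/big_rec: _ => [|j x Qj Lx]; [exact: sf0|apply: (sfD hL) => //; exact: Lf].
Qed.
Lemma gal_prod I (r : seq I) (Q : pred I) (f : I -> C) : (forall i, Q i -> L (f i)) ->
  sg (\prod_(i <- r | Q i) f i) = \prod_(i <- r | Q i) sg (f i).
Proof.
move=> Lf; elim: r => [|i r IH]; first by rewrite !big_nil gal1.
rewrite !big_cons; case: ifP => // Qi; rewrite galM ?IH //; first exact: Lf.
by apply: (sf_prod hL).
Qed.
Lemma gal_nat n : sg n%:R = n%:R.
Proof.
elim: n => [|n IH]; first exact: gal0.
by rewrite mulrS galD ?IH ?gal1 //; [exact: sf1|exact: sf_nat].
Qed.
End Element.

Lemma gal_comp K L sg tau : Gal L K sg -> Gal L K tau -> Gal L K (sg \o tau).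
Proof.
move=> hs ht; split=> [|x y Lx Ly|x y Lx Ly|x Kx|z nLz] /=.
- split=> [x Lx|x y /set_mem Lx /set_mem Ly /= e|y Ly].
  + by apply: (gal_in hs); exact: (gal_in ht).
  + by apply: (gal_inj ht) => //; apply: (gal_inj hs) => //; exact: (gal_in ht).
  + have [z Lz <-] := gal_surj hs Ly; have [x Lx <-] := gal_surj ht Lz.
    by exists x.
- by rewrite (galD ht) ?(galD hs) //; exact: (gal_in ht).
- by rewrite (galM ht) ?(galM hs) //; exact: (gal_in ht).
- by rewrite (gal_fix ht) ?(gal_fix hs).
- by rewrite (gal_out ht) ?(gal_out hs).
Qed.

Lemma gal_id K L : Gal L K id.
Proof. by split=> //; split=> // y Ly; exists y. Qed.

Lemma gal_iter K L sg n : Gal L K sg -> Gal L K (iter n sg).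
Proof.
move=> hs; elim: n => [|n IH]; first exact: gal_id.
by have := gal_comp hs IH; congr Gal; apply/funext.
Qed.

Lemma unity_root_pow (m : nat) x y : m.-primitive_root x -> y ^+ m = 1 -> exists k, y = x ^+ k.
Proof. by move=> px ym; have [k ->] := prim_rootP px ym; exists k. Qed.

Section Fixed.
Variables (A K : set C).
Hypotheses (hK : subfieldC K) (KL : K `<=` Qadj A).
Hypothesis Aroot : forall a, A a -> exists2 n, (0 < n)%N & a ^+ n = 1.
Local Notation L := (Qadj A).
Let hL := Qadj_subfield A.

(** An embedding maps a root of unity to one of the same order, so each is a power of the other.
    Hence it maps a field generated by roots of unity onto itself. *)
Lemma gal_of_graph (G : set (C * C)) : isograph G -> (forall k, K k -> G (k, k)) ->
  (forall y, L y -> exists y', G (y, y')) ->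
  exists2 sg, Gal L K sg & forall y, L y -> G (y, sg y).
Proof.
move=> hG GK GL; have hA a a' : A a -> G (a, a') -> L a' /\ exists2 b, L b & G (b, a).
  move=> Aa Gaa; have La := Qadj_gen Aa; have [n n0 an] := Aroot Aa.
  have [m pm _] := prim_order_exists n0 an.
  have m0 := prim_order_gt0 pm.
  have pm' : m.-primitive_root a'.
    have a'm : a' ^+ m = 1.
      have := igX hG m Gaa; rewrite (prim_expr_order pm) => h.
      by have := ig_fun hG (ig1 hG) h.
    have [m' pm' dm'] := prim_order_exists m0 a'm.
    have := igX hG m' Gaa; rewrite (prim_expr_order pm') => h.
    have e := ig_inj hG h (ig1 hG); suff -> : m = m' by [].
    apply/eqP; rewrite eqn_dvd dm' andbT.
    by rewrite (prim_order_dvd pm) e.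
  have [k ek] := unity_root_pow pm (prim_expr_order pm').
  have [k' ek'] := unity_root_pow pm' (prim_expr_order pm).
  split; first by rewrite ek; exact: (sfX hL).
  by exists (a ^+ k'); [exact: (sfX hL)|rewrite {2}ek'; exact: igX].
pose sg y := if `[< L y >] then xget 0 [set y' | G (y, y')] else y.
have sgP y : L y -> G (y, sg y).
  by move=> Ly; rewrite /sg asboolT //; case: xgetP => [z -> //|h]; have [z /h] := GL y Ly.
have sgE y y' : L y -> G (y, y') -> sg y = y' by move=> /sgP h h'; apply: ig_fun h h'.
have LG : L `<=` [set y | exists2 y', L y' & G (y, y')].
  apply: Qadj_sub => [|a Aa]; last first.
    by have [a' Ga] := GL a (Qadj_gen Aa); have [La' _] := hA a a' Aa Ga; exists a'.
  apply: subfieldP => [|x y [x' Lx Gx] [y' Ly Gy]|x y [x' Lx Gx] [y' Ly Gy]].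
  - by exists 1; [exact: sf1|exact: ig1].
  - by exists (x' - y'); [exact: (sfB hL)|exact: igB].
  - by exists (x' / y'); [exact: (sfdiv hL)|exact: igdiv].
have LG' : L `<=` [set y | exists2 x, L x & G (x, y)].
  apply: Qadj_sub => [|a Aa]; last first.
    by have [a' Ga] := GL a (Qadj_gen Aa); have [_ ] := hA a a' Aa Ga.
  apply: subfieldP => [|x y [x' Lx Gx] [y' Ly Gy]|x y [x' Lx Gx] [y' Ly Gy]].
  - by exists 1; [exact: sf1|exact: ig1].
  - by exists (x' - y'); [exact: (sfB hL)|exact: igB].
  - by exists (x' / y'); [exact: (sfdiv hL)|exact: igdiv].
exists sg => //; split=> [|x y Lx Ly|x y Lx Ly|k Kk|z nLz].
- split=> [x Lx|x y /set_mem Lx /set_mem Ly /= e|y Ly].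
  + by have [x' Lx' Gx] := LG _ Lx; rewrite (sgE _ _ Lx Gx).
  + by have := sgP _ Lx; rewrite e => h; apply: (ig_inj hG h); exact: sgP.
  + by have [x Lx Gx] := LG' _ Ly; exists x => //; exact: sgE.
- by apply: sgE; [exact: (sfD hL)|apply: igD => //; exact: sgP].
- by apply: sgE; [exact: (sfM hL)|apply: igM => //; exact: sgP].
- by apply: sgE; [exact: KL|exact: GK].
- by rewrite /sg asboolF.
Qed.

(** An element outside K is moved by some embedding, which restricts to an element of the Galois
    group. *)
Lemma gal_fixed x : L x -> (forall sg, Gal L K sg -> sg x = x) -> K x.
Proof.
move=> Lx fx; apply: contrapT => nKx.
have Lalg y : L y -> alg hK y.
  by apply: alg_Qadj => a /Aroot[n n0 an]; exact: alg_unity_root an.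
have [G [hG GK GL [x' xx' Gx]]] := embedding_ex Lalg Lx nKx.
have [sg hs /(_ _ Lx)] := gal_of_graph hG GK GL; rewrite fx // => Gx'.
by rewrite (ig_fun hG Gx Gx') eqxx in xx'.
Qed.
End Fixed.
End GaloisGroup.

(** * Quadratic Gauss sums *)

Section GaussSum.
Context {C : numClosedFieldType}.
Variables (p : nat) (p_prime : prime p) (p_odd : p != 2%N).
Variables (zeta : C) (zeta_prim : p.-primitive_root zeta).
Variables (e : 'F_p) (e_prim : (p.-1).-primitive_root e).

(** The residue a is read as its representative in the natural numbers; additivity holds because
    zeta has order p. *)
Definition Fp_char (a : 'F_p) : C := zeta ^+ a.
Local Notation chi := Fp_char.
Definition gauss_sum (c : 'F_p) : C := \sum_(a : 'F_p) chi (c * a ^+ 2).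

Lemma zeta_Fp_nat n : zeta ^+ (n%:R : 'F_p) = zeta ^+ n.
Proof. by rewrite val_Fp_nat //= prim_expr_mod. Qed.

Let chiD a b : chi (a + b) = chi a * chi b.
Proof.
have -> : a + b = (a + b)%N%:R :> 'F_p by rewrite natrD !natr_Zp.
by rewrite /chi zeta_Fp_nat exprD.
Qed.

Let chi0 : chi 0 = 1. Proof. by rewrite /chi expr0. Qed.

Let cardF : #|'F_p| = p. Proof. by rewrite card_Fp. Qed.

Let chi_sum c : \sum_a chi (c * a) = if c == 0 then p%:R else 0.
Proof.
case: eqP => [->|/eqP c0].
  rewrite (eq_bigr (fun=> 1)) => [|a _]; last by rewrite mul0r chi0.
  by rewrite sumr_const cardF.
have s1 : chi c != 1.
  rewrite /chi -(prim_order_dvd zeta_prim) (dvdn_pcharf (pchar_Fp p_prime)) natr_Zp //.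
apply/eqP; have : (chi c - 1) * (\sum_a chi (c * a)) = 0.
  rewrite mulrBl mul1r mulr_sumr (reindex_inj (addIr 1)) /= [X in _ - X](reindex_inj (addIr 1)) /=.
  rewrite [X in _ - X](reindex_inj (addIr (1 : 'F_p))) /=.
  apply/eqP; rewrite subr_eq0; apply/eqP; apply: eq_bigr => a _.
  by rewrite -chiD; congr chi; ring.
by move/eqP; rewrite mulf_eq0 subr_eq0 (negbTE s1).
Qed.

Let two_neq0 : (2 : 'F_p) != 0.
Proof.
rewrite -(dvdn_pcharf (pchar_Fp p_prime)); apply: contra p_odd => h.
by rewrite eqn_leq (dvdn_leq _ h) // prime_gt1.
Qed.

Lemma gauss_sumN : gauss_sum 1 * gauss_sum (-1) = p%:R.
Proof.
rewrite /gauss_sum mulrC mulr_suml.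
(* With a + b for a, a^2 - b^2 becomes a^2 + 2 a b, and the sum over b vanishes unless a = 0. *)
have h b : \sum_a chi (-1 * b ^+ 2) * chi (1 * a ^+ 2) = \sum_a chi (a ^+ 2) * chi (2 * a * b).
  rewrite (reindex_inj (addIr b)) /=; apply: eq_bigr => a _.
  by rewrite -!chiD; congr chi; ring.
under eq_bigr => b _ do rewrite mulr_sumr.
under eq_bigr => b _ do rewrite h.
rewrite exchange_big /=; under eq_bigr => a _ do rewrite -mulr_sumr chi_sum.
rewrite (bigD1 0) //= big1 ?addr0 => [|a a0]; last by rewrite mulf_eq0 (negbTE two_neq0) (negbTE a0) mulr0.
by rewrite mulr0 eqxx expr2 mulr0 chi0 mul1r.
Qed.

Lemma gauss_sum_neq0 : gauss_sum 1 != 0.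
Proof.
apply/eqP => g0; have := gauss_sumN; rewrite g0 mul0r => /esym/eqP.
by rewrite pnatr_eq0 -leqn0 leqNgt prime_gt0.
Qed.

Lemma gauss_sum_sqr c x : x != 0 -> gauss_sum (c * x ^+ 2) = gauss_sum c.
Proof.
move=> x0; rewrite [RHS](reindex_inj (mulfI x0)); apply: eq_bigr => a _.
by congr chi; ring.
Qed.

Let e_neq0 : e != 0.
Proof.
have p1 := prim_order_gt0 e_prim; apply/eqP => e0; have := prim_expr_order e_prim.
by rewrite e0 expr0n -[p.-1 == 0%N]negbK -lt0n p1 => /esym/eqP; rewrite oner_eq0.
Qed.

Lemma gauss_sum_even k : gauss_sum (e ^+ (2 * k)) = gauss_sum 1.
Proof. by rewrite mulnC exprM -[_ ^+ 2]mul1r gauss_sum_sqr // expf_neq0 // e_neq0. Qed.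

Lemma gauss_sum_odd k : gauss_sum (e ^+ (2 * k).+1) = gauss_sum e.
Proof. by rewrite exprS mulnC exprM gauss_sum_sqr // expf_neq0 // e_neq0. Qed.

Lemma Fp_log (c : 'F_p) : c != 0 -> exists k, c = e ^+ k.
Proof.
move=> c0; have [|k ->] := prim_rootP e_prim (x := c); last by exists k.
apply: (mulfI c0); rewrite mulr1 -exprS prednK ?prime_gt0 //.
by have := finfield.expf_card c; rewrite card_Fp.
Qed.

Lemma sum_Fp_powers (f : 'F_p -> C) : \sum_(c | c != 0) f c = \sum_(j < p.-1) f (e ^+ j).
Proof.
rewrite -(big_mkord xpredT (fun j => f (e ^+ j))) /index_iota subn0.
rewrite -(big_map (fun j => e ^+ j) xpredT f).
rewrite -(big_filter (index_enum _) (fun c : 'F_p => c != 0)); apply: perm_big.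
have p1 := prim_order_gt0 e_prim; apply: uniq_perm => [||c].
- by rewrite filter_uniq // index_enum_uniq.
- rewrite map_inj_in_uniq ?iota_uniq // => i j; rewrite !mem_iota !add0n => /andP[_ hi] /andP[_ hj].
  by move=> /eqP; rewrite (eq_prim_root_expr e_prim) !modn_small // => /eqP.
- rewrite mem_filter mem_index_enum andbT; apply/idP/mapP => [/Fp_log[k ->]|[j _ ->]].
    by exists (k %% p.-1)%N; rewrite ?prim_expr_mod // mem_iota add0n ltn_mod.
  by rewrite expf_neq0 ?e_neq0.
Qed.

(** The Gauss sums of all nonzero c add up to 0; half of them equal [gauss_sum 1] and half equal
    [gauss_sum e]. *)
Lemma gauss_sum_nonsquare : gauss_sum e = - gauss_sum 1.
Proof.
have p1 := prim_order_gt0 e_prim.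
have s0 : \sum_(c | c != 0) gauss_sum c = 0.
  have h (c : 'F_p) : c != 0 -> \sum_(d | d != 0) chi (d * c) = -1.
    move=> c0; have := chi_sum c; rewrite (negbTE c0) (bigD1 0) //= mulr0 chi0 => /eqP.
    by rewrite addrC addr_eq0 => /eqP <-; apply: eq_bigr => d _; rewrite mulrC.
  rewrite exchange_big (bigD1 0) //.
  transitivity (\sum_(c : 'F_p | c != 0) (1 : C) + \sum_(a : 'F_p | true && (a != 0)) (-1 : C)).
    apply: congr2; apply: eq_bigr => a a0; first by rewrite expr2 !mulr0 chi0.
    by rewrite -(h (a ^+ 2)) ?expf_neq0.
  by rewrite /= sumrN addrN.
have hs h : \sum_(j < (2 * h)%N) gauss_sum (e ^+ j) = h%:R * (gauss_sum 1 + gauss_sum e).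
  elim: h => [|h IH]; first by rewrite big_ord0 mul0r.
  rewrite (_ : (2 * h.+1)%N = (2 * h).+2); last by rewrite mulnS.
  by rewrite !big_ord_recr /= IH gauss_sum_odd gauss_sum_even -natr1; ring.
have [h ph] : exists h, p.-1 = (2 * h)%N.
  exists p.-1./2; rewrite mul2n -[LHS]odd_double_half; case: (even_prime p_prime) p_odd => [->//|po _].
  by rewrite -subn1 oddB ?prime_gt0 // po.
move: s0; rewrite sum_Fp_powers ph hs => /eqP; rewrite mulf_eq0 pnatr_eq0 => /orP[/eqP h0|].
  by move: p1; rewrite ph h0.
by rewrite addrC addr_eq0 => /eqP.
Qed.

Lemma gauss_sum_eq1 c : c != 0 -> gauss_sum c = gauss_sum 1 -> exists k, c = e ^+ (2 * k).
Proof.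
move=> /Fp_log[k ->]; rewrite -[k]odd_double_half -mul2n; case: (odd k) => /=; last first.
  by move=> _; exists k./2.
rewrite add1n gauss_sum_odd gauss_sum_nonsquare => /eqP; rewrite eq_sym -subr_eq0 opprK -mulr2n.
by rewrite mulrn_eq0 (negbTE gauss_sum_neq0).
Qed.

(** The sign depends on whether -1 is a square modulo p. *)
Lemma gauss_sum2 : gauss_sum 1 ^+ 2 = p%:R \/ gauss_sum 1 ^+ 2 = - p%:R.
Proof.
have [|k e1] := @Fp_log (-1); first by rewrite oppr_eq0 oner_eq0.
have := gauss_sumN; rewrite e1 -[k]odd_double_half -mul2n; case: (odd k) => /=.
  by rewrite add1n gauss_sum_odd gauss_sum_nonsquare mulrN -expr2 => <-; right; rewrite opprK.
by rewrite gauss_sum_even -expr2; left.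
Qed.
End GaussSum.

(** * The Galois action on the values of a character *)

Section CharacterValues.
Context {R : realType} {F : nonArchLocalFieldType}.
Local Notation C := R[i].
Variables (p : nat) (p_char : is_residue_char F p).
Variables (lam : F -> C).
Hypotheses (lam_char : unitary_character lam) (lam_nontrivial : exists t, lam t != 1).
Local Notation O := (val_ge (@lval F)).
Local Notation P := (@primering_closure F).
Local Notation pk k := ((p ^ k)%N%:R : F).
Let p_prime := char_prime p_char.
Let p_gt0 := prime_gt0 p_prime.

Lemma lam_pX_large s : exists k, forall k', (k <= k')%N -> forall w, O 0 w -> lam (pk k' * w * s) = 1.
Proof.
exists `|conductor lam - lval s|%N => k' kk w w0; apply: (lam_conductor lam_char lam_nontrivial).
have h : O (k'%:Z + lval s) (pk k' * w * s).
  by apply: val_geM; [exact: (val_ge_pX p_char)|right; exact: lexx].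
by apply: val_ge_le h; lia.
Qed.

Lemma lam_root_le k k' s : (k <= k')%N -> lam s ^+ (p ^ k) = 1 -> lam s ^+ (p ^ k') = 1.
Proof. by move=> /subnK <- e; rewrite addnC expnD exprM e expr1n. Qed.

Lemma lam_root s : exists k, lam s ^+ (p ^ k) = 1.
Proof.
have [k hk] := lam_pX_large s; exists k; rewrite -(lam_nat lam_char).
by have := hk k (leqnn k) 1 val_ge1; rewrite mulr1.
Qed.

Lemma lam_primering z t : P z -> lam t = 1 -> lam (z * t) = 1.
Proof.
move=> Pz t1; have [k hk] := lam_pX_large t.
have [m [w Pw e]] := primering_nat_approx p_char k Pz.
rewrite -(subrK m%:R z) e mulrDl (lamD lam_char) (lam_nat lam_char) t1 expr1n mulr1.
by apply: hk (leqnn k) _ (primering_ge0 Pw).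
Qed.

Lemma lam_primering_nat z t k m w : P w -> z - m%:R = pk k * w -> lam t ^+ (p ^ k) = 1 ->
  lam (z * t) = lam t ^+ m.
Proof.
move=> Pw e t1; rewrite -(subrK m%:R z) e mulrDl (lamD lam_char) (lam_nat lam_char).
rewrite [pk k * w]mulrC -mulrA lam_primering ?mul1r //.
by rewrite (lam_nat lam_char).
Qed.

Lemma lam_mul_inj r r' : (forall s, lam (r * s) = lam (r' * s)) -> r = r'.
Proof.
move=> h; apply/eqP; rewrite -subr_eq0; apply/negPn/negP => rr.
have [t] := lam_nontrivial; rewrite -[t](mulVKf rr) mulrBl (lamB lam_char) h divff ?eqxx //.
exact: lam_neq0.
Qed.

Lemma lam_order_p : exists t, lam t != 1 /\ lam t ^+ p = 1.
Proof.
have [t t1] := lam_nontrivial; have exk := lam_root t.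
case: (ex_minnP (P := fun k => lam t ^+ (p ^ k) == 1)) => [|k /eqP hk mink].
  by have [k hk] := exk; exists k; apply/eqP.
case: k hk mink => [|k] hk mink; first by rewrite expr1 in hk; rewrite hk eqxx in t1.
exists (pk k * t); rewrite (lam_nat lam_char) -exprM -expnSr hk; split=> //.
by apply/negP => /mink; rewrite ltnn.
Qed.

Lemma prime_power_root (z : C) k : z ^+ (p ^ k) != 1 -> z ^+ (p ^ k.+1) = 1 ->
  (p ^ k.+1)%N.-primitive_root z.
Proof.
move=> z1 zp; have [|d pd] := prim_order_exists _ zp; first by rewrite expn_gt0 p_gt0.
move=> /(dvdn_pfactor _ _ p_prime)[j jk ed]; move: pd; rewrite ed => pd.
move: jk; rewrite leq_eqVlt => /orP[/eqP <- //|]; rewrite ltnS => jk; case/eqP: z1.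
by move: (prim_expr_order pd); rewrite -(subnK jk) addnC expnD exprM => ->; rewrite expr1n.
Qed.

(** [lam (w * s)] has to detect w modulo p^k. In characteristic 0 this takes a root of unity of
    exact order p^k, found by dividing t by a power of p; in characteristic p, where p^k = 0 for k >
    0, any t with [lam t] of order p does. *)
Lemma lam_level_ex k : exists s, [/\ lam s ^+ (p ^ k) = 1,
  forall w, P w -> lam (w * s) = 1 -> exists2 z, P z & w = pk k * z &
  forall t, lam t ^+ (p ^ k) = 1 -> exists c, lam t = lam s ^+ c].
Proof.
case: k => [|k].
  exists 0; rewrite (lam0 lam_char) expr1n; split=> // [w Pw _|t].
    by exists w => //; rewrite mul1r.
  by rewrite expr1 => ->; exists 0%N.
have [t [t1 tp]] := lam_order_p; have [p0|p0] := eqVneq (p%:R : F) 0.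
  have pt : (p ^ 1)%N.-primitive_root (lam t) by apply: prime_power_root; rewrite ?expr1 ?expn1.
  have pk0 : pk k.+1 = 0 by rewrite expnS natrM p0 mul0r.
  exists t; rewrite expnS exprM tp expr1n; split=> // [w Pw wt|t' _].
    have [m [z Pz e]] := primering_nat_approx p_char k.+1 Pw.
    have tk : lam t ^+ (p ^ k.+1) = 1 by rewrite expnS exprM tp expr1n.
    move: wt; rewrite (lam_primering_nat Pz e tk) => /eqP.
    rewrite -(prim_order_dvd pt) expn1 => /dvdnP[m' em].
    exists 0; first exact: primering0.
    by apply/eqP; rewrite mulr0 -(subrK m%:R w) e pk0 mul0r add0r em natrM p0 mulr0.
  apply: (unity_root_pow pt); rewrite expn1 -(lam_nat lam_char) p0 mul0r.
  exact: (lam0 lam_char).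
have pk0 : pk k != 0 by rewrite natrX expf_neq0.
pose s := t / pk k; have es : lam s ^+ (p ^ k) = lam t by rewrite -(lam_nat lam_char) mulrC divfK.
have ek : lam s ^+ (p ^ k.+1) = 1 by rewrite expnSr exprM es.
have ps : (p ^ k.+1)%N.-primitive_root (lam s) by apply: prime_power_root => //; rewrite es.
exists s; split=> // [w Pw ws|t' t'k]; last exact: (unity_root_pow ps).
have [m [z Pz e]] := primering_nat_approx p_char k.+1 Pw.
move: ws; rewrite (lam_primering_nat Pz e ek) => /eqP.
rewrite -(prim_order_dvd ps) => /dvdnP[m' em].
exists (z + m'%:R); first by apply: primeringD => //; exact: primering_nat.
by rewrite -(subrK m%:R w) e em natrM mulrDr [m'%:R * _]mulrC.
Qed.

(* [lam (lam_level k)] generates the roots of unity of order dividing p^k in the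
   image of [lam]; in characteristic p these are the p-th ones for all k > 0. *)
Definition lam_level k : F := projT1 (cid (lam_level_ex k)).
Local Notation sl := lam_level.

Lemma lam_levelP k : [/\ lam (sl k) ^+ (p ^ k) = 1,
  forall w, P w -> lam (w * sl k) = 1 -> exists2 z, P z & w = pk k * z &
  forall t, lam t ^+ (p ^ k) = 1 -> exists c, lam t = lam (sl k) ^+ c].
Proof. by rewrite /lam_level; case: cid. Qed.

Lemma lam_level1_prim : p.-primitive_root (lam (sl 1)).
Proof.
have [h1 h2 _] := lam_levelP 1; rewrite -[p]expn1; apply: prime_power_root => //.
rewrite expn0 expr1; apply/eqP => e.
have [||z Pz] := h2 1; [exact: primering1|by rewrite mul1r|] => e1.
by apply: (@vunit_nge1 F 1) vunit1 _; rewrite e1; apply: (val_ge_pX p_char) (primering_ge0 Pz).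
Qed.

Lemma lam_level_sep k w : P w -> lam (w * sl k) = 1 -> O k%:Z w.
Proof. by move=> Pw; have [_ h _] := lam_levelP k => /(h _ Pw)[z Pz ->]; apply: (val_ge_pX p_char) (primering_ge0 Pz). Qed.

Local Notation E := (fieldE lam).
Let hE : subfieldC E := Qadj_subfield _.

Lemma lamE s : E (lam s). Proof. by apply: Qadj_gen; left; exists s. Qed.
Lemma fieldE_i : E (sqrtC (-1)). Proof. by apply: Qadj_gen; right. Qed.

Section GaloisChar.
Variables (K : set C) (sg : C -> C) (hs : Gal E K sg).

(** sg raises the roots of unity of level k to a power a_k. The separation property of [lam_level]
    makes these exponents Cauchy, and r is their limit. *)
Lemma gal_lam : exists2 r, P r & forall t, sg (lam t) = lam (r * t).
Proof.
have ak k : exists a, sg (lam (sl k)) = lam (sl k) ^+ a.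
  have [h1 _ _] := lam_levelP k; have [|m pm _] := prim_order_exists _ h1; first by rewrite expn_gt0 p_gt0.
  apply: (unity_root_pow pm); rewrite -(galX hE hs); last exact: lamE.
  by rewrite (prim_expr_order pm) (gal1 hE hs).
pose a k := projT1 (cid (ak k)); have aP k : sg (lam (sl k)) = lam (sl k) ^+ a k by rewrite /a; case: cid.
have aT k t : lam t ^+ (p ^ k) = 1 -> sg (lam t) = lam t ^+ a k.
  have [_ _ h] := lam_levelP k => /h[c ->].
  by rewrite (galX hE hs) ?aP; [rewrite -!exprM mulnC|exact: lamE].
have [||r Pr hr] := @primering_limit F (fun k => (a k)%:R).
- by move=> k; exact: primering_nat.
- move=> k; apply: lam_level_sep; first by apply: primeringB; exact: primering_nat.
  rewrite mulrBl (lamB lam_char) !(lam_nat lam_char); have [h1 _ _] := lam_levelP k.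
  rewrite -(aT k) // -(aT k.+1) ?divff // ?(gal_eq0 hE hs) ?(lam_neq0 lam_char) //; first exact: lamE.
  exact: (lam_root_le (leqnSn k)).
exists r => // t; have [k0 h0] := lam_root t; pose k := maxn k0 `|conductor lam - lval t|%N.
rewrite (aT k) ?(lam_root_le (leq_maxl _ _) h0) //.
rewrite -[in RHS](subrK (a k)%:R r) mulrDl (lamD lam_char) (lam_nat lam_char).
rewrite [lam (_ * t)](lam_conductor lam_char lam_nontrivial) ?mul1r //.
have h : O (k%:Z + lval t) ((r - (a k)%:R) * t).
  by apply: val_geM; [exact: hr|right; exact: lexx].
apply: val_ge_le h; rewrite /k; have := leq_maxr k0 `|conductor lam - lval t|%N.
by move: (maxn _ _) => j; lia.
Qed.
End GaloisChar.

Lemma acts_asP sg r : P r -> acts_as lam p sg r <-> forall t, sg (lam t) = lam (r * t).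
Proof.
move=> Pr; split=> [h t|h zeta k m [t _ <-] tk [z Pz e]].
  have [k tk] := lam_root t; have [m [z Pz e]] := primering_nat_approx p_char k Pr.
  rewrite (lam_primering_nat Pz e tk); apply: (h _ k m (ex_intro2 _ _ t I erefl) tk).
  by exists z.
by rewrite h; exact: lam_primering_nat Pz e tk.
Qed.

End CharacterValues.

(** * The parameters of an element of the Galois group *)

Section SubfieldSquares.
Context {R : realType}.
Local Notation C := R[i].

Lemma sf_sqr_pm (L : set C) (x y : C) : subfieldC L -> L (sqrtC (-1)) -> L y ->
  x ^+ 2 = y ^+ 2 \/ x ^+ 2 = - y ^+ 2 -> L x.
Proof.
move=> hL Li Ly; have pm z : L z -> x ^+ 2 = z ^+ 2 -> L x.
  by move=> Lz /eqP; rewrite eqf_sqr => /orP[] /eqP -> //; exact: sfN.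
case=> [|e]; first exact: pm.
by apply: (pm (sqrtC (-1) * y)); [exact: (sfM hL)|rewrite exprMn sqrtCK mulN1r].
Qed.

Lemma sqrt_pm_subfield p : subfieldC (sqrt_pm (R := R) p).
Proof. exact: Qadj_subfield. Qed.

Lemma sqrt_pm_i p : (0 < p)%N -> sqrt_pm (R := R) p (sqrtC (-1)).
Proof.
move=> p0; have hK := sqrt_pm_subfield p.
have n0 : (p%:R : C) != 0 by rewrite pnatr_eq0 -lt0n.
have K1 : sqrt_pm p (sqrtC (p%:R : C)) by apply: Qadj_gen; left.
have K2 : sqrt_pm p (sqrtC (- p%:R : C)) by apply: Qadj_gen; right.
have : sqrt_pm p (sqrtC (- p%:R : C) / sqrtC (p%:R : C)) by exact: (sfdiv hK).
set z := _ / _ => Kz; have : sqrtC (-1 : C) ^+ 2 = z ^+ 2.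
  by rewrite /z expr_div_n !sqrtCK mulNr divff.
by move/eqP; rewrite eqf_sqr => /orP[] /eqP -> //; exact: (sfN hK).
Qed.

(** A square root of a power of q = p^f is up to sign a power of sqrt p; this puts the scalars of
    the Weil operators into Q(sqrt p, sqrt(-p)). *)
Lemma sqrt_pm_pow p (x : R) q f (k : int) : (0 < p)%N -> q = (p ^ f)%N -> x ^+ 2 = q%:R ^ k ->
  sqrt_pm p (x%:C).
Proof.
move=> p0 -> e; have hK := sqrt_pm_subfield p.
have K1 : sqrt_pm p (sqrtC (p%:R : C)) by apply: Qadj_gen; left.
have KX (j : int) y : sqrt_pm (R := R) p y -> sqrt_pm p (y ^ j).
  by move=> Ky; case: j => j; [exact: (sfX hK)|apply: (sfV hK); exact: (sfX hK)].
pose y := sqrtC (p%:R : C) ^+ f; have yE : y ^+ 2 = (p ^ f)%N%:R by rewrite exprAC sqrtCK -natrX.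
have : (x%:C) ^+ 2 = (y ^ k) ^+ 2.
  rewrite -[LHS](rmorphXn (@real_complex R)) e; case: k {e} => k.
    by rewrite -!exprnP exprAC yE rmorphXn rmorph_nat.
  by rewrite !NegzE -!exprnN exprVn exprAC yE fmorphV rmorphXn rmorph_nat.
have Ky : sqrt_pm p y by exact: (sfX hK).
by move/eqP; rewrite eqf_sqr => /orP[] /eqP ->; [|apply: (sfN hK)]; exact: KX.
Qed.
End SubfieldSquares.

Section GaloisParameters.
Context {R : realType} {F : nonArchLocalFieldType}.
Local Notation C := R[i].
Variables (p : nat) (p_char : is_residue_char F p) (p_neq2 : p != 2%N).
Variables (lam : F -> C).
Hypotheses (lam_char : unitary_character lam) (lam_nontrivial : exists t, lam t != 1).
Variables (eps : F) (eps_unit : primering_units eps) (eps_prim : (p.-1).-primitive_root eps).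
Local Notation O := (val_ge (@lval F)).
Local Notation P := (@primering_closure F).
Local Notation E := (fieldE lam).
Local Notation K := (sqrt_pm (R := R) p).
Local Notation sl := (lam_level p_char lam_char lam_nontrivial).
Local Notation h := (p.-1./2).
Let p_prime := char_prime p_char.
Let p_gt0 := prime_gt0 p_prime.
Let hE : subfieldC E := Qadj_subfield _.
Let hK := sqrt_pm_subfield (R := R) p.
Let zeta := lam (sl 1).
Let zeta_prim : p.-primitive_root zeta := lam_level1_prim p_char lam_char lam_nontrivial.

Lemma p1_half : p.-1 = (2 * h)%N.
Proof.
rewrite mul2n -[LHS]odd_double_half; case: (even_prime p_prime) p_neq2 => [->//|po _].
by rewrite -subn1 oddB ?prime_gt0 // po.
Qed.

Lemma eqn_mod_double i j : (2 * i == 2 * j %[mod p.-1])%N = (i == j %[mod h])%N.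
Proof. by have := p1_half; set k := h => ->; rewrite -!muln_modr eqn_pmul2l. Qed.

Lemma half_gt0 : (0 < h)%N.
Proof. by have := prim_order_gt0 eps_prim; rewrite [X in (0 < X)%N]p1_half; case: (p.-1./2). Qed.

Lemma Fp_prim_ex : exists e : 'F_p, (p.-1).-primitive_root e.
Proof. by have [e [_ pe]] := eps_nat p_char eps_unit eps_prim; exists e%:R. Qed.

Lemma gauss_in L : subfieldC L -> L zeta -> L (gauss_sum (p := p) zeta 1).
Proof. by move=> hL Lz; apply: sf_sum => // a; apply: sfX. Qed.

Lemma sqrt_pm_gauss : K (gauss_sum (p := p) zeta 1).
Proof.
have [e pe] := Fp_prim_ex.
refine (sf_sqr_pm hK (sqrt_pm_i p_gt0) (y := sqrtC (p%:R : C)) _ _).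
  by apply: Qadj_gen; left.
by rewrite sqrtCK; exact: (gauss_sum2 p_prime p_neq2 zeta_prim pe).
Qed.

(** The Gauss sum squares to p or -p, so sqrt p and sqrt(-p) equal it up to a fourth root of
    unity. *)
Lemma sqrt_pm_sub L : subfieldC L -> L zeta -> L (sqrtC (-1)) -> K `<=` L.
Proof.
move=> hL Lz Li; have [e pe] := Fp_prim_ex; have Lg := gauss_in hL Lz.
apply: Qadj_sub => // x [->|->]; apply: (@sf_sqr_pm _ _ _ _ hL Li Lg); rewrite sqrtCK.
  by have [->|->] := gauss_sum2 p_prime p_neq2 zeta_prim pe; [left|right; rewrite opprK].
by have [->|->] := gauss_sum2 p_prime p_neq2 zeta_prim pe; [right|left].
Qed.

Lemma sqrt_pm_fieldE : K `<=` E.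
Proof. by apply: sqrt_pm_sub => //; [exact: lamE|exact: fieldE_i]. Qed.

Lemma fieldE_fixed x : E x -> (forall sg, Gal E K sg -> sg x = x) -> K x.
Proof.
apply: gal_fixed => // [|a [[t _ <-]|->]]; first exact: sqrt_pm_fieldE.
  have [k e] := lam_root p_char lam_char lam_nontrivial t.
  by exists (p ^ k)%N; rewrite ?expn_gt0 ?p_gt0.
by exists 4%N => //; rewrite (exprM _ 2 2) sqrtCK sqrrN expr1n.
Qed.

(** sg fixes the Gauss sum, so by [gauss_sum_eq1] its exponent is a square modulo p, an even power
    of the generator. The field L is general in order to serve for both E and the cyclotomic
    field. *)
Lemma gal_zeta_even L sg m : subfieldC L -> L zeta -> Gal L K sg -> sg zeta = zeta ^+ m ->
  exists k, O 1 (m%:R - eps ^+ (2 * k)).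
Proof.
move=> hL Lz hs sz; have [e [e1 pe]] := eps_nat p_char eps_unit eps_prim.
have LX x : L (zeta ^+ x) by exact: sfX.
have m0 : (m%:R : 'F_p) != 0.
  rewrite -(dvdn_pcharf (pchar_Fp p_prime)); apply/negP => /dvdnP[j em].
  move: sz; rewrite em mulnC exprM (prim_expr_order zeta_prim) expr1n -(gal1 hL hs).
  move=> /(gal_inj hs Lz (sf1 hL)) z1; have := prim_expr_mod zeta_prim 1.
  move: zeta_prim; rewrite z1 => /prim_order_dvd /(_ 1%N); rewrite expr1n eqxx dvdn1.
  by move=> /eqP p1; have := prime_gt1 p_prime; rewrite p1.
have [|k ek] := gauss_sum_eq1 p_prime p_neq2 zeta_prim pe m0.
  rewrite -(gal_fix hs sqrt_pm_gauss) /gauss_sum (gal_sum hL hs) => [|a _]; last exact: LX.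
  apply: eq_bigr => a _; rewrite (galX hL hs) // sz mul1r -exprM /Fp_char.
  by rewrite -[in RHS](zeta_Fp_nat p_prime zeta_prim) natrM natr_Zp.
exists k; have : (m%:R == (e ^ (2 * k))%N%:R :> 'F_p) by rewrite natrX ek.
move=> /(nat_Fp_eq p_char) me; rewrite -(subrKA (e ^ (2 * k))%N%:R); apply: val_geD => //.
rewrite natrX -opprB; apply: val_geN; rewrite subrXX; apply: val_geMr => //.
elim/big_ind: _ => [|? ?|j _]; [by left|exact: val_geD|].
by apply: val_geMl; apply: val_geX0; [exact/primering_ge0/eps_primering|exact: val_ge_nat].
Qed.

(* The pair (i, s) selected in [delta]. *)
Definition gal_param (sg : C -> C) := xget (0%N, 0) (assoc lam p eps sg).

Lemma assoc_ex sg : Gal E K sg -> exists c, assoc lam p eps sg c.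
Proof.
move=> hs; have [r Pr hr] := gal_lam p_char lam_char lam_nontrivial hs.
have [m [z Pz e]] := primering_nat_approx p_char 1 Pr.
have [z1 _ _] := lam_levelP p_char lam_char lam_nontrivial 1.
have sz : sg zeta = zeta ^+ m by rewrite hr (lam_primering_nat p_char lam_char lam_nontrivial Pz e).
have [k mk] := gal_zeta_even hE (lamE (sl 1)) hs sz.
(* The range of i is 1..h, so h stands for the class of 0. *)
pose i := if (k %% h == 0)%N then h else (k %% h)%N.
have h0 := half_gt0; have ih : (1 <= i <= h)%N.
  by rewrite /i; case: eqP => [_|/eqP]; rewrite ?h0 ?leqnn // -lt0n => -> /=; rewrite ltnW // ltn_pmod.
have ei : eps ^+ (2 * i) = eps ^+ (2 * k).
  apply/eqP; rewrite (eq_prim_root_expr eps_prim) eqn_mod_double.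
  by rewrite /i; case: ifP => [/eqP ->|_]; rewrite ?modnn ?modn_mod.
have ue := eps_vunit p_char eps_unit eps_prim; have Pe := eps_primering eps_unit.
have eV : (eps ^+ (2 * i))^-1 = eps ^+ (p.-1.-1 * (2 * i)).
  apply: (mulfI (vunit_neq0 (vunitX (2 * i) ue))); rewrite divff ?(vunit_neq0 (vunitX (2 * i) ue)) //.
  rewrite -exprD -mulSn prednK ?(prim_order_gt0 eps_prim) // exprM (prim_expr_order eps_prim).
  by rewrite expr1n.
(* Once the power of eps is divided out, a principal unit remains, and it has a square root as p is
   odd. *)
have uw : @one_units F p (r / eps ^+ (2 * i)).
  apply/(one_unitsE p_char); split; first by rewrite eV; apply: primeringM => //; exact: primeringX.
  rewrite -[X in _ - X](divff (vunit_neq0 (vunitX (2 * i) ue))) -mulrBl.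
  apply: val_geMr; last by rewrite eV; exact/vunit_ge0/vunitX.
  rewrite ei -(subrKA m%:R); apply: val_geD => //.
  by rewrite e expn1; apply: (val_geMr (val_ge_p p_char)) (primering_ge0 Pz).
have [s us es] := one_units_sqrt p_char p_neq2 uw.
exists (i, s); split=> //=; rewrite es mulrC divfK ?(vunit_neq0 (vunitX (2 * i) ue)) //.
exact/(acts_asP p_char lam_char lam_nontrivial).
Qed.

Lemma gal_paramP sg : Gal E K sg -> let c := gal_param sg in
  [/\ (1 <= c.1 <= h)%N, @one_units F p c.2 &
      forall t, sg (lam t) = lam (eps ^+ (2 * c.1) * c.2 ^+ 2 * t)].
Proof.
move=> hs /=; have := xgetPex (0%N, 0) (assoc_ex hs); rewrite -/(gal_param sg) => -[h1 h2 h3].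
split=> //; apply/(acts_asP p_char lam_char lam_nontrivial) => //.
have [Ps _] := (one_unitsE p_char _).1 h2.
by apply: primeringM; apply: primeringX => //; exact: eps_primering.
Qed.

Let ue : vunit eps := eps_vunit p_char eps_unit eps_prim.

Lemma one_units_eq s s' : @one_units F p s -> @one_units F p s' -> s ^+ 2 = s' ^+ 2 -> s = s'.
Proof.
move=> us us' /eqP; rewrite eqf_sqr => /orP[/eqP //|/eqP e].
have [_ s1] := (one_unitsE p_char _).1 us; have [_ s1'] := (one_unitsE p_char _).1 us'.
case: (vunit_nge1 (vunit2 p_char p_neq2)); have -> : 2 = - ((s - 1) + (s' - 1)) :> F by rewrite e; ring.
by apply: val_geN; apply: val_geD.
Qed.

Lemma eps_even_inj i j : O 1 (eps ^+ (2 * i) - eps ^+ (2 * j)) -> (i = j %[mod h])%N.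
Proof.
move=> /(epsX_congr p_char eps_unit eps_prim)/eqP; rewrite (eq_prim_root_expr eps_prim).
by rewrite eqn_mod_double => /eqP.
Qed.

Lemma eps_one_units i j s s' : @one_units F p s -> @one_units F p s' ->
  O 1 (eps ^+ i * s - eps ^+ j * s') -> O 1 (eps ^+ i - eps ^+ j).
Proof.
move=> /(one_unitsE p_char)[_ s1] /(one_unitsE p_char)[_ s1'] hO.
have -> : eps ^+ i - eps ^+ j = (eps ^+ i * s - eps ^+ j * s') - (eps ^+ i * (s - 1) - eps ^+ j * (s' - 1)).
  by ring.
apply: val_geD => //; apply: val_geN; apply: val_geD; last apply: val_geN.
  by apply: val_geMl => //; exact/vunit_ge0/vunitX.
by apply: val_geMl => //; exact/vunit_ge0/vunitX.
Qed.

(** Exponents add modulo h since eps^2 has order h; as i, j and k all lie in 1..h, i + j exceeds k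
    by 0 or h. *)
Lemma gal_param_comp sg tau : Gal E K sg -> Gal E K tau ->
  let: (i, s) := gal_param sg in let: (j, t) := gal_param tau in
  let: (k, w) := gal_param (sg \o tau) in
  w = s * t /\ (k = (i + j)%N \/ (k + h)%N = (i + j)%N).
Proof.
move=> hs ht; have := gal_paramP hs; have := gal_paramP ht; have := gal_paramP (gal_comp hs ht).
case: (gal_param sg) => i s; case: (gal_param tau) => j t; case: (gal_param _) => k w /=.
move=> [hk uw ew] [hj ut et] [hi us es].
have e : eps ^+ (2 * k) * w ^+ 2 = eps ^+ (2 * (i + j)) * (s * t) ^+ 2.
  apply: (lam_mul_inj lam_char lam_nontrivial) => x; rewrite -ew /= et es; congr lam.
  by rewrite mulnDr exprD exprMn; ring.
have ust := one_unitsM p_char us ut.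
have hmod : (k = i + j %[mod h])%N.
  apply: eps_even_inj; apply: eps_one_units (one_unitsX p_char 2 uw) (one_unitsX p_char 2 ust) _.
  by rewrite e subrr; left.
have ee : eps ^+ (2 * k) = eps ^+ (2 * (i + j)).
  by apply/eqP; rewrite (eq_prim_root_expr eps_prim) eqn_mod_double hmod.
split.
  apply: one_units_eq => //; move: e; rewrite ee; apply: mulfI.
  exact/vunit_neq0/vunitX.
have [q eq] : exists q, (i + j = k + q * h \/ k = i + j + q * h)%N.
  case: (leqP k (i + j)) => le.
    have /dvdnP[q eq] : (h %| i + j - k)%N by rewrite -eqn_mod_dvd // hmod.
    by exists q; left; rewrite -eq subnKC.
  have /dvdnP[q eq] : (h %| k - (i + j))%N by rewrite -eqn_mod_dvd ?(ltnW le) // hmod.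
  by exists q; right; rewrite -eq subnKC // ltnW.
move: hk hj hi => /andP[k1 k2] /andP[j1 j2] /andP[i1 i2].
case: q eq => [|[|q]]; rewrite ?mul0n ?mul1n; [lia|lia|].
by rewrite mulSn mulSn; move: (q * h)%N => a; lia.
Qed.

(** Continuity of sg |-> (i, s): s is controlled by s^2, because s + t is congruent to 2 and
    therefore a unit. *)
Lemma gal_param_close sg tau k : (0 < k)%N -> Gal E K sg -> Gal E K tau ->
  sg (lam (sl k)) = tau (lam (sl k)) ->
  (gal_param sg).1 = (gal_param tau).1 /\ O k%:Z ((gal_param sg).2 - (gal_param tau).2).
Proof.
move=> k0 hs ht; have := gal_paramP hs; have := gal_paramP ht.
case: (gal_param sg) => i s; case: (gal_param tau) => j t /= [hj ut et] [hi us es].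
have [Ps s1] := (one_unitsE p_char _).1 us; have [Pt t1] := (one_unitsE p_char _).1 ut.
have Pe := eps_primering eps_unit.
rewrite es et => e.
have hO : O k%:Z (eps ^+ (2 * i) * s ^+ 2 - eps ^+ (2 * j) * t ^+ 2).
  apply: (lam_level_sep (p_char := p_char) (lam_char := lam_char) (lam_nontrivial := lam_nontrivial)).
    by apply: primeringB; apply: primeringM; apply: primeringX.
  by rewrite mulrBl (lamB lam_char) e divff // lam_neq0.
have ij : i = j.
  have : (i = j %[mod h])%N.
    apply: eps_even_inj; apply: eps_one_units (one_unitsX p_char 2 us) (one_unitsX p_char 2 ut) _.
    by apply: val_ge_le hO; lia.
  move: hj hi => /andP[j1 j2] /andP[i1 i2].
  move: i2 j2; rewrite (leq_eqVlt i) (leq_eqVlt j) => /orP[/eqP->|i2] /orP[/eqP->|j2] //.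
  - by rewrite modnn modn_small // => j0; rewrite -j0 in j1.
  - by rewrite modnn modn_small // => i0; rewrite i0 in i1.
  - by rewrite !modn_small.
split=> //; rewrite ij -mulrBr in hO; move/(val_ge_vunitM _ _ (vunitX _ ue)): hO.
rewrite subr_sqr mulrC; suff ust : vunit (s + t) by move/(val_ge_vunitM _ _ ust).
apply: (@vunit_congr _ 2); first exact: vunit2 p_char p_neq2.
have -> : s + t - 2 = (s - 1) + (t - 1) by ring.
exact: val_geD.
Qed.

Lemma lam_zeta_congr r r' : P r -> P r' -> O 1 (r - r') -> lam (r * sl 1) = lam (r' * sl 1).
Proof.
move=> Pr Pr' rr; have [w Pw e] := primering_dvd p_char (primeringB Pr Pr') rr.
rewrite -[r](subrK r') e mulrDl (lamD lam_char) [p%:R * w]mulrC -mulrA.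
rewrite (lam_primering p_char lam_char lam_nontrivial) ?mul1r //.
by rewrite (lam_nat lam_char); exact: (prim_expr_order zeta_prim).
Qed.

Local Notation Cy := (cyclo_i (R := R) p).
Let hCy : subfieldC Cy := Qadj_subfield _.

Lemma cyclo_zeta : Cy zeta.
Proof. by apply: Qadj_gen; left; exact: (prim_expr_order zeta_prim). Qed.

Lemma cyclo_i_mem : Cy (sqrtC (-1)).
Proof. by apply: Qadj_gen; right. Qed.

Lemma cyclo_sub L : subfieldC L -> L zeta -> L (sqrtC (-1)) -> Cy `<=` L.
Proof.
move=> hL Lz Li; apply: Qadj_sub => // x [xp|->//].
by have [k ->] := unity_root_pow zeta_prim xp; exact: sfX.
Qed.

Lemma cyclo_fieldE : Cy `<=` E.
Proof. by apply: cyclo_sub => //; [exact: lamE|exact: fieldE_i]. Qed.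

(** The two automorphisms may belong to different fields: elements of the Galois groups of E and of
    the cyclotomic field get compared. *)
Lemma gal_eq_cyclo L L' sg tau : subfieldC L -> subfieldC L' -> Cy `<=` L -> Cy `<=` L' ->
  Gal L K sg -> Gal L' K tau -> sg zeta = tau zeta -> forall x, Cy x -> sg x = tau x.
Proof.
move=> hL hL' CL CL' hs ht e; suff : Cy `<=` [set x | Cy x /\ sg x = tau x] by move=> h x /h[].
have fi : K (sqrtC (-1)) := sqrt_pm_i p_gt0.
apply: cyclo_sub => /=; [|by split=> //; exact: cyclo_zeta|].
  apply: subfieldP => /= [|x y [Cx ex] [Cyy ey]|x y [Cx ex] [Cyy ey]].
  - by split; [exact: sf1|rewrite (gal1 hL hs) (gal1 hL' ht)].
  - split; first exact: (sfB hCy).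
    by rewrite (galB hL hs) ?(galB hL' ht) ?ex ?ey //; [apply: CL'|apply: CL'|apply: CL|apply: CL].
  - split; first exact: (sfdiv hCy).
    by rewrite (galdiv hL hs) ?(galdiv hL' ht) ?ex ?ey //; [apply: CL'|apply: CL'|apply: CL|apply: CL].
by split; [exact: cyclo_i_mem|rewrite (gal_fix hs) ?(gal_fix ht)].
Qed.

Section Eta.
Variables (eta : C -> C) (eta_gal : Gal E K eta) (eta_eps : acts_as lam p eta (eps ^+ 2)).
Let Pe : P eps := eps_primering eps_unit.

Lemma eta_lam l t : iter l eta (lam t) = lam (eps ^+ (2 * l) * t).
Proof.
elim: l t => [|l IH] t; first by rewrite mul1r.
rewrite iterSr (_ : eta (lam t) = lam (eps ^+ 2 * t)); last first.
  have Pe2 : P (eps ^+ 2) by exact: primeringX.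
  exact: ((acts_asP p_char lam_char lam_nontrivial eta Pe2).1 eta_eps t).
by rewrite IH mulrA -exprD mulnS addnC.
Qed.

Lemma eta_cyclo_in l x : Cy x -> Cy (iter l eta x).
Proof.
elim: l => [//|l IH] /IH; rewrite iterS; move: (iter l eta x) => y {IH}.
suff : Cy `<=` [set x | Cy x /\ Cy (eta x)] by move=> h /h[].
apply: cyclo_sub => /= [||]; last first.
  by split; rewrite ?(gal_fix eta_gal (sqrt_pm_i p_gt0)); exact: cyclo_i_mem.
  split; first exact: cyclo_zeta.
  apply: Qadj_gen; left; rewrite /= -(galX hE eta_gal); last exact: lamE.
  by rewrite (prim_expr_order zeta_prim) (gal1 hE eta_gal).
have CE := cyclo_fieldE.
apply: subfieldP => /= [|a b [Cx ex] [Cyy ey]|a b [Cx ex] [Cyy ey]].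
- by split; rewrite ?(gal1 hE eta_gal); exact: sf1.
- by split; rewrite ?(galB hE eta_gal); try exact: (sfB hCy); exact: CE.
- by split; rewrite ?(galdiv hE eta_gal); try exact: (sfdiv hCy); exact: CE.
Qed.

(** The factor s^2 is congruent to 1, so it does not act on the p-th roots of unity. *)
Lemma gal_eta sg : Gal E K sg -> forall x, Cy x -> sg x = iter (gal_param sg).1 eta x.
Proof.
move=> hs; apply: (gal_eq_cyclo hE hE cyclo_fieldE cyclo_fieldE hs (gal_iter _ eta_gal)).
have [_ us es] := gal_paramP hs; rewrite /zeta es eta_lam; move: (gal_param sg).2 us => s us.
have [Ps s1] := (one_unitsE p_char _).1 (one_unitsX p_char 2 us).
apply: lam_zeta_congr; [by apply: primeringM => //; exact: primeringX|exact: primeringX|].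
rewrite -[X in _ - X]mulr1 -mulrBr; apply: val_geMl => //; exact/vunit_ge0/vunitX.
Qed.

Lemma eta_period x : Cy x -> iter h eta x = x.
Proof.
apply: (gal_eq_cyclo hE hE cyclo_fieldE cyclo_fieldE (gal_iter h eta_gal) (gal_id _ _)).
by rewrite /zeta eta_lam -p1_half (prim_expr_order eps_prim) mul1r.
Qed.

(** Elements of [Gal] are the identity outside their field, hence this truncation of the powers of
    eta. *)
Let etaC l z := if `[< Cy z >] then iter l eta z else z.

Let etaC_gal l : Gal Cy K (etaC l).
Proof.
have hl := gal_iter l eta_gal; have CE := cyclo_fieldE.
have eC x : Cy x -> etaC l x = iter l eta x by move=> Cx; rewrite /etaC asboolT.
split=> [|x y Cx Cz|x y Cx Cz|x Kx|z nz].
- split=> [x Cx|x y /set_mem Cx /set_mem Cz|y Cz].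
  + by rewrite eC //; exact: eta_cyclo_in.
  + by rewrite !eC // => /(gal_inj hl (CE _ Cx) (CE _ Cz)).
  (* On the cyclotomic field eta^j inverts eta^l as soon as h divides l + j. *)
  + have [j jl] : exists j, (h %| l + j)%N.
      by exists (l * h.-1)%N; rewrite -mulnS prednK ?half_gt0 // dvdn_mull.
    exists (iter j eta y); first exact: eta_cyclo_in.
    rewrite eC; last exact: eta_cyclo_in.
    rewrite -iterD; move: jl => /dvdnP[q ->]; elim: q => [|q IH]; first by [].
    by rewrite mulSn iterD IH eta_period.
- by rewrite !eC ?(galD hl) //; [exact: CE|exact: CE|exact: (sfD hCy)].
- by rewrite !eC ?(galM hl) //; [exact: CE|exact: CE|exact: (sfM hCy)].
- by rewrite eC ?(gal_fix hl) //; apply: (sqrt_pm_sub hCy cyclo_zeta cyclo_i_mem).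
- by rewrite /etaC asboolF.
Qed.

Lemma eta_inj l l' : (l < h)%N -> (l' < h)%N -> iter l eta zeta = iter l' eta zeta -> l = l'.
Proof.
move=> lh lh'; rewrite /zeta !eta_lam => e.
have : O 1 (eps ^+ (2 * l) - eps ^+ (2 * l')).
  apply: (lam_level_sep (p_char := p_char) (lam_char := lam_char) (lam_nontrivial := lam_nontrivial)).
    by apply: primeringB; exact: primeringX.
  by rewrite mulrBl (lamB lam_char) e divff // lam_neq0.
by move=> /eps_even_inj; rewrite !modn_small.
Qed.

Lemma gal_cyclo tau : Gal Cy K tau -> exists2 l, (l < h)%N & tau = etaC l.
Proof.
move=> ht; have Cz := cyclo_zeta.
have [m em] : exists m, tau zeta = zeta ^+ m.
  apply: (unity_root_pow zeta_prim); rewrite -(galX hCy ht) //.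
  by rewrite (prim_expr_order zeta_prim) (gal1 hCy ht).
have [k mk] := gal_zeta_even hCy Cz ht em.
exists (k %% h)%N; first by rewrite ltn_mod half_gt0.
have e2 : eps ^+ (2 * (k %% h)) = eps ^+ (2 * k).
  by apply/eqP; rewrite (eq_prim_root_expr eps_prim) eqn_mod_double modn_mod.
have ez : tau zeta = iter (k %% h) eta zeta.
  rewrite em /zeta eta_lam e2 -(lam_nat lam_char); apply: lam_zeta_congr => //.
    exact: primering_nat.
  exact: primeringX.
apply/funext => x; rewrite /etaC; case: asboolP => [Cx|nx]; last exact: (gal_out ht).
exact: (gal_eq_cyclo hCy hE _ cyclo_fieldE ht (gal_iter _ eta_gal)).
Qed.

(** The Galois group of the cyclotomic field consists of the eta^l with l < h: [gal_zeta_even]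
    leaves only even powers of eps as exponents on zeta, and [eta_inj] separates them. *)
Lemma eta_norm u : Cy u -> normC Cy K u = \prod_(0 <= l < h) iter l eta u.
Proof.
move=> Cu; have bij : set_bij `I_h (Gal Cy K) etaC.
  split=> [l _|l l' /set_mem lh /set_mem lh' e|tau /gal_cyclo[l lh ->]]; last by exists l.
    exact: etaC_gal.
  apply: eta_inj => //; have := congr1 (fun f => f zeta) e.
  by rewrite /etaC asboolT //; exact: cyclo_zeta.
rewrite /normC (reindex_fsbig etaC `I_h) // big_mkord fsbig_ord.
by apply: eq_fsbigr => l _; rewrite /etaC asboolT.
Qed.
End Eta.

Lemma lam_level_le k k' sg tau : (k <= k')%N -> Gal E K sg -> Gal E K tau ->
  sg (lam (sl k')) = tau (lam (sl k')) -> sg (lam (sl k)) = tau (lam (sl k)).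
Proof.
move=> kk hs ht e; have [h1 _ _] := lam_levelP p_char lam_char lam_nontrivial k.
have [_ _ h3] := lam_levelP p_char lam_char lam_nontrivial k'.
have [c ->] := h3 _ (lam_root_le kk h1).
by rewrite (galX hE hs) ?(galX hE ht) ?e //; exact: lamE.
Qed.

(** Elements of E that are controlled by a single level form a subfield, and the generators are
    among them. *)
Lemma gal_level_ex x : E x -> exists k, forall sg tau, Gal E K sg -> Gal E K tau ->
  sg (lam (sl k)) = tau (lam (sl k)) -> sg x = tau x.
Proof.
suff : E `<=` [set x | E x /\ exists k, forall sg tau, Gal E K sg -> Gal E K tau ->
  sg (lam (sl k)) = tau (lam (sl k)) -> sg x = tau x] by move=> h /h[].
clear x; have two x y : E x /\ (exists k, forall sg tau, Gal E K sg -> Gal E K tau ->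
    sg (lam (sl k)) = tau (lam (sl k)) -> sg x = tau x) ->
  E y /\ (exists k, forall sg tau, Gal E K sg -> Gal E K tau ->
    sg (lam (sl k)) = tau (lam (sl k)) -> sg y = tau y) ->
  [/\ E x, E y & exists k, forall sg tau, Gal E K sg -> Gal E K tau ->
    sg (lam (sl k)) = tau (lam (sl k)) -> sg x = tau x /\ sg y = tau y].
  move=> [Ex [k hk]] [Ey [k' hk']]; split=> //; exists (maxn k k') => sg tau hs ht e.
  by split; [apply: hk => //; apply: lam_level_le e => //; exact: leq_maxl
            |apply: hk' => //; apply: lam_level_le e => //; exact: leq_maxr].
apply: Qadj_sub => [|_ [[t _ <-]|->]] /=.
- apply: subfieldP => [|x y hx hy|x y hx hy] /=.
  + by split; [exact: sf1|exists 0%N => sg tau hs ht _; rewrite (gal1 hE hs) (gal1 hE ht)].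
  + have [Ex Ey [k hk]] := two _ _ hx hy; split; first exact: (sfB hE).
    by exists k => sg tau hs ht e; have [e1 e2] := hk _ _ hs ht e; rewrite (galB hE hs) ?(galB hE ht) ?e1 ?e2.
  + have [Ex Ey [k hk]] := two _ _ hx hy; split; first exact: (sfdiv hE).
    by exists k => sg tau hs ht e; have [e1 e2] := hk _ _ hs ht e; rewrite (galdiv hE hs) ?(galdiv hE ht) ?e1 ?e2.
- split; first exact: lamE.
  have [k tk] := lam_root p_char lam_char lam_nontrivial t.
  have [_ _ h3] := lam_levelP p_char lam_char lam_nontrivial k.
  exists k => sg tau hs ht e; have [c ->] := h3 _ tk.
  by rewrite (galX hE hs) ?(galX hE ht) ?e //; exact: lamE.
- split; first exact: fieldE_i.
  exists 0%N => sg tau hs ht _; have fi : K (sqrtC (-1)) := sqrt_pm_i p_gt0.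
  by rewrite (gal_fix hs) ?(gal_fix ht).
Qed.

End GaloisParameters.

(** * The twisted Galois action *)

Section TwistedAction.
Context {R : realType} {F : nonArchLocalFieldType}.
Local Notation C := R[i].
Variables (p : nat) (p_char : is_residue_char F p) (p_neq2 : p != 2%N).
Variables (lam : F -> C).
Hypotheses (lam_char : unitary_character lam) (lam_nontrivial : exists t, lam t != 1).
Variables (eps : F) (eps_unit : primering_units eps) (eps_prim : (p.-1).-primitive_root eps).
Local Notation O := (val_ge (@lval F)).
Local Notation E := (fieldE lam).
Local Notation K := (sqrt_pm (R := R) p).
Local Notation Cy := (cyclo_i (R := R) p).
Variables (eta : C -> C) (eta_gal : Gal E K eta) (eta_eps : acts_as lam p eta (eps ^+ 2)).
Variables (u : C) (u_cyclo : Cy u) (u_norm : normC Cy K u = -1).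
Local Notation sl := (lam_level p_char lam_char lam_nontrivial).
Local Notation h := (p.-1./2).
Local Notation par := (gal_param p lam eps).
Let hE : subfieldC E := Qadj_subfield _.
Let hCy : subfieldC Cy := Qadj_subfield _.
Let ue : vunit eps := eps_vunit p_char eps_unit eps_prim.
Let CE : Cy `<=` E := cyclo_fieldE p_char lam_char lam_nontrivial.

(** The scalar of [Aop] on odd functions; in i it is a cocycle for the powers of eta. *)
Definition eta_prod i : C := \prod_(0 <= l < i) iter l eta u.
Local Notation U := eta_prod.

Lemma eta_prod_cyclo i : Cy (U i).
Proof.
apply: (sf_prod hCy) => l _.
exact: (eta_cyclo_in p_char lam_char lam_nontrivial eta_gal).
Qed.

Lemma eta_prod_E i : E (U i). Proof. exact: (CE (eta_prod_cyclo i)). Qed.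

Lemma eta_prodD i j : U (i + j) = U i * iter i eta (U j).
Proof.
have hi := gal_iter i eta_gal.
rewrite {1}/eta_prod (big_cat_nat (n := i)) ?leq_addr //=; congr (_ * _).
rewrite (gal_prod hE hi) => [|l _]; last first.
  exact: (CE (eta_cyclo_in p_char lam_char lam_nontrivial eta_gal l u_cyclo)).
rewrite -[X in \prod_(X <= _ < _) _]add0n [(i + j)%N]addnC big_addn addnK; apply: eq_bigr => l _.
by rewrite addnC iterD.
Qed.

Lemma eta_prod_half : U h = -1.
Proof.
rewrite -u_norm.
exact/esym/(eta_norm p_char p_neq2 lam_char lam_nontrivial eps_unit eps_prim eta_gal eta_eps).
Qed.

Lemma eta_prod_halfD k : U (k + h) = - U k.
Proof.
have hk := gal_iter k eta_gal.
by rewrite eta_prodD eta_prod_half (galN hE hk) ?(gal1 hE hk) ?mulrN1 //; exact: sf1.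
Qed.

Lemma eps_half : eps ^+ h = -1.
Proof.
have /eqP : (eps ^+ h) ^+ 2 = 1.
  by rewrite -exprM mulnC -(p1_half p_char p_neq2) (prim_expr_order eps_prim).
rewrite sqrf_eq1 => /orP[/eqP e|/eqP //].
have h0 := half_gt0 p_char p_neq2 eps_prim.
have : (p.-1 %| h)%N by rewrite (prim_order_dvd eps_prim) e.
by move=> /(dvdn_leq h0); have := p1_half p_char p_neq2; move: h0; move: h => a; lia.
Qed.

Definition gal_scalar sg : F := eps ^+ (par sg).1 * (par sg).2.
Local Notation ts := gal_scalar.

Lemma gal_scalar_vunit sg : Gal E K sg -> vunit (ts sg).
Proof.
move=> hs; have [_ us _] := gal_paramP p_char p_neq2 lam_char lam_nontrivial eps_unit eps_prim hs.
by apply: vunitM; [exact: vunitX|exact: one_units_vunit us].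
Qed.

Lemma gal_scalarE sg t : Gal E K sg -> sg (lam t) = lam (ts sg ^+ 2 * t).
Proof.
move=> hs; have [_ _ ->] := gal_paramP p_char p_neq2 lam_char lam_nontrivial eps_unit eps_prim hs.
by congr lam; rewrite /gal_scalar exprMn -exprM mulnC.
Qed.

(* The scalars of composable elements multiply only up to sign; the norm
   condition on [u] makes the products [eta_prod] absorb that sign. *)
Lemma gal_scalar_comp sg tau : Gal E K sg -> Gal E K tau ->
  let i := (par sg).1 in let j := (par tau).1 in let k := (par (sg \o tau)).1 in
  (U (i + j) = U k /\ ts (sg \o tau) = ts sg * ts tau) \/
  (U (i + j) = - U k /\ ts (sg \o tau) = - (ts sg * ts tau)).
Proof.
move=> hs ht /=; have := gal_param_comp p_char p_neq2 lam_char lam_nontrivial eps_unit eps_prim hs ht.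
rewrite /gal_scalar; case: (par sg) => i s; case: (par tau) => j t; case: (par _) => k w /=.
move=> [-> [->|e]]; [left|right]; first by split=> //; rewrite exprD; ring.
split; first by rewrite -e eta_prod_halfD.
have : eps ^+ (k + h) = eps ^+ (i + j) by rewrite e.
by rewrite !exprD eps_half mulrN1 => /(canRL (@opprK _)) ->; ring.
Qed.

Variable n : nat.
Implicit Types (f : 'rV[F]_n -> C) (sg tau : C -> C).

(* [delta sg (sg \o f)] in coordinates. *)
Definition twist sg f : 'rV[F]_n -> C := fun x =>
  (1 + U (par sg).1) / 2 * sg (f ((ts sg)^-1 *: x)) +
  (1 - U (par sg).1) / 2 * sg (f (- ((ts sg)^-1 *: x))).

Lemma twist_val sg f : Gal E K sg -> (forall x, E (f x)) -> forall x, E (twist sg f x).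
Proof.
move=> hs Ef x; have EU := eta_prod_E (par sg).1; have E2 := sf_nat hE 2; have E1 := sf1 hE.
apply: (sfD hE); apply: (sfM hE); try exact: (gal_in hs).
  by apply: (sfdiv hE) => //; exact: (sfD hE).
by apply: (sfdiv hE) => //; exact: (sfB hE).
Qed.

Lemma twist_level m sg f : Gal E K sg -> level m f -> level m (twist sg f).
Proof.
move=> hs [l1 l2]; have us := vunitV (gal_scalar_vunit hs).
have LN m' z : latt n m' z -> latt n m' (- z) := subgroupN (latt_subgroup n m').
split=> [x y xy|x].
  have h1 : latt n m ((ts sg)^-1 *: x - (ts sg)^-1 *: y) by rewrite -scalerBr; apply/latt_vunit.
  rewrite /twist (l1 _ _ h1); congr (_ + _ * sg _); apply: l1; rewrite -opprD.
  exact: LN.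
move=> fx; apply/(latt_vunit _ _ us).
have [f1|/l2//] := eqVneq (f ((ts sg)^-1 *: x)) 0.
have [f2|/l2/LN] := eqVneq (f (- ((ts sg)^-1 *: x))) 0; last by rewrite opprK.
by move: fx; rewrite /twist f1 f2 (gal0 hE hs) !mulr0 addr0 eqxx.
Qed.

Lemma twist_lin sg a f g : Gal E K sg -> E a -> (forall x, E (f x)) -> (forall x, E (g x)) ->
  twist sg (fun x => a * f x + g x) = (fun x => sg a * twist sg f x + twist sg g x).
Proof.
move=> hs Ea Ef Eg; apply/funext => x; rewrite /twist.
by rewrite !(galD hs, galM hs) //; try exact: (sfM hE); ring.
Qed.

(** On even functions the sign ambiguity of the dilations is invisible; on odd functions it is
    cancelled by the sign of [eta_prod], according to the two cases of [gal_scalar_comp]. *)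
Lemma twist_comp sg tau f : Gal E K sg -> Gal E K tau -> (forall x, E (f x)) ->
  twist sg (twist tau f) = twist (sg \o tau) f.
Proof.
move=> hs ht Ef; apply/funext => x; rewrite {1}/twist.
have E2 := sf_nat hE 2; have E1 := sf1 hE; have EU := eta_prod_E (par tau).1.
have Es y : E (tau (f y)) by exact: (gal_in ht).
have EA : E ((1 + U (par tau).1) / 2) by apply: (sfdiv hE) => //; exact: (sfD hE).
have EB : E ((1 - U (par tau).1) / 2) by apply: (sfdiv hE) => //; exact: (sfB hE).
have tw y : sg (twist tau f y) = (1 + sg (U (par tau).1)) / 2 * sg (tau (f ((ts tau)^-1 *: y))) +
    (1 - sg (U (par tau).1)) / 2 * sg (tau (f (- ((ts tau)^-1 *: y)))).
  have sA : sg ((1 + U (par tau).1) / 2) = (1 + sg (U (par tau).1)) / 2.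
    by rewrite (galdiv hE hs) ?(galD hs) ?(gal1 hE hs) ?(gal_nat hE hs) //; exact: (sfD hE).
  have sB : sg ((1 - U (par tau).1) / 2) = (1 - sg (U (par tau).1)) / 2.
    by rewrite (galdiv hE hs) ?(galB hE hs) ?(gal1 hE hs) ?(gal_nat hE hs) //; exact: (sfB hE).
  rewrite /twist; move: ((1 + _) / 2) ((1 - _) / 2) sA sB EA EB => A B sA sB EA EB.
  by rewrite (galD hs) ?(galM hs EA) ?(galM hs EB) ?sA ?sB //; apply: (sfM hE).
rewrite !tw !scalerN !opprK !scalerA -!invfM.
have Us : sg (U (par tau).1) = iter (par sg).1 eta (U (par tau).1).
  exact: (gal_eta p_char p_neq2 lam_char lam_nontrivial eps_unit eps_prim eta_gal eta_eps hs (eta_prod_cyclo _)).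
have UU := eta_prodD (par sg).1 (par tau).1; rewrite -Us in UU.
have t2 : (2 : C) != 0 by rewrite pnatr_eq0.
rewrite /twist /=; have [[e1 e2]|[e1 e2]] := gal_scalar_comp hs ht; rewrite e2 ?invrN ?scaleNr ?opprK.
  rewrite [ts tau * _]mulrC -e1 UU; move: (sg (tau _)) (sg (tau _)) (U _) (sg (U _)) => a b c d.
  by field.
have -> : U (par (sg \o tau)).1 = - (U (par sg).1 * sg (U (par tau).1)) by rewrite -UU e1 opprK.
rewrite [ts tau * _]mulrC.
move: (sg (tau _)) (sg (tau _)) (U _) (sg (U _)) => a b c d.
by field.
Qed.

Lemma twist_id f : (forall x, E (f x)) -> twist id f = f.
Proof.
move=> Ef; have hid : Gal E K id := gal_id _ _.
have := gal_param_comp p_char p_neq2 lam_char lam_nontrivial eps_unit eps_prim hid hid.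
have := gal_paramP p_char p_neq2 lam_char lam_nontrivial eps_unit eps_prim hid.
rewrite (_ : id \o id = id :> (C -> C)) // /twist /gal_scalar; case: (par id) => i s /=.
move=> [/andP[i1 _] /one_units_vunit us _] [ss ii].
(* The identity is encoded by i = h, not by 0: the signs [U h] = -1 and eps^h = -1 compensate each
   other. *)
have s1 : s = 1 by apply: (mulfI (vunit_neq0 (us p_char))); rewrite mulr1.
have -> : i = h by case: ii => [|/eqP]; [lia|rewrite eqn_add2l => /eqP].
rewrite s1 eta_prod_half eps_half; apply/funext => x.
rewrite mulr1 invrN invr1 scaleN1r opprK subrr mul0r mul0r add0r opprK.
by rewrite divff ?mul1r // pnatr_eq0.
Qed.

(** f takes finitely many values, each controlled by one level, and dilations by sufficiently close
    units agree on functions of a given level. *)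
Lemma twist_close m f : level m f -> (forall x, E (f x)) ->
  exists k, forall sg tau, Gal E K sg -> Gal E K tau -> sg (lam (sl k)) = tau (lam (sl k)) ->
    twist sg f = twist tau f.
Proof.
move=> lf Ef; have [l1 l2] := lf.
have [m0 [m00 [f1 f2] _]] := sch2 (ex_intro (fun m => level m f) m lf) (ex_intro (fun m => level m f) m lf).
have mm : - m0 <= m0 by lia.
have [Rr [uR MR eR iR] _] := @latt_reps F n _ _ mm.
have [k hk] : exists k, forall r, r \in Rr -> forall sg tau, Gal E K sg -> Gal E K tau ->
    sg (lam (sl k)) = tau (lam (sl k)) -> sg (f r) = tau (f r).
  elim: {uR MR eR iR} Rr => [|r Rr [k hk]]; first by exists 0%N.
  have [k' hk'] := gal_level_ex p_char lam_char lam_nontrivial (Ef r).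
  exists (maxn k k') => r'; rewrite inE => /orP[/eqP->|rR] sg tau hs ht e.
    by apply: hk' => //; apply: (lam_level_le _ hs ht e); exact: leq_maxr.
  by apply: hk => //; apply: (lam_level_le _ hs ht e); exact: leq_maxl.
have hall sg tau : Gal E K sg -> Gal E K tau -> sg (lam (sl k)) = tau (lam (sl k)) ->
    forall x, sg (f x) = tau (f x).
  move=> hs ht e x; have [->|/f2/eR[r rR xr]] := eqVneq (f x) 0.
    by rewrite (gal0 hE hs) (gal0 hE ht).
  by rewrite (f1 _ _ xr); exact: hk.
(* k serves the values of f. A scalar of valuation at least 2 m0 maps the lattice of exponent -m0
   into that of exponent m0; the successor makes k2 positive. *)
pose k2 := (maxn k (`|m0| + `|m0|)).+1.
exists k2 => sg tau hs ht e.
have e1 : sg (lam (sl k)) = tau (lam (sl k)).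
  by apply: (lam_level_le _ hs ht e); rewrite /k2 ltnW // ltnS leq_maxl.
have k20 : (0 < k2)%N by [].
have [ei hO] := gal_param_close p_neq2 eps_unit eps_prim k20 hs ht e.
have us := gal_scalar_vunit hs; have ut := gal_scalar_vunit ht.
have tO : O k2%:Z ((ts sg)^-1 - (ts tau)^-1).
  have -> : (ts sg)^-1 - (ts tau)^-1 = (ts sg)^-1 * (ts tau)^-1 * - (ts sg - ts tau).
    by field; rewrite (vunit_neq0 us) (vunit_neq0 ut).
  apply: val_geMl; first by apply: vunit_ge0; apply: vunitM; exact: vunitV.
  apply: val_geN; rewrite /gal_scalar ei -mulrBr; apply: val_geMl => //.
  exact/vunit_ge0/vunitX.
have fE x : f ((ts sg)^-1 *: x) = f ((ts tau)^-1 *: x).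
  have [xm|xm] := pselect (latt n (- m0) x).
    apply: f1; rewrite -scalerBl; have h1 := latt_scale tO xm; apply: latt_le h1.
    by rewrite /k2; have := leq_maxr k (`|m0| + `|m0|)%N; move: (maxn _ _) => a; lia.
  have z v : vunit v -> f (v^-1 *: x) = 0.
    move=> uv; apply/eqP; apply: contra_notT xm => /f2 /latt_vunit; apply.
    exact: vunitV.
  by rewrite !z.
apply/funext => x; rewrite /twist ei -!scalerN !fE.
by rewrite !(hall _ _ hs ht e1).
Qed.

Definition twist_fixed f := forall sg, Gal E K sg -> twist sg f = f.

Lemma twist_sum sg I (r : seq I) (a : I -> C) (f : I -> 'rV[F]_n -> C) : Gal E K sg ->
  (forall i, E (a i)) -> (forall i x, E (f i x)) ->
  twist sg (fun x => \sum_(i <- r) a i * f i x) =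
  (fun x => \sum_(i <- r) sg (a i) * twist sg (f i) x).
Proof.
move=> hs Ea Ef; elim: r => [|i r IH].
  by apply/funext => x; rewrite /twist !big_nil (gal0 hE hs) !mulr0 addr0.
under eq_fun do rewrite big_cons.
rewrite twist_lin //; last by move=> x; apply: (sf_sum hE) => j; exact: (sfM hE).
by rewrite IH; apply/funext => x; rewrite big_cons.
Qed.

Lemma level_sum m I (r : seq I) (a : I -> C) (f : I -> 'rV[F]_n -> C) :
  (forall i, level m (f i)) -> level m (fun x => \sum_(i <- r) a i * f i x).
Proof.
move=> lf; elim: r => [|i r IH].
  by split=> [x y _|x]; rewrite !big_nil ?eqxx.
by under eq_fun do rewrite big_cons; exact: level_lin.
Qed.

(* The sums over representatives [sg] of [sg(zeta)^l sg(f)], for varying l, are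
   fixed; Lagrange interpolation at the distinct values [sg(zeta)] recovers f. *)
Lemma twist_descent m f : level m f -> (forall x, E (f x)) ->
  exists (N : nat) (c : nat -> C) (T : nat -> 'rV[F]_n -> C),
  [/\ forall l, E (c l), forall l, [/\ level m (T l), forall x, E (T l x) & twist_fixed (T l)] &
      f = (fun x => \sum_(l < N) c l * T l x)].
Proof.
move=> lf Ef; have [k hk] := twist_close lf Ef.
pose z := lam (sl k); have Ez : E z by exact: lamE.
have [zk _ _] := lam_levelP p_char lam_char lam_nontrivial k.
have [|d pd _] := prim_order_exists _ zk; first by rewrite expn_gt0 prime_gt0 // (char_prime p_char).
have d0 := prim_order_gt0 pd.
pose att v := `[< exists2 sg, Gal E K sg & sg z = v >].
(* The conjugates of z, found among its powers. *)
pose vs := [seq v <- undup [seq z ^+ j | j <- iota 0 d] | att v].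
have vsP v : v \in vs <-> exists2 sg, Gal E K sg & sg z = v.
  rewrite mem_filter mem_undup; split=> [/andP[/asboolP //]|[sg hs <-]].
  apply/andP; split; first by apply/asboolP; exists sg.
  have [j ->] : exists j, sg z = z ^+ j.
    by apply: (unity_root_pow pd); rewrite -(galX hE hs) // (prim_expr_order pd) (gal1 hE hs).
  by apply/mapP; exists (j %% d)%N; rewrite ?prim_expr_mod // mem_iota add0n ltn_mod.
have uvs : uniq vs by rewrite filter_uniq ?undup_uniq.
have Evs v : v \in vs -> E v by move=> /vsP[sg hs <-]; exact: (gal_in hs).
(* A chosen automorphism for each conjugate. The default [id] makes [G v] meaningful for every v, as
   the lemmas on indexed sums require; [ev] has its default 0 for the same reason. *)
pose gs v := if pselect (exists sg, Gal E K sg /\ sg z = v) is left e then projT1 (cid e) else id.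
have gsP v : v \in vs -> Gal E K (gs v) /\ gs v z = v.
  by move=> /vsP[sg hs sz]; rewrite /gs; case: pselect => [e|[]]; [case: cid|exists sg].
have gsG v : Gal E K (gs v).
  by rewrite /gs; case: pselect => [e|_]; [case: cid => g []|exact: gal_id].
pose G v := twist (gs v) f; have EG v x : E (G v x) by exact: twist_val.
have lG v : level m (G v) by exact: twist_level.
pose ev v := if v \in vs then v else 0.
have Eev v : E (ev v) by rewrite /ev; case: ifP => [/Evs//|_]; exact: (sf0 hE).
pose T l x := \sum_(v <- vs) ev v ^+ l * G v x.
have TE l x : T l x = \sum_(v <- vs) v ^+ l * G v x.
  by rewrite /T big_seq [RHS]big_seq; apply: eq_bigr => v hv; rewrite /ev hv.
have zvs : z \in vs by apply/vsP; exists id => //; exact: gal_id.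
(* Lagrange polynomial: [Q] is 1 at z and 0 at the other conjugates, and its coefficients lie in
   E. *)
pose q := \prod_(w <- rem z vs) ('X - w%:P) : {poly C}.
pose Q := (q.[z])^-1 *: q.
exists (size Q), (fun l => Q`_l), T.
have qz : q.[z] != 0.
  rewrite -[_ == 0]/(root q z) /q root_prod_XsubC mem_rem_uniq // inE eqxx //.
split.
- have Eq l : E q`_l.
    have : q \is a polyOver (mem_sf hE).
      rewrite /q big_seq; apply: rpred_prod => w /mem_rem/Evs Ew.
      by rewrite polyOverXsubC; exact: mem_set.
    by move=> /polyOverP/(_ l) h; apply/set_mem.
  move=> l; rewrite coefZ; apply: (sfM hE) => //; apply: (sfV hE).
  rewrite horner_coef; apply: (sf_sum hE) => j; apply: (sfM hE) => //; exact: (sfX hE).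
- move=> l; split.
  + exact: level_sum.
  + by move=> x; apply: (sf_sum hE) => v; apply: (sfM hE) => //; exact: (sfX hE).
  move=> sg hs; rewrite /T twist_sum //; last by move=> v; exact: (sfX hE).
  apply/funext => x; rewrite -/(T l x) TE.
  (* sg permutes the conjugates, and twisting [G v] by sg gives [G (sg v)] by the choice of level
     k. *)
  have perm : perm_eq [seq sg v | v <- vs] vs.
    have us : uniq [seq sg v | v <- vs].
      by rewrite map_inj_in_uniq // => v w /Evs Ev /Evs Ew; exact: (gal_inj hs).
    have sub : {subset [seq sg v | v <- vs] <= vs}; last first.
      by apply: uniq_perm => //; apply: (uniq_min_size us sub _).2; rewrite size_map.
    move=> w /mapP[v /vsP[tau ht <-] ->]; apply/vsP; exists (sg \o tau) => //.
    exact: gal_comp.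
  rewrite -[RHS](perm_big _ perm) /= big_map big_seq [RHS]big_seq; apply: eq_bigr => v hv.
  have [gv ev1] := gsP v hv; rewrite {1}/ev hv (galX hE hs); last exact: Evs.
  have svs : sg v \in vs by apply/vsP; exists (sg \o gs v); [exact: gal_comp|rewrite /= ev1].
  have [gsv ev2] := gsP _ svs.
  congr (_ * _); rewrite /G twist_comp //; congr (_ x); apply: hk => //; first exact: gal_comp.
  by rewrite /= -/z ev1 ev2.
- apply/funext => x; under eq_bigr => l _ do rewrite TE mulr_sumr.
  rewrite exchange_big /= (bigD1_seq z) //= [X in _ + X]big_seq_cond [X in _ + X]big1 ?addr0.
    have -> : \sum_(l < size Q) Q`_l * (z ^+ l * G z x) = Q.[z] * G z x.
      by rewrite horner_coef mulr_suml; apply: eq_bigr => l _; rewrite mulrA.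
    rewrite /Q hornerZ mulVf // mul1r /G -[in LHS](twist_id Ef).
    have [gz ez] := gsP z zvs; congr (_ x); apply: hk => //; exact: gal_id.
  move=> v /andP[hv vz].
  have -> : \sum_(l < size Q) Q`_l * (v ^+ l * G v x) = Q.[v] * G v x.
    by rewrite horner_coef mulr_suml; apply: eq_bigr => l _; rewrite mulrA.
  have : root q v by rewrite /q root_prod_XsubC mem_rem_uniq // inE vz.
  by rewrite /Q hornerZ => /eqP->; rewrite mulr0 mul0r.
Qed.

End TwistedAction.

(** * Bases adapted to a filtration *)

Section FilteredBasis.
Context {R : realType}.
Local Notation C := R[i].
Variables (E : set C) (hE : subfieldC E) (T : Type).
Local Notation fn := (T -> C).
Local Notation zero := ((fun=> 0) : fn).
Variables (L : nat -> set fn) (N : nat -> nat) (pts : forall m, 'I_(N m) -> T).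
Arguments pts : clear implicits.
Hypothesis L_val : forall m f, L m f -> forall x, E (f x).
Hypothesis L_mono : forall m f, L m f -> L m.+1 f.
Hypothesis L_lin : forall m a f g, E a -> L m f -> L m g -> L m (fun x => a * f x + g x).
Hypothesis L_0 : forall m, L m zero.
Hypothesis L_ext : forall m f, L m f -> (forall j, f (pts m j) = 0) -> f = zero.
Hypothesis L_delta : forall m j, exists2 f, L m f & forall j', f (pts m j') = (j' == j)%:R.

(** Families are sequences of which the first k terms count, so that bases of all the spaces [L m]
    can be initial segments of one sequence. *)
Definition lincomb k (e : nat -> fn) (c : nat -> C) : fn := fun x => \sum_(i < k) c i * e i x.
Definition free_on k (e : nat -> fn) : Prop := forall c, (forall i, E (c i)) ->
  lincomb k e c = zero -> forall i, (i < k)%N -> c i = 0.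

Lemma lincomb_in m k e c : (forall i, E (c i)) -> (forall i, (i < k)%N -> L m (e i)) ->
  L m (lincomb k e c).
Proof.
move=> Ec; elim: k => [|k IH] Le.
  by rewrite (_ : lincomb _ _ _ = zero) //; apply/funext => x; rewrite /lincomb big_ord0.
rewrite (_ : lincomb _ _ _ = fun x => c k * e k x + lincomb k e c x); last first.
  by apply/funext => x; rewrite /lincomb big_ord_recr addrC.
by apply: L_lin; [exact: Ec|exact: Le|apply: IH => i ik; apply: Le; exact: ltnW].
Qed.

Let mkE (x : C) : subF hE := insubd 0 x.
Let mkEK x : E x -> val (mkE x) = x.
Proof. by move=> Ex; rewrite /mkE val_insubd (_ : (x \in mem_sf hE) = true) //; exact: mem_set. Qed.

Let valM (a b : subF hE) : val (a * b) = val a * val b. Proof. by rewrite rmorphM. Qed.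
Let val_sum k (f : 'I_k -> subF hE) : val (\sum_i f i) = \sum_i val (f i).
Proof. by rewrite raddf_sum. Qed.

(** Evaluation at the points; by [L_ext] and [L_delta] it identifies [L m] with row vectors of
    length [N m] over E. *)
Let rowof m (f : fn) : 'rV[subF hE]_(N m) := \row_j mkE (f (pts m j)).
Let mxof m k (e : nat -> fn) : 'M[subF hE]_(k, N m) := \matrix_(i, j) mkE (e i (pts m j)).

Let ext k (v : 'rV[subF hE]_k) (i : nat) : C := if insub i is Some j then val (v 0 j) else 0.
Let extE k (v : 'rV[subF hE]_k) (i : 'I_k) : ext v i = val (v 0 i).
Proof. by rewrite /ext insubT //= => h; congr (val (v 0 _)); apply/val_inj. Qed.
Let ext_val k (v : 'rV[subF hE]_k) i : E (ext v i).
Proof. by rewrite /ext; case: insub => [j|]; [exact: subF_val|exact: sf0]. Qed.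

Let mul_mxof m k e (v : 'rV[subF hE]_k) j : (forall i, (i < k)%N -> L m (e i)) ->
  val ((v *m mxof m k e) 0 j) = lincomb k e (ext v) (pts m j).
Proof.
move=> Le; rewrite mxE val_sum /lincomb; apply: eq_bigr => i _.
by rewrite valM mxE extE mkEK //; apply: (L_val (Le i _)).
Qed.

Lemma free_row_free m k e : (forall i, (i < k)%N -> L m (e i)) -> free_on k e -> row_free (mxof m k e).
Proof.
move=> Le fe; rewrite -kermx_eq0; apply/rowV0P => v /sub_kermxP vA.
have z : lincomb k e (ext v) = zero.
  apply: (@L_ext m); first by apply: lincomb_in => // i; exact: ext_val.
  by move=> j; rewrite -mul_mxof // vA mxE rmorph0.
apply/rowP => i; apply/val_inj; rewrite mxE rmorph0 -extE; by apply: fe => // i'; exact: ext_val.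
Qed.

Lemma free_leq m k e : (forall i, (i < k)%N -> L m (e i)) -> free_on k e -> (k <= N m)%N.
Proof. by move=> Le fe; have /eqP <- := free_row_free Le fe; exact: rank_leq_col. Qed.

Lemma free_span m e : (forall i, (i < N m)%N -> L m (e i)) -> free_on (N m) e ->
  forall f, L m f -> exists2 c, (forall i, E (c i)) & f = lincomb (N m) e c.
Proof.
move=> Le fe f Lf; have := free_row_free Le fe; rewrite /row_free => rf.
have /submxP[v ev] : (rowof m f <= mxof m (N m) e)%MS by apply: submx_full; rewrite /row_full.
exists (ext v) => [i|]; first exact: ext_val.
have Lc : L m (lincomb (N m) e (ext v)) by apply: lincomb_in => // i; exact: ext_val.
have := @L_ext m _ (L_lin (sfN hE (sf1 hE)) Lc Lf) => h; apply/funext => x.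
have /(congr1 (fun g => g x)) : (fun x => -1 * lincomb (N m) e (ext v) x + f x) = zero.
  apply: h => j; rewrite -mul_mxof // -ev mxE mkEK; last exact: (L_val Lf).
  by rewrite mulN1r addNr.
by rewrite mulN1r addrC => /eqP; rewrite subr_eq0 => /eqP.
Qed.

Lemma free_rcons k e f : (forall i x, (i < k)%N -> E (e i x)) -> (forall x, E (f x)) -> free_on k e ->
  (~ exists2 c, (forall i, E (c i)) & f = lincomb k e c) ->
  free_on k.+1 (fun i => if (i < k)%N then e i else f).
Proof.
move=> Ee Ef fe nf c Ec; set e' := fun i => _.
have lE x : lincomb k.+1 e' c x = lincomb k e c x + c k * f x.
  rewrite /lincomb big_ord_recr /= /e' ltnn; congr (_ + _); apply: eq_bigr => i _.
  by rewrite ltn_ord.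
move=> l0; have ck : c k = 0.
  apply/eqP/negPn/negP => ck; apply: nf; exists (fun i => - c i / c k).
    by move=> i; apply: (sfdiv hE); [apply: (sfN hE)|]; exact: Ec.
  apply/funext => x; have /eqP := congr1 (fun g => g x) l0; rewrite lE addr_eq0 => /eqP e1.
  have -> : lincomb k e (fun i => - c i / c k) x = - lincomb k e c x / c k.
    by rewrite /lincomb -sumrN mulr_suml; apply: eq_bigr => i _; rewrite mulNr mulNr mulrAC -mulNr.
  by rewrite e1 opprK mulrC mulKf.
move=> i; rewrite ltnS leq_eqVlt => /orP[/eqP->//|ik]; apply: (fe c Ec) => //.
by apply/funext => x; have := congr1 (fun g => g x) l0; rewrite lE ck mul0r addr0.
Qed.

Section Invariants.
Variable S : set fn.
Hypothesis S_span : forall m f, L m f -> exists k (c : nat -> C) (e : nat -> fn),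
  [/\ forall i, E (c i), forall i, L m (e i) /\ S (e i) & f = lincomb k e c].

(** S spans [L m], of dimension [N m] > k; so S cannot lie in the span of k functions there. *)
Lemma not_span m k e : (k < N m)%N -> (forall i, (i < k)%N -> L m (e i)) ->
  exists f, [/\ S f, L m f & ~ exists2 c, (forall i, E (c i)) & f = lincomb k e c].
Proof.
move=> kN Le; apply: contrapT => nex.
have hS f : S f -> L m f -> (rowof m f <= mxof m k e)%MS.
  move=> Sf Lf; have [c Ec fE] : exists2 c, (forall i, E (c i)) & f = lincomb k e c.
    by apply: contrapT => h; apply: nex; exists f.
  apply/submxP; exists (\row_i mkE (c i)); apply/rowP => j; apply/val_inj.
  rewrite mul_mxof // mxE mkEK; last exact: (L_val Lf).
  rewrite {1}fE /lincomb; apply: eq_bigr => i _; congr (_ * _).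
  by rewrite extE mxE mkEK.
have full : (1%:M <= mxof m k e)%MS.
  apply/row_subP => j; have [d Ld dE] := L_delta j.
  have -> : row j 1%:M = rowof m d.
    apply/rowP => j'; apply/val_inj; rewrite !mxE mkEK; last exact: (L_val Ld).
    by rewrite dE eq_sym rmorph_nat.
  have [k' [c [e' [Ec Le' dE']]]] := S_span Ld.
  have -> : rowof m d = \sum_(i < k') mkE (c i) *: rowof m (e' i).
    apply/rowP => j'; apply/val_inj; rewrite summxE val_sum mxE mkEK; last exact: (L_val Ld).
    rewrite dE' /lincomb; apply: eq_bigr => i _; rewrite !mxE valM !mkEK //.
    by have [h _] := Le' i; exact: (L_val h).
  by apply: summx_sub => i _; apply: scalemx_sub; have [h1 h2] := Le' i; exact: hS.
have := mxrankS full; rewrite mxrank1 => h.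
by have := leq_trans h (rank_leq_row _); rewrite leqNgt kN.
Qed.

Lemma free_extend m k e : free_on k e -> (forall i, (i < k)%N -> L m (e i) /\ S (e i)) ->
  exists e', [/\ free_on (N m) e', forall i, (i < N m)%N -> L m (e' i) /\ S (e' i) &
                 forall i, (i < k)%N -> e' i = e i].
Proof.
move=> fe He; have kN : (k <= N m)%N by apply: (free_leq _ fe) => i /He[].
move: {2}(N m - k)%N (erefl (N m - k)%N) => d; elim: d k e fe He kN => [|d IH] k e fe He kN dE.
  have kE : k = N m by apply/eqP; rewrite eqn_leq kN -subn_eq0 dE.
  by rewrite -kE; exists e.
have kN' : (k < N m)%N by rewrite -subn_gt0 dE.
have Le i : (i < k)%N -> L m (e i) by move=> /He[].
have [f [Sf Lf nf]] := not_span kN' Le.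
have fr := free_rcons (fun i x ik => L_val (Le i ik) x) (L_val Lf) fe nf.
have hf i : (i < k.+1)%N -> L m (if (i < k)%N then e i else f) /\ S (if (i < k)%N then e i else f).
  by case: ifP => [ik _|_ _] //; exact: He.
have [|e' [h1 h2 h3]] := IH _ _ fr hf kN'; first by rewrite subnS dE.
by exists e'; split=> // i ik; rewrite h3 ?ik // ltnW.
Qed.

Definition filtered_basis (e : nat -> fn) : Prop := forall m,
  [/\ forall i, (i < N m)%N -> L m (e i), free_on (N m) e &
      forall f, L m f -> exists2 c, (forall i, E (c i)) & f = lincomb (N m) e c].

Lemma N_leS m : (N m <= N m.+1)%N.
Proof.
have f0 : free_on 0 (fun=> zero) by [].
have [|e [h1 h2 _]] := @free_extend m 0 (fun=> zero) f0; first by [].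
by apply: (@free_leq m.+1 _ e) => // i /h2[/L_mono].
Qed.

Lemma N_le m m' : (m <= m')%N -> (N m <= N m')%N.
Proof. by move=> /subnK <-; elim: (m' - m)%N => // d /leq_trans; apply; rewrite addSn; exact: N_leS. Qed.

Lemma filtered_basis_ex : exists2 e, filtered_basis e & forall m i, (i < N m)%N -> S (e i).
Proof.
pose good m e := free_on (N m) e /\ forall i, (i < N m)%N -> L m (e i) /\ S (e i).
have [b0 gb0] : exists b0, good 0%N b0.
  have f0 : free_on 0 (fun=> zero) by [].
  by have [|e [h1 h2 _]] := @free_extend 0%N 0 (fun=> zero) f0; [|exists e].
have stepP m b : exists b', good m b -> good m.+1 b' /\ forall i, (i < N m)%N -> b' i = b i.
  have [[fb hb]|nb] := pselect (good m b); last by exists b.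
  have [|e [h1 h2 h3]] := @free_extend m.+1 _ _ fb; last by exists e.
  by move=> i /hb[/L_mono].
pose step m b := projT1 (cid (stepP m b)).
pose B := fix B m := if m is m'.+1 then step m' (B m') else b0.
have gB m : good m (B m).
  by elim: m => [//|m IH] /=; rewrite /step; case: cid => b' /= /(_ IH)[].
have BS m i : (i < N m)%N -> B m.+1 i = B m i.
  by move=> im /=; rewrite /step; case: cid => b' /= /(_ (gB m))[_]; apply.
have BE m m' i : (m <= m')%N -> (i < N m)%N -> B m' i = B m i.
  move=> /subnK <- im; elim: (m' - m)%N => // d IH; rewrite addSn BS //.
  by apply: leq_trans im (N_le _); exact: leq_addl.
(* The i-th function is read at any stage that contains it; later stages keep it. *)
pose e i := B (xget 0%N [set m | (i < N m)%N]) i.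
have eE m i : (i < N m)%N -> e i = B m i.
  move=> im; rewrite /e; case: xgetP => [m' _ /= im'|h]; last by have := h m; rewrite /= im.
  by case: (leqP m m') => [mm|/ltnW mm]; [exact: BE|rewrite (BE _ _ _ mm)].
have ge m : good m e.
  have [fB hB] := gB m; split=> [c Ec l0 i im|i im]; last by rewrite (eE m) //; exact: hB.
  apply: (fB c Ec) => //; rewrite -l0; apply/funext => x; apply: eq_bigr => j _.
  by rewrite (eE m).
exists e => [m|m i im]; last by have [_ /(_ i im)[]] := ge m.
have [fe he] := ge m; have Le i : (i < N m)%N -> L m (e i) by move=> /he[].
by split=> //; exact: free_span.
Qed.
End Invariants.

Section BasisChange.
Hypothesis N_le' : forall m m', (m <= m')%N -> (N m <= N m')%N.

(** A relation, since the coordinates are taken at an unspecified level; by [same_coords_fun] the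
    choice has no influence. *)
Definition same_coords (e e' : nat -> fn) (f g : fn) : Prop := exists m, exists2 c,
  (forall i, E (c i)) & f = lincomb (N m) e c /\ g = lincomb (N m) e' c.

Lemma lincomb_pad k k' e c : (k <= k')%N ->
  lincomb k e c = lincomb k' e (fun i => if (i < k)%N then c i else 0).
Proof.
move=> kk; apply/funext => x; rewrite /lincomb.
rewrite -(big_mkord xpredT (fun i => c i * e i x)).
rewrite -(big_mkord xpredT (fun i => (if (i < k)%N then c i else 0) * e i x)).
rewrite [RHS](big_cat_nat (n := k)) //=.
have -> : \sum_(k <= i < k') (if (i < k)%N then c i else 0) * e i x = 0.
  by rewrite big_nat_cond big1 // => i /andP[/andP[ki _] _]; rewrite ltnNge ki mul0r.
rewrite addr0 big_nat_cond [RHS]big_nat_cond; apply: eq_bigr => i /andP[/andP[_ ik] _].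
by rewrite ik.
Qed.

Lemma same_coords_fun e e' f g g' : filtered_basis e -> same_coords e e' f g -> same_coords e e' f g' ->
  g = g'.
Proof.
move=> be [m [c Ec [fE gE]]] [m' [c' Ec' [fE' gE']]].
pose M := maxn m m'; have mM := N_le' (leq_maxl m m'); have mM' := N_le' (leq_maxr m m').
have [_ fr _] := be M.
move: fE fE' gE gE'; rewrite !(lincomb_pad _ _ mM) !(lincomb_pad _ _ mM').
set d := fun i => _; set d' := fun i => _ => fE fE' -> ->.
have Ed i : E (d i) by rewrite /d; case: ifP => // _; exact: sf0.
have Ed' i : E (d' i) by rewrite /d'; case: ifP => // _; exact: sf0.
have dd i : (i < N M)%N -> d i = d' i.
  move=> iM; apply/eqP; rewrite -subr_eq0; apply/eqP; apply: (fr (fun i => d i - d' i)) => //.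
    by move=> j; exact: (sfB hE).
  apply/funext => x; rewrite /lincomb; under eq_bigr do rewrite mulrBl.
  by rewrite sumrB; apply/eqP; rewrite subr_eq0; apply/eqP; exact: (congr1 (fun h : fn => h x) (etrans (esym fE) fE')).
by apply/funext => x; apply: eq_bigr => i _; rewrite dd.
Qed.

Lemma same_coords_sym e e' f g : same_coords e e' f g -> same_coords e' e g f.
Proof. by move=> [m [c Ec [h1 h2]]]; exists m, c. Qed.

Lemma same_coords_ex m e e' f : filtered_basis e -> filtered_basis e' -> L m f ->
  exists2 g, same_coords e e' f g & L m g.
Proof.
move=> be be' Lf; have [_ _ /(_ _ Lf)[c Ec fE]] := be m.
exists (lincomb (N m) e' c); first by exists m, c.
by have [Le _ _] := be' m; apply: lincomb_in.
Qed.

Definition basis_change (e e' : nat -> fn) (f : fn) : fn :=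
  if pselect (exists g, same_coords e e' f g) is left h then projT1 (cid h) else zero.

Variables (e e' : nat -> fn) (be : filtered_basis e) (be' : filtered_basis e').

Lemma basis_changeE f g : same_coords e e' f g -> basis_change e e' f = g.
Proof.
move=> h; rewrite /basis_change; case: pselect => [h'|[]]; last by exists g.
by case: cid => g' /= hg'; exact: same_coords_fun hg' h.
Qed.

Lemma basis_changeP m f : L m f -> same_coords e e' f (basis_change e e' f) /\ L m (basis_change e e' f).
Proof. by move=> /(same_coords_ex be be')[g h Lg]; rewrite (basis_changeE h). Qed.
End BasisChange.
End FilteredBasis.

(** * Descent of the Weil representation *)

Section Descent.
Context {R : realType} {F : nonArchLocalFieldType}.
Local Notation C := R[i].
Variables (p : nat) (p_char : is_residue_char F p) (p_neq2 : p != 2%N).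
Variables (lam : F -> C).
Hypotheses (lam_char : unitary_character lam) (lam_nontrivial : exists t, lam t != 1).
Variables (mu : {measure set (borelF F) -> \bar R}).
Hypotheses (mu_haar : is_haar mu) (mu_dual : self_dual lam mu).
Variable V : sympl_space F.
Variables (eps : F) (eps_unit : primering_units eps) (eps_prim : (p.-1).-primitive_root eps).
Local Notation E := (fieldE lam).
Local Notation K := (sqrt_pm (R := R) p).
Variables (eta : C -> C) (eta_gal : Gal E K eta) (eta_eps : acts_as lam p eta (eps ^+ 2)).
Variables (u : C) (u_cyclo : cyclo_i p u) (u_norm : normC (cyclo_i p) K u = -1).
Local Notation n := (sn V).
Local Notation X := (subvs_of (sX V)).
Local Notation fn := (X -> C).
Local Notation W := (weil (V := V) lam mu).
Local Notation xv := (@Xvec F V).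
Local Notation xr := (@Xrow F V).
Local Notation Wc := (weilc (V := V) lam mu).
Local Notation SE := (SX (V := V) E).
Local Notation SK := (SX (V := V) K).
Local Notation tw := (@twist R F p lam eps eta u n).
Implicit Types (phi psi : fn) (sg tau : C -> C) (g : 'End(V)).
Let hE : subfieldC E := Qadj_subfield _.
Let hK := sqrt_pm_subfield (R := R) p.
Let unit2 : vunit (2 : F) := vunit2 p_char p_neq2.
Let KE : K `<=` E := sqrt_pm_fieldE p_char p_neq2 lam_char lam_nontrivial eps_unit eps_prim.

Lemma SX_P (A : set C) phi : SX (V := V) A phi <-> (forall x, A (phi x)) /\ sch (phi \o xv).
Proof.
rewrite /SX /= (schwartzP A); split=> -[h1 h2]; split=> // x; last exact: h1.
by rewrite -(XrowK x); exact: h1.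
Qed.

Lemma weilE g phi x : W g phi x = Wc g (phi \o xv) (Xrow x).
Proof.
have e : (phi \o xv) \o xr = phi by apply/funext => y /=; rewrite XrowK.
by rewrite /weilc e XrowK.
Qed.

Let sqrt_fix x : (exists k : int, x ^+ 2 = (@resorder F)%:R ^ k) -> K x%:C.
Proof.
move=> [k e]; have [f qf] := resorder_pX p_char.
exact: (sqrt_pm_pow (prime_gt0 (char_prime p_char)) qf e).
Qed.

Let volE : forall m : int, exists k : int, vol mu m ^+ 2 = (@resorder F)%:R ^ k :=
  vol_sqr lam_char lam_nontrivial mu_haar mu_dual.

(** [twist] combines conjugations by the dilations of scalars t and -t; their squares agree, so
    [weilc_twist] applies to both. *)
Lemma weilc_twistE sg g f : Gal E K sg -> Sp V g -> sch f -> (forall x, E (f x)) ->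
  Wc g (tw sg f) = tw sg (Wc g f).
Proof.
move=> hs sg_ sf Ef; have us := gal_scalar_vunit p_char p_neq2 lam_char lam_nontrivial eps_unit eps_prim hs.
have s0 := gal0 hE hs.
have key t : vunit t -> (forall s, sg (lam s) = lam (t ^+ 2 * s)) ->
    (fun r => sg (Wc g f (t^-1 *: r))) = Wc g (fun x => sg (f (t^-1 *: x))).
  move=> ut ht; apply: (weilc_twist lam_char lam_nontrivial mu_haar unit2 sg_ ut sf
    (sf0 hE) (sfD hE) (sfM hE) (@lamE R F lam) _ volE (galD hs) (galM hs) ht Ef) => x hx.
  by split; [exact: (KE (sqrt_fix hx))|exact: (gal_fix hs (sqrt_fix hx))].
have k1 := key _ us (fun s => gal_scalarE p_char p_neq2 lam_char lam_nontrivial eps_unit eps_prim s hs).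
have k2 : (fun r => sg (Wc g f ((- gal_scalar p lam eps sg)^-1 *: r))) =
    Wc g (fun x => sg (f ((- gal_scalar p lam eps sg)^-1 *: x))).
  apply: key; first exact: vunitN.
  by move=> s; rewrite sqrrN; apply: (gal_scalarE p_char p_neq2 lam_char lam_nontrivial eps_unit eps_prim s hs).
have sft t : vunit t -> sch (fun x => sg (f (t^-1 *: x))).
  by move=> ut; apply: (@sch_scale _ _ _ _ (sg \o f)); [exact: vunitV|exact: sch_map].
have sf1 := sft _ us; have sf2 := sft _ (vunitN us).
pose A := (1 + eta_prod eta u (gal_param p lam eps sg).1) / 2.
pose B := (1 - eta_prod eta u (gal_param p lam eps sg).1) / 2.
(* One copy of the second term is split off with coefficient 1, to fit the form a f + g of
   linearity. *)
have twE f' : tw sg f' = fun x => A * sg (f' ((gal_scalar p lam eps sg)^-1 *: x)) +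
   ((B - 1) * sg (f' ((- gal_scalar p lam eps sg)^-1 *: x)) + sg (f' ((- gal_scalar p lam eps sg)^-1 *: x))).
  by apply/funext => x; rewrite /twist -/A -/B invrN scaleNr; ring.
have wl := @weilc_lin R F V lam mu lam_char lam_nontrivial mu_haar unit2 g.
rewrite !twE wl //; last exact: sch_lin.
by rewrite wl // -k1 -k2.
Qed.

Definition twistX sg psi : fn := tw sg (psi \o xv) \o xr.

Lemma twistX_vec sg psi : twistX sg psi \o xv = tw sg (psi \o xv).
Proof. by apply/funext => r; rewrite /twistX /= XvecK. Qed.

Lemma fn_eq phi psi : phi \o xv = psi \o xv -> phi = psi.
Proof. by move=> e; apply/funext => x; rewrite -(XrowK x); exact: (congr1 (fun h => h (Xrow x)) e). Qed.

Lemma twistX_SE sg psi : Gal E K sg -> SE psi -> SE (twistX sg psi).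
Proof.
move=> hs /SX_P[Ep [m lp]]; apply/SX_P; rewrite twistX_vec; split.
  move=> x; apply: (twist_val p_char lam_char lam_nontrivial eps eta_gal u_cyclo hs) => r; exact: Ep.
by exists m; apply: (twist_level p_char p_neq2 lam_char lam_nontrivial eps_unit eps_prim).
Qed.

Lemma weil_vec g psi : W g psi \o xv = Wc g (psi \o xv).
Proof. by apply/funext => r; rewrite /= weilE XvecK. Qed.

Lemma weil_SE g psi : Sp V g -> SE psi -> SE (W g psi).
Proof.
move=> sg /SX_P[Ep sp]; apply/SX_P; rewrite weil_vec; split; last exact: weilc_sch.
move=> x; rewrite weilE; apply: (weilc_valued lam_char lam_nontrivial mu_haar unit2 sg sp
  (sf0 hE) (sfD hE) (sfM hE) (@lamE R F lam) _ volE) => [y hy|r]; [exact: (KE (sqrt_fix hy))|exact: Ep].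
Qed.

Lemma weil_twistX sg g psi : Gal E K sg -> Sp V g -> SE psi -> W g (twistX sg psi) = twistX sg (W g psi).
Proof.
move=> hs sp /SX_P[Ep sp']; apply: fn_eq; rewrite weil_vec !twistX_vec weil_vec.
by apply: weilc_twistE => // r; exact: Ep.
Qed.

(** W of the dilation by -1 is f(x) |-> f(-x), so the two rho operators project to even and odd
    functions, and dilations by units bring in no scalar. *)
Lemma delta_twist sg psi : Gal E K sg -> SE psi ->
  delta lam mu p eps u eta sg (sg \o psi) = twistX sg psi.
Proof.
move=> hs /SX_P[Ep sp]; have us := gal_scalar_vunit p_char p_neq2 lam_char lam_nontrivial eps_unit eps_prim hs.
have Wd t phi : vunit t -> W (dilation V t) phi = fun x => phi (Xvec (t^-1 *: Xrow x)).
  by move=> ut; apply/funext => x; rewrite weilE (weilc_dilation lam_char mu_haar).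
have vm1 : vunit (-1 : F) by apply: vunitN; exact: vunit1.
apply/funext => x; rewrite /delta -/(gal_param p lam eps sg) /twistX /twist /gal_scalar /=.
move: us; rewrite /gal_scalar; case: (gal_param _ _ _ _) => i s /= us.
rewrite /Aop /rho_even /rho_odd /Dop /= !Wd // invrN invr1 !scaleN1r XvecK scalerN -/(eta_prod eta u i).
rewrite !compE; move: (sg _) (sg _) (eta_prod _ _ _) => a b c; by field.
Qed.

Lemma SE_gal sg psi : Gal E K sg -> SE psi -> SE (sg \o psi).
Proof.
move=> hs /SX_P[Ep sp]; apply/SX_P; split=> [x|]; first by apply: (gal_in hs); exact: Ep.
exact: (sch_map (gal0 hE hs) sp).
Qed.

Lemma SE_galinv sg phi : Gal E K sg -> SE phi ->
  SE ('pinv_id E sg \o phi) /\ sg \o ('pinv_id E sg \o phi) = phi.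
Proof.
move=> hs /SX_P[Ep sp]; have pE x : E x -> E ('pinv_id E sg x) /\ sg ('pinv_id E sg x) = x.
  move=> Ex; have [y Ey <-] := gal_surj hs Ex.
  have -> : 'pinv_id E sg (sg y) = y; last by [].
  apply: pinvKV; last by rewrite inE.
  by move=> a b /set_mem Ea /set_mem Eb; exact: (gal_inj hs).
have p0 : 'pinv_id E sg 0 = 0.
  have [h1 h2] := pE 0 (sf0 hE); apply: (gal_inj hs) => //; first exact: (sf0 hE).
  by rewrite h2 (gal0 hE hs).
split; last by apply/funext => x /=; exact: (pE _ (Ep x)).2.
apply/SX_P; split=> [x|]; first exact: (pE _ (Ep x)).1.
exact: (sch_map p0 sp).
Qed.

Lemma SK_SE phi : SK phi -> SE phi.
Proof. by move=> /SX_P[Kp sp]; apply/SX_P; split=> // x; exact: (KE (Kp x)). Qed.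

Lemma SK_fix sg phi : Gal E K sg -> SK phi -> sg \o phi = phi.
Proof. by move=> hs /SX_P[Kp sp]; apply/funext => x /=; exact: (gal_fix hs (Kp x)). Qed.

Lemma SK_fixed phi : SE phi -> (forall sg, Gal E K sg -> sg \o phi = phi) -> SK phi.
Proof.
move=> /SX_P[Ep sp] hf; apply/SX_P; split=> // x.
apply: (fieldE_fixed p_char p_neq2 lam_char lam_nontrivial eps_unit eps_prim (Ep x)) => sg hs.
exact: (congr1 (fun h : fn => h x) (hf sg hs)).
Qed.

Lemma SE_lin a phi psi : E a -> SE phi -> SE psi -> SE (fun x => a * phi x + psi x).
Proof.
move=> Ea /SX_P[E1 s1] /SX_P[E2 s2]; apply/SX_P; split=> [x|].
  by apply: (sfD hE) => //; exact: (sfM hE).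
exact: (sch_lin a s1 s2).
Qed.

Lemma weil_lin g : Sp V g -> linear_on E SE (W g).
Proof.
move=> sg a phi psi Ea /SX_P[E1 s1] /SX_P[E2 s2]; apply/funext => x; rewrite !weilE.
have := weilc_lin lam_char lam_nontrivial mu_haar unit2 a sg s1 s2.
by move=> /(congr1 (fun h => h (Xrow x))).
Qed.

Let ballX m : fn := @ball R F V m \o xr.

Let ballX_vec m : ballX m \o xv = @ball R F V m.
Proof. by apply/funext => r; rewrite /ballX !compE XvecK. Qed.

Let ballX_SK m : SK (ballX m).
Proof.
apply/SX_P; rewrite ballX_vec; split; last exact: ball_sch.
by move=> x; exact: (sf_nat hK).
Qed.

Let ballX_neq0 m : exists x, ballX m x != 0.
Proof.
exists (xv 0); rewrite -[_ (xv 0)]/((ballX m \o xv) 0) ballX_vec /ball asboolT ?oner_neq0 //.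
exact: (subgroup0 (latt_subgroup n m)).
Qed.

(** Schur's lemma yields complex constants; comparing values of a test function places them in a
    subfield. *)
Lemma scal_in (A : set C) c x y : subfieldC A -> x = c * y -> y != 0 -> A x -> A y -> A c.
Proof.
by move=> hA e y0 Ax Ay; have -> : c = x / y; [rewrite e mulfK|exact: (sfdiv hA)].
Qed.

Lemma weil_spinv g : Sp V g -> exists c, [/\ E c, c != 0 &
  forall phi, SE phi -> W g (W (spinv g) phi) = fun x => c * phi x].
Proof.
move=> sg; have [c c0 hc] := weilc_spinv lam_char lam_nontrivial mu_haar unit2 sg.
have sk := spinv_Sp sg.
have hX phi : SE phi -> W g (W (spinv g) phi) = fun x => c * phi x.
  move=> /SX_P[E1 s1]; apply: fn_eq; rewrite !weil_vec hc //.
exists c; split=> //; have [x bx] := ballX_neq0 0; have hb := SK_SE (ballX_SK 0).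
have /(congr1 (fun f : fn => f x)) e := hX _ hb.
apply: (scal_in hE e bx); last by have /SX_P[h _] := hb.
by have /SX_P[h _] := weil_SE sg (weil_SE sk hb).
Qed.

Lemma SE0 : SE (fun=> 0).
Proof. by apply/SX_P; split=> [x|]; [exact: (sf0 hE)|exists 0; split=> // x; rewrite eqxx]. Qed.

Lemma linear_on_inj (T : fn -> fn) : (forall phi, SE phi -> SE (T phi)) -> linear_on E SE T ->
  (forall phi, SE phi -> T phi = (fun=> 0) -> phi = fun=> 0) -> {in SE &, injective T}.
Proof.
move=> TE lT T0 phi psi /set_mem hp /set_mem hq e.
have Em1 : E (-1) by apply: (sfN hE); exact: (sf1 hE).
have : (fun x => -1 * phi x + psi x) = fun=> 0.
  apply: T0; first exact: SE_lin.
  by rewrite lT // e; apply/funext => x; rewrite mulN1r addNr.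
move=> h; apply/funext => x; have := congr1 (fun f : fn => f x) h.
by rewrite mulN1r addrC => /eqP; rewrite subr_eq0 => /eqP.
Qed.

Lemma linear_on0 (T : fn -> fn) : linear_on E SE T -> T (fun=> 0) = fun=> 0.
Proof.
move=> lT; have Em1 : E (-1) by apply: (sfN hE); exact: (sf1 hE).
have := lT (-1) _ _ Em1 SE0 SE0; rewrite (_ : (fun=> -1 * 0 + 0) = fun=> 0); last first.
  by apply/funext => x; rewrite mulr0 addr0.
by move=> ->; apply/funext => x; rewrite mulN1r addNr.
Qed.

Lemma linear_onZ (T : fn -> fn) a phi : linear_on E SE T -> E a -> SE phi ->
  T (fun x => a * phi x) = fun x => a * T phi x.
Proof.
move=> lT Ea hp; have := lT a phi (fun=> 0) Ea hp SE0; rewrite linear_on0 //.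
rewrite (_ : (fun x => a * phi x + 0) = fun x => a * phi x); last by apply/funext => x; rewrite addr0.
by move=> ->; apply/funext => x; rewrite addr0.
Qed.

Lemma SE_scal a phi : E a -> SE phi -> SE (fun x => a * phi x).
Proof.
move=> Ea hp; have := SE_lin Ea hp SE0; congr SX; apply/funext => x; by rewrite addr0.
Qed.

Lemma weil_GL g : Sp V g -> GL E SE (W g).
Proof.
move=> sg; have lW := weil_lin sg; split=> //.
split=> [psi||phi hp]; first exact: weil_SE.
  apply: linear_on_inj => // [psi|psi /SX_P[E1 s1] e]; first exact: weil_SE.
  apply: fn_eq; have := weilc_inj0 lam_char lam_nontrivial mu_haar unit2 sg s1; rewrite -weil_vec e.
  by move=> ->.
have [c [Ec c0 hc]] := weil_spinv sg; have sk := spinv_Sp sg.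
have EcV : E c^-1 by exact: (sfV hE).
exists (fun x => c^-1 * W (spinv g) phi x); first by apply: SE_scal => //; exact: weil_SE.
rewrite (linear_onZ lW) //; last exact: weil_SE.
by rewrite hc //; apply/funext => x; rewrite mulKf.
Qed.

Lemma weil_proj g h : Sp V g -> Sp V h -> exists c, [/\ E c, c != 0 &
  forall phi, SE phi -> W g (W h phi) = fun x => c * W (spmul g h) phi x].
Proof.
move=> sg sh; have [c c0 hc] := weilc_proj lam_char lam_nontrivial mu_haar unit2 sg sh.
have sk : Sp V (spmul g h) by apply/Sp_mx; rewrite mx_of_spmul; apply: spmx_mul; apply/Sp_mx.
have hX phi : SE phi -> W g (W h phi) = fun x => c * W (spmul g h) phi x.
  by move=> /SX_P[E1 s1]; apply: fn_eq; rewrite !weil_vec hc // -weil_vec.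
exists c; split=> //; have hb := SK_SE (ballX_SK 0).
have [x bx] : exists x, W (spmul g h) (ballX 0) x != 0.
  apply: contrapT => nex; have [[_ inj _] lW] := weil_GL sk.
  have [y by0] := ballX_neq0 0; case/eqP: by0.
  have e : W (spmul g h) (ballX 0) = W (spmul g h) (fun=> 0).
    rewrite linear_on0 //; apply/funext => x; apply/eqP; apply: contra_notT nex => h1.
    by exists x.
  by have /(congr1 (fun f : fn => f y)) := inj _ _ (mem_set hb) (mem_set SE0) e.
have /(congr1 (fun f : fn => f x)) e := hX _ hb.
apply: (scal_in hE e bx); last by have /SX_P[h1 _] := weil_SE sk hb.
by have /SX_P[h1 _] := weil_SE sg (weil_SE sh hb).
Qed.

Lemma GL_comp (A : set C) (S : set fn) (T T' : fn -> fn) : GL A S T -> GL A S T' -> GL A S (T \o T').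
Proof.
move=> [b l] [b' l']; split; first exact: set_bij_comp b' b.
move=> a phi psi Aa hp hq /=; have [TS _ _] := b'.
by rewrite l' // l //; [exact: TS|exact: TS].
Qed.

Lemma GL_opinv (A : set C) (S : set fn) (T : fn -> fn) : GL A S T ->
  (forall a phi psi, A a -> S phi -> S psi -> S (fun x => a * phi x + psi x)) ->
  [/\ GL A S (opinv S T), forall phi, S phi -> opinv S T (T phi) = phi &
      forall phi, S phi -> T (opinv S T phi) = phi].
Proof.
move=> [b l] Slin; have [TS inj surj] := b; have bi := bijpinv_bij id b.
have K1 phi : S phi -> opinv S T (T phi) = phi by move=> hp; apply: (pinvKV id inj); exact: mem_set.
have K2 phi : S phi -> T (opinv S T phi) = phi.
  by move=> /surj[psi hpsi <-]; rewrite K1.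
split=> //; split=> // a phi psi Aa hp hq; have [iS _ _] := bi.
have S1 : S (opinv S T phi) by exact: iS.
have S2 : S (opinv S T psi) by exact: iS.
by rewrite -[in LHS](K2 _ hp) -[in LHS](K2 _ hq) -l // K1 //; exact: Slin.
Qed.

(* A relation with a coefficient 1 becomes shorter when [sg - 1] is applied to it. *)
Lemma free_on_ext k (e : nat -> fn) : (forall i, SK (e i)) -> free_on K k e -> free_on E k e.
Proof.
move=> Ke; have Kex i x : K (e i x) by have /SX_P[h _] := Ke i.
elim: k => [|k IH] fK; first by move=> c _ _ i.
have {}IH : free_on E k e.
  apply: IH => c Kc l0 i ik.
  pose d j := if (j < k)%N then c j else 0.
  have Kd j : K (d j) by rewrite /d; case: ifP => // _; exact: (sf0 hK).
  have : d i = 0; last by rewrite /d ik.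
  apply: (fK d Kd); last exact: ltnW.
  rewrite -l0; apply/funext => x; rewrite /lincomb big_ord_recr /= {2}/d ltnn mul0r addr0.
  by apply: eq_bigr => j _; rewrite /d ltn_ord.
move=> c Ec l0; have lS (d : nat -> C) x : lincomb k.+1 e d x = lincomb k e d x + d k * e k x.
  by rewrite /lincomb big_ord_recr.
have ck : c k = 0.
  apply/eqP/negPn/negP => ck.
  pose d i := c i / c k; have Ed i : E (d i) by exact: (sfdiv hE).
  have dk : d k = 1 by rewrite /d divff.
  have ld x : lincomb k.+1 e d x = 0.
    have := congr1 (fun f : fn => f x / c k) l0; rewrite mul0r => <-.
    by rewrite /lincomb mulr_suml; apply: eq_bigr => i _; rewrite /d mulrAC.
  have fix_d i : (i < k)%N -> K (d i).
    move=> ik; apply: (fieldE_fixed p_char p_neq2 lam_char lam_nontrivial eps_unit eps_prim (Ed i)) => sg hs.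
    apply/eqP; rewrite -subr_eq0; apply/eqP.
    apply: (IH (fun i => sg (d i) - d i)) => // [j|].
      by apply: (sfB hE) => //; exact: (gal_in hs).
    apply/funext => x; have h1 := ld x; have h2 := congr1 sg h1.
    move: h2; rewrite (gal0 hE hs) {1}/lincomb (gal_sum hE hs) => [|j _]; last first.
      by apply: (sfM hE) => //; exact: (KE (Kex j x)).
    rewrite (eq_bigr (fun i : 'I_k.+1 => sg (d i) * e i x)) => [h2|j _]; last first.
      by rewrite (galM hs (Ed j) (KE (Kex j x))) (gal_fix hs (Kex j x)).
    have : lincomb k.+1 e (fun i => sg (d i) - d i) x = 0.
      transitivity (\sum_(i < k.+1) sg (d i) * e i x - lincomb k.+1 e d x).
        by rewrite /lincomb -sumrB; apply: eq_bigr => j _; rewrite mulrBl.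
      by rewrite h1 h2 subrr.
    by rewrite lS dk (gal1 hE hs) subrr mul0r addr0.
  pose d' i := if (i < k)%N then d i else 1.
  have Kd' i : K (d' i) by rewrite /d'; case: ifP => [/fix_d|_] //; exact: (sf1 hK).
  have /eqP : d' k = 0.
    apply: (fK d' Kd') => //; apply/funext => x; rewrite -(ld x) !lS dk {2}/d' ltnn.
    by congr (_ + _); apply: eq_bigr => i _; rewrite /d' ltn_ord.
  by rewrite /d' ltnn oner_eq0.
move=> i; rewrite ltnS leq_eqVlt => /orP[/eqP->//|ik]; apply: (IH c Ec) => //.
by apply/funext => x; have := congr1 (fun f : fn => f x) l0; rewrite lS ck mul0r addr0.
Qed.

Section Form.
Variable al : fn -> fn.
Hypothesis al_GL : GL E SE al.
Hypothesis al_splits : forall sg, Gal E K sg -> forall phi, SE phi ->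
  delta lam mu p eps u eta sg phi = opinv SE al (galconj E sg al phi).
Local Notation al' := (opinv SE al).
Local Notation W' g := (al \o W g \o al').

Let al'_props := GL_opinv al_GL SE_lin.
Let al'_GL : GL E SE al'. Proof. by case: al'_props. Qed.
Let al'K phi : SE phi -> al' (al phi) = phi. Proof. by case: al'_props => _ h _; apply: h. Qed.
Let alK phi : SE phi -> al (al' phi) = phi. Proof. by case: al'_props => _ _; apply. Qed.
Let al_SE phi : SE phi -> SE (al phi). Proof. by case: al_GL => -[h _ _] _; apply: h. Qed.
Let al'_SE phi : SE phi -> SE (al' phi). Proof. by case: al'_GL => -[h _ _] _; apply: h. Qed.

(** The splitting of delta in usable form: [al] intertwines the twisted action with the plain Galois
    action on values. *)
Lemma splits_twist sg psi : Gal E K sg -> SE psi -> al (twistX sg psi) = sg \o al psi.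
Proof.
move=> hs hp; have hq := SE_gal hs hp; have [h1 h2] := SE_galinv hs hq.
have e : 'pinv_id E sg \o (sg \o psi) = psi.
  apply/funext => x; have /SX_P[Ep _] := hp; have /SX_P[E1 _] := h1.
  apply: (gal_inj hs); [exact: E1|exact: Ep|].
  exact: (congr1 (fun f : fn => f x) h2).
rewrite -(delta_twist hs hp) (al_splits hs hq) /galconj e alK //.
by apply: SE_gal => //; exact: al_SE.
Qed.

Lemma al_fixed psi : SE psi -> (forall sg, Gal E K sg -> twistX sg psi = psi) -> SK (al psi).
Proof.
move=> hp fx; apply: SK_fixed; first exact: al_SE.
by move=> sg hs; rewrite -splits_twist // fx.
Qed.

Lemma al'_fixed xi sg : SK xi -> Gal E K sg -> twistX sg (al' xi) = al' xi.
Proof.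
move=> hx hs; have hE' := SK_SE hx.
rewrite -[LHS]al'K; last by apply: twistX_SE => //; exact: al'_SE.
by rewrite splits_twist ?alK ?(SK_fix hs) //; exact: al'_SE.
Qed.

Lemma form_stable g : Sp V g -> forall phi, SK phi -> SK (W' g phi).
Proof.
move=> sg phi hp /=; have hE' := al'_SE (SK_SE hp); apply: al_fixed; first exact: weil_SE.
by move=> s hs; rewrite -weil_twistX // al'_fixed.
Qed.

Lemma form_GL_E g : Sp V g -> GL E SE (W' g).
Proof. by move=> sg; apply: GL_comp al'_GL; apply: GL_comp (weil_GL sg). Qed.

Lemma form_GL g : Sp V g -> GL K SK (W' g).
Proof.
move=> sg; have [[TS inj surj] lT] := form_GL_E sg; split.
  split=> [phi hp|phi psi /set_mem hp /set_mem hq e|phi hp].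
  - exact: form_stable.
  - by apply: inj => //; apply/mem_set/SK_SE.
  (* The preimage over E is already K-valued: W(g) is injective and commutes with the twisted
     action, so [al' psi] is fixed. *)
  - have hE' := SK_SE hp; have [psi hpsi epsi] := surj _ hE'.
    exists psi => //; have h1 := al'_SE hpsi.
    rewrite -(alK hpsi); apply: al_fixed => // s hs.
    have [[_ injW _] _] := weil_GL sg.
    apply: injW; [exact/mem_set/twistX_SE|exact: mem_set|].
    rewrite weil_twistX // -[W g (al' psi)](al'K (weil_SE sg h1)).
    by rewrite [al (W g (al' psi))]epsi al'_fixed.
by move=> a phi psi Ka hp hq; apply: lT; [exact: KE|exact: SK_SE|exact: SK_SE].
Qed.

Lemma form_proj : proj_rep (Sp V) (@spmul F V) K SK (fun g => W' g).
Proof.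
split=> [g|g h sg sh]; first exact: form_GL.
have sk : Sp V (spmul g h) by apply/Sp_mx; rewrite mx_of_spmul; apply: spmx_mul; apply/Sp_mx.
have [c [Ec c0 hc]] := weil_proj sg sh; have [_ lal] := al_GL.
have hX phi : SK phi -> W' g (W' h phi) = fun x => c * W' (spmul g h) phi x.
  move=> hp; have h1 := al'_SE (SK_SE hp) => /=.
  rewrite al'K ?hc //; last exact: weil_SE.
  by rewrite linear_onZ //; exact: weil_SE.
(* The constant found over E lies in K because both sides are K-valued on a K-valued test
   function. *)
exists c; split=> //; have hb := ballX_SK 0.
have [y by0] := ballX_neq0 0.
have [x bx] : exists x, W' (spmul g h) (ballX 0) x != 0.
  apply: contrapT => nex; have [[_ inj _] lW] := form_GL_E sk.
  case/eqP: by0.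
  have e : W' (spmul g h) (ballX 0) = W' (spmul g h) (fun=> 0).
    rewrite [RHS]linear_on0 //; apply/funext => x; apply/eqP; apply: contra_notT nex => h1.
    by exists x.
  by have /(congr1 (fun f : fn => f y)) := inj _ _ (mem_set (SK_SE hb)) (mem_set SE0) e.
have /(congr1 (fun f : fn => f x)) e := hX _ hb.
apply: (scal_in hK e bx); last by have /SX_P[h1 _] := form_stable sk hb.
by have /SX_P[h1 _] := form_stable sg (form_stable sh hb).
Qed.

Lemma form_extension : scalar_extension K E SK SE ->
  is_form (Sp V) (@spmul F V) K E SK SE (fun g => W' g) W al.
Proof.
move=> hext; split=> //; first exact: form_proj.
move=> g sg; exists (W' g); split=> //; first exact: form_GL_E.
by move=> phi hp /=; rewrite al'K.
Qed.
End Form.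

Let latt_repsP (m : nat) : exists Rr, transversal (@latt F n (- m%:Z)) (@latt F n m%:Z) Rr.
Proof. by have [|Rr t _] := @latt_reps F n (- m%:Z) m%:Z; [lia|exists Rr]. Qed.
Let reps m := projT1 (cid (latt_repsP m)).
Let repsP m : transversal (latt n (- m%:Z)) (latt n m%:Z) (reps m).
Proof. by rewrite /reps; case: cid. Qed.
Let N m := size (reps m).
Let pts m (j : 'I_(N m)) : X := xv (nth 0 (reps m) j).
Let L (m : nat) : set fn := [set phi : fn | level m%:Z (phi \o xv) /\ forall x, E (phi x)].

Let SE_L phi : SE phi -> exists m, L m phi.
Proof.
move=> /SX_P[Ep [m lm]]; exists `|m|%N; split=> //; apply: level_le lm.
by rewrite abszE ler_norm.
Qed.
Let L_SE m phi : L m phi -> SE phi.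
Proof. by move=> [lp Ep]; apply/SX_P; split=> //; exists m%:Z. Qed.
Let L_le m m' phi : (m <= m')%N -> L m phi -> L m' phi.
Proof. by move=> mm [lp Ep]; split=> //; apply: level_le lp; rewrite lez_nat. Qed.
Let L_val m phi : L m phi -> forall x, E (phi x). Proof. by case. Qed.
Let L_mono m phi : L m phi -> L m.+1 phi. Proof. exact: L_le. Qed.
Let L_lin m a phi psi : E a -> L m phi -> L m psi -> L m (fun x => a * phi x + psi x).
Proof.
move=> Ea [l1 E1] [l2 E2]; split; first exact: (level_lin a l1 l2).
by move=> x; apply: (sfD hE) => //; exact: (sfM hE).
Qed.
Let L_0 m : L m (fun=> 0).
Proof. by split=> [|x]; [split=> // x; rewrite eqxx|exact: (sf0 hE)]. Qed.

Let L_ext m phi : L m phi -> (forall j, phi (@pts m j) = 0) -> phi = (fun=> 0) :> fn.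
Proof.
move=> [[l1 l2] _] h; apply: fn_eq; apply/funext => r; have [_ _ cover _] := repsP m.
have [->//|/l2/cover[s sr rs]] := eqVneq ((phi \o xv) r) 0.
rewrite (l1 _ _ rs); have sj : (index s (reps m) < N m)%N by rewrite index_mem.
by have := h (Ordinal sj : 'I_(N m)); rewrite /pts /= nth_index.
Qed.

Let ind m (j : 'I_(N m)) : fn := fun x => (`[< latt n m%:Z (xr x - nth 0 (reps m) j) >])%:R.

Let ind_level m (j : 'I_(N m)) : level m%:Z (ind j \o xv).
Proof.
have [_ Rm _ _] := repsP m.
split=> [x y xy|x]; rewrite !compE /ind !XvecK.
  congr (nat_of_bool _)%:R; apply: asbool_equiv_eq; split=> h.
    by apply: latt_near h _; exact: latt_sym.
  exact: latt_near h xy.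
case: asboolP => [h _|_]; last by rewrite eqxx.
rewrite -(subrK (nth 0 (reps m) j) x); apply: (subgroupD (latt_subgroup n _)).
  by apply: latt_le h; lia.
exact/Rm/mem_nth/ltn_ord.
Qed.

Let ind_pts m (j j' : 'I_(N m)) : ind j (pts j') = (j' == j)%:R.
Proof.
rewrite /ind /pts XvecK; congr (nat_of_bool _)%:R; have [uR _ _ inj] := repsP m.
apply/asboolP/eqP => [h|->]; last by rewrite subrr; exact: (subgroup0 (latt_subgroup n _)).
apply/val_inj/eqP; rewrite -(nth_uniq 0 _ _ uR) ?ltn_ord //; apply/eqP.
by apply: inj => //; exact/mem_nth/ltn_ord.
Qed.

Let ind_L m (j : 'I_(N m)) : L m (ind j).
Proof. by split; [exact: ind_level|move=> x; exact: (sf_nat hE)]. Qed.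

Let L_delta m (j : 'I_(N m)) : exists2 f, L m f & forall j', f (@pts m j') = (j' == j)%:R.
Proof. by exists (ind j) => // j'; exact: ind_pts. Qed.

Let ind' m i : fn := if insub i is Some j then @ind m j else fun=> 0.
Let ind'_K m i : SK (ind' m i).
Proof.
apply/SX_P; rewrite /ind'; case: insub => [j|]; split.
- by move=> x; exact: (sf_nat hK).
- by exists m%:Z; exact: ind_level.
- by move=> x; exact: (sf0 hK).
- by exists 0; split=> // x; rewrite /= eqxx.
Qed.
Let ind'_L m i : L m (ind' m i).
Proof. by rewrite /ind'; case: insub => [j|]; [exact: ind_L|exact: L_0]. Qed.

Lemma lincomb_ind m phi : L m phi -> exists k (c : nat -> C) (e : nat -> fn),
  [/\ forall i, E (c i), forall i, L m (e i) /\ SK (e i) & phi = lincomb k e c].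
Proof.
move=> Lp; pose c i := if insub i is Some j then phi (@pts m j) else 0.
exists (N m), c, (ind' m); split=> [i|i|].
- by rewrite /c; case: insub => [j|]; [exact: (L_val Lp)|exact: (sf0 hE)].
- by split; [exact: ind'_L|exact: ind'_K].
have Ec i : E (c i) by rewrite /c; case: insub => [j|]; [exact: (L_val Lp)|exact: (sf0 hE)].
have Ll : L m (lincomb (N m) (ind' m) c) by apply: (lincomb_in L_lin L_0 Ec) => i _; exact: ind'_L.
have := L_ext (L_lin (sfN hE (sf1 hE)) Ll Lp) => h; apply/funext => x.
have /(congr1 (fun f : fn => f x)) : (fun x => -1 * lincomb (N m) (ind' m) c x + phi x) = (fun=> 0) :> fn.
  apply: h => j; rewrite /lincomb (bigD1 j) //= big1 => [|i ij].
    by rewrite /c /ind' valK ind_pts eqxx mulr1 addr0 mulN1r addNr.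
  by rewrite /ind' valK ind_pts eq_sym (negbTE ij) mulr0.
by rewrite mulN1r addrC => /eqP; rewrite subr_eq0 => /eqP.
Qed.

(** Indicators of cosets are K-valued and span over E; independence survives the extension of
    scalars by [free_on_ext]. *)
Lemma SK_scalar_extension : scalar_extension K E SK SE.
Proof.
split=> [phi|phi /SE_L[m /lincomb_ind[k [c [e [Ec Le ->]]]]]|m psi hpsi hK0 c Ec hc j]; first exact: SK_SE.
  by exists k, (fun i => c i), (fun i => e i); split=> // i; split=> //; have [] := Le i.
pose e i : fn := if insub i is Some j then psi j else fun=> 0.
have SK0 : SK (fun=> 0).
  by apply/SX_P; split=> [x|]; [exact: (sf0 hK)|exists 0; split=> // x; rewrite /= eqxx].
have Ke i : SK (e i) by rewrite /e; case: insub.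
have eE (i : 'I_m) : e i = psi i by rewrite /e insubT //= => h; congr psi; exact: val_inj.
pose c' i := if insub i is Some j then c j else 0.
have c'E (i : 'I_m) : c' i = c i by rewrite /c' insubT //= => h; congr c; exact: val_inj.
have fK : free_on K m e.
  move=> d Kd l0 i im; apply: (hK0 (fun i => d i) _ _ (Ordinal im)) => // x.
  transitivity (lincomb m e d x); last by rewrite l0.
  by apply: eq_bigr => i' _; rewrite eE.
rewrite -c'E; apply: (free_on_ext Ke fK) => // [i|].
  by rewrite /c'; case: insub => [i'|]; [exact: Ec|exact: (sf0 hE)].
by apply/funext => x; rewrite -[RHS](hc x); apply: eq_bigr => i _; rewrite eE c'E.
Qed.

Let Sinv : set fn := [set phi : fn | forall sg, Gal E K sg -> twistX sg phi = phi].

Lemma lincomb_inv m phi : L m phi -> exists k (c : nat -> C) (e : nat -> fn),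
  [/\ forall i, E (c i), forall i, L m (e i) /\ Sinv (e i) & phi = lincomb k e c].
Proof.
move=> [lp Ep]; have Ep' x : E ((phi \o xv) x) by exact: Ep.
have [k [c [T [Ec hT fE]]]] := twist_descent p_char p_neq2 lam_char lam_nontrivial eps_unit eps_prim
  eta_gal eta_eps u_cyclo u_norm lp Ep'.
have Tv l : (T l \o xr) \o xv = T l by apply/funext => r; rewrite !compE XvecK.
exists k, c, (fun l => T l \o xr); split=> // [l|].
  have [h1 h2 h3] := hT l; split; first by split; [rewrite Tv|move=> x; exact: h2].
  by move=> sg hs; apply: fn_eq; rewrite twistX_vec Tv h3.
apply: fn_eq; rewrite fE; apply/funext => r; rewrite compE /lincomb; apply: eq_bigr => l _.
by rewrite compE XvecK.
Qed.

Lemma splitting_ex : exists2 al, GL E SE al & forall sg, Gal E K sg -> forall phi, SE phi ->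
  delta lam mu p eps u eta sg phi = opinv SE al (galconj E sg al phi).
Proof.
(* Two bases adapted to the same filtration, e of functions fixed by the twisted action and e' of
   K-valued ones. At each level both have length [N m], so they can be matched index by index. *)
have [e be eS] := filtered_basis_ex hE L_val L_mono L_lin L_0 L_ext L_delta lincomb_inv.
have [e' be' eS'] := filtered_basis_ex hE L_val L_mono L_lin L_0 L_ext L_delta lincomb_ind.
have N_mono m m' : (m <= m')%N -> (N m <= N m')%N.
  exact: (N_le hE L_val L_mono L_lin L_0 L_ext L_delta lincomb_ind).
pose al := basis_change E N e e'.
have alP m phi := basis_changeP hE L_lin L_0 N_mono be be' (m := m) (f := phi).
have alE phi psi := basis_changeE hE N_mono be (e' := e') (f := phi) (g := psi).
have alE' phi psi := basis_changeE hE N_mono be' (e' := e) (f := phi) (g := psi).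
have al_SE phi : SE phi -> SE (al phi) by move=> /SE_L[m /alP[_ /L_SE]].
have alK phi : SE phi -> basis_change E N e' e (al phi) = phi.
  by move=> /SE_L[m /alP[h _]]; apply: alE'; exact: same_coords_sym.
have al_comb m c : (forall i, E (c i)) -> al (lincomb (N m) e c) = lincomb (N m) e' c.
  by move=> Ec; apply: alE; exists m, c.
have al_GL : GL E SE al.
  split.
    split=> [phi|phi psi /set_mem hp /set_mem hq ee|phi /SE_L[m Lp]]; first exact: al_SE.
      by rewrite -(alK _ hp) -(alK _ hq) ee.
    have [h1 h2] := basis_changeP hE L_lin L_0 N_mono be' be Lp.
    by exists (basis_change E N e' e phi); [exact: (L_SE h2)|apply: alE; exact: same_coords_sym].
  move=> a phi psi Ea /SE_L[m Lp] /SE_L[m' Lq].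
  have {}Lp := L_le (leq_maxl m m') Lp; have {}Lq := L_le (leq_maxr m m') Lq.
  have [_ _ span] := be (maxn m m'); have [c Ec ->] := span _ Lp; have [d Ed ->] := span _ Lq.
  have comb f : (fun x => a * lincomb (N (maxn m m')) f c x + lincomb (N (maxn m m')) f d x) =
      lincomb (N (maxn m m')) f (fun i => a * c i + d i).
    apply/funext => x; rewrite /lincomb mulr_sumr -big_split; apply: eq_bigr => i _ /=.
    by rewrite mulrDl mulrA.
  rewrite comb !al_comb ?comb // => i; apply: (sfD hE) => //; exact: (sfM hE).
exists al => // sg hs phi hphi.
have [h1 h2] := SE_galinv hs hphi; set psi := 'pinv_id E sg \o phi in h1 h2 *.
rewrite -[in LHS]h2 (delta_twist hs h1) /galconj -/psi.
have [_ opK _] := GL_opinv al_GL SE_lin.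
rewrite -[LHS]opK; last exact: twistX_SE.
congr opinv; have [m Lp] := SE_L h1; have [Le _ span] := be m; have [c Ec pE] := span _ Lp.
have Ee i x : (i < N m)%N -> E (e i x) by move=> im; exact: (L_val (Le i im)).
have Esc i : E (sg (c i)) by exact: (gal_in hs).
(* Since each e_i is fixed, the twisted action only conjugates coordinates; on the e' side the plain
   action does the same. *)
have -> : twistX sg psi = lincomb (N m) e (fun i => sg (c i)).
  apply: fn_eq; rewrite twistX_vec.
  have -> : psi \o xv = fun r => \sum_(i < N m) c i * (e i \o xv) r.
    by rewrite pE; apply/funext => r.
  rewrite (twist_sum eps eta u (index_enum 'I_(N m)) (a := fun i => c i) (f := fun i => e i \o xv) hs) //.
    apply/funext => r; rewrite compE /lincomb; apply: eq_bigr => i _; congr (_ * _).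
    by rewrite -twistX_vec compE (eS m i) //.
  by move=> i r; exact: Ee.
rewrite pE !al_comb //; apply/funext => x; rewrite compE /lincomb.
rewrite (gal_sum hE hs) => [|i _]; last first.
  by have [Le' _ _] := be' m; apply: (sfM hE) => //; exact: (L_val (Le' i (ltn_ord i))).
apply: eq_bigr => i _; have /SX_P[Kx _] := eS' m i (ltn_ord i).
by rewrite (galM hs (Ec i) (KE (Kx x))) (gal_fix hs (Kx x)).
Qed.

End Descent.

Theorem mainTheorem1 (R : realType) (F : nonArchLocalFieldType) (p : nat)
    (p_char : is_residue_char F p) (p_neq2 : p != 2%N)
    (lam : F -> R[i]) (lam_char : unitary_character lam)
    (lam_nontrivial : exists t, lam t != 1)
    (mu : {measure set (borelF F) -> \bar R})
    (mu_haar : is_haar mu) (mu_dual : self_dual lam mu)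
    (V : sympl_space F)
    (eps : F) (eps_unit : primering_units eps)
    (eps_prim : (p.-1).-primitive_root eps)
    (u : R[i]) (u_cyclo : cyclo_i p u)
    (u_norm : normC (cyclo_i p) (sqrt_pm p) u = -1)
    (eta : R[i] -> R[i]) (eta_gal : Gal (fieldE lam) (sqrt_pm p) eta)
    (eta_eps : acts_as lam p eta (eps ^+ 2)) :
  let E := fieldE lam in
  let K := sqrt_pm (R := R) p in
  let SE := SX (V := V) E in
  let SK := SX (V := V) K in
  let W := weil (V := V) lam mu in
  let splits al := forall sigma, Gal E K sigma -> forall phi, SE phi ->
    delta lam mu p eps u eta sigma phi = opinv SE al (galconj E sigma al phi) in
  let W' al g := al \o W g \o opinv SE al in
  (exists2 al, GL E SE al & splits al) /\
  (forall al, GL E SE al -> splits al ->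
     (forall g, Sp V g -> forall phi, SK phi -> SK (W' al g phi)) /\
     is_form (Sp V) (@spmul F V) K E SK SE (W' al) W al).
Proof.
split.
  exact: (splitting_ex p_char p_neq2 lam_char lam_nontrivial mu_haar V eps_unit eps_prim eta_gal eta_eps u_cyclo u_norm).
move=> al al_GL al_splits; split=> [g sg phi|].
  exact: (form_stable p_char p_neq2 lam_char lam_nontrivial mu_haar mu_dual eps_unit eps_prim eta_gal u_cyclo al_GL al_splits).
apply: (form_extension p_char p_neq2 lam_char lam_nontrivial mu_haar mu_dual eps_unit eps_prim eta_gal u_cyclo al_GL al_splits).
exact: (SK_scalar_extension p_char p_neq2 lam_char lam_nontrivial V eps_unit eps_prim).
Qed.
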